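(* Let $n\ge 4$ and let $\alpha\in W^{1,\infty}(\partial\Omega;\mathbb{C})$ be such that $$\operatorname{Re}\alpha\ge|\operatorname{Im}\alpha|\qquad\text{and}\qquad x\cdot\nabla\operatorname{Re}\alpha\le 0$$ almost everywhere on $\partial\Omega$. Suppose there exist non-negative numbers $b_1,b_2$ satisfying $$2\,[\,b_1(b_1+b_2)\,]^{1/2}<1$$ such that $$\|x\operatorname{Im}\alpha\|_{L^\infty(\partial\Omega)}\le b_1$$ and $$\int_{\partial\Omega}|\operatorname{div}(x'\operatorname{Im}\alpha)|^2|\psi|^2\,d\sigma\le b_2^2\int_{\partial\Omega}|\nabla\psi|^2\,d\sigma\qquad\text{for all }\psi\in H^1(\partial\Omega).$$ Then the Robin Laplacian has no eigenvalues: $\sigma_{\mathrm p}(-\Delta_\alpha^\Omega)=\varnothing$.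
   Context: $\Omega:=\mathbb{R}^{n-1}\times(0,\infty)$ is the upper half-space, with $\partial\Omega$ identified with $\mathbb{R}^{n-1}$; points are $x=(x',x_n)$, $x'=(x_1,\dots,x_{n-1})$, and on $\partial\Omega$ one has $x=(x',0)$; $\nabla$ and $\operatorname{div}$ applied to functions and vector fields on $\partial\Omega$ are those of $\mathbb{R}^{n-1}$; $|\cdot|$ of a vector is its Euclidean norm. For $\alpha\in L^\infty(\partial\Omega;\mathbb{C})$, the Robin Laplacian $-\Delta_\alpha^\Omega$ is the m-sectorial operator in $L^2(\Omega)$ associated, via the first representation theorem, with the closed form $h_\alpha[u]:=\int_\Omega|\nabla u|^2\,dx+\int_{\partial\Omega}\alpha|u|^2\,d\sigma$, $\mathcal{D}(h_\alpha):=H^1(\Omega)$ (boundary values in the sense of traces). That is, $u\in\mathcal{D}(-\Delta_\alpha^\Omega)$ iff $u\in H^1(\Omega)$ and there is $w_u\in L^2(\Omega)$ such that $\int_\Omega\nabla u\cdot\overline{\nabla v}\,dx+\int_{\partial\Omega}\alpha u\bar v\,d\sigma=\int_\Omega w_u\bar v\,dx$ for all $v\in H^1(\Omega)$, and then $-\Delta_\alpha^\Omega u:=w_u$. $\sigma_{\mathrm p}(H)$ is the set of eigenvalues of $H$. *)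

(* Defs.v *)
From HB Require Import structures.
From mathcomp Require Import all_boot all_order all_algebra.
From mathcomp Require Import all_classical all_reals all_analysis.
From mathcomp Require Import complex.

Set Implicit Arguments.
Unset Strict Implicit.
Unset Printing Implicit Defensive.

Import Order.TTheory GRing.Theory Num.Theory.
Import numFieldTopology.Exports numFieldNormedType.Exports.

Local Open Scope classical_set_scope.
Local Open Scope ring_scope.
Local Open Scope complex_scope.

(* The row vectors carry the product (that is, Borel) sigma-algebra, as
   n.-tuple does in the library. *)
Definition rV_display : measure_display -> measure_display.
Proof. exact. Qed.

Section measurable_rV.
Variables (R : realType) (m : nat).

Definition rV_coord (i : 'I_m) (x : 'rV[R]_m) : measurableTypeR R := x ord0 i.

Let rV_set0 : g_sigma_preimage rV_coord set0.
Proof. exact: sigma_algebra0. Qed.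

Let rV_setC A : g_sigma_preimage rV_coord A -> g_sigma_preimage rV_coord (~` A).
Proof. exact: sigma_algebraC. Qed.

Let rV_bigcup (F : _^nat) : (forall i, g_sigma_preimage rV_coord (F i)) ->
  g_sigma_preimage rV_coord (\bigcup_i (F i)).
Proof. exact: sigma_algebra_bigcup. Qed.

HB.instance Definition _ :=
  @isMeasurable.Build (rV_display default_measure_display)
  'rV[R]_m (g_sigma_preimage rV_coord) rV_set0 rV_setC rV_bigcup.

End measurable_rV.

Section measurable_rV_theory.
Variables (R : realType) (m : nat).

Lemma measurable_rV_coord (i : 'I_m) :
  measurable_fun [set: 'rV[R]_m] (@rV_coord R m i).
Proof.
move=> _ Y mY; rewrite setTI; apply: sub_sigma_algebra => /=.
rewrite -bigcup_seq/=; exists i => /=; first by rewrite mem_index_enum.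
by exists Y => //; rewrite setTI.
Qed.

Lemma measurable_fun_rV d (T : measurableType d) (f : T -> 'rV[R]_m) :
  (forall i, measurable_fun [set: T] (rV_coord i \o f)) ->
  measurable_fun [set: T] f.
Proof.
move=> mf _ A; rewrite setTI.
apply: (@smallest_sub _ _ _ [set A | measurable (f @^-1` A)]).
  split=> /=.
  - by rewrite preimage_set0; exact: measurable0.
  - by move=> B mB; rewrite setTD preimage_setC; exact: measurableC.
  - by move=> F mF; rewrite preimage_bigcup; exact: bigcup_measurable.
rewrite -bigcup_seq/= => B [i _ [C mC <-]] /=.
rewrite setTI -comp_preimage -[X in measurable X]setTI.
exact: mf.
Qed.

End measurable_rV_theory.

Section snoc.
Variables (R : realType) (m : nat).

(* (x', x_n) as a point of R^n, where n = m.+1 *)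
Definition snoc (p : 'rV[R]_m * measurableTypeR R) : 'rV[R]_m.+1 :=
  \row_i (if unlift ord_max i is Some j then p.1 ord0 j else p.2).

Definition unsnoc (y : 'rV[R]_m.+1) : 'rV[R]_m * measurableTypeR R :=
  (\row_j y ord0 (lift ord_max j), y ord0 ord_max).

Lemma snocK : cancel snoc unsnoc.
Proof.
move=> [x t]; congr pair; last by rewrite mxE unlift_none.
by apply/rowP => j; rewrite !mxE liftK.
Qed.

Lemma unsnocK : cancel unsnoc snoc.
Proof.
move=> y; apply/rowP => i; rewrite mxE.
by case: unliftP => [j ->|->] //=; rewrite mxE.
Qed.

Lemma measurable_snoc : measurable_fun setT snoc.
Proof.
apply: measurable_fun_rV => i.
have [j ij|i_max] := unliftP ord_max i.
  rewrite (_ : _ \o _ = rV_coord j \o fst); last first.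
    by apply/funext => p /=; rewrite /rV_coord mxE ij liftK.
  apply: measurableT_comp; first exact: measurable_rV_coord.
  exact: measurable_fst.
rewrite (_ : _ \o _ = snd); first exact: measurable_snd.
by apply/funext => p /=; rewrite /rV_coord mxE i_max unlift_none.
Qed.

Lemma measurable_unsnoc : measurable_fun setT unsnoc.
Proof.
apply: measurable_fun_pair; last exact: measurable_rV_coord.
apply: measurable_fun_rV => j.
rewrite (_ : _ \o _ = rV_coord (lift ord_max j)).
  exact: measurable_rV_coord.
by apply/funext => y /=; rewrite /rV_coord mxE.
Qed.

End snoc.

Section lebesgue_rV.
Variable R : realType.

Section step.
Variable m : nat.
Variable mu : {sigma_finite_measure set 'rV[R]_m -> \bar R}.

Definition lebesgue_snoc : set 'rV[R]_m.+1 -> \bar R :=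
  pushforward (mu \x @lebesgue_measure R)%E (@snoc R m).

HB.instance Definition _ := Measure.copy lebesgue_snoc
  (measure_function_pushforward__canonical__measure_function_Measure
     (mu \x @lebesgue_measure R)%E (@measurable_snoc R m)).

Let lebesgue_snoc_sigma_finite : sigma_finite setT lebesgue_snoc.
Proof.
have /sigma_finiteP[F [TF ndF Foo]] := sigma_finiteT mu.
have /sigma_finiteP[G [TG ndG Goo]] := sigma_finiteT (@lebesgue_measure R).
exists (fun k => @unsnoc R m @^-1` (F k `*` G k)).
  rewrite -preimage_bigcup (_ : \bigcup_k _ = setT) ?preimage_setT//.
  apply/seteqP; split => // -[x t] _.
  have [k _ Fx] : (\bigcup_k F k) x by rewrite -TF.
  have [l _ Gt] : (\bigcup_k G k) t by rewrite -TG.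
  exists (maxn k l) => //; split => /=.
  - by move: x Fx; exact/subsetPset/ndF/leq_maxl.
  - by move: t Gt; exact/subsetPset/ndG/leq_maxr.
move=> k; have [mF Fk] := Foo k; have [mG Gk] := Goo k; split.
  rewrite -[X in measurable X]setTI.
  by apply: measurable_unsnoc => //; exact: measurableX.
rewrite /lebesgue_snoc /pushforward -comp_preimage (_ : _ \o _ = id).
  by rewrite preimage_id product_measure1E// lte_mul_pinfty// ge0_fin_numE.
exact/funext/snocK.
Qed.

HB.instance Definition _ := Measure_isSigmaFinite.Build _ _ _ lebesgue_snoc
  lebesgue_snoc_sigma_finite.

End step.

Definition dirac_rV0 : set 'rV[R]_0 -> \bar R := dirac (0 : 'rV[R]_0).
HB.instance Definition _ := Measure.on dirac_rV0.

Let dirac_rV0_sigma_finite : sigma_finite setT dirac_rV0.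
Proof.
exists (fun=> setT); first by rewrite bigcup_const.
by move=> _; split => //; rewrite /dirac_rV0 diracT ltry.
Qed.

HB.instance Definition _ := Measure_isSigmaFinite.Build _ _ _ dirac_rV0
  dirac_rV0_sigma_finite.

(* The Lebesgue measure on the Borel sets of R^m *)
Fixpoint lebesgue_rV m : {sigma_finite_measure set 'rV[R]_m -> \bar R} :=
  match m with
  | 0 => dirac_rV0
  | m'.+1 => lebesgue_snoc (lebesgue_rV m')
  end.

End lebesgue_rV.

(* `|x| is the sup norm on row vectors *)
Definition enorm (R : realType) m (x : 'rV[R]_m) : R :=
  Num.sqrt (\sum_(i < m) x ord0 i ^+ 2).

Section real_sobolev.
Variables (R : realType) (m : nat).
Local Notation leb := (lebesgue_rV R m).
Implicit Types (D : set 'rV[R]_m) (i : 'I_m) (p : \bar R).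
Implicit Types (u g phi : 'rV[R]_m -> R).

Definition partial i phi : 'rV[R]_m -> R := 'D_(delta_mx ord0 i) phi.

Fixpoint isCk (k : nat) phi : Prop :=
  continuous phi /\
  if k is k'.+1 then
    forall i, (forall x, derivable phi x (delta_mx ord0 i)) /\
              isCk k' (partial i phi)
  else True.

(* phi \in C_c^oo(D) *)
Definition test_function D phi : Prop :=
  [/\ forall k, isCk k phi,
      compact (closure [set x | phi x != 0]) &
      closure [set x | phi x != 0] `<=` D].

Definition locally_integrable_rV D u : Prop :=
  forall K, compact K -> K `<=` D -> leb.-integrable K (EFin \o u).

Definition is_weak_partial D i u g : Prop :=
  [/\ locally_integrable_rV D u, locally_integrable_rV D g &
      forall phi, test_function D phi ->
        \int[leb]_(x in D) (u x * partial i phi x) =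
        - \int[leb]_(x in D) (g x * phi x)].

(* A representative of the weak derivative, which is unique almost everywhere
   in D; 0 if there is none. *)
Definition weak_partial D i u : 'rV[R]_m -> R :=
  xget (cst 0) [set g | is_weak_partial D i u g].

(* Functions on D are total functions whose values outside D are ignored. *)
Definition Lp D p u : Prop := u \_ D \in Lfun leb p.

Definition W1p D p u : Prop :=
  Lp D p u /\ forall i, exists2 g, is_weak_partial D i u g & Lp D p g.

(* Equivalent to the usual Hilbert norm of H^1(D) *)
Definition H1_norm D u : \bar R :=
  ('N[leb]_2%:E[EFin \o (u \_ D)] +
   \sum_(i < m) 'N[leb]_2%:E[EFin \o (weak_partial D i u \_ D)])%E.

End real_sobolev.

Section half_space.
Variables (R : realType) (m : nat).

Definition half_space : set 'rV[R]_m.+1 := [set x | 0 < x ord0 ord_max].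

(* The trace operator is the continuous extension to H^1 of the restriction of
   functions in C_c^oo(R^n) to the boundary. *)
Definition is_trace (u : 'rV[R]_m.+1 -> R) (tau : 'rV[R]_m -> R) : Prop :=
  [/\ W1p half_space 2%:E u, Lp setT 2%:E tau &
  exists phi : nat -> 'rV[R]_m.+1 -> R,
    [/\ forall k, test_function setT (phi k),
        H1_norm half_space (phi k \- u) @[k --> \oo] --> 0%E &
        'N[lebesgue_rV R m]_2%:E[
           EFin \o (fun x' => phi k (snoc (x', 0 : R)) - tau x')%R]%E
          @[k --> \oo] --> 0%E]].

Definition trace (u : 'rV[R]_m.+1 -> R) : 'rV[R]_m -> R :=
  xget (cst 0) [set tau | is_trace u tau].

End half_space.
Arguments half_space : clear implicits.

(* L^p, W^{1,p}, weak derivatives and traces of complex-valued functions are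
   taken on the real and imaginary parts; the test functions being real, this
   agrees with the direct definitions. *)
Section complex_sobolev.
Variables (R : realType) (m : nat).
Implicit Types (D : set 'rV[R]_m) (u : 'rV[R]_m -> R[i]).

Definition normc2 (z : R[i]) : R := complex.Re z ^+ 2 + complex.Im z ^+ 2.

Definition cintegral D u : R[i] :=
  (\int[lebesgue_rV R m]_(x in D) complex.Re (u x)) +i*
  (\int[lebesgue_rV R m]_(x in D) complex.Im (u x)).

Definition cLp D p u : Prop :=
  Lp D p (@complex.Re R \o u) /\ Lp D p (@complex.Im R \o u).

Definition cW1p D p u : Prop :=
  W1p D p (@complex.Re R \o u) /\ W1p D p (@complex.Im R \o u).

Definition cweak_partial D i u (x : 'rV[R]_m) : R[i] :=
  weak_partial D i (@complex.Re R \o u) x +i*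
  weak_partial D i (@complex.Im R \o u) x.

End complex_sobolev.

Definition ctrace (R : realType) m (u : 'rV[R]_m.+1 -> R[i]) (x' : 'rV[R]_m) :
    R[i] :=
  trace (@complex.Re R \o u) x' +i* trace (@complex.Im R \o u) x'.

Definition weak_div (R : realType) m (F : 'rV[R]_m -> 'rV[R]_m)
    (x : 'rV[R]_m) : R :=
  \sum_(i < m) weak_partial setT i (fun y => F y ord0 i) x.

Section robin.
Variables (R : realType) (m : nat) (alpha : 'rV[R]_m -> R[i]).
Local Notation Omega := (half_space R m).
Implicit Types u v w : 'rV[R]_m.+1 -> R[i].

Definition robin_form u v : R[i] :=
  cintegral Omega (fun x =>
    \sum_(i < m.+1)
      cweak_partial Omega i u x * conjc (cweak_partial Omega i v x)) +
  cintegral setT (fun x' => alpha x' * ctrace u x' * conjc (ctrace v x')).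

(* Graph of the operator of the first representation theorem for robin_form:
   u is in its domain and is mapped to w. *)
Definition robin_laplacian u w : Prop :=
  [/\ cW1p Omega 2%:E u, cLp Omega 2%:E w &
      forall v, cW1p Omega 2%:E v ->
        robin_form u v = cintegral Omega (fun x => w x * conjc (v x))].

End robin.

(* Eigenvalues of an operator in L^2(D) given by its graph; eigenfunctions are
   nonzero as elements of L^2(D). *)
Definition point_spectrum (R : realType) m (D : set 'rV[R]_m)
    (H : ('rV[R]_m -> R[i]) -> ('rV[R]_m -> R[i]) -> Prop) : set R[i] :=
  [set lambda | exists2 u, H u (fun x => lambda * u x) &
     ~ {ae lebesgue_rV R m, forall x, D x -> u x = 0}].

(* Main.v *)
Require Import Defs.
From HB Require Import structures.
From mathcomp Require Import all_boot all_order all_algebra.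
From mathcomp Require Import all_classical all_reals all_analysis.
From mathcomp Require Import complex.
From mathcomp Require Import ring lra measurable_realfun ess_sup_inf.

(** Write [lambda = l1 + i l2] and [u = p + i q].  For [l1 <= 0] the quadratic
    form itself forces [grad u = 0].  For [l1 = k^2 > 0], with the sign of [k]
    such that [l2 = mu k] and [mu >= 0], test the equation with
    [2 x.grad u + n u - u + mu r u - 2 i k r u], where
    [r = sqrt (|x|^2 + d^2)].  The resulting virial identity is a quadratic
    form in the gradient of [w = exp (- i k r) u]: the interior terms
    dominate [int |grad w|^2], the [Re alpha] terms have a sign by the
    radial monotonicity of [Re alpha], and what remains is
    [2 int_bd Im alpha x.(w1 grad w2 - w2 grad w1)].  A boundary integral
    [int_bd F d_i h] becomes an interior one by integrating normally and
    then tangentially, the tangential derivative falling on [Im alpha]; this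
    bounds the remainder by [(b1 / s + (b1 + b2) s) int |grad w|^2] for every
    [s > 0], where [s] comes from replacing [w (x', x_n)] by
    [w (x', s^2 x_n)] in one factor.  The optimal constant is
    [2 sqrt (b1 (b1 + b2)) < 1], and Hardy's inequality then yields [u = 0].

    Eigenfunctions have only H^1 regularity, so [2 x.grad u + n u] is replaced
    by the limit as [s] tends to 1 of the difference quotients
    [(a (s x) - s^-n a (x / s)) / (s - 1)], [a] a cut-off of [u], and all
    identities are proved for smooth compactly supported approximants of [u],
    uniformly in [s]. *)

Set Implicit Arguments.
Unset Strict Implicit.
Unset Printing Implicit Defensive.
Import Order.TTheory GRing.Theory Num.Theory.
Import numFieldTopology.Exports numFieldNormedType.Exports.

Local Open Scope classical_set_scope.
Local Open Scope ring_scope.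

(** * Integration on row vectors *)

(** The multiplier is unbounded and costs a derivative; this dictates two regularisations. The
    cut-off [chi = (1 + e |x|^2)^-1] puts [x . grad] of the cut function in L^2, at the price of a
    commutator [hcut] whose contribution vanishes as [e] tends to 0. The factor [s^-n] of the
    dilation quotient makes the gradient term symmetric under [s |-> 1/s], so that it needs no
    difference quotient and stays continuous in H^1. The parameter [d] smooths [|x|] at the origin
    and costs a boundary error of order [d]. The final estimate is for [mass], whose weight involves
    neither [e] nor [d]; so [e], then [d], then the index of the approximant can be chosen in turn.
    The boundary transfer serves twice: for the sharp bound of the [Im alpha] term, and for uniform
    bounds on the boundary difference quotients. Complex functions are pairs of real ones: the
    equation for [p + i q] is the real form at [(p, q)] and at [(q, - p)], the latter being
    multiplication by [- i]. The dimension enters through the two Hardy inequalities, where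
    completing the square leaves [n - 4] and [n - 3]. *)

Section rV_measure.
Variable R : realType.

Lemma coord_le_norm n (x : 'rV[R]_n) i : `|x ord0 i| <= `|x|.
Proof.
rewrite [leRHS]/Num.norm /= mx_normrE; apply/bigmax_geP; right => /=.
by exists (ord0, i).
Qed.

Lemma norm_le_coord n (x : 'rV[R]_n) M :
  0 <= M -> (forall i, `|x ord0 i| <= M) -> `|x| <= M.
Proof.
move=> M0 xM; rewrite [leLHS]/Num.norm /= mx_normrE; apply/bigmax_leP.
by split => // -[i j] _; rewrite /= ord1.
Qed.

(** The sigma-algebra is generated by the coordinates, so measurability of open sets has to be
    proved: an open set is the countable union of the boxes with rational centre and radius
    [1 / (k + 1)] that it contains. *)
Lemma open_measurable_rV n (U : set 'rV[R]_n) : open U -> measurable U.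
Proof.
move=> oU.
pose B (p : 'rV[rat]_n * nat) : set 'rV[R]_n :=
  \bigcap_(i in [set: 'I_n])
    ((@rV_coord R n i) @^-1` (ball (ratr (p.1 ord0 i) : R) p.2.+1%:R^-1)).
have mB p : measurable (B p).
  apply: fin_bigcap_measurable => // i _.
  rewrite -[X in measurable X]setTI; apply: measurable_rV_coord => //.
  by rewrite ball_itv; exact: measurable_itv.
rewrite (_ : U = \bigcup_p (if `[< B p `<=` U >] then B p else set0)).
  apply: countable_bigcupT_measurable; first exact: countableP.
  by move=> p; case: ifP.
apply/seteqP; split => [x Ux|x [p _]]; last first.
  by case: ifPn => // /asboolP; apply.
have /nbhs_ballP[e /= e0 eU] : nbhs x U by exact: open_nbhs_nbhs.
pose k := Num.truncn (2 / e).
pose d : R := k.+1%:R^-1.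
(* Twice the radius: the centre is within [d] of [x], and the other points of the box are within [d]
   of the centre. *)
have ke : 2 * d < e.
  by rewrite ltr_pdivrMr ?ltr0n// mulrC -ltr_pdivrMr// truncnS_gt.
have d0 : 0 < d by rewrite invr_gt0.
have /choice[q qx] : forall i, exists r : rat, `|x ord0 i - ratr r| < d.
  move=> i.
  have /rat_in_itvoo[r] : x ord0 i - d < x ord0 i + d by lra.
  by rewrite in_itv/= => /andP[r1 r2]; exists r; rewrite ltr_norml; lra.
have Bxp y : B (\row_i q i, k) y -> `|x - y| <= 2 * d.
  move=> By; apply: norm_le_coord; first lra.
  move=> i; have := By i I; rewrite /ball /= mxE /rV_coord -/d => yq.
  rewrite !mxE.
  by rewrite (le_trans (ler_distD (ratr (q i)) _ _))//; have qi := qx i; lra.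
exists (\row_i q i, k) => //; case: asboolP => [_ i _ /=|[]].
  by rewrite /ball /= mxE /rV_coord distrC.
by move=> y /Bxp xy; apply: eU; rewrite -ball_normE /ball_ /=; lra.
Qed.

Lemma continuous_measurable_rV n (f : 'rV[R]_n -> R) :
  continuous f -> measurable_fun setT f.
Proof.
move=> /continuousP cf; apply: (measurability _ (RGenOpens.measurableE R)).
move=> _ [U [a [b ->] <-]].
by rewrite setTI; apply: open_measurable_rV; exact/cf/interval_open.
Qed.

Lemma measurable_affine_rV n (s : R) (a : 'rV[R]_n) :
  measurable_fun setT (fun x : 'rV[R]_n => s *: x + a).
Proof.
apply: measurable_fun_rV => i.
rewrite (_ : _ \o _ = fun x => s * rV_coord i x + a ord0 i).
  apply: measurable_funD => //; apply: measurable_funM => //.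
  exact: measurable_rV_coord.
by apply/funext => x; rewrite /rV_coord/= !mxE.
Qed.

Local Notation leb := (lebesgue_rV R).
Local Open Scope ereal_scope.

Lemma ge0_integral_snoc m (f : 'rV[R]_m.+1 -> \bar R) :
  measurable_fun setT f -> (forall x, 0 <= f x) ->
  \int[leb m.+1]_x f x =
  \int[leb m]_x \int[lebesgue_measure]_t f (snoc (x, t)).
Proof.
move=> mf f0; have ms := @measurable_snoc R m.
have mfs := measurableT_comp mf ms.
transitivity (\int[pushforward (leb m \x lebesgue_measure) (@snoc R m)]_x f x).
  by [].
rewrite ge0_integral_pushforward// preimage_setT.
exact: (@fubini_tonelli1 _ _ _ _ _ _ _ _ mfs (fun p => f0 (snoc p))).
Qed.

Lemma ge0_integral_snoc2 m (f : 'rV[R]_m.+1 -> \bar R) :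
  measurable_fun setT f -> (forall x, 0 <= f x) ->
  \int[leb m.+1]_x f x =
  \int[lebesgue_measure]_t \int[leb m]_x f (snoc (x, t)).
Proof.
move=> mf f0; have ms := @measurable_snoc R m.
have mfs := measurableT_comp mf ms.
transitivity (\int[pushforward (leb m \x lebesgue_measure) (@snoc R m)]_x f x).
  by [].
rewrite ge0_integral_pushforward// preimage_setT.
exact: (@fubini_tonelli2 _ _ _ _ _ _ _ _ mfs (fun p => f0 (snoc p))).
Qed.

(** By uniqueness of Lebesgue measure: [s] times its image under [t |-> s t + a] gives every
    half-open interval its length. *)
Lemma ge0_integral_affine1 (s a : R) (f : measurableTypeR R -> \bar R) :
  (0 < s)%R -> measurable_fun setT f -> (forall x, 0 <= f x) ->
  \int[@lebesgue_measure R]_t f (s * t + a)%R =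
  (s^-1)%:E * \int[@lebesgue_measure R]_t f t.
Proof.
move=> s0 mf f0.
pose phi : measurableTypeR R -> measurableTypeR R := fun t => (s * t + a)%R.
have mphi : measurable_fun setT phi.
  by apply: measurable_funD => //; apply: measurable_funM.
have s0' : (0 <= s)%R by exact: ltW.
pose pm := measure_function_pushforward__canonical__measure_function_Measure
  (@lebesgue_measure R) mphi.
pose mu := mscale (NngNum s0') pm.
have E (A : set (measurableTypeR R)) :
    measurable A -> lebesgue_measure A = mu A.
  move: A; apply: lebesgue_measure_unique => _ [[c d]] _ <-.
  change (lebesgue_measure `]c, d]%classic =
    s%:E * lebesgue_measure (phi @^-1` `]c, d]%classic)).
  rewrite (_ : phi @^-1` _ = `](c - a) / s, (d - a) / s]%classic)%R; last first.
    apply/seteqP; split => t /=; rewrite !in_itv/= /phi.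
      by move=> /andP[? ?]; rewrite ltr_pdivrMr// ler_pdivlMr//; lra.
    by rewrite ltr_pdivrMr// ler_pdivlMr// => /andP[? ?]; lra.
  rewrite !lebesgue_measure_itv/= !lte_fin.
  rewrite ltr_pM2r ?invr_gt0// ltrD2r; case: ifPn => cd; last by rewrite mule0.
  rewrite -!EFinB -EFinM; congr EFin.
  by field; rewrite gt_eqF.
have -> : \int[@lebesgue_measure R]_t f t = \int[mu]_t f t.
  by apply: eq_measure_integral => A mA _; exact: E.
rewrite ge0_integral_mscale//= ge0_integral_pushforward// preimage_setT.
by rewrite muleA -EFinM mulVf ?gt_eqF// mul1e.
Qed.

Lemma snoc_affine m (s : R) (a : 'rV[R]_m.+1) (x : 'rV[R]_m) (t : R) :
  (s *: snoc (x, t) + a =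
  snoc (s *: x + (unsnoc a).1, s * t + (unsnoc a).2))%R.
Proof.
apply/rowP => i; rewrite !mxE; case: unliftP => [j ->|->] //=.
by rewrite !mxE.
Qed.

Lemma measurable_snocl m (t : R) :
  measurable_fun setT (fun x : 'rV[R]_m => snoc (x, t)).
Proof.
apply: measurableT_comp; first exact: measurable_snoc.
exact: measurable_pair2.
Qed.

Lemma measurable_snocr m (x : 'rV[R]_m) :
  measurable_fun setT (fun t : measurableTypeR R => snoc (x, t)).
Proof.
apply: measurableT_comp; first exact: measurable_snoc.
exact: measurable_pair1.
Qed.

Lemma ge0_integral_affine m (s : R) (a : 'rV[R]_m) (f : 'rV[R]_m -> \bar R) :
  (0 < s)%R -> measurable_fun setT f -> (forall x, 0 <= f x) ->
  \int[leb m]_x f (s *: x + a)%R = (s^-1 ^+ m)%:E * \int[leb m]_x f x.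
Proof.
move=> s0; elim: m a f => [|m IH] a f mf f0.
  rewrite expr0 mul1e; apply: eq_integral => x _; congr f.
  by apply/rowP => -[].
have mg : measurable_fun setT (fun x : 'rV[R]_m.+1 => f (s *: x + a)%R).
  by apply: measurableT_comp => //; exact: measurable_affine_rV.
pose F (x : 'rV[R]_m) := \int[@lebesgue_measure R]_t f (snoc (x, t)).
have mF : measurable_fun setT F.
  apply: (@measurable_fun_fubini_tonelli_F _ _ _ _ _ _ (fun p => f (snoc p))).
    by apply: measurableT_comp => //; exact: measurable_snoc.
  by [].
have F0 x : 0 <= F x by exact: integral_ge0.
rewrite (ge0_integral_snoc mf f0) (ge0_integral_snoc mg)//.
transitivity (\int[leb m]_x ((s^-1)%:E * F (s *: x + (unsnoc a).1)%R)).
  apply: eq_integral => x _.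
  have := @ge0_integral_affine1 s (unsnoc a).2
    (fun t => f (snoc ((s *: x + (unsnoc a).1)%R, t))) s0.
  rewrite -/(F _) => <-//; first by apply: eq_integral => t _; rewrite snoc_affine.
  by apply: measurableT_comp => //; exact: measurable_snocr.
rewrite ge0_integralZl; first by rewrite (IH _ F)// muleA -EFinM exprS.
- exact: measurableT.
- by apply: (measurableT_comp mF); exact: measurable_affine_rV.
- by move=> x _; exact: F0.
- by rewrite lee_fin invr_ge0 ltW.
Qed.

End rV_measure.

Section derive_gen.
Variables (R : realType) (V : normedModType R).
Implicit Types (f : V -> R) (x v : V).

Lemma is_deriveP f x v (l : R) :
  is_derive x v f l <->
  h^-1 * (f (h *: v + x) - f x) @[h --> (0 : R)^'] --> l.
Proof.
split=> [[dv dl]|dl].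
  by rewrite -dl; exact: dv.
by split; [apply/cvg_ex; exists l | apply/cvg_lim].
Qed.

Lemma is_derive_epsP f x v (l : R) :
  is_derive x v f l <->
  forall e : R, 0 < e -> exists2 d : R, 0 < d & forall h : R, h != 0 -> `|h| < d ->
    `|l - h^-1 * (f (h *: v + x) - f x)| <= e.
Proof.
rewrite is_deriveP; split.
  move=> /cvgrPdist_le H e e0; have [d /= d0 Hd] := H _ e0.
  exists d => // h h0 hd; apply: Hd => //=.
  by rewrite sub0r normrN.
move=> H; apply/cvgrPdist_le => e e0; have [d d0 Hd] := H _ e0.
exists d => // h /= hd h0; apply: Hd => //.
by move: hd; rewrite sub0r normrN.
Qed.

End derive_gen.

Section derive_line.
Variables (R : realType) (V : normedModType R).
Implicit Types (f : V -> R) (x v : V).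

Lemma is_derive_lin (W : normedModType R) (L : W -> V) f (y w : W) v (l : R) :
  (forall h, L (h *: w + y) = h *: v + L y) ->
  is_derive (L y) v f l -> is_derive y w (f \o L) l.
Proof.
move=> Lh /is_derive_epsP fl; apply/is_derive_epsP => e /fl[d d0 H].
by exists d => // h h0 hd; rewrite /= Lh; exact: H.
Qed.

Lemma is_derive_line f v (g : V -> R) :
  (forall x : V, is_derive x v f (g x)) ->
  forall x (s : R), is_derive s 1 (fun s => f (s *: v + x)) (g (s *: v + x)).
Proof.
move=> fg x s; apply: (@is_derive_lin _ (fun s : R => s *: v + x) f s 1 v) => //.
by move=> h; rewrite scalerDl -addrA (_ : h%:A = h)//; exact: mulr1.
Qed.

End derive_line.

Lemma MVT_all (R : realType) (f g : R -> R) :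
  (forall s : R, is_derive s 1 f (g s)) ->
  forall a b, exists2 c, `|c - a| <= `|b - a| & f b - f a = g c * (b - a).
Proof.
move=> fg a b.
have cf : continuous f.
  by move=> s; apply/differentiable_continuous/derivable1_diffP; have [] := fg s.
have [ab|ba|->] := ltgtP a b.
- have [c] := MVT ab (fun x _ => fg x) (continuous_subspaceT cf).
  rewrite in_itv/= => /andP[ac cb] E; exists c => //.
  by rewrite !ger0_norm; lra.
- have [c] := MVT ba (fun x _ => fg x) (continuous_subspaceT cf).
  rewrite in_itv/= => /andP[ac cb] E; exists c; last lra.
  by rewrite !ler0_norm; lra.
- by exists b; rewrite ?subrr// mulr0.
Qed.

(** * Continuously differentiable functions *)

Section C1.
Variable R : realType.

Lemma cont_eps (V : normedModType R) (f : V -> R) (x : V) :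
  {for x, continuous f} ->
  forall e : R, 0 < e -> exists2 d : R, 0 < d &
    forall y : V, `|x - y| < d -> `|f x - f y| < e.
Proof.
move=> /cvgrPdist_lt H e /H /nbhs_ballP[d /= d0 Hd]; exists d => // y xy.
by apply: Hd; rewrite -ball_normE.
Qed.

Definition C1 n (f : 'rV[R]_n -> R) (Df : 'I_n -> 'rV[R]_n -> R) : Prop :=
  [/\ continuous f, forall i, continuous (Df i) &
      forall i x, is_derive x (delta_mx ord0 i) f (Df i x)].

(** The classical passage from continuous partial derivatives to directional ones. The truncations
    [w k] of the direction gain one coordinate at a time; the mean value theorem handles the new
    coordinate, and continuity of [Df j] absorbs the displaced base point. *)
Lemma C1_is_derive n (f : 'rV[R]_n -> R) Df : C1 f Df ->
  forall x v : 'rV[R]_n, is_derive x v f (\sum_i v ord0 i * Df i x).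
Proof.
move=> [cf cDf df] x v.
pose w k : 'rV[R]_n := \row_i (if (i < k)%N then v ord0 i else 0).
suff H k : (k <= n)%N ->
    is_derive x (w k) f (\sum_(i < n | (i < k)%N) v ord0 i * Df i x).
  have := H n (leqnn n).
  rewrite (_ : w n = v); last by apply/rowP => i; rewrite mxE ltn_ord.
  by under eq_bigl => i do rewrite ltn_ord.
elim: k => [_|k IH kn].
  rewrite (_ : w 0%N = 0); last by apply/rowP => i; rewrite !mxE.
  by rewrite big1//; exact: is_derive0.
pose j := Ordinal kn.
have wS : w k.+1 = v ord0 j *: delta_mx ord0 j + w k.
  apply/rowP => i; rewrite !mxE eqxx/= ltnS leq_eqVlt.
  have [->|ij] := eqVneq i j; first by rewrite eqxx/= mulr1 ltnn addr0.
  by rewrite mulr0 add0r (negbTE (_ : i != k :> nat))//; apply: contra ij => /eqP ik; apply/eqP/val_inj.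
have -> : \sum_(i < n | (i < k.+1)%N) v ord0 i * Df i x =
    v ord0 j * Df j x + \sum_(i < n | (i < k)%N) v ord0 i * Df i x.
  rewrite (bigD1 j)//=; congr +%R; apply: eq_bigl => i.
  rewrite ltnS ltn_neqAle andbC; congr andb.
have /is_derive_epsP {}IH := IH (ltnW kn).
apply/is_derive_epsP => e e0.
have e2 : 0 < e / 2 by rewrite divr_gt0.
have [d1 d10 H1] := IH _ e2.
pose M := `|v ord0 j| + 1.
have M0 : 0 < M by rewrite ltr_wpDl.
have [|d2 d20 H2] := cont_eps (cDf j x) (_ : 0 < e / 2 / M).
  by rewrite divr_gt0.
pose N := `|w k| + M.
have N0 : 0 < N by rewrite ltr_wpDl.
exists (Num.min d1 (d2 / N)); first by rewrite lt_min d10 divr_gt0.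
move=> h h0; rewrite lt_min => /andP[hd1 hd2].
have := @MVT_all _ _ _ (is_derive_line (df j) (h *: w k + x)) 0 (h * v ord0 j).
rewrite !subr0 scale0r add0r => -[c]; rewrite subr0 => ch.
rewrite addrA -scalerA -scalerDr -wS => E.
have H3 : `|v ord0 j * Df j x - v ord0 j * Df j (c *: delta_mx ord0 j + (h *: w k + x))| <= e / 2.
  rewrite -mulrBr normrM (@le_trans _ _ (M * (e / 2 / M)))//.
    apply: ler_pM => //; first by rewrite lerDl.
    apply/ltW/H2.
    rewrite (_ : x - _ = - (c *: delta_mx ord0 j + h *: w k)); last first.
      by rewrite addrA opprD addrCA subrr addr0.
    rewrite normrN (le_lt_trans (ler_normD _ _))// !normrZ.
    have : `|delta_mx ord0 j : 'rV[R]_n| <= 1.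
      apply: norm_le_coord => // i; rewrite mxE eqxx /=.
      by case: eqP; rewrite ?normr1 ?normr0.
    move=> dl; move: hd2; rewrite ltr_pdivlMr//; apply: le_lt_trans.
    rewrite /N mulrDr addrC lerD2l.
    apply: le_trans (_ : `|c| * 1 <= _); first exact: ler_wpM2l.
    rewrite mulr1 (le_trans ch)// normrM ler_wpM2l// /M; lra.
  by rewrite mulrC divfK// gt_eqF.
have := H1 h h0 hd1.
have -> : f (h *: w k.+1 + x) = f (h *: w k + x) +
    Df j (c *: delta_mx ord0 j + (h *: w k + x)) * (h * v ord0 j) by lra.
move=> H4.
set A := Df j (c *: _ + _) in H3 *; set B := \sum_(_ < _ | _) _ in H4 *.
rewrite (_ : _ - _ = (v ord0 j * Df j x - v ord0 j * A) +
  (B - h^-1 * (f (h *: w k + x) - f x))); last by field.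
by rewrite (le_trans (ler_normD _ _))//; lra.
Qed.

End C1.
Section derive_comp.
Variables (R : realType) (V : normedModType R).

Lemma is_derive_at0 (F : V -> R) (x v : V) (l : R) :
  is_derive (0 : R) 1 (fun h : R => F (h *: v + x)) l <-> is_derive x v F l.
Proof.
split => /is_derive_epsP H; apply/is_derive_epsP => e /H[d d0 {}H];
  exists d => // h h0 hd; move: (H h h0 hd).
- by rewrite scale0r add0r addr0 (_ : h *: 1 = h)//; exact: mulr1.
- by rewrite scale0r add0r addr0 (_ : h *: 1 = h)//; exact: mulr1.
Qed.

Lemma is_derive_comp1 (f : V -> R) (g : R -> R) (x v : V) (l l' : R) :
  is_derive x v f l -> is_derive (f x) 1 g l' -> is_derive x v (g \o f) (l' * l).
Proof.
move=> /is_derive_at0 fl gl; apply/is_derive_at0.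
apply: (@is_derive1_comp _ g (fun h : R => f (h *: v + x)) 0) => //.
by rewrite scale0r add0r.
Qed.

End derive_comp.

Section cont_closure.
Variables (R : realType) (T : topologicalType).
Implicit Types f g : T -> R.

Lemma contD f g : continuous f -> continuous g -> continuous (fun x => f x + g x).
Proof. by move=> cf cg x; apply: continuousD; [exact: cf|exact: cg]. Qed.

Lemma contM f g : continuous f -> continuous g -> continuous (fun x => f x * g x).
Proof. by move=> cf cg x; apply: continuousM; [exact: cf|exact: cg]. Qed.

Lemma contN f : continuous f -> continuous (fun x => - f x).
Proof. by move=> cf x; apply: continuousN; exact: cf. Qed.

Lemma cont_sum (I : Type) (s : seq I) (f : I -> T -> R) :
  (forall i, continuous (f i)) -> continuous (fun x => \sum_(i <- s) f i x).
Proof.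
move=> cf; elim: s => [|j s IH].
  rewrite (_ : (fun _ => _) = cst 0); first by move=> x; exact: cst_continuous.
  by apply/funext => x; rewrite big_nil.
rewrite (_ : (fun _ => _) = fun x => f j x + \sum_(i <- s) f i x).
  exact: contD.
by apply/funext => x; rewrite big_cons.
Qed.

End cont_closure.

Section C1_closure.
Variables (R : realType) (n : nat).
Implicit Types (f g : 'rV[R]_n -> R) (Df Dg : 'I_n -> 'rV[R]_n -> R).

Lemma C1_cst (c : R) : C1 (fun _ : 'rV[R]_n => c) (fun _ _ => 0).
Proof.
split => [x|i x|i x]; [exact: cst_continuous|exact: cst_continuous|].
exact: is_derive_cst.
Qed.

Lemma C1_coord (j : 'I_n) :
  C1 (fun x : 'rV[R]_n => x ord0 j) (fun i _ => (i == j)%:R).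
Proof.
split => [x|i x|i x]; [exact: coord_continuous|exact: cst_continuous|].
apply/is_derive_epsP => e e0; exists 1 => // h h0 _.
by rewrite !mxE eqxx/= addrK eq_sym mulrA mulVf// mul1r subrr normr0 ltW.
Qed.

Lemma C1D f Df g Dg : C1 f Df -> C1 g Dg ->
  C1 (fun x => f x + g x) (fun i x => Df i x + Dg i x).
Proof.
move=> [cf cDf df] [cg cDg dg]; split => [x|i x|i x].
- by apply: continuousD; [exact: cf|exact: cg].
- by apply: continuousD; [exact: cDf|exact: cDg].
- exact: is_deriveD.
Qed.

Lemma C1M f Df g Dg : C1 f Df -> C1 g Dg ->
  C1 (fun x => f x * g x) (fun i x => f x * Dg i x + g x * Df i x).
Proof.
move=> [cf cDf df] [cg cDg dg]; split => [x|i x|i x].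
- by apply: continuousM; [exact: cf|exact: cg].
- exact: (contD (contM cf (cDg i)) (contM cg (cDf i))).
- exact: is_deriveM.
Qed.

Lemma C1N f Df : C1 f Df -> C1 (fun x => - f x) (fun i x => - Df i x).
Proof.
move=> [cf cDf df]; split => [x|i x|i x].
- by apply: continuousN; exact: cf.
- by apply: continuousN; exact: cDf.
- exact: is_deriveN.
Qed.

Lemma C1_ext f Df g Dg : f =1 g -> (forall i x, Df i x = Dg i x) ->
  C1 f Df -> C1 g Dg.
Proof.
move=> /funext <- D.
suff -> : Dg = Df by [].
by apply/funext => i; apply/funext => x; rewrite D.
Qed.

Lemma C1B f Df g Dg : C1 f Df -> C1 g Dg ->
  C1 (fun x => f x - g x) (fun i x => Df i x - Dg i x).
Proof. by move=> cf /C1N cg; exact: C1D. Qed.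

Lemma C1Z (c : R) f Df : C1 f Df -> C1 (fun x => c * f x) (fun i x => c * Df i x).
Proof.
move=> cf; have := C1M (C1_cst c) cf; apply: C1_ext => // i x.
by rewrite mulr0 addr0.
Qed.

Lemma C1_sum (I : Type) (s : seq I) (f : I -> 'rV[R]_n -> R)
    (Df : I -> 'I_n -> 'rV[R]_n -> R) :
  (forall j, C1 (f j) (Df j)) ->
  C1 (fun x => \sum_(j <- s) f j x) (fun i x => \sum_(j <- s) Df j i x).
Proof.
move=> fD; elim: s => [|j s IH].
  by apply: C1_ext (C1_cst 0) => [x|i x]; rewrite big_nil.
by apply: C1_ext (C1D (fD j) IH) => [x|i x]; rewrite big_cons.
Qed.

Lemma C1_comp (h h' : R -> R) f Df : C1 f Df ->
  (forall x, is_derive (f x) 1 h (h' (f x))) -> continuous (h' \o f) ->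
  C1 (h \o f) (fun i x => h' (f x) * Df i x).
Proof.
move=> [cf cDf df] dh ch; split => [x|i x|i x].
- apply: continuous_comp; first exact: cf.
  by apply/differentiable_continuous/derivable1_diffP; have [] := dh x.
- by apply: continuousM; [exact: ch|exact: cDf].
- exact: is_derive_comp1.
Qed.

Definition sqn (x : 'rV[R]_n) := \sum_i x ord0 i ^+ 2.

Lemma C1_sqn : C1 sqn (fun i x => 2 * x ord0 i).
Proof.
have := C1_sum (index_enum 'I_n) (fun j => C1M (C1_coord j) (C1_coord j)).
apply: C1_ext => [x|i x]; first by apply: eq_bigr => j _; rewrite expr2.
rewrite (bigD1 i)//= eqxx big1 ?addr0; first by rewrite mulr1 mulr_natl mulr2n.
by move=> j ji; rewrite eq_sym (negbTE ji) mulr0 addr0.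
Qed.

Lemma sqn_ge0 (x : 'rV[R]_n) : 0 <= sqn x.
Proof. by apply: sumr_ge0 => i _; exact: sqr_ge0. Qed.

Lemma C1_lin k (L : 'rV[R]_k -> 'rV[R]_n) (w : 'I_k -> 'rV[R]_n) f Df :
  (forall i h y, L (h *: delta_mx ord0 i + y) = h *: w i + L y) ->
  continuous L -> C1 f Df ->
  C1 (f \o L) (fun i y => \sum_j w i ord0 j * Df j (L y)).
Proof.
move=> Lh cL fD; have [cf cDf df] := fD; split => [x|i x|i x].
- by apply: continuous_comp; [exact: cL|exact: cf].
- apply: cont_sum => {x} j; apply: contM; first by move=> x; exact: cst_continuous.
  by move=> x; apply: (@continuous_comp _ _ _ L (Df j)); [exact: cL|exact: cDf].
- by apply: is_derive_lin (C1_is_derive fD (L x) (w i)) => h; rewrite Lh.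
Qed.

Lemma C1_affine (s : R) (a : 'rV[R]_n) f Df : C1 f Df ->
  C1 (fun x => f (s *: x + a)) (fun i x => s * Df i (s *: x + a)).
Proof.
move=> fD.
have := @C1_lin n (fun x => s *: x + a) (fun i => s *: delta_mx ord0 i) f Df.
move=> /(_ _ _ fD) H; apply: C1_ext (H _ _) => //.
- move=> i x; rewrite (bigD1 i)//= !mxE !eqxx mulr1 big1 ?addr0// => j ji.
  by rewrite !mxE (negbTE ji) andbF mulr0 mul0r.
- by move=> i h y; rewrite scalerDr scalerA mulrC -scalerA addrA.
- move=> x; apply: (@continuousD _ _ _ (fun x : 'rV[R]_n => s *: x) (cst a)).
    exact: scaler_continuous.
  exact: cst_continuous.
Qed.

End C1_closure.

(** * Locally bounded functions and bounded supports *)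

Section lbm.
Variables (R : realType) (n : nat).
Implicit Types (f g : 'rV[R]_n -> R).

(** Together with [bsupp] this gives a class stable under sums, products and slices that contains
    both the C^1 functions and the merely bounded coefficients of the boundary condition, so that
    integrability can be read off the shape of an integrand. *)
Definition lbm f := measurable_fun setT f /\
  forall M : R, exists K : R, forall x, `|x| <= M -> `|f x| <= K.

Definition bsupp f := exists M : R, forall x, M < `|x| -> f x = 0.

Lemma lbm_cst (c : R) : lbm (fun=> c).
Proof. by split => // M; exists `|c|. Qed.

Lemma lbmD f g : lbm f -> lbm g -> lbm (fun x => f x + g x).
Proof.
move=> [mf bf] [mg bg]; split => [|M]; first exact: measurable_funD.
have [K1 H1] := bf M; have [K2 H2] := bg M; exists (K1 + K2) => x xM.
by rewrite (le_trans (ler_normD _ _))// lerD ?H1 ?H2.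
Qed.

Lemma lbmM f g : lbm f -> lbm g -> lbm (fun x => f x * g x).
Proof.
move=> [mf bf] [mg bg]; split => [|M]; first exact: measurable_funM.
have [K1 H1] := bf M; have [K2 H2] := bg M; exists (K1 * K2) => x xM.
by rewrite normrM ler_pM ?H1 ?H2.
Qed.

Lemma lbmN f : lbm f -> lbm (fun x => - f x).
Proof.
move=> /(lbmM (lbm_cst (-1))); congr lbm.
by apply/funext => x; rewrite mulN1r.
Qed.

Lemma lbmX f k : lbm f -> lbm (fun x => f x ^+ k).
Proof.
move=> lf; elim: k => [|k IH]; first exact: lbm_cst.
have := lbmM lf IH; congr lbm.
by apply/funext => x; rewrite exprS.
Qed.

Lemma lbm_sum (I : Type) (s : seq I) (P : pred I) (f : I -> 'rV[R]_n -> R) :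
  (forall j, lbm (f j)) -> lbm (fun x => \sum_(j <- s | P j) f j x).
Proof.
move=> lf; elim: s => [|j s IH].
  by have := lbm_cst 0; congr lbm; apply/funext => x; rewrite big_nil.
case: (boolP (P j)) => Pj.
  have := lbmD (lf j) IH; congr lbm.
  by apply/funext => x; rewrite big_cons Pj.
by move: IH; congr lbm; apply/funext => x; rewrite big_cons (negbTE Pj).
Qed.

Lemma lbm_norm f : lbm f -> lbm (fun x => `|f x|).
Proof.
move=> [mf bf]; split => [|M]; first exact: measurableT_comp.
by have [K H] := bf M; exists K => x xM; rewrite normr_id H.
Qed.

Lemma lbm_cont f : continuous f -> lbm f.
Proof.
move=> cf; split => [|M]; first exact: continuous_measurable_rV.
have : compact (closed_ball_ Num.norm (0 : 'rV[R]_n) M).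
  apply: bounded_closed_compact; last exact: closed_closed_ball_.
  exists M; split; first exact: num_real.
  by move=> y My x; rewrite /closed_ball_/= sub0r normrN => /le_trans; apply; exact/ltW.
move=> /(continuous_compact (continuous_subspaceT cf)) /compact_bounded[K [_ HK]].
exists (K + 1) => x xM; apply: (HK (K + 1)); first by rewrite ltrDl.
by exists x => //; rewrite /closed_ball_/= sub0r normrN.
Qed.

Lemma lbm_restrict f (D : set 'rV[R]_n) : measurable D -> lbm f -> lbm (f \_ D).
Proof.
move=> mD [mf bf]; split => [|M].
  apply/(measurable_restrictT _ mD); exact: measurable_funTS.
have [K H] := bf M; exists K => x xM; rewrite patchE; case: ifPn => _; first exact: H.
by rewrite normr0 (le_trans _ (H _ xM)).
Qed.

Lemma lbm_coord (i : 'I_n) : lbm (fun x => x ord0 i).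
Proof. by apply: lbm_cont => x; exact: coord_continuous. Qed.

Lemma lbm_comp k (L : 'rV[R]_k -> 'rV[R]_n) f :
  measurable_fun setT L -> (forall M : R, exists K : R, forall x, `|x| <= M -> `|L x| <= K) ->
  lbm f -> measurable_fun setT (f \o L) /\
  forall M : R, exists K : R, forall x, `|x| <= M -> `|f (L x)| <= K.
Proof.
move=> mL bL [mf bf]; split => [|M]; first exact: measurableT_comp.
have [K1 H1] := bL M; have [K H] := bf K1; exists K => x xM.
by apply: H; exact: H1.
Qed.

Lemma bsuppMl f g : bsupp f -> bsupp (fun x => f x * g x).
Proof. by move=> [M HM]; exists M => x /HM ->; rewrite mul0r. Qed.

Lemma bsuppMr f g : bsupp g -> bsupp (fun x => f x * g x).
Proof. by move=> [M HM]; exists M => x /HM ->; rewrite mulr0. Qed.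

Lemma bsuppD f g : bsupp f -> bsupp g -> bsupp (fun x => f x + g x).
Proof.
move=> [M HM] [N HN]; exists (Num.max M N) => x.
by rewrite gt_max => /andP[/HM -> /HN ->]; rewrite addr0.
Qed.

Lemma bsupp_cst0 : bsupp (fun=> 0).
Proof. by exists 0. Qed.

Lemma bsuppN f : bsupp f -> bsupp (fun x => - f x).
Proof. by move=> [M HM]; exists M => x /HM ->; rewrite oppr0. Qed.

Lemma bsuppB f g : bsupp f -> bsupp g -> bsupp (fun x => f x - g x).
Proof. by move=> bf /bsuppN bg; exact: bsuppD. Qed.

Lemma bsuppX f k : (0 < k)%N -> bsupp f -> bsupp (fun x => f x ^+ k).
Proof. by move=> k0 [M HM]; exists M => x /HM ->; rewrite expr0n gtn_eqF. Qed.

Lemma bsupp_norm f : bsupp f -> bsupp (fun x => `|f x|).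
Proof. by move=> [M HM]; exists M => x /HM ->; rewrite normr0. Qed.

Lemma bsupp_sum (I : Type) (s : seq I) (P : pred I) (f : I -> 'rV[R]_n -> R) :
  (forall j, bsupp (f j)) -> bsupp (fun x => \sum_(j <- s | P j) f j x).
Proof.
move=> lf; elim: s => [|j s IH].
  by have := bsupp_cst0; congr bsupp; apply/funext => x; rewrite big_nil.
case: (boolP (P j)) => Pj.
  have := bsuppD (lf j) IH; congr bsupp.
  by apply/funext => x; rewrite big_cons Pj.
by move: IH; congr bsupp; apply/funext => x; rewrite big_cons (negbTE Pj).
Qed.

Lemma bsupp_restrict f (D : set 'rV[R]_n) : bsupp f -> bsupp (f \_ D).
Proof. by move=> [M HM]; exists M => x /HM fx; rewrite patchE fx; case: ifP. Qed.

Lemma bsupp_scale f (s : R) : 0 < s -> bsupp f -> bsupp (fun x => f (s *: x)).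
Proof.
move=> s0 [M HM]; exists (M / s) => x; rewrite ltr_pdivrMr// => Mx.
by rewrite HM// normrZ gtr0_norm// mulrC.
Qed.

End lbm.
Section lebesgue_rV_integral.
Variable R : realType.
Local Notation leb := (lebesgue_rV R).

Lemma norm_hd m (y : 'rV[R]_m.+1) : `|(unsnoc y).1| <= `|y|.
Proof. by apply: norm_le_coord => // i; rewrite mxE coord_le_norm. Qed.

Lemma norm_last m (y : 'rV[R]_m.+1) : `|(unsnoc y).2| <= `|y|.
Proof. exact: coord_le_norm. Qed.

Lemma norm_snoc m (x : 'rV[R]_m) (t : R) : `|snoc (x, t)| <= Num.max `|x| `|t|.
Proof.
apply: norm_le_coord => [|i]; first by rewrite le_max normr_ge0.
rewrite mxE; case: unliftP => [j _|_] /=; rewrite le_max ?lexx ?orbT//.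
by rewrite coord_le_norm.
Qed.

Lemma norm_snocl m (x : 'rV[R]_m) (t : R) : `|x| <= `|snoc (x, t)|.
Proof. by have := norm_hd (snoc (x, t)); rewrite snocK. Qed.

Lemma norm_snocr m (x : 'rV[R]_m) (t : R) : `|t| <= `|snoc (x, t)|.
Proof. by have := norm_last (snoc (x, t)); rewrite snocK. Qed.

Lemma norm_measurable n : measurable_fun setT (fun x : 'rV[R]_n => `|x|).
Proof. by apply: continuous_measurable_rV => x; exact: norm_continuous. Qed.

Lemma measurable_ball_rV n (M : R) : measurable [set x : 'rV[R]_n | `|x| <= M].
Proof.
rewrite -[X in measurable X]setTI -/((fun x : 'rV[R]_n => `|x|) @^-1` `]-oo, M]).
exact: norm_measurable.
Qed.

Lemma lebesgue_itv_lty (a b : R) : (@lebesgue_measure R `[a, b]%classic < +oo)%E.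
Proof.
by rewrite lebesgue_measure_itv/=; case: ifP => _; rewrite ?ltry// -EFinB ltry.
Qed.

Lemma lebesgue_rV_ball n (M : R) : (leb n [set x | (`|x| <= M)%R] < +oo)%E.
Proof.
elim: n => [|n IH]; first by rewrite /= /dirac_rV0 /dirac indicE ltry.
have -> : leb n.+1 [set x | `|x| <= M] =
    (leb n \x @lebesgue_measure R)%E (@snoc R n @^-1` [set x | `|x| <= M]) by [].
rewrite (_ : _ @^-1` _ = [set x | `|x| <= M] `*` `[- M, M]); last first.
  apply/seteqP; split => -[x t] /=; rewrite in_itv/= -ler_norml.
    by move=> xM; rewrite (le_trans (norm_snocl x t))// (le_trans (norm_snocr x t)).
  by move=> [xM tM]; rewrite (le_trans (norm_snoc x t))// ge_max xM.
rewrite product_measure1E//; last exact: measurable_ball_rV.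
rewrite lte_mul_pinfty// ?ge0_fin_numE//.
exact: lebesgue_itv_lty.
Qed.

Lemma lbs_integrable n (f : 'rV[R]_n -> R) (D : set 'rV[R]_n) :
  measurable D -> lbm f -> bsupp f -> (leb n).-integrable D (EFin \o f).
Proof.
move=> mD [mf bf] [M fM].
apply: (@integrableS _ _ _ _ setT) => //.
have [K HK] := bf M.
pose B := [set x : 'rV[R]_n | `|x| <= M].
have mB : measurable B by exact: measurable_ball_rV.
have fE : f = f \_ B.
  apply/funext => x; rewrite patchE; case: ifPn => //.
  by rewrite notin_setE /B/= => /negP; rewrite -ltNge; exact: fM.
rewrite fE (_ : EFin \o _ = (EFin \o f) \_ B); last by rewrite restrict_EFin.
apply: (integrable_mkcond _ mB).1; apply: measurable_bounded_integrable => //.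
- exact: lebesgue_rV_ball.
- exact: measurable_funTS.
- exists `|K|; split; first exact: num_real.
  move=> y Ky x Bx; apply: le_trans (ltW Ky).
  by rewrite (le_trans (HK x Bx))// ler_norm.
Qed.

Lemma ge0_RintegralE d (T : measurableType d) (mu : {measure set T -> \bar R})
    (D : set T) (f : T -> R) : measurable D -> mu.-integrable D (EFin \o f) ->
  (\int[mu]_(x in D) f x)%:E = (\int[mu]_(x in D) (f x)%:E)%E.
Proof. by move=> mD If; rewrite fineK//; exact: integrable_fin_num. Qed.

Lemma integrable_snoc m (f : 'rV[R]_m.+1 -> R) :
  (leb m.+1).-integrable setT (EFin \o f) ->
  (leb m \x @lebesgue_measure R)%E.-integrable setT (EFin \o (f \o @snoc R m)).
Proof.
move=> /integrableP[mf fi]; apply/integrableP; split.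
  by apply: (measurableT_comp mf); exact: measurable_snoc.
move: fi; rewrite ge0_integral_snoc//; last exact: measurableT_comp.
rewrite (@fubini_tonelli1 _ _ _ _ _ _ _ (fun p => `|(f (snoc p))%:E|)%E)//.
apply: measurableT_comp => //; apply: (measurableT_comp mf).
exact: measurable_snoc.
Qed.

Lemma integral_snoc m (f : 'rV[R]_m.+1 -> R) :
  (leb m.+1).-integrable setT (EFin \o f) ->
  (\int[leb m.+1]_x (f x)%:E)%E =
  (\int[leb m \x @lebesgue_measure R]_p (f (snoc p))%:E)%E.
Proof.
move=> fi; have /integrableP[mf _] := fi.
have := @integral_pushforward _ _ _ _ _ (@snoc R m) (@measurable_snoc R m)
  (leb m \x @lebesgue_measure R)%E setT (EFin \o f) mf.
rewrite preimage_setT; apply => //; exact: integrable_snoc.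
Qed.

Lemma Rint_snoc m (f : 'rV[R]_m.+1 -> R) :
  (leb m.+1).-integrable setT (EFin \o f) ->
  (forall x, (@lebesgue_measure R).-integrable setT (EFin \o (fun t => f (snoc (x, t))))) ->
  \int[leb m.+1]_x f x = \int[leb m]_x \int[lebesgue_measure]_t f (snoc (x, t)) /\
  (leb m).-integrable setT (EFin \o (fun x => \int[lebesgue_measure]_t f (snoc (x, t)))).
Proof.
move=> fi fs; have fi2 := integrable_snoc fi.
have E : EFin \o (fun x => \int[lebesgue_measure]_t f (snoc (x, t))) =
    fubini_F (@lebesgue_measure R) (EFin \o (f \o @snoc R m)).
  by apply/funext => x; rewrite /= ge0_RintegralE//; exact: fs.
split; last by rewrite E; exact: integrable_fubini_F.
rewrite /Rintegral integral_snoc// -(integral12_prod_meas1 fi2) -E.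
by congr fine; apply: eq_integral.
Qed.

Lemma Rint_snoc2 m (f : 'rV[R]_m.+1 -> R) :
  (leb m.+1).-integrable setT (EFin \o f) ->
  (forall t, (leb m).-integrable setT (EFin \o (fun x => f (snoc (x, t))))) ->
  \int[leb m.+1]_x f x = \int[lebesgue_measure]_t \int[leb m]_x f (snoc (x, t)).
Proof.
move=> fi fs; have fi2 := integrable_snoc fi.
have E : EFin \o (fun t => \int[leb m]_x f (snoc (x, t))) =
    fubini_G (leb m) (EFin \o (f \o @snoc R m)).
  by apply/funext => t; rewrite /= ge0_RintegralE//; exact: fs.
rewrite /Rintegral integral_snoc// -(integral21_prod_meas1 fi2) -E.
by congr fine; apply: eq_integral.
Qed.

Lemma lbm_slice m (f : 'rV[R]_m.+1 -> R) (t : R) :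
  lbm f -> lbm (fun x : 'rV[R]_m => f (snoc (x, t))).
Proof.
move=> lf; apply: (lbm_comp _ _ lf); first exact: measurable_snocl.
move=> M; exists (Num.max M `|t|) => x xM.
by rewrite (le_trans (norm_snoc x t))// ge_max !le_max xM lexx orbT.
Qed.

Lemma bsupp_slice m (f : 'rV[R]_m.+1 -> R) (t : R) :
  bsupp f -> bsupp (fun x : 'rV[R]_m => f (snoc (x, t))).
Proof.
by move=> [M HM]; exists M => x xM; apply: HM; rewrite (lt_le_trans xM)// norm_snocl.
Qed.

Lemma lbm_hd m (f : 'rV[R]_m -> R) :
  lbm f -> lbm (fun x : 'rV[R]_m.+1 => f (unsnoc x).1).
Proof.
move=> lf; apply: (lbm_comp _ _ lf).
  by apply: (measurableT_comp measurable_fst); exact: measurable_unsnoc.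
by move=> M; exists M => x xM; rewrite (le_trans (norm_hd x)).
Qed.

Lemma lbm_affine n (f : 'rV[R]_n -> R) (s : R) (a : 'rV[R]_n) :
  lbm f -> lbm (fun x => f (s *: x + a)).
Proof.
move=> lf; apply: (lbm_comp _ _ lf); first exact: measurable_affine_rV.
move=> M; exists (`|s| * M + `|a|) => x xM.
by rewrite (le_trans (ler_normD _ _))// lerD2r normrZ ler_wpM2l.
Qed.

Lemma bsupp_affine n (f : 'rV[R]_n -> R) (s : R) (a : 'rV[R]_n) : 0 < s ->
  bsupp f -> bsupp (fun x => f (s *: x + a)).
Proof.
move=> s0 [M HM]; exists ((M + `|a|) / s) => x; rewrite ltr_pdivrMr// => Mx.
apply: HM; rewrite -(ltrD2r `|a|) (lt_le_trans Mx)//.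
rewrite mulrC -{1}(gtr0_norm s0) -normrZ.
by rewrite -{1}(addrK a (s *: x)) (le_trans (ler_normB _ _)).
Qed.

Lemma slice_integrable m (f : 'rV[R]_m.+1 -> R) (x : 'rV[R]_m) :
  lbm f -> bsupp f ->
  (@lebesgue_measure R).-integrable setT (EFin \o (fun t => f (snoc (x, t)))).
Proof.
move=> [mf bf] [M HM].
have [K HK] := bf (Num.max `|x| `|M|).
have mg : measurable_fun setT (fun t : measurableTypeR R => f (snoc (x, t))).
  by apply: measurableT_comp => //; exact: measurable_snocr.
have -> : (fun t : R => f (snoc (x, t))) =
    (fun t => f (snoc (x, t))) \_ `[- M, M].
  apply/funext => t; rewrite patchE; case: ifPn => //.
  rewrite notin_setE /= in_itv/= -ler_norml => /negP; rewrite -ltNge => Mt.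
  by apply: HM; rewrite (lt_le_trans Mt)// norm_snocr.
rewrite (_ : EFin \o _ = (EFin \o (fun t : R => f (snoc (x, t)))) \_ `[- M, M]);
  last by rewrite restrict_EFin.
have mI : measurable (`[- M, M]%classic : set (measurableTypeR R)).
  exact: measurable_itv.
apply: (integrable_mkcond _ mI).1.
apply: measurable_bounded_integrable => //.
- exact: lebesgue_itv_lty.
- exact: measurable_funTS.
- exists `|K|; split; first exact: num_real.
  move=> y Ky t; rewrite /= in_itv/= -ler_norml => tM; apply: le_trans (ltW Ky).
  rewrite (le_trans _ (ler_norm K))//; apply: HK.
  rewrite (le_trans (norm_snoc x t))// ge_max !le_max lexx/=.
  by rewrite (le_trans tM (ler_norm M)) orbT.
Qed.

Lemma Rint_lbs1 m (f : 'rV[R]_m.+1 -> R) : lbm f -> bsupp f ->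
  \int[leb m.+1]_x f x = \int[leb m]_x \int[lebesgue_measure]_t f (snoc (x, t)).
Proof.
move=> lf bf; have [] // := @Rint_snoc m f; first exact: lbs_integrable.
by move=> x; exact: slice_integrable.
Qed.

Lemma Rint_lbs2 m (f : 'rV[R]_m.+1 -> R) : lbm f -> bsupp f ->
  \int[leb m.+1]_x f x = \int[lebesgue_measure]_t \int[leb m]_x f (snoc (x, t)).
Proof.
move=> lf bf; apply: Rint_snoc2; first exact: lbs_integrable.
move=> t; apply: lbs_integrable; [exact: measurableT|exact: lbm_slice|exact: bsupp_slice].
Qed.

(** No integrability is assumed: positive and negative parts are rescaled separately, and when their
    difference is infinite [fine] returns 0 on both sides. *)
Lemma Rint_affine n (s : R) (a : 'rV[R]_n) (f : 'rV[R]_n -> R) : 0 < s ->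
  measurable_fun setT f ->
  \int[leb n]_x f (s *: x + a) = s^-1 ^+ n * \int[leb n]_x f x.
Proof.
move=> s0 mf; rewrite /Rintegral.
have mf' : measurable_fun setT (EFin \o f) by exact: measurableT_comp.
set c := s^-1 ^+ n.
rewrite (integralE _ setT (EFin \o f)) (integralE _ setT (fun x => _)).
have -> : (\int[leb n]_x ((fun x => (f (s *: x + a))%:E)^\+ x))%E =
    (c%:E * \int[leb n]_x ((EFin \o f)^\+ x))%E.
  rewrite (@funepos_comp _ _ _ (EFin \o f) (fun x : 'rV[R]_n => s *: x + a)).
  exact: (@ge0_integral_affine _ _ s a (EFin \o f)^\+%E s0 (measurable_funepos mf')
    (fun x => funepos_ge0 _ x)).
have -> : (\int[leb n]_x ((fun x => (f (s *: x + a))%:E)^\- x))%E =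
    (c%:E * \int[leb n]_x ((EFin \o f)^\- x))%E.
  rewrite (@funeneg_comp _ _ _ (EFin \o f) (fun x : 'rV[R]_n => s *: x + a)).
  exact: (@ge0_integral_affine _ _ s a (EFin \o f)^\-%E s0 (measurable_funeneg mf')
    (fun x => funeneg_ge0 _ x)).
have c0 : 0 < c by rewrite exprn_gt0// invr_gt0.
set A := integral _ _ _; set B := integral _ _ _.
case: A => [A| |]; case: B => [B| |] //=; rewrite ?(gt0_muley,gt0_muleNy,mulr0,mulry,mulrNy) ?gtr0_sg ?mul1e ?mulr0 ?lte_fin//=; lra.
Qed.

End lebesgue_rV_integral.

(** * Differentiation under the integral, Cauchy-Schwarz, fundamental theorem of calculus *)

Section general_integral.
Context d (T : measurableType d) (R : realType) (mu : {measure set T -> \bar R}).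
Variables (D : set T) (mD : measurable D).

Lemma diff_under (f f' : R -> T -> R) (G : T -> R) (a u v : R) : u < a < v ->
  (forall s, u < s < v -> mu.-integrable D (EFin \o f s)) ->
  (forall s x, u < s < v -> D x -> is_derive s 1 (f^~ x) (f' s x)) ->
  mu.-integrable D (EFin \o G) ->
  (forall s x, u < s < v -> D x -> `|f' s x| <= G x) ->
  is_derive a 1 (fun s => \int[mu]_(x in D) f s x) (\int[mu]_(x in D) f' a x).
Proof.
move=> auv If df IG fG.
have Ia : (`]u, v[%classic : set R) a by rewrite /= in_itv.
have E x y : (`]u, v[%classic : set R) x -> D y -> partial1of2 f x y = f' x y.
  rewrite /= in_itv/= => xuv Dy; rewrite partial1of2E.
  by have [] := df x y xuv Dy.
have H1 x : (`]u, v[%classic : set R) x -> mu.-integrable D (EFin \o f x).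
  by rewrite /= in_itv/=; exact: If.
have H2 x y : (`]u, v[%classic : set R) x -> D y -> derivable (f ^~ y) x 1.
  by rewrite /= in_itv/= => xuv Dy; have [] := df x y xuv Dy.
have IG' : mu.-integrable D (EFin \o (fun x => `|G x|)) by exact: integrable_norm.
have H3 x y : (`]u, v[%classic : set R) x -> D y ->
    `|partial1of2 f x y| <= `|G y|.
  move=> xuv Dy; rewrite E//; move: xuv; rewrite /= in_itv/= => xuv.
  by rewrite (le_trans (fG _ _ xuv Dy))// ler_norm.
split.
  exact: (@derivable_under_integral _ _ _ _ f D mD a u v Ia H1 H2 _ _ IG' H3).
rewrite -derive1E.
rewrite (@differentiation_under_integral _ _ _ _ f D mD a u v Ia H1 H2 _ _ IG' H3)//.
by apply: eq_Rintegral => x; rewrite inE => Dx; rewrite E.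
Qed.

(** The discriminant of the nonnegative quadratic [s |-> int (s f + g)^2]. *)
Lemma Rint_CS (f g : T -> R) :
  mu.-integrable D (EFin \o (fun x => f x ^+ 2)) ->
  mu.-integrable D (EFin \o (fun x => g x ^+ 2)) ->
  mu.-integrable D (EFin \o (fun x => f x * g x)) ->
  (\int[mu]_(x in D) (f x * g x)) ^+ 2 <=
  \int[mu]_(x in D) (f x ^+ 2) * \int[mu]_(x in D) (g x ^+ 2).
Proof.
move=> If Ig Ifg.
set A := \int[mu]_(x in D) (f x ^+ 2).
set B := \int[mu]_(x in D) (f x * g x).
set C := \int[mu]_(x in D) (g x ^+ 2).
have H s : 0 <= s ^+ 2 * A + 2 * s * B + C.
  have IZ k (h : T -> R) : mu.-integrable D (EFin \o h) ->
      mu.-integrable D (EFin \o (fun x => k * h x)).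
    by move=> /(integrableZl mD k); apply: eq_integrable.
  have -> : s ^+ 2 * A + 2 * s * B + C =
      \int[mu]_(x in D) ((s ^+ 2 * f x ^+ 2 + 2 * s * (f x * g x)) + g x ^+ 2).
    rewrite RintegralD//; first by rewrite RintegralD ?RintegralZl//; exact: IZ.
    apply: eq_integrable (integrableD mD (IZ (s ^+ 2) _ If) (IZ (2 * s) _ Ifg)) => //.
  apply: Rintegral_ge0 => x _.
  suff -> : s ^+ 2 * f x ^+ 2 + 2 * s * (f x * g x) + g x ^+ 2 =
    (s * f x + g x) ^+ 2 by exact: sqr_ge0.
  by ring.
have A0 : 0 <= A by apply: Rintegral_ge0 => x _; exact: sqr_ge0.
have [A00|An0] := eqVneq A 0.
  have [->|Bn0] := eqVneq B 0; first by rewrite A00 expr0n mul0r.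
  (* With [A = 0] the quadratic is affine in [s] and takes the value -1 at this point, which is
     impossible. *)
  have := H (- (C + 1) / (2 * B)); rewrite A00 mulr0 add0r.
  have -> : 2 * (- (C + 1) / (2 * B)) * B = - (C + 1) by field.
  lra.
have Ap : 0 < A by rewrite lt_def An0.
have := H (- B / A).
have -> : (- B / A) ^+ 2 * A + 2 * (- B / A) * B + C = (A * C - B ^+ 2) / A by field.
by rewrite pmulr_lge0 ?invr_gt0// subr_ge0.
Qed.

End general_integral.

Section FTC.
Variable R : realType.
Local Notation mu := (@lebesgue_measure R).

Lemma FTC_all (F f : R -> R) (a b : R) : a < b ->
  (forall s : R, is_derive s 1 F (f s)) -> continuous f ->
  \int[mu]_(s in `[a, b]) f s = F b - F a.
Proof.
move=> ab dF cf.
have cF : continuous F.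
  by move=> s; apply/differentiable_continuous/derivable1_diffP; have [] := dF s.
rewrite /Rintegral (@continuous_FTC2 _ f F a b ab (continuous_subspaceT cf))//.
  split => [x _||]; first by have [] := dF x.
    by apply: cvg_at_right_filter; exact: cF.
  by apply: cvg_at_left_filter; exact: cF.
by move=> x _; rewrite derive1E; have [] := dF x.
Qed.

Lemma FTC_halfline (F f : R -> R) (M : R) :
  (forall s : R, is_derive s 1 F (f s)) -> continuous f ->
  (forall s, M < s -> F s = 0) -> (forall s, M < s -> f s = 0) ->
  \int[mu]_(s in `]0, +oo[) f s = - F 0.
Proof.
move=> dF cf F0 f0.
pose N := `|M| + 1.
have N0 : 0 < N by rewrite ltr_wpDl.
have MN : M < N by rewrite (le_lt_trans (ler_norm M))// ltrDl.
have If : mu.-integrable `[0, N] (EFin \o f).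
  apply: continuous_compact_integrable; first exact: segment_compact.
  exact: continuous_subspaceT.
have -> : \int[mu]_(s in `]0, +oo[) f s = \int[mu]_(s in `]0, N]) f s.
  rewrite [LHS]Rintegral_mkcond [RHS]Rintegral_mkcond; congr fine.
  apply: eq_integral => s _; congr EFin; rewrite !patchE.
  have := lerP s N; case => sN.
    by congr (if _ then _ else _); apply/idP/idP; rewrite !inE/= !in_itv/= ?andbT ?sN ?andbT.
  by rewrite f0 ?(lt_trans MN)//; do 2 case: ifP.
rewrite Rintegral_itv_obnd_cbnd; last first.
  by apply: integrableS If => // s /=; rewrite !in_itv/= => /andP[/ltW -> ->].
by rewrite (FTC_all N0 dF cf) F0// sub0r.
Qed.

End FTC.

(** * Calculus on the half-space *)

Section half_space_integral.
Variables (R : realType).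
Local Notation leb := (lebesgue_rV R).

Lemma measurable_half_space m : measurable (half_space R m).
Proof.
rewrite -[X in measurable X]setTI.
rewrite (_ : half_space R m = (@rV_coord R m.+1 ord_max) @^-1` `]0, +oo[).
  by apply: measurable_rV_coord => //; exact: measurable_itv.
by apply/seteqP; split => x; rewrite /half_space/= in_itv/= andbT.
Qed.

Lemma snoc_last m (x : 'rV[R]_m) (t : R) : snoc (x, t) ord0 ord_max = t.
Proof. by rewrite mxE unlift_none. Qed.

Lemma snoc_lift m (x : 'rV[R]_m) (t : R) i :
  snoc (x, t) ord0 (lift ord_max i) = x ord0 i.
Proof. by rewrite mxE liftK. Qed.

Lemma restrict_half_space m (f : 'rV[R]_m.+1 -> R) (x : 'rV[R]_m) (t : R) :
  (f \_ (half_space R m)) (snoc (x, t)) = ((fun s : R => f (snoc (x, s))) \_ `]0, +oo[) t.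
Proof.
rewrite !patchE; congr (if _ then _ else _).
by apply/idP/idP; rewrite !inE /half_space/= in_itv/= andbT snoc_last.
Qed.

Lemma RintO_snoc1 m (f : 'rV[R]_m.+1 -> R) : lbm f -> bsupp f ->
  \int[leb m.+1]_(x in half_space R m) f x =
  \int[leb m]_x \int[lebesgue_measure]_(t in `]0, +oo[) f (snoc (x, t)).
Proof.
move=> lf bf; rewrite Rintegral_mkcond Rint_lbs1; last 2 first.
- by apply: lbm_restrict => //; exact: measurable_half_space.
- exact: bsupp_restrict.
apply: eq_Rintegral => x _; rewrite [RHS]Rintegral_mkcond.
by apply: eq_Rintegral => t _; rewrite restrict_half_space.
Qed.

Lemma RintO_snoc2 m (f : 'rV[R]_m.+1 -> R) : lbm f -> bsupp f ->
  \int[leb m.+1]_(x in half_space R m) f x =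
  \int[lebesgue_measure]_(t in `]0, +oo[) \int[leb m]_x f (snoc (x, t)).
Proof.
move=> lf bf; rewrite Rintegral_mkcond Rint_lbs2; last 2 first.
- by apply: lbm_restrict => //; exact: measurable_half_space.
- exact: bsupp_restrict.
rewrite [RHS]Rintegral_mkcond.
apply: eq_Rintegral => t _; rewrite patchE; case: ifPn => Ht.
  apply: eq_Rintegral => x _; rewrite restrict_half_space patchE Ht//.
rewrite (_ : (fun x => _) = cst 0); last first.
  by apply/funext => x; rewrite restrict_half_space patchE (negbTE Ht).
by rewrite /Rintegral integral0.
Qed.

Lemma snoc_line m (x : 'rV[R]_m) (s h : R) :
  snoc (x, h + s) = h *: delta_mx ord0 ord_max + snoc (x, s).
Proof.
apply/rowP => i; rewrite !mxE eqxx/=.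
case: unliftP => [j ->|->] /=; last by rewrite eqxx mulr1.
by rewrite [_ == _](negbTE _) ?mulr0 ?add0r// eq_sym neq_lift.
Qed.

Lemma snoc_lineT m (x : 'rV[R]_m) (s : R) (i : 'I_m) (h : R) :
  snoc (h *: delta_mx ord0 i + x, s) =
  h *: delta_mx ord0 (lift ord_max i) + snoc (x, s).
Proof.
apply/rowP => j; rewrite !mxE eqxx/=.
case: unliftP => [k ->|->] /=; last first.
  by rewrite [_ == _](negbTE _) ?mulr0 ?add0r// neq_lift.
by rewrite !mxE eqxx/= (inj_eq lift_inj).
Qed.

Lemma nonexp_cont (V W : normedModType R) (f : V -> W) :
  (forall x y, `|f x - f y| <= `|x - y|) -> continuous f.
Proof.
move=> H x; apply/cvgrPdist_lt => e e0; apply/nbhs_ballP; exists e => //= y.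
by rewrite -ball_normE; exact: le_lt_trans.
Qed.

Lemma cont_snocl m (s : R) : continuous (fun x : 'rV[R]_m => snoc (x, s)).
Proof.
apply: nonexp_cont => x y; apply: norm_le_coord => // i.
have [j ->|->] := unliftP ord_max i.
  by rewrite !mxE !liftK; have := coord_le_norm (x - y) j; rewrite !mxE.
by rewrite !mxE !unlift_none subrr normr0.
Qed.

Lemma C1_slice m (f : 'rV[R]_m.+1 -> R) Df (s : R) : C1 f Df ->
  C1 (fun x => f (snoc (x, s))) (fun i x => Df (lift ord_max i) (snoc (x, s))).
Proof.
move=> [cf cDf df]; split => [x|i x|i x].
- by apply: (@continuous_comp _ _ _ (fun x => snoc (x, s)) f); [exact: cont_snocl|exact: cf].
- by apply: (@continuous_comp _ _ _ (fun x => snoc (x, s)) (Df _)); [exact: cont_snocl|exact: cDf].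
- apply: (is_derive_lin _ (df _ _)) => h; exact: snoc_lineT.
Qed.

Lemma C1_vert m (f : 'rV[R]_m.+1 -> R) Df (x : 'rV[R]_m) (s : R) : C1 f Df ->
  is_derive s 1 (fun t => f (snoc (x, t))) (Df ord_max (snoc (x, s))).
Proof.
move=> [cf cDf df].
apply: (@is_derive_lin _ _ R (fun t => snoc (x, t)) f s 1 _ _ _ (df _ _)) => h.
by rewrite (_ : h%:A = h) ?snoc_line//; exact: mulr1.
Qed.

Lemma cont_snocr m (x : 'rV[R]_m) : continuous (fun t : R => snoc (x, t)).
Proof.
apply: nonexp_cont => s t; apply: norm_le_coord => // i.
have [j ->|->] := unliftP ord_max i.
  by rewrite !mxE !liftK subrr normr0.
by rewrite !mxE !unlift_none.
Qed.

Lemma C1_cont n (f : 'rV[R]_n -> R) Df : C1 f Df -> continuous f.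
Proof. by case. Qed.

Lemma C1_contD n (f : 'rV[R]_n -> R) Df i : C1 f Df -> continuous (Df i).
Proof. by case. Qed.

Lemma C1_lbm n (f : 'rV[R]_n -> R) Df : C1 f Df -> lbm f.
Proof. by move=> /C1_cont; exact: lbm_cont. Qed.

Lemma C1_lbmD n (f : 'rV[R]_n -> R) Df i : C1 f Df -> lbm (Df i).
Proof. by case=> _ cD _; exact/lbm_cont/cD. Qed.

(** Outside the ball that carries [f], a short step along [v] stays outside, so the difference
    quotients vanish. *)
Lemma bsupp_deriv n (f g : 'rV[R]_n -> R) (v : 'rV[R]_n) :
  (forall x, is_derive x v f (g x)) -> bsupp f -> bsupp g.
Proof.
move=> df [M HM]; exists M => x Mx.
have /is_derive_epsP H := df x.
apply/eqP; rewrite -normr_le0; apply/ler_addgt0Pl => e e0; rewrite addr0.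
have [d d0 Hd] := H _ e0.
pose h := Num.min (d / 2) ((`|x| - M) / 2 / (`|v| + 1)).
have v1 : 0 < `|v| + 1 by rewrite ltr_wpDl.
have h0 : 0 < h by rewrite lt_min !divr_gt0// subr_gt0.
have hd : `|h| < d.
  by rewrite gtr0_norm// /h gt_min; apply/orP; left; lra.
have := Hd h (lt0r_neq0 h0) hd.
rewrite (HM x)// HM ?subrr ?mulr0 ?subr0//.
have hv : h * `|v| <= (`|x| - M) / 2.
  apply: (@le_trans _ _ (h * (`|v| + 1))); first by rewrite ler_pM2l// lerDl.
  by rewrite -ler_pdivlMr// /h ge_min lexx orbT.
rewrite -(ltrD2r `|h *: v|) normrZ (gtr0_norm h0).
have := ler_normB (h *: v + x) (h *: v); rewrite addrAC subrr add0r normrZ (gtr0_norm h0).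
lra.
Qed.

Lemma C1_bsuppD n (f : 'rV[R]_n -> R) Df i : C1 f Df -> bsupp f -> bsupp (Df i).
Proof. by move=> [_ _ df]; exact: bsupp_deriv. Qed.

End half_space_integral.

Ltac lbm_tac := first
 [ assumption
 | lazymatch goal with
   | |- lbm (fun x => _ + _) => apply: lbmD
   | |- lbm (fun x => _ * _) => apply: lbmM
   | |- lbm (fun x => - _) => apply: lbmN
   | |- lbm (fun x => _ ^+ _) => apply: lbmX
   | |- lbm (fun x => `|_|) => apply: lbm_norm
   | |- lbm (fun x => \sum_(_ <- _ | _) _) => apply: lbm_sum => ?
   | |- lbm (fun x => fun_of_matrix x _ _) => exact: lbm_coord
   end; lbm_tac
 | exact: lbm_cst
 | lazymatch goal with |- lbm ?f =>
     lazymatch f with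
     | context [snoc] => solve [apply: lbm_slice; lbm_tac]
     | context [unsnoc] => solve [apply: lbm_hd; lbm_tac]
     end
   end
 | eapply C1_lbm; eassumption
 | eapply C1_lbmD; eassumption
 | solve [eauto] ].

Ltac bsupp_tac := first
 [ assumption
 | lazymatch goal with
   | |- bsupp (fun _ => ?c) => fail 1
   | |- bsupp (fun x => _ + _) => apply: bsuppD; bsupp_tac
   | |- bsupp (fun x => _ * _) =>
       first [solve [apply: bsuppMl; bsupp_tac] | solve [apply: bsuppMr; bsupp_tac]]
   | |- bsupp (fun x => - _) => apply: bsuppN; bsupp_tac
   | |- bsupp (fun x => _ ^+ _) => apply: bsuppX => //; bsupp_tac
   | |- bsupp (fun x => `|_|) => apply: bsupp_norm; bsupp_tac
   | |- bsupp (fun x => \sum_(_ <- _ | _) _) => apply: bsupp_sum => ?; bsupp_tac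
   end
 | lazymatch goal with |- bsupp ?f =>
     lazymatch f with
     | context [snoc] => solve [apply: bsupp_slice; bsupp_tac]
     end
   end
 | eapply C1_bsuppD; [eassumption | assumption]
 | solve [eauto] ].

Section lbs_integral.
Variables (R : realType) (n : nat) (D : set 'rV[R]_n).
Hypothesis mD : measurable D.
Local Notation leb := (lebesgue_rV R n).
Local Notation I f := (\int[leb]_(x in D) f x).
Implicit Types f g : 'rV[R]_n -> R.

Definition lbs f := lbm f /\ bsupp f.

Lemma lbs_int f : lbs f -> leb.-integrable D (EFin \o f).
Proof. by case; exact: lbs_integrable. Qed.

Lemma IntD f g : lbs f -> lbs g -> I (fun x => f x + g x) = I f + I g.
Proof. by move=> /lbs_int If /lbs_int Ig; rewrite RintegralD. Qed.

Lemma IntB f g : lbs f -> lbs g -> I (fun x => f x - g x) = I f - I g.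
Proof. by move=> /lbs_int If /lbs_int Ig; rewrite RintegralB. Qed.

Lemma IntZ (c : R) f : lbs f -> I (fun x => c * f x) = c * I f.
Proof. by move=> /lbs_int If; rewrite RintegralZl. Qed.

Lemma IntN f : lbs f -> I (fun x => - f x) = - I f.
Proof.
move=> lf; rewrite -mulN1r -IntZ//; apply: eq_Rintegral => x _.
by rewrite mulN1r.
Qed.

Lemma lbs_sum (J : Type) (s : seq J) (f : J -> 'rV[R]_n -> R) :
  (forall j, lbs (f j)) -> lbs (fun x => \sum_(j <- s) f j x).
Proof.
by move=> lf; split; [apply: lbm_sum => j|apply: bsupp_sum => j]; have [] := lf j.
Qed.

Lemma Int_sum (J : Type) (s : seq J) (f : J -> 'rV[R]_n -> R) :
  (forall j, lbs (f j)) ->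
  I (fun x => \sum_(j <- s) f j x) = \sum_(j <- s) I (f j).
Proof.
move=> lf; elim: s => [|j s IH].
  rewrite big_nil; under eq_Rintegral => x _ do rewrite big_nil.
  by rewrite /Rintegral integral0.
rewrite big_cons -IH -IntD//; last exact: lbs_sum.
by apply: eq_Rintegral => x _; rewrite big_cons.
Qed.

Lemma Int_le f g : lbs f -> lbs g -> (forall x, D x -> f x <= g x) -> I f <= I g.
Proof. by move=> /lbs_int If /lbs_int Ig; exact: le_Rintegral. Qed.

Lemma Int_norm f : lbs f -> `|I f| <= I (fun x => `|f x|).
Proof. by move=> /lbs_int If; exact: le_normr_Rintegral. Qed.

Lemma Int_CS f g : lbm f -> lbm g -> bsupp f -> bsupp g ->
  (I (fun x => f x * g x)) ^+ 2 <=
  I (fun x => f x ^+ 2) * I (fun x => g x ^+ 2).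
Proof.
by move=> lf lg bf bg; apply: Rint_CS => //; apply: lbs_int; split;
  (lbm_tac || bsupp_tac).
Qed.

Lemma lbm_bounded f : lbm f -> bsupp f -> exists2 K : R, 0 <= K & forall x, `|f x| <= K.
Proof.
move=> [_ bf] [M HM]; have [K HK] := bf M; exists `|K| => // x.
have [xM|/HM ->] := lerP `|x| M; last by rewrite normr0.
by rewrite (le_trans (HK x xM))// ler_norm.
Qed.

(** Differentiation under the integral. The derivative brings down a factor [x], dominated thanks to
    the bounded support of [z]; on unbounded supports this factor is what the cut-off [chi] will
    have to absorb. *)
Lemma Int_scale_derive (z b : 'rV[R]_n -> R) Db (s : R) :
  lbm z -> bsupp z -> C1 b Db -> bsupp b -> 0 < s ->
  is_derive s 1 (fun s => I (fun x => z x * b (s *: x)))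
    (I (fun x => z x * \sum_i x ord0 i * Db i (s *: x))).
Proof.
move=> lz bz bD bb s0.
have /choice[K HK] : forall i, exists K : R, forall x, `|Db i x| <= K.
  move=> i; have [||K _ HK] := @lbm_bounded (Db i); last by exists K.
    exact: C1_lbmD bD.
  exact: C1_bsuppD bD bb.
have lbb (t : R) : lbm (fun x => b (t *: x)).
  have := lbm_affine t 0 (C1_lbm bD); congr lbm.
  by apply/funext => x; rewrite addr0.
apply: (@diff_under _ _ _ leb D mD (fun s x => z x * b (s *: x))
  (fun s x => z x * \sum_i x ord0 i * Db i (s *: x))
  (fun x => `|z x| * \sum_i `|x ord0 i| * K i) s 0 (s + 1)).
- by apply/andP; split => //; lra.
- by move=> t _; apply: lbs_int; split; [lbm_tac|bsupp_tac].
- move=> t x _ _.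
  have H : is_derive t 1 (fun t => b (t *: x)) (\sum_i x ord0 i * Db i (t *: x)).
    apply: (@is_derive_lin _ _ R (fun t => t *: x) b t 1 x) => [h|].
      by rewrite scalerDl (_ : h%:A = h)//; exact: mulr1.
    exact: C1_is_derive.
  have := @is_deriveZ _ _ _ (fun t : R => b (t *: x)) (z x) t 1 _ H.
  by [].
- apply: lbs_int; split; first by lbm_tac.
  bsupp_tac.
- move=> t x _ _; rewrite normrM ler_wpM2l// (le_trans (ler_norm_sum _ _ _))//.
  by apply: ler_sum => i _; rewrite normrM ler_wpM2l.
Qed.

(** As [D] is invariant along [e_i], the integral of a translate of [f] does not depend on the
    shift; its derivative at shift 0 is the integral of [Df i]. All tangential integrations by parts
    rest on this. *)
Lemma Int_translation (f : 'rV[R]_n -> R) Df i :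
  C1 f Df -> bsupp f ->
  (forall h x, D (h *: delta_mx ord0 i + x) <-> D x) -> I (Df i) = 0.
Proof.
move=> fD bf invD.
pose F (s : R) (x : 'rV[R]_n) := f (s *: delta_mx ord0 i + x).
have lF s : lbm (F s).
  have := lbm_affine 1 (s *: delta_mx ord0 i) (C1_lbm fD); congr lbm.
  by apply/funext => x; rewrite scale1r addrC.
have bF s : bsupp (F s).
  have := bsupp_affine (s *: delta_mx ord0 i) (@ltr01 R) bf; congr bsupp.
  by apply/funext => x; rewrite scale1r addrC.
have Fc s : I (F s) = I f.
  have := @Rint_affine R n 1 (s *: delta_mx ord0 i) (f \_ D) ltr01.
  rewrite invr1 expr1n mul1r => E; rewrite [LHS]Rintegral_mkcond [RHS]Rintegral_mkcond -E.
    apply: eq_Rintegral => x _; rewrite !patchE /F scale1r addrC.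
    congr (if _ then _ else _); by apply/idP/idP; rewrite !inE addrC => /invD.
  apply/(measurable_restrictT _ mD); apply: measurable_funTS.
  by have [] := C1_lbm fD.
have [K K0 HK] := lbm_bounded (C1_lbmD i fD) (C1_bsuppD i fD bf).
have [M HM] := C1_bsuppD i fD bf.
(* Translates by less than 1 are all carried by this enlarged ball, on which a constant
   dominates. *)
pose B := [set x : 'rV[R]_n | `|x| <= M + 1].
have : is_derive (0 : R) 1 (fun s => I (F s)) (I (fun x => Df i (0 *: delta_mx ord0 i + x))).
  apply: (@diff_under _ _ _ leb D mD F (fun s x => Df i (s *: delta_mx ord0 i + x))
    ((fun=> K) \_ B) 0 (-1) 1).
  - by apply/andP; split; lra.
  - by move=> s _; apply: lbs_int; split; [exact: lF|exact: bF].
  - move=> s x _ _; have [_ _ df] := fD.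
    exact: (@is_derive_line _ _ f (delta_mx ord0 i) (Df i) (df i) x s).
  - apply: lbs_int; split; first by apply: lbm_restrict; [exact: measurable_ball_rV|exact: lbm_cst].
    exists (M + 1) => x Mx; rewrite patchE; case: ifPn => //.
    by rewrite inE /B/= leNgt Mx.
  - move=> s x /andP[s1 s2] _; rewrite patchE; case: ifPn => //.
    rewrite notin_setE /B/= => /negP; rewrite -ltNge => Mx.
    rewrite HM ?normr0//.
    have := ler_normB (s *: delta_mx ord0 i + x) (s *: delta_mx ord0 i : 'rV[R]_n).
    rewrite addrAC subrr add0r normrZ.
    have : `|delta_mx ord0 i : 'rV[R]_n| <= 1.
      apply: norm_le_coord => // j; rewrite mxE eqxx /=.
      by case: eqP; rewrite ?normr1 ?normr0.
    have s1' : `|s| <= 1 by rewrite ler_norml; lra.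
    move=> d1 H; have : `|s| * `|delta_mx ord0 i : 'rV[R]_n| <= 1.
      by rewrite -[leRHS]mulr1 ler_pM.
    lra.
have -> : (fun s => I (F s)) = cst (I f) by apply/funext => s; rewrite Fc.
move=> [_]; rewrite derive_cst => E.
rewrite [RHS]E; apply: eq_Rintegral => x _; by rewrite scale0r add0r.
Qed.

End lbs_integral.

Lemma lip_cont (R : realType) (V W : normedModType R) (k : R) (f : V -> W) :
  0 < k -> (forall x y, `|f x - f y| <= k * `|x - y|) -> continuous f.
Proof.
move=> k0 H x; apply/cvgrPdist_lt => e e0; apply/nbhs_ballP; exists (e / k).
  by rewrite /= divr_gt0.
move=> y; rewrite -ball_normE /= ltr_pdivlMr// mulrC; apply: le_lt_trans.
exact: H.
Qed.

Section half_space_calculus.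
Variables (R : realType) (m : nat).
Local Notation leb := (lebesgue_rV R).
Local Notation Om := (half_space R m).
Implicit Types f g : 'rV[R]_m.+1 -> R.

Lemma half_space_tan (i : 'I_m) (h : R) (x : 'rV[R]_m.+1) :
  Om (h *: delta_mx ord0 (lift ord_max i) + x) <-> Om x.
Proof.
by rewrite /half_space/= !mxE eqxx/= [_ == _](negbTE (neq_lift _ _)) mulr0 add0r.
Qed.

Lemma IntO_tan f Df (i : 'I_m) : C1 f Df -> bsupp f ->
  \int[leb m.+1]_(x in Om) Df (lift ord_max i) x = 0.
Proof.
move=> fD bf; apply: (@Int_translation R m.+1 Om (@measurable_half_space R m) f Df
  (lift ord_max i) fD bf) => h x.
exact: half_space_tan.
Qed.

Lemma slice_integrable_in f (x : 'rV[R]_m) (D : set (measurableTypeR R)) :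
  measurable D -> lbm f -> bsupp f ->
  (@lebesgue_measure R).-integrable D (EFin \o (fun t => f (snoc (x, t)))).
Proof.
move=> mD lf bf; apply: integrableS measurableT mD (@subsetT _ _) _.
exact: slice_integrable.
Qed.

(** The fundamental theorem of calculus on each vertical half-line. The weight [be] depends on the
    boundary variable alone, so it is not differentiated. *)
Lemma IntO_nor f Df (be : 'rV[R]_m -> R) : C1 f Df -> bsupp f -> lbm be ->
  \int[leb m]_x (be x * f (snoc (x, 0))) =
  - \int[leb m.+1]_(x in Om) (be (unsnoc x).1 * Df ord_max x).
Proof.
move=> fD bf lb; rewrite RintO_snoc1; last 2 first.
- lbm_tac.
- bsupp_tac.
have [M HM] := bf; have [N HN] := C1_bsuppD ord_max fD bf.
have E x : \int[lebesgue_measure]_(t in `]0, +oo[)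
    (be (unsnoc (snoc (x, t))).1 * Df ord_max (snoc (x, t))) =
    - (be x * f (snoc (x, 0))).
  transitivity (\int[lebesgue_measure]_(t in `]0, +oo[)
      (be x * Df ord_max (snoc (x, t)))).
    by apply: eq_Rintegral => t _; rewrite snocK.
  rewrite RintegralZl; last 2 first.
  - exact: measurable_itv.
  - apply: slice_integrable_in (C1_lbmD ord_max fD) (C1_bsuppD ord_max fD bf).
    exact: measurable_itv.
  have H1 : continuous (fun t : R => Df ord_max (snoc (x, t))).
    move=> t; apply: (@continuous_comp _ _ _ (fun t => snoc (x, t)) (Df ord_max)).
      exact: cont_snocr.
    by have [_ + _] := fD; apply.
  have H2 t : Num.max M N < t -> f (snoc (x, t)) = 0.
    rewrite gt_max => /andP[Mt _]; apply: HM.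
    by rewrite (lt_le_trans Mt)// (le_trans (ler_norm t))// norm_snocr.
  have H3 t : Num.max M N < t -> Df ord_max (snoc (x, t)) = 0.
    rewrite gt_max => /andP[_ Nt]; apply: HN.
    by rewrite (lt_le_trans Nt)// (le_trans (ler_norm t))// norm_snocr.
  by rewrite (FTC_halfline (fun t => C1_vert x t fD) H1 H2 H3) mulrN.
under [in RHS]eq_Rintegral => x _ do rewrite E.
rewrite IntN ?opprK//; split; first by lbm_tac.
by apply: bsuppMr; exact: bsupp_slice.
Qed.

(** [IntO_nor] for [f^2], followed by [- 2 f d_n f <= f^2 + (d_n f)^2]. *)
Lemma trace_sq_le f Df : C1 f Df -> bsupp f ->
  \int[leb m]_x (f (snoc (x, 0)) ^+ 2) <=
  \int[leb m.+1]_(x in Om) (f x ^+ 2 + Df ord_max x ^+ 2).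
Proof.
move=> fD bf; have mO := @measurable_half_space R m.
have := @IntO_nor _ _ (fun=> 1) (C1M fD fD) (bsuppMl f bf) (@lbm_cst R m 1).
rewrite (_ : \int[leb m]_x (f (snoc (x, 0)) ^+ 2) =
  \int[leb m]_x (1 * (f (snoc (x, 0)) * f (snoc (x, 0))))); last first.
  by apply: eq_Rintegral => x _; rewrite mul1r expr2.
move=> ->; rewrite -IntN//; last by split; [lbm_tac|bsupp_tac].
apply: Int_le => //; [split; [lbm_tac|bsupp_tac]..|].
move=> x _; have := sqr_ge0 (f x + Df ord_max x); lra.
Qed.

(** The integrand is minus the derivative of [(1 - t) f]. Being linear in [f] and its normal
    derivative and confined to a strip, the right side makes sense for H^1 functions and will
    provide their trace. *)
Lemma trace_formula f Df (x : 'rV[R]_m) : C1 f Df ->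
  f (snoc (x, 0)) = \int[lebesgue_measure]_(t in `[0, 1])
    (f (snoc (x, t)) - (1 - t) * Df ord_max (snoc (x, t))).
Proof.
move=> fD; have [cf cDf _] := fD.
have ct (g : 'rV[R]_m.+1 -> R) : continuous g -> continuous (fun t : R => g (snoc (x, t))).
  move=> cg t; apply: (@continuous_comp _ _ _ (fun t => snoc (x, t)) g); [exact: cont_snocr|exact: cg].
have H1 (t : R) : is_derive t 1 (fun t => - ((1 - t) * f (snoc (x, t))))
    (f (snoc (x, t)) - (1 - t) * Df ord_max (snoc (x, t))).
  have H := C1_vert x t fD.
  have H1 : is_derive t 1 (fun t : R => 1 - t) (0 - 1) by exact: is_deriveB.
  have HH := is_deriveN (is_deriveM H1 H).
  rewrite (_ : f _ - _ = - ((1 - t) *: Df ord_max (snoc (x, t)) +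
    f (snoc (x, t)) *: (0 - 1))); first exact: HH.
  by rewrite /GRing.scale/=; ring.
have H2 : continuous (fun t : R => f (snoc (x, t)) - (1 - t) * Df ord_max (snoc (x, t))).
  apply: contD; first exact: ct.
  apply: contN; apply: contM; last exact: ct.
  apply: contD; first by move=> t; exact: cst_continuous.
  by apply: contN => t; exact: cvg_id.
have -> := FTC_all ltr01 H1 H2.
by rewrite subrr subr0 mul0r mul1r oppr0 sub0r opprK.
Qed.

Lemma IntO_scale (s : R) f : 0 < s -> measurable_fun setT f ->
  \int[leb m.+1]_(x in Om) f (s *: x) =
  s^-1 ^+ m.+1 * \int[leb m.+1]_(x in Om) f x.
Proof.
move=> s0 mf; rewrite [in LHS]Rintegral_mkcond [in RHS]Rintegral_mkcond.
rewrite -(Rint_affine 0 s0); last first.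
  apply/(measurable_restrictT _ (@measurable_half_space R m)).
  exact: measurable_funTS.
apply: eq_Rintegral => x _; rewrite !patchE addr0.
congr (if _ then _ else _); apply/idP/idP; rewrite !inE /half_space/= mxE.
  by move=> x0; rewrite mulr_gt0.
by rewrite pmulr_rgt0.
Qed.

Definition vert (q : R) (x : 'rV[R]_m.+1) : 'rV[R]_m.+1 :=
  snoc ((unsnoc x).1, q * (unsnoc x).2).

Lemma vert_snoc q x t : vert q (snoc (x, t)) = snoc (x, q * t).
Proof. by rewrite /vert snocK. Qed.

Lemma vert_lin q (i : 'I_m.+1) (h : R) y :
  vert q (h *: delta_mx ord0 i + y) =
  h *: ((if i == ord_max then q else 1) *: delta_mx ord0 i) + vert q y.
Proof.
apply/rowP => k; rewrite !mxE !eqxx/=.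
have [j ->|->] := unliftP ord_max k; rewrite ?mxE /=; last first.
  by case: eqVneq => [->|_]; rewrite ?mulr0 ?add0r//; lra.
have [->|_] := eqVneq i ord_max; last by rewrite mul1r.
by rewrite [_ == _](negbTE _) ?mulr0// eq_sym neq_lift.
Qed.

Lemma cont_vert q : continuous (vert q).
Proof.
apply: (@lip_cont _ _ _ (`|q| + 1)) => [|x y]; first by rewrite ltr_wpDl.
rewrite mulrC; apply: norm_le_coord => [|k]; first by rewrite mulr_ge0// addr_ge0.
have [j ->|->] := unliftP ord_max k; rewrite !mxE ?liftK ?unlift_none /= ?mxE.
  have := coord_le_norm (x - y) (lift ord_max j); rewrite !mxE => /le_trans; apply.
  by rewrite ler_peMr// lerDr.
rewrite -mulrBr normrM mulrC ler_pM ?lerDl//.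
by have := coord_le_norm (x - y) ord_max; rewrite !mxE.
Qed.

Lemma C1_vertscale q f Df : C1 f Df ->
  C1 (fun x => f (vert q x))
    (fun i x => (if i == ord_max then q else 1) * Df i (vert q x)).
Proof.
move=> fD; have := C1_lin (@vert_lin q) (@cont_vert q) fD.
apply: C1_ext => // i x; rewrite (bigD1 i)//= big1 ?addr0 => [|j ji].
  by rewrite !mxE !eqxx mulr1.
by rewrite !mxE (negbTE ji) andbF mulr0 mul0r.
Qed.

Lemma bsupp_vert q f : 0 < q -> bsupp f -> bsupp (fun x => f (vert q x)).
Proof.
move=> q0 [M HM]; exists (Num.max M (M / q)) => x; rewrite gt_max ltr_pdivrMr// => /andP[M1 M2].
apply: HM; rewrite ltNge; apply/negP => H.
have : `|x| <= Num.max M (M / q).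
  apply: norm_le_coord => [|k].
    by rewrite le_max (le_trans _ H).
  have [j ->|->] := unliftP ord_max k; rewrite le_max.
    have := norm_snocl (unsnoc x).1 (q * (unsnoc x).2); rewrite -/(vert q x).
    have := coord_le_norm (unsnoc x).1 j; rewrite mxE => H1 H2.
    by rewrite (le_trans H1 (le_trans H2 H)).
  have := norm_snocr (unsnoc x).1 (q * (unsnoc x).2); rewrite -/(vert q x) normrM.
  rewrite (gtr0_norm q0) => H1.
  by rewrite ler_pdivlMr// mulrC (le_trans H1 H) orbT.
by rewrite leNgt gt_max ltr_pdivrMr// M1 M2.
Qed.

Lemma lbm_vert q f : lbm f -> lbm (fun x => f (vert q x)).
Proof.
move=> lf; apply: (lbm_comp _ _ lf).
  apply: measurableT_comp; first exact: measurable_snoc.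
  apply: measurable_fun_pair.
    by apply: (measurableT_comp measurable_fst); exact: measurable_unsnoc.
  apply: measurable_funM => //.
  by apply: (measurableT_comp measurable_snd); exact: measurable_unsnoc.
move=> M; exists (Num.max M (`|q| * M)) => x xM.
rewrite (le_trans (norm_snoc _ _))// ge_max !le_max.
rewrite (le_trans (norm_hd x) xM)/= normrM ler_wpM2l ?orbT//.
by rewrite (le_trans (norm_last x)).
Qed.

Lemma IntO_vert (q : R) f : 0 < q -> lbm f -> bsupp f -> (forall x, 0 <= f x) ->
  \int[leb m.+1]_(x in Om) f (vert q x) = q^-1 * \int[leb m.+1]_(x in Om) f x.
Proof.
move=> q0 lf bf f0.
have lb := @bsupp_vert q f q0 bf.
rewrite RintO_snoc1//; last exact: lbm_vert.
rewrite RintO_snoc1//.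
have E x : \int[lebesgue_measure]_(t in `]0, +oo[) f (vert q (snoc (x, t))) =
    q^-1 * \int[lebesgue_measure]_(t in `]0, +oo[) f (snoc (x, t)).
  rewrite [in LHS]Rintegral_mkcond [in RHS]Rintegral_mkcond.
  pose h (t : measurableTypeR R) : \bar R := (((fun t => f (snoc (x, t))) \_ `]0, +oo[) t)%:E.
  have mh : measurable_fun setT h.
    apply: measurableT_comp => //; apply/(measurable_restrictT _ (measurable_itv _)).
    apply: measurable_funTS; apply: measurableT_comp; last exact: measurable_snocr.
    by have [] := lf.
  have h0 t : (0 <= h t)%E.
    by rewrite lee_fin patchE; case: ifP => _ //; exact: f0.
  have := ge0_integral_affine1 0 q0 mh h0.
  move=> /(congr1 fine); rewrite fineM//; last first.
    rewrite integrable_fin_num//.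
    have mI : measurable (`]0, +oo[%classic : set (measurableTypeR R)).
      exact: measurable_itv.
    have := (integrable_mkcond _ mI).1 (slice_integrable_in x mI lf bf).
    by rewrite restrict_EFin.
  rewrite /Rintegral => <-; congr fine; apply: eq_integral => t _; congr EFin.
  rewrite !patchE vert_snoc addr0.
  congr (if _ then _ else _); apply/idP/idP; rewrite !inE /= !in_itv/= !andbT.
    by move=> x0; rewrite mulr_gt0.
  by rewrite pmulr_rgt0.
under eq_Rintegral => x _ do rewrite E.
rewrite RintegralZl//.
have lfO : lbm (f \_ Om) by apply: lbm_restrict => //; exact: measurable_half_space.
have bfO : bsupp (f \_ Om) by exact: bsupp_restrict.
have [_] := Rint_snoc (lbs_integrable measurableT lfO bfO)
  (fun x => slice_integrable x lfO bfO).
apply: eq_integrable => // x _; congr EFin; rewrite [RHS]Rintegral_mkcond.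
by apply: eq_Rintegral => t _; rewrite restrict_half_space.
Qed.

End half_space_calculus.

Lemma bsuppI (R : realType) n (f : 'rV[R]_n -> R) (M : R) :
  (forall x, M < `|x| -> f x = 0) -> bsupp f.
Proof. by exists M. Qed.

Lemma bsuppE (R : realType) n (f : 'rV[R]_n -> R) : bsupp f ->
  exists M : R, forall x, M < `|x| -> f x = 0.
Proof. by []. Qed.

Lemma lbm_measurable (R : realType) n (f : 'rV[R]_n -> R) :
  lbm f -> measurable_fun setT f.
Proof. by case. Qed.

Lemma lbm_locally_bounded (R : realType) n (f : 'rV[R]_n -> R) (M : R) :
  lbm f -> exists K : R, forall x, `|x| <= M -> `|f x| <= K.
Proof. by case=> _; exact. Qed.

Global Opaque lbm bsupp.

Ltac lbst := split; [lbm_tac | bsupp_tac].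

(** * Smooth bumps and mollification *)

Section flat_exp.
Variable R : realType.

(** The family is closed under derivation up to linear combinations, so smoothness of
    [exp (- 1 / t)] reduces to one differentiability statement, [is_derive_fexp]. *)
Definition fexp (j : nat) (t : R) : R := if 0 < t then t^-1 ^+ j * expR (- t^-1) else 0.

Lemma fexp_ge0 j t : 0 <= fexp j t.
Proof.
by rewrite /fexp; case: ltrP => // t0; rewrite mulr_ge0 ?expR_ge0// exprn_ge0// invr_ge0 ltW.
Qed.

Lemma fexp_gt0 t : 0 < t -> 0 < fexp 0 t.
Proof. by move=> t0; rewrite /fexp t0 expr0 mul1r expR_gt0. Qed.

Lemma fexp_eq0 j t : t <= 0 -> fexp j t = 0.
Proof. by rewrite /fexp ltNge => ->. Qed.

Lemma fexp0_le t s : t <= s -> fexp 0 t <= fexp 0 s.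
Proof.
move=> ts; have [t0|t0] := lerP t 0; first by rewrite fexp_eq0// fexp_ge0.
have s0 : 0 < s by apply: lt_le_trans ts.
by rewrite /fexp t0 s0 !expr0 !mul1r ler_expR lerN2 lef_pV2.
Qed.

(** From [exp y >= y^(j+1) / (j+1)!] at [y = 1 / t]. The linear rate also settles the derivative at
    0, because [fexp j h / h] is [fexp j.+1 h] for [h > 0]. *)
Lemma fexp_le j t : fexp j t <= (j.+1)`!%:R * `|t|.
Proof.
rewrite /fexp; case: ltrP => t0; last by rewrite mulr_ge0.
have i0 : 0 <= t^-1 by rewrite invr_ge0 ltW.
have f0 : 0 < (j.+1)`!%:R :> R by rewrite ltr0n fact_gt0.
have h := expR_ge1Dxn j i0.
have h2 : t^-1 ^+ j.+1 / (j.+1)`!%:R <= expR t^-1 by apply: le_trans h; rewrite lerDr.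
rewrite gtr0_norm// expRN ler_pdivrMr ?expR_gt0//.
apply: (@le_trans _ _ ((j.+1)`!%:R * t * (t^-1 ^+ j.+1 / (j.+1)`!%:R))); last first.
  by rewrite ler_wpM2l// mulr_ge0// ltW.
by rewrite le_eqVlt; apply/orP; left; apply/eqP; rewrite exprS; field; rewrite !gt_eqF.
Qed.

Lemma is_derive_fexp j (t : R) : is_derive t 1 (fexp j) (fexp j.+2 t - j%:R * fexp j.+1 t).
Proof.
have [t0|t0|->] := ltrgtP t 0.
- rewrite !(fexp_eq0 _ (ltW t0)) mulr0 subr0.
  apply: (@near_eq_is_derive _ _ _ (cst 0)).
  near=> s; rewrite /= fexp_eq0//; apply: ltW; near: s; exact: lt_nbhsl.
- have tn0 : t != 0 by rewrite gt_eqF.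
  apply: (@near_eq_is_derive _ _ _ (fun s : R => s^-1 ^+ j * expR (- s^-1))).
    by near=> s; rewrite /fexp ifT//; near: s; exact: lt_nbhsr.
  have Hi : is_derive t 1 (fun s : R => s^-1) (- t ^- 2).
    have := @is_deriveV R idfun t 1 1 tn0 (is_derive_id _ _).
    by rewrite /= /GRing.scale/= mulr1.
  have He : is_derive t 1 (fun s : R => expR (- s^-1)) (expR (- t^-1) * (t ^- 2)).
    have HN := is_deriveN Hi; rewrite opprK in HN.
    exact: (@is_derive1_comp _ expR (fun s : R => - s^-1) t _ _ (is_derive_expR _) HN).
  have Hn n : is_derive t 1 (fun s : R => s^-1 ^+ n) (- n%:R * t^-1 ^+ n.+1).
    elim: n => [|n IH].
      rewrite (_ : (fun s : R => _) = cst 1); first by rewrite oppr0 mul0r; exact: is_derive_cst.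
      by apply/funext => s; rewrite expr0.
    rewrite (_ : (fun s : R => _) = (fun s : R => s^-1) * (fun s : R => s^-1 ^+ n)).
      have := is_deriveM Hi IH; congr is_derive.
      by rewrite /GRing.scale/= !exprS -natr1; field.
    by apply/funext => s; rewrite exprS.
  have := is_deriveM (Hn j) He; congr is_derive.
  by rewrite /GRing.scale/= /fexp t0 !exprS; field.
- rewrite !fexp_eq0// mulr0 subr0; apply/is_derive_epsP => e e0.
  have C0 : 0 < (j.+2)`!%:R :> R by rewrite ltr0n fact_gt0.
  exists (e / (j.+2)`!%:R); first by rewrite divr_gt0.
  move=> h h0 hd; rewrite sub0r normrN (fexp_eq0 j (lexx 0)) subr0 /GRing.scale/= mulr1 addr0.
  have [h1|h1] := lerP h 0; first by rewrite fexp_eq0// mulr0 normr0 ltW.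
  have -> : h^-1 * fexp j h = fexp j.+1 h by rewrite /fexp h1 exprS mulrA.
  rewrite ger0_norm ?fexp_ge0//; apply: (le_trans (fexp_le _ _)).
  by rewrite mulrC -ler_pdivlMr// ltW.
Unshelve. all: end_near. Qed.

(** A syntactic class closed under derivation, which yields derivatives of all orders by induction.
    The exponential is included for the functions [exp (- k fexp)] that will approximate indicators
    of half-spaces. *)
Inductive smooth1 : (R -> R) -> Prop :=
| smE j : smooth1 (fexp j)
| smC c : smooth1 (fun=> c)
| smD f g : smooth1 f -> smooth1 g -> smooth1 (fun t => f t + g t)
| smM f g : smooth1 f -> smooth1 g -> smooth1 (fun t => f t * g t)
| smX f : smooth1 f -> smooth1 (fun t => expR (f t)).

Lemma smooth1_derive f : smooth1 f -> exists2 f', smooth1 f' & forall t : R, is_derive t 1 f (f' t).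
Proof.
elim=> {f}.
- move=> j; exists (fun t => fexp j.+2 t + (- j%:R) * fexp j.+1 t).
    by apply: smD; [exact: smE|apply: smM; [exact: smC|exact: smE]].
  by move=> t; rewrite mulNr; exact: is_derive_fexp.
- move=> c; exists (fun=> 0); first exact: smC.
  by move=> t; exact: is_derive_cst.
- move=> f g _ [f' sf Hf] _ [g' sg Hg]; exists (fun t => f' t + g' t); first exact: smD.
  by move=> t; exact: is_deriveD (Hf t) (Hg t).
- move=> f g sf0 [f' sf Hf] sg0 [g' sg Hg]; exists (fun t => f t * g' t + g t * f' t).
    by apply: smD; apply: smM.
  by move=> t; exact: is_deriveM (Hf t) (Hg t).
- move=> f sf0 [f' sf Hf]; exists (fun t => expR (f t) * f' t).
    by apply: smM => //; exact: smX.
  by move=> t; apply: (@is_derive1_comp _ expR f) => //; exact: is_derive_expR.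
Qed.

End flat_exp.

Section isCk.
Variables (R : realType) (n : nat).
Implicit Types f g : 'rV[R]_n -> R.

Lemma isCk_cont k f : isCk k f -> continuous f.
Proof. by case: k => [[]//|k [cf _]]; exact: cf. Qed.

Lemma isCkS k f Df : continuous f ->
  (forall i x, is_derive x (delta_mx ord0 i) f (Df i x)) ->
  (forall i, isCk k (Df i)) -> isCk k.+1 f.
Proof.
move=> cf H HD; split=> // i; split; first by move=> x; case: (H i x).
rewrite (_ : partial i f = Df i); first exact: HD.
by apply/funext => x; case: (H i x).
Qed.

Lemma isCk_partial k f i : isCk k.+1 f -> isCk k (partial i f).
Proof. by move=> [_ /(_ i)[]]. Qed.

Lemma isCk_derive k f i x : isCk k.+1 f -> is_derive x (delta_mx ord0 i) f (partial i f x).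
Proof. by move=> [_ /(_ i)[/(_ x) Hd _]]; exact: DeriveDef. Qed.

Lemma isCk_pred k f : isCk k.+1 f -> isCk k f.
Proof.
elim: k f => [|k IH] f; first by move=> /isCk_cont.
move=> [cf H]; split=> // i; have [Hd HC] := H i; split=> //; exact: IH.
Qed.

Lemma isCk_cst k (c : R) : isCk k (fun _ : 'rV[R]_n => c).
Proof.
elim: k c => [|k IH] c; first by split => //; exact: cst_continuous.
apply: (@isCkS _ _ (fun _ _ => 0)); first exact: cst_continuous.
by move=> i; exact: IH.
Qed.

Lemma isCk_coord k (j : 'I_n) : isCk k (fun x : 'rV[R]_n => x ord0 j).
Proof.
have [c cD d] := C1_coord R j.
case: k => [|k]; first by split.
by apply: (isCkS c d) => i; exact: isCk_cst.
Qed.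

Lemma isCkD k f g : isCk k f -> isCk k g -> isCk k (fun x => f x + g x).
Proof.
elim: k f g => [|k IH] f g Hf Hg.
  by split=> //; apply: contD; [exact: isCk_cont Hf|exact: isCk_cont Hg].
apply: (@isCkS _ _ (fun i x => partial i f x + partial i g x)).
- by apply: contD; [exact: isCk_cont Hf|exact: isCk_cont Hg].
- by move=> i x; exact: is_deriveD (isCk_derive i x Hf) (isCk_derive i x Hg).
- by move=> i; apply: IH; exact: isCk_partial.
Qed.

Lemma isCkM k f g : isCk k f -> isCk k g -> isCk k (fun x => f x * g x).
Proof.
elim: k f g => [|k IH] f g Hf Hg.
  by split=> //; apply: contM; [exact: isCk_cont Hf|exact: isCk_cont Hg].
apply: (@isCkS _ _ (fun i x => f x * partial i g x + g x * partial i f x)).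
- by apply: contM; [exact: isCk_cont Hf|exact: isCk_cont Hg].
- by move=> i x; exact: is_deriveM (isCk_derive i x Hf) (isCk_derive i x Hg).
- by move=> i; apply: isCkD; apply: IH; [exact: isCk_pred|exact: isCk_partial|exact: isCk_pred|exact: isCk_partial].
Qed.

Lemma isCk_comp k (f : R -> R) g : smooth1 f -> (forall k, isCk k g) -> isCk k (fun x => f (g x)).
Proof.
move=> sf Hg; elim: k f sf => [|k IH] f sf.
  have [f' _ Hf] := smooth1_derive sf; split=> // x.
  apply: continuous_comp; first exact: (isCk_cont (Hg 0%N)).
  by apply: differentiable_continuous; apply/derivable1_diffP; case: (Hf (g x)).
have [f' sf' Hf] := smooth1_derive sf.
apply: (@isCkS _ _ (fun i x => f' (g x) * partial i g x)).
- exact: isCk_cont (IH f sf).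
- move=> i x; exact: (is_derive_comp1 (isCk_derive i x (Hg 1%N)) (Hf _)).
- by move=> i; apply: isCkM; [exact: IH|exact: isCk_partial].
Qed.

Lemma isCk_sum k (I : Type) (s : seq I) (f : I -> 'rV[R]_n -> R) :
  (forall j, isCk k (f j)) -> isCk k (fun x => \sum_(j <- s) f j x).
Proof.
move=> H; elim: s => [|j s IH].
  by rewrite (_ : (fun x => _) = fun=> 0); [exact: isCk_cst|apply/funext => x; rewrite big_nil].
rewrite (_ : (fun x => _) = fun x => f j x + \sum_(j <- s) f j x); first exact: isCkD.
by apply/funext => x; rewrite big_cons.
Qed.

Lemma isCk_C1 f : isCk 1 f -> C1 f (fun i => partial i f).
Proof.
move=> Hf; split; first exact: isCk_cont Hf.
  by move=> i; exact: isCk_cont (isCk_partial i Hf).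
by move=> i x; exact: (isCk_derive i x Hf).
Qed.

Lemma isCk_exprn k f p : isCk k f -> isCk k (fun x => f x ^+ p).
Proof.
move=> Hf; elim: p => [|p IH].
  by rewrite (_ : (fun x => _) = fun=> 1); [exact: isCk_cst|apply/funext => x; rewrite expr0].
rewrite (_ : (fun x => _) = fun x => f x * f x ^+ p); first exact: isCkM.
by apply/funext => x; rewrite exprS.
Qed.

Definition rbump (c : 'rV[R]_n) (r : R) (x : 'rV[R]_n) : R := fexp 0 (1 - sqn (x - c) / r ^+ 2).

Lemma isCk_bump k c (r : R) : isCk k (rbump c r).
Proof.
apply: isCk_comp; first exact: smE.
move=> {}k; rewrite (_ : (fun x : 'rV[R]_n => _) = fun x : 'rV[R]_n => 1 + (- r ^- 2) * \sum_i (x ord0 i + - c ord0 i) ^+ 2).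
  apply: isCkD; first exact: isCk_cst.
  apply: isCkM; first exact: isCk_cst.
  apply: isCk_sum => i; apply: isCk_exprn.
  by apply: isCkD; [exact: isCk_coord|exact: isCk_cst].
apply/funext => x; rewrite mulNr; congr (_ - _); rewrite mulrC; congr (_ * _).
by apply: eq_bigr => i _; rewrite !mxE.
Qed.

Lemma bump_ge0 c r x : 0 <= rbump c r x.
Proof. exact: fexp_ge0. Qed.

Lemma bump_gt0 c r x : 0 < r -> sqn (x - c) < r ^+ 2 -> 0 < rbump c r x.
Proof.
by move=> r0 h; apply: fexp_gt0; rewrite subr_gt0 ltr_pdivrMr ?exprn_gt0// mul1r.
Qed.

Lemma bump_supp c r x : 0 < r -> rbump c r x != 0 -> `|x - c| <= r.
Proof.
move=> r0; apply: contraNT; rewrite -ltNge => h; rewrite /rbump fexp_eq0//.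
rewrite subr_le0 ler_pdivlMr ?exprn_gt0// mul1r leNgt; apply/negP => h2.
move: h; apply/negP; rewrite -leNgt; apply: norm_le_coord; first exact: ltW.
move=> i; rewrite -(@ler_pXn2r _ 2) ?nnegrE ?(ltW r0)// real_normK ?num_real//.
apply: le_trans (ltW h2); rewrite /sqn (bigD1 i)//= lerDl.
by apply: sumr_ge0 => j _; exact: sqr_ge0.
Qed.

End isCk.

Section ball_measure.
Variable R : realType.
Local Notation leb := (lebesgue_rV R).

Lemma snoc_norm_le m (x : 'rV[R]_m) (t M : R) :
  (`|snoc (x, t)| <= M) = (`|x| <= M) && (`|t| <= M).
Proof.
apply/idP/andP => [h|[h1 h2]].
  by split; apply: le_trans h; [exact: norm_snocl|exact: norm_snocr].
by apply: (le_trans (norm_snoc _ _)); rewrite ge_max h1.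
Qed.

(** Positivity makes the bumps normalisable, and it makes the L^oo norm a true essential supremum in
    [Linfty_le]. *)
Lemma lebesgue_rV_ball_gt0 n (M : R) : 0 < M -> (0 < leb n [set x | (`|x| <= M)%R])%E.
Proof.
move=> M0; elim: n => [|n IH].
  rewrite /= /dirac_rV0 diracE mem_set ?lte01//=.
  apply: norm_le_coord; [exact: ltW|by case].
have mB k := @measurable_ball_rV R k M.
have mI : measurable [set t : measurableTypeR R | `|t| <= M].
  rewrite (_ : [set t | _] = `[- M, M]%classic); first exact: measurable_itv.
  by apply/seteqP; split=> t /=; rewrite in_itv/= ler_norml.
have I2 : (@lebesgue_measure R [set t : measurableTypeR R | (`|t| <= M)%R] = (M + M)%:E)%E.
  rewrite (_ : [set t | _] = `[- M, M]%classic); last first.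
    by apply/seteqP; split=> t /=; rewrite in_itv/= ler_norml.
  by rewrite lebesgue_measure_itv/= lte_fin gtrN// -EFinB opprK.
have P1 : (leb n.+1 [set x | (`|x| <= M)%R] = leb n [set x | (`|x| <= M)%R] * (M + M)%:E)%E.
  have := @integral_indic _ _ _ (leb n.+1) setT measurableT _ (mB n.+1).
  rewrite setIT => <-.
  rewrite ge0_integral_snoc; last 2 first.
  - by apply/measurable_EFinP; apply: measurable_indic; exact: mB.
  - by move=> x; rewrite lee_fin.
  pose I : set (measurableTypeR R) := [set t | `|t| <= M].
  transitivity (\int[leb n]_x ((\1_[set x : 'rV[R]_n | `|x| <= M] x : R)%:E * (M + M)%:E))%E.
    apply: eq_integral => x _.
    transitivity (\int[@lebesgue_measure R]_t ((\1_[set x : 'rV[R]_n | `|x| <= M] x : R)%:E * (\1_I t : R)%:E))%E.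
      apply: eq_integral => t _; rewrite -EFinM; congr EFin.
      rewrite !indicE -natrM mulnb; congr ((_ : bool)%:R).
      apply/idP/andP.
        by rewrite inE/= snoc_norm_le => /andP[h1 h2]; split; rewrite inE.
      by rewrite !inE/= snoc_norm_le => -[-> ->].
    have mI' : measurable_fun setT (fun t : measurableTypeR R => (\1_I t : R)%:E).
      by apply/measurable_EFinP; exact: measurable_indic.
    have I0 (t : measurableTypeR R) : setT t -> (0 <= (\1_I t : R)%:E)%E by move=> _; rewrite lee_fin.
    have B0 : 0 <= \1_[set x : 'rV[R]_n | `|x| <= M] x :> R by [].
    rewrite (ge0_integralZl_EFin _ measurableT I0 mI' B0).
    rewrite integral_indic// setIT; congr (_ * _)%E; exact: I2.
  have mBn : measurable_fun setT (fun x : 'rV[R]_n => (\1_[set x : 'rV[R]_n | `|x| <= M] x : R)%:E).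
    by apply/measurable_EFinP; apply: measurable_indic; exact: mB.
  have Bn0 (x : 'rV[R]_n) : setT x -> (0 <= (\1_[set x : 'rV[R]_n | `|x| <= M] x : R)%:E)%E.
    by move=> _; rewrite lee_fin.
  have M2 : (0 <= (M + M)%:E)%E by rewrite lee_fin addr_ge0// ltW.
  rewrite (ge0_integralZr _ measurableT mBn Bn0 M2).
  by rewrite (integral_indic _ measurableT (mB n)) setIT.
by rewrite P1 mule_gt0// lte_fin addr_gt0.
Qed.

End ball_measure.

Lemma eps_cont (R : realType) (V : normedModType R) (f : V -> R) :
  (forall x e, 0 < e -> exists2 d : R, 0 < d & forall y, `|x - y| < d -> `|f x - f y| <= e) ->
  continuous f.
Proof.
move=> H x; apply/cvgrPdist_le => e /(H x)[d d0 Hd].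
by apply/nbhs_ballP; exists d => // y; rewrite -ball_normE; exact: Hd.
Qed.

Section mollifier.
Variables (R : realType) (n : nat).
Local Notation leb := (lebesgue_rV R n).
Implicit Types (f k : 'rV[R]_n -> R).

(** The centre [c] is free so that the support can be pushed into the half-space. Commuting second
    derivatives are recorded for the exchange of normal and tangential derivatives. Of the two
    normalisations the first gives convergence, the second the contraction in L^2. *)
Definition mollifier (r : R) (c : 'rV[R]_n) k :=
  [/\ forall j, isCk j k, forall i j, partial i (partial j k) = partial j (partial i k),
      forall z, 0 <= k z, forall z, r < `|z - c| -> k z = 0 &
      (forall x, \int[leb]_y k (y - x) = 1) /\ (forall y, \int[leb]_x k (y - x) = 1)].

Lemma isCk_lbm f : isCk 0 f -> lbm f.
Proof. by move=> [cf _]; exact: lbm_cont. Qed.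

Lemma Rint_shift f (a : 'rV[R]_n) : lbm f -> \int[leb]_y f (y - a) = \int[leb]_y f y.
Proof.
move=> lf; have := @Rint_affine R n 1 (- a) f ltr01 (lbm_measurable lf).
rewrite invr1 expr1n mul1r => <-.
by apply: eq_Rintegral => y _; rewrite scale1r.
Qed.

Lemma supp_ball (r : R) c f : (forall z : 'rV[R]_n, r < `|z - c| -> f z = 0) -> bsupp f.
Proof.
move=> H; apply: (@bsuppI _ _ _ (`|c| + r)) => x h; apply: H.
rewrite ltNge; apply/negP => h2; move: h; apply/negP; rewrite -leNgt.
by rewrite -[x](subrK c) addrC (le_trans (ler_normD _ _))// lerD2l.
Qed.

Lemma bump_out (c : 'rV[R]_n) (r : R) z : 0 < r -> r < `|z - c| -> rbump c r z = 0.
Proof.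
by move=> r0 h; apply/eqP; apply: contraTT h => /(bump_supp r0); rewrite -leNgt.
Qed.

Lemma partial_E f Df i : (forall x, is_derive x (delta_mx ord0 i) f (Df x)) -> partial i f = Df.
Proof. by move=> H; apply/funext => x; case: (H x). Qed.

(** A bump is a function of [|x - c|^2], so its mixed second derivatives are explicit and visibly
    symmetric. *)
Lemma bump_sym (c : 'rV[R]_n) (r : R) i j :
  partial i (partial j (rbump c r)) = partial j (partial i (rbump c r)).
Proof.
have [f' sf' H1] := smooth1_derive (smE R 0); have [f'' sf'' H2] := smooth1_derive sf'.
pose g (x : 'rV[R]_n) := 1 - sqn (x - c) / r ^+ 2.
have gD : C1 g (fun i x => - (2 / r ^+ 2) * (x ord0 i - c ord0 i)).
  have := C1B (C1_cst n 1) (C1Z (r ^- 2) (C1_affine 1 (- c) (C1_sqn R n))).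
  apply: C1_ext => [x|l x]; first by rewrite scale1r mulrC.
  by rewrite scale1r !mxE sub0r; ring.
have P1 l : partial l (rbump c r) = fun x => f' (g x) * (- (2 / r ^+ 2) * (x ord0 l - c ord0 l)).
  apply: partial_E => x; case: gD => _ _ /(_ l x) Hg.
  exact: (is_derive_comp1 Hg (H1 _)).
have cf' : continuous (f' : R -> R).
  by move=> t; apply: differentiable_continuous; apply/derivable1_diffP; case: (H2 t).
have P2 l l' : partial l (partial l' (rbump c r)) =
   fun x => f'' (g x) * (- (2 / r ^+ 2) * (x ord0 l - c ord0 l)) * (- (2 / r ^+ 2) * (x ord0 l' - c ord0 l')) +
     f' (g x) * (- (2 / r ^+ 2) * (l == l')%:R).
  rewrite P1; apply: partial_E => x; case: gD => _ _ /(_ l x) Hg.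
  have A := is_derive_comp1 Hg (H2 _).
  have [_ _ B] := C1Z (- (2 / r ^+ 2)) (C1B (C1_coord R l') (C1_cst n (c ord0 l'))).
  have := is_deriveM A (B l x); congr (is_derive _ _ _ _).
  by rewrite /GRing.scale/= subr0; ring.
rewrite !P2; apply/funext => x; rewrite [j == i]eq_sym.
have [->|_] := eqVneq i j; first by [].
by rewrite !mulr0n; ring.
Qed.

Lemma bump_int_gt0 (r : R) : 0 < r -> 0 < \int[leb]_x rbump 0 r x.
Proof.
(* For [|x| <= p] in the sup norm, [sqn x <= n p^2 <= r^2 / 2], so the bump is at least
   [fexp 0 (1/2)] on a ball of positive measure. *)
move=> r0; pose p := r / (n.+1%:R * 2); have p0 : 0 < p by rewrite divr_gt0// mulr_gt0.
have mB := @measurable_ball_rV R n p.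
have lb : lbm (rbump 0 r : 'rV[R]_n -> R) by apply: isCk_lbm; exact: isCk_bump.
have bb : bsupp (rbump 0 r : 'rV[R]_n -> R) by apply: supp_ball => z; exact: bump_out.
have f0 : 0 < fexp 0 (2^-1 : R) by apply: fexp_gt0; rewrite invr_gt0.
have lg : lbm ((fun=> fexp 0 (2^-1 : R)) \_ [set x : 'rV[R]_n | `|x| <= p]).
  by apply: lbm_restrict => //; exact: lbm_cst.
have bg : bsupp ((fun=> fexp 0 (2^-1 : R)) \_ [set x : 'rV[R]_n | `|x| <= p]).
  by apply: (@bsuppI _ _ _ p) => x px; rewrite patchE memNset//= leNgt px.
have H : \int[leb]_x ((fun=> fexp 0 (2^-1 : R)) \_ [set x : 'rV[R]_n | `|x| <= p]) x <= \int[leb]_x rbump 0 r x.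
  apply: (Int_le measurableT) => [||x _]; [lbst|lbst|].
  rewrite patchE; case: ifPn => [|_]; last exact: bump_ge0.
  rewrite inE/= => xp; apply: fexp0_le; rewrite subr0.
  suff sx : sqn x / r ^+ 2 <= 2^-1 by lra.
  rewrite ler_pdivrMr ?exprn_gt0//.
  apply: (@le_trans _ _ (n%:R * p ^+ 2)).
    apply: (@le_trans _ _ (\sum_(i < n) p ^+ 2)).
      apply: ler_sum => i _; rewrite -[leLHS]real_normK ?num_real// lerXn2r ?nnegrE ?(ltW p0)//.
      by apply: le_trans xp; exact: coord_le_norm.
    by rewrite sumr_const card_ord mulr_natl.
  have n1 : 1 <= n.+1%:R :> R by rewrite ler1n.
  have n2 : n%:R <= n.+1%:R :> R by rewrite ler_nat.
  rewrite /p exprMn exprVn mulrCA mulrC ler_pM2r ?exprn_gt0//.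
  rewrite ler_pdivrMr ?exprn_gt0 ?mulr_gt0// exprMn.
  have : n.+1%:R * 1 <= n.+1%:R * n.+1%:R :> R by rewrite ler_wpM2l.
  rewrite -expr2; lra.
apply: lt_le_trans H; rewrite -Rintegral_mkcond Rintegral_cst// mulr_gt0//.
apply: fine_gt0; rewrite lebesgue_rV_ball_gt0//=; exact: lebesgue_rV_ball.
Qed.

Lemma mollifier_exists (r : R) c : 0 < r -> exists k, mollifier r c k.
Proof.
move=> r0; have I0 := bump_int_gt0 r0; set I := \int[leb]_x _ in I0.
have lb : lbm (rbump 0 r : 'rV[R]_n -> R) by apply: isCk_lbm; exact: isCk_bump.
have bb : bsupp (rbump 0 r : 'rV[R]_n -> R) by apply: supp_ball => z; exact: bump_out.
have kE (z : 'rV[R]_n) : rbump c r z = rbump 0 r (z - c) by rewrite /rbump subr0.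
have ls (a : 'rV[R]_n) : lbs (fun y => rbump 0 r (y - a)).
  have E : (fun y => rbump 0 r (y - a)) = fun y : 'rV[R]_n => rbump 0 r (1 *: y + - a).
    by apply/funext => y; rewrite scale1r.
  by rewrite E; split; [exact: lbm_affine|exact: bsupp_affine].
exists (fun z => I^-1 * rbump c r z); split.
- by move=> j; apply: isCkM; [exact: isCk_cst|exact: isCk_bump].
- move=> i j.
  have Z (g : 'rV[R]_n -> R) l : isCk 1 g -> partial l (fun z => I^-1 * g z) = fun z => I^-1 * partial l g z.
    move=> gk; apply: partial_E => x.
    by have [_ _ H] := C1Z I^-1 (isCk_C1 gk); exact: (H l x).
  have k2 : isCk 2 (rbump c r) by exact: isCk_bump.
  rewrite !Z; [|exact: isCk_partial|exact: isCk_bump|exact: isCk_partial|exact: isCk_bump].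
  by rewrite bump_sym.
- by move=> z; rewrite mulr_ge0 ?bump_ge0// invr_ge0 ltW.
- by move=> z h; rewrite bump_out ?mulr0.
- split=> [x|y].
    have -> : \int[leb]_y (I^-1 * rbump c r (y - x)) = \int[leb]_y (I^-1 * rbump 0 r (y - (x + c))).
      by apply: eq_Rintegral => y _; rewrite kE opprD addrA.
    by rewrite (IntZ measurableT) ?Rint_shift// -/I mulVf// gt_eqF.
  have -> : \int[leb]_x (I^-1 * rbump c r (y - x)) = \int[leb]_x (I^-1 * rbump 0 r (x - (y - c))).
    apply: eq_Rintegral => x _; rewrite kE; congr (_ * _).
    rewrite /rbump; congr (fexp 0 (1 - _ / _)); apply: eq_bigr => i _.
    by rewrite !mxE -sqrrN; congr (_ ^+ 2); ring.
  by rewrite (IntZ measurableT) ?Rint_shift// -/I mulVf// gt_eqF.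
Qed.

Lemma C1c_lip k Dk : C1 k Dk -> bsupp k ->
  exists2 L : R, 0 <= L & forall z z', `|k z - k z'| <= L * `|z - z'|.
Proof.
move=> kD bk.
have HC i : exists C : R, 0 <= C /\ forall z, `|Dk i z| <= C.
  have [C C0 HC] := lbm_bounded (C1_lbmD i kD) (C1_bsuppD i kD bk).
  by exists C.
have [C HC'] := choice HC.
exists (\sum_i C i); first by apply: sumr_ge0 => i _; case: (HC' i).
move=> z z'.
have [c _] := MVT_all (is_derive_line (fun x => C1_is_derive kD x (z - z')) z') 0 1.
rewrite scale1r subrK scale0r add0r subr0 mulr1 => ->.
rewrite (le_trans (ler_norm_sum _ _ _))// mulr_suml; apply: ler_sum => i _.
rewrite normrM mulrC; have [C0 HCi] := HC' i.
apply: ler_pM => //; by [exact: HCi|exact: coord_le_norm].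
Qed.

Lemma unif_cont f : continuous f -> bsupp f -> forall e : R, 0 < e ->
  exists2 d : R, 0 < d & forall x y, `|x - y| < d -> `|f x - f y| <= e.
Proof.
move=> cf /bsuppE[M HM] e e0.
pose K := [set x : 'rV[R]_n | `|x| <= M + 1].
have cK : compact K.
  apply: bounded_closed_compact.
    exists (M + 1); split; first exact: num_real.
    by move=> t Mt x /= xM; exact: le_trans xM (ltW Mt).
  apply: (@closed_comp _ _ (fun x : 'rV[R]_n => `|x|) [set t : R | t <= M + 1]).
    by move=> x _; exact: norm_continuous.
  exact: closed_le.
have /compact_near_coveringP H := cK.
pose P (d : R) (x : 'rV[R]_n) := forall y, `|x - y| < d -> `|f x - f y| <= e.
have := H _ (0^'+) P _ => /(_ _)[].
  move=> x Kx; have e2 : 0 < e / 2 by rewrite divr_gt0.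
  have [d d0 Hd] := cont_eps (cf x) e2.
  exists (ball x (d / 2), [set t : R | t < d / 2]) => /=.
    split; first by apply: nbhsx_ballx; rewrite divr_gt0.
    by apply: nbhs_right_lt; rewrite divr_gt0.
  move=> [x' t] /= [xx' td] y xy.
  have h1 : `|x - x'| < d / 2 by rewrite -ball_normE in xx'.
  have h2 : `|x - y| < d.
    rewrite -(subrK x' x) -addrA (le_lt_trans (ler_normD _ _))// (splitr d) ltrD//.
    exact: lt_trans td.
  have h3 : `|x - x'| < d by apply: lt_trans h1 _; rewrite ltr_pdivrMr// ltr_pMr// ltr1n.
  have := Hd _ h2; have := Hd _ h3.
  have -> : f x' - f y = (f x - f y) - (f x - f x') by ring.
  move=> a b; apply: (le_trans (ler_normB _ _)); lra.
move=> d /= d0 Hd; pose t := d / 2; have t0 : 0 < t by rewrite divr_gt0.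
have Kt : K `<=` P t.
  by apply: Hd => //=; rewrite sub0r normrN gtr0_norm// /t ltr_pdivrMr// ltr_pMr// ltr1n.
(* Compactness covers the ball of radius [M + 1]; a point outside it has no neighbour closer than 1
   where [f] is nonzero, whence the 1. *)
exists (Num.min t 1); first by rewrite lt_min t0 ltr01.
move=> x y; rewrite lt_min => /andP[xyt xy1].
have [xK|xK] := lerP `|x| (M + 1); first exact: (Kt x xK y xyt).
have xM : M < `|x| by apply: lt_trans xK; rewrite ltrDl.
have yM : M < `|y|.
  have := ler_distD y x 0; rewrite !subr0 => h; lra.
by rewrite !HM// subrr normr0 ltW.
Qed.

Definition loc1 f := measurable_fun setT f /\
  forall M : R, leb.-integrable [set y | `|y| <= M] (EFin \o f).

Lemma lbm_loc1 f : lbm f -> loc1 f.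
Proof.
move=> lf; split; first exact: lbm_measurable.
move=> M; have mB := @measurable_ball_rV R n M.
apply: (@eq_integrable _ _ _ leb _ mB (EFin \o (f \_ [set y | `|y| <= M]))) => // [x xB|].
  by rewrite /= patchE xB.
apply: lbs_integrable => //; first exact: lbm_restrict.
by apply: (@bsuppI _ _ _ M) => x px; rewrite patchE memNset//= leNgt px.
Qed.

Lemma loc1_mul f g : loc1 f -> lbm g -> bsupp g -> leb.-integrable setT (EFin \o (fun y => f y * g y)).
Proof.
move=> [mf fM] lg bg; have [C C0 HC] := lbm_bounded lg bg; have [M HM] := bsuppE bg.
have mB := @measurable_ball_rV R n M.
have mfg : measurable_fun setT (fun y => f y * g y).
  by apply: measurable_funM => //; exact: lbm_measurable.
apply: (@eq_integrable _ _ _ leb _ measurableT ((EFin \o (fun y => f y * g y)) \_ [set y | `|y| <= M])) => // [x _|].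
  rewrite patchE; case: ifPn => // /negP; rewrite inE/= => /negP; rewrite -ltNge => h.
  by rewrite HM// mulr0.
apply/(integrable_mkcond _ mB).1.
apply: (@le_integrable _ _ _ leb _ mB _ (fun y => C%:E * (f y)%:E)%E).
- by apply/measurable_EFinP; exact: measurable_funTS.
- move=> x _ /=; rewrite lee_fin !normrM mulrC ler_wpM2r//.
  by rewrite (le_trans (HC x))// ler_norm.
- exact: integrableZl.
Qed.

(** The kernel is taken at [y - x], so that [mconv f k x] is an average around [x + c] and is
    literally [f] tested against [k (. - x)]. Hence the minus sign in [conv_derive]. *)
Definition mconv f k x := \int[leb]_y (f y * k (y - x)).

Lemma lbs_shift k (x : 'rV[R]_n) : lbm k -> bsupp k -> lbs (fun y => k (y - x)).
Proof.
move=> lk bk.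
have -> : (fun y => k (y - x)) = fun y : 'rV[R]_n => k (1 *: y + - x).
  by apply/funext => y; rewrite scale1r.
by split; [exact: lbm_affine|exact: bsupp_affine].
Qed.

Lemma conv_int f k x : loc1 f -> lbm k -> bsupp k ->
  leb.-integrable setT (EFin \o (fun y => f y * k (y - x))).
Proof. by move=> lf lk bk; have [? ?] := lbs_shift x lk bk; exact: loc1_mul. Qed.

Lemma loc1_bound f g (c r : R) : loc1 f -> lbm g -> 0 <= c -> (forall y, `|g y| <= c) ->
  (forall y, r < `|y| -> g y = 0) ->
  `|\int[leb]_y (f y * g y)| <= c * \int[leb]_(y in [set y | `|y| <= r]) `|f y|.
Proof.
move=> lf lg c0 gc gr; have mB := @measurable_ball_rV R n r.
have bg : bsupp g by exact: bsuppI gr.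
have ifg := loc1_mul lf lg bg.
have inorm D (h : 'rV[R]_n -> R) : measurable D -> leb.-integrable D (EFin \o h) ->
    leb.-integrable D (EFin \o (fun y => `|h y|)).
  by move=> mD ih; have := integrable_abse ih.
apply: (le_trans (le_normr_Rintegral measurableT ifg)).
rewrite -RintegralZl//; last by apply: inorm => //; exact: lf.2.
have -> : \int[leb]_y `|f y * g y| = \int[leb]_(y in [set y | `|y| <= r]) `|f y * g y|.
  rewrite [RHS]Rintegral_mkcond; apply: eq_Rintegral => y _; rewrite patchE; case: ifPn => //.
  move=> /negP; rewrite inE/= => /negP; rewrite -ltNge => h.
  by rewrite gr// mulr0 normr0.
have ia := inorm _ _ mB (lf.2 r).
apply: le_Rintegral => //.
- by apply: inorm => //; apply: integrableS ifg.
- by have := integrableZl mB c ia.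
- by move=> y _; rewrite normrM mulrC ler_wpM2r.
Qed.

Lemma conv_cont f k Dk : loc1 f -> C1 k Dk -> bsupp k -> continuous (mconv f k).
Proof.
move=> lf kD bk; apply: eps_cont => x e e0; have [L L0 HL] := C1c_lip kD bk; have [M HM] := bsuppE bk.
have lk := C1_lbm kD.
pose r := `|x| + 1 + M.
pose A := \int[leb]_(y in [set y | `|y| <= r]) `|f y|.
have A0 : 0 <= A by apply: Rintegral_ge0.
have LA : 0 < L * A + 1 by rewrite ltr_wpDl// mulr_ge0.
exists (Num.min 1 (e / (L * A + 1))); first by rewrite lt_min ltr01 divr_gt0.
move=> x'; rewrite lt_min => /andP[/ltW x1 /ltW x2].
rewrite /mconv -RintegralB//; [|exact: conv_int|exact: conv_int].
have -> : \int[leb]_y (f y * k (y - x) - f y * k (y - x')) = \int[leb]_y (f y * (k (y - x) - k (y - x'))).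
  by apply: eq_Rintegral => y _; rewrite mulrBr.
have [l1 b1] := lbs_shift x lk bk; have [l2 b2] := lbs_shift x' lk bk.
have xx : `|x'| <= `|x| + 1.
  by rewrite -(subrK x x') addrC (le_trans (ler_normD _ _))// lerD2l distrC.
apply: (le_trans (@loc1_bound f (fun y => k (y - x) - k (y - x')) (L * `|x - x'|) r lf _ _ _ _)).
- by lbm_tac.
- by rewrite mulr_ge0.
- move=> y; apply: (le_trans (HL _ _)).
  by rewrite opprB addrC addrA subrK distrC.
- move=> y ry; rewrite !HM ?subrr//.
    have := lerB_normD y (- x'); rewrite normrN => h; rewrite /r in ry; lra.
  have := lerB_normD y (- x); rewrite normrN => h; rewrite /r in ry; lra.
rewrite -/A mulrAC; apply: (@le_trans _ _ ((L * A + 1) * (e / (L * A + 1)))).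
  by apply: ler_pM => //; [rewrite mulr_ge0|rewrite lerDl].
by rewrite mulrC divfK// gt_eqF.
Qed.

Lemma conv_derive f k Dk i x : loc1 f -> C1 k Dk -> bsupp k ->
  is_derive x (delta_mx ord0 i) (mconv f k) (- mconv f (Dk i) x).
Proof.
move=> lf kD bk; have lk := C1_lbm kD; have lD := C1_lbmD i kD; have bD := C1_bsuppD i kD bk.
have [C C0 HC] := lbm_bounded lD bD; have [M HM] := bsuppE bD.
pose v : 'rV[R]_n := delta_mx ord0 i.
apply/is_derive_at0.
pose r := `|x| + `|v| + M; have mB := @measurable_ball_rV R n r.
have intG : leb.-integrable setT (EFin \o ((fun y => C * `|f y|) \_ [set y | `|y| <= r])).
  rewrite -restrict_EFin; apply/(integrable_mkcond _ mB).1.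
  have := integrableZl mB C (integrable_abse (lf.2 r)).
  by apply: eq_integrable => // y _.
have H := @diff_under _ _ R leb setT measurableT
  (fun (s : R) y => f y * k (y - (s *: v + x)))
  (fun (s : R) y => f y * - Dk i (y - (s *: v + x))) _ 0 (-1) 1 _ _ _ intG _.
have -> : - mconv f (Dk i) x = \int[leb]_y (f y * - Dk i (y - (0 *: v + x))).
  rewrite scale0r add0r /mconv -[LHS]mulN1r -RintegralZl//; last exact: conv_int.
  by apply: eq_Rintegral => y _; ring.
apply: H.
- by rewrite ltrN10 ltr01.
- by move=> s _; exact: conv_int.
- move=> s y _ _.
  have H := is_derive_line (fun z => C1_is_derive kD z (- v)) (y - x) s.
  have -> : (fun s => f y * k (y - (s *: v + x))) = (fun s => f y * k (s *: (- v) + (y - x))).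
    by apply/funext => t; congr (_ * k _); rewrite scalerN opprD addrCA.
  have E : \sum_j (- v) ord0 j * Dk j (s *: (- v) + (y - x)) = - Dk i (y - (s *: v + x)).
    rewrite (bigD1 i)//= big1 => [|j ji].
      rewrite !mxE !eqxx addr0 mulN1r; congr (- Dk i _).
      by rewrite scalerN opprD addrCA.
    by rewrite !mxE eqxx (negbTE ji) /= oppr0 mul0r.
  rewrite -E; exact: is_deriveZ.
- move=> s y /andP[s1 s2] _; rewrite patchE; case: ifPn => [_|/negP].
    by rewrite normrM normrN mulrC ler_wpM2r.
  rewrite inE/= => /negP; rewrite -ltNge => ry.
  rewrite HM ?oppr0 ?mulr0 ?normr0//.
  have := lerB_normD y (- (s *: v + x)); rewrite normrN => h.
  have h2 := ler_normD (s *: v) x.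
  have h3 : `|s *: v| <= `|v| by rewrite normrZ ler_piMl// ler_norml !ltW.
  rewrite /r in ry; lra.
Qed.

Lemma isCk_conv j f k : loc1 f -> (forall j, isCk j k) -> bsupp k -> isCk j (mconv f k).
Proof.
move=> lf; elim: j k => [|j IH] k kC bk; have kD := isCk_C1 (kC 1%N).
  by split=> //; exact: conv_cont lf kD bk.
apply: (@isCkS _ _ _ _ (fun i x => - mconv f (partial i k) x)).
- exact: conv_cont lf kD bk.
- by move=> i x; exact: (conv_derive i x lf kD bk).
- move=> i; have -> : (fun x => - mconv f (partial i k) x) = fun x => -1 * mconv f (partial i k) x.
    by apply/funext => x; rewrite mulN1r.
  apply: isCkM; first exact: isCk_cst.
  apply: IH => [l|]; first exact: isCk_partial (kC l.+1).
  exact: C1_bsuppD kD bk.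
Qed.

Lemma conv_parts f Df k Dk i x : C1 f Df -> C1 k Dk -> bsupp k ->
  - mconv f (Dk i) x = mconv (Df i) k x.
Proof.
move=> fD kD bk; have lk := C1_lbm kD; have lD := C1_lbmD i kD; have bD := C1_bsuppD i kD bk.
have lf := C1_lbm fD; have lDf := C1_lbmD i fD.
have kS := C1_affine 1 (- x) kD.
have [l1 b1] := lbs_shift x lk bk; have [l2 b2] := lbs_shift x lD bD.
have kS' : C1 (fun y => k (y - x)) (fun i y => Dk i (y - x)).
  by apply: C1_ext kS => [y|j y]; rewrite ?mul1r scale1r.
have := Int_translation measurableT (C1M fD kS') (bsuppMr f b1) (i := i) (fun _ _ => conj (fun _ => I) (fun _ => I)).
rewrite (IntD measurableT); [|lbst|lbst] => /eqP; rewrite addr_eq0 => /eqP E.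
rewrite /mconv E opprK; apply: eq_Rintegral => y _; exact: mulrC.
Qed.

Lemma conv_near f k (r e : R) c x : lbm f -> mollifier r c k -> 0 <= e ->
  (forall y, `|y - x - c| <= r -> `|f y - f x| <= e) -> `|mconv f k x - f x| <= e.
Proof.
move=> lf [kC _ k0 kr [k1 _]] e0 H.
have lk := isCk_lbm (kC 0%N); have bk : bsupp k by exact: supp_ball kr.
have [l1 b1] := lbs_shift x lk bk.
have -> : mconv f k x - f x = \int[leb]_y ((f y - f x) * k (y - x)).
  have e1 : f x = \int[leb]_y (f x * k (y - x)).
    by rewrite (IntZ measurableT); [rewrite k1 mulr1|lbst].
  transitivity (mconv f k x - \int[leb]_y (f x * k (y - x))); first by rewrite -e1.
  rewrite /mconv -(IntB measurableT); [|lbst|lbst].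
  by apply: eq_Rintegral => y _; ring.
apply: (le_trans (Int_norm measurableT _)); first by lbst.
rewrite -[leRHS]mulr1 -(k1 x) -(IntZ measurableT); [|lbst].
apply: (Int_le measurableT) => [||y _]; [lbst|lbst|].
rewrite normrM (ger0_norm (k0 _)).
have [h|h] := lerP `|y - x - c| r; first by rewrite ler_wpM2r// H.
by rewrite kr// !mulr0.
Qed.

(** Uniform C^1 approximation with supports in one ball. What is gained over [h] is a symmetric
    second derivative, needed to exchange [d_n] and [d_i] in [wder_trace_smooth]. *)
Lemma C1c_mollify h Dh :
  C1 h Dh -> bsupp h -> exists M : R, forall e : R, 0 < e ->
  exists h' Dh' (D2h' : 'I_n -> 'I_n -> 'rV[R]_n -> R), [/\ forall p : nat, isCk p h', C1 h' Dh',
    (forall i, C1 (Dh' i) (D2h' i)) /\ (forall i j x, D2h' i j x = D2h' j i x),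
    forall x, M < `|x| -> h' x = 0 &
    (forall x, `|h x - h' x| <= e) /\ (forall i x, `|Dh i x - Dh' i x| <= e)].
Proof.
move=> hD bh; have [M HM] := bsuppE bh.
have lh := C1_lbm hD; have lDh i := C1_lbmD i hD; have bDh i := C1_bsuppD i hD bh.
exists (M + 1) => e e0.
have [d0 d00 Hd0] := unif_cont (C1_cont hD) bh e0.
have Hi i : exists d : R, 0 < d /\ forall x y, `|x - y| < d -> `|Dh i x - Dh i y| <= e.
  by have [d dp Hd] := unif_cont (C1_contD (i := i) hD) (bDh i) e0; exists d.
have [di Hdi] := choice Hi.
pose r := (Num.min 1 (Num.min d0 (\big[Num.min/1]_i di i))) / 2.
have m0 : 0 < \big[Num.min/1]_i di i.
  by elim/big_ind: _ => // [x y x0 y0|i _]; [rewrite lt_min x0|case: (Hdi i)].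
have r0 : 0 < r by rewrite divr_gt0// !lt_min ltr01 d00.
have rlt (d : R) : Num.min 1 (Num.min d0 (\big[Num.min/1]_i di i)) <= d -> r < d.
  by move=> le_d; apply: lt_le_trans le_d; rewrite ltr_pdivrMr// ltr_pMr ?ltr1n// !lt_min ltr01 d00.
have r1 : r < 1 by apply: rlt; rewrite ge_min lexx.
have rd0 : r < d0 by apply: rlt; rewrite !ge_min lexx !orbT.
have rdi i : r < di i.
  apply: rlt; rewrite !ge_min; apply/orP; right; apply/orP; right; exact: bigmin_le.
have [k kM] := mollifier_exists 0 r0.
have [kC ksym k0 kr [k1 _]] := kM.
have bk : bsupp k by exact: supp_ball kr.
have kD := isCk_C1 (kC 1%N).
have kDD i := isCk_C1 (isCk_partial i (kC 2%N)).
have bkD i : bsupp (partial i k) by exact: C1_bsuppD kD bk.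
have loch := lbm_loc1 lh; have locD i := lbm_loc1 (lDh i).
(* The second derivatives are written with one derivative on [h] and one on the kernel; moving both
   onto the kernel shows that they are symmetric. *)
exists (mconv h k), (fun i => mconv (Dh i) k), (fun i j x => - mconv (Dh i) (partial j k) x).
split.
- by move=> j; exact: isCk_conv.
- split=> [|i|i x].
  + exact: conv_cont loch kD bk.
  + exact: conv_cont (locD i) kD bk.
  + by rewrite -(conv_parts i x hD kD bk); exact: conv_derive i x loch kD bk.
- split=> [i|i j x].
    split=> [|j|j x].
    + exact: conv_cont (locD i) kD bk.
    + apply: contN; exact: conv_cont (locD i) (kDD j) (bkD j).
    + exact: conv_derive j x (locD i) kD bk.
  rewrite -(conv_parts i x hD (kDD j) (bkD j)) -(conv_parts j x hD (kDD i) (bkD i)).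
  by rewrite ksym.
- move=> x Mx; rewrite /mconv (_ : (fun y => _) = fun=> 0); first by rewrite /Rintegral integral0.
  apply/funext => y; have [h1|h1] := ltrP M `|y|; first by rewrite HM ?mul0r.
  rewrite kr ?mulr0// subr0; have := lerB_normD x (- y); rewrite normrN distrC => h2; lra.
- split=> [x|i x]; rewrite distrC.
    apply: (conv_near lh kM (ltW e0)) => y; rewrite subr0 => near_y.
    by apply: Hd0; exact: le_lt_trans near_y rd0.
  apply: (conv_near (lDh i) kM (ltW e0)) => y; rewrite subr0 => near_y.
  by apply: (Hdi i).2; exact: le_lt_trans near_y (rdi i).
Qed.

End mollifier.

(** * The boundary term *)

Section weak_derivative.
Variables (R : realType) (m : nat).
Local Notation leb := (lebesgue_rV R).
Local Notation Om := (half_space R m).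

(** Stated for everywhere defined representatives and C^1 test functions, so that slices of C^1
    functions on the half-space can be used directly; [wder_weak] is the bridge from
    [is_weak_partial]. *)
Definition wder (i : 'I_m) (be ga : 'rV[R]_m -> R) : Prop :=
  forall phi Dphi, C1 phi Dphi -> bsupp phi ->
  \int[leb m]_x (be x * Dphi i x) = - \int[leb m]_x (ga x * phi x).

Section wder_trace.
Variables (i : 'I_m) (be ga : 'rV[R]_m -> R).
Hypotheses (lbe : lbm be) (lga : lbm ga) (w : wder i be ga).
Local Notation il := (lift ord_max i).
Local Notation hd x := (unsnoc x).1.

Lemma wder_half_space f Df : C1 f Df -> bsupp f ->
  \int[leb m.+1]_(x in Om) (be (hd x) * Df il x) =
  - \int[leb m.+1]_(x in Om) (ga (hd x) * f x).
Proof.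
move=> fD bf; have mO := @measurable_half_space R m.
have lf := C1_lbm fD; have lDf := C1_lbmD il fD; have bDf := C1_bsuppD il fD bf.
rewrite -IntN; [|exact: mO|lbst].
rewrite RintO_snoc2; [|lbm_tac|bsupp_tac].
rewrite RintO_snoc2; [|lbm_tac|bsupp_tac].
apply: eq_Rintegral => t _.
transitivity (\int[leb m]_x (be x * Df il (snoc (x, t)))).
  by apply: eq_Rintegral => x _; rewrite snocK.
rewrite (w (C1_slice t fD) (bsupp_slice t bf)) -IntN; [|exact: measurableT|].
  by apply: eq_Rintegral => x _; rewrite snocK.
by split; [lbm_tac|apply: bsuppMr; exact: bsupp_slice].
Qed.

(* Second derivatives of [h] allow [d_n d_i h = d_i d_n h], after which [d_i] is moved
   onto [be] and [F]. *)
Lemma wder_trace_smooth F DF h Dh D2h :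
  C1 F DF -> bsupp F -> C1 h Dh -> bsupp h ->
  (forall j, C1 (Dh j) (D2h j)) -> (forall j k x, D2h j k x = D2h k j x) ->
  \int[leb m]_x (be x * (F (snoc (x, 0)) * Dh il (snoc (x, 0)))) =
  - (\int[leb m.+1]_(x in Om) (be (hd x) * (DF ord_max x * Dh il x))) +
  \int[leb m.+1]_(x in Om) ((ga (hd x) * F x + be (hd x) * DF il x) * Dh ord_max x).
Proof.
move=> FD bF hD bh hD2 sym; have mO := @measurable_half_space R m.
have bD j : bsupp (Dh j) by exact: C1_bsuppD hD bh.
have lD j : lbm (Dh j) by exact: C1_lbmD hD.
have lD2 j k : lbm (D2h j k) by exact: C1_lbmD (hD2 j).
rewrite (IntO_nor (C1M FD (hD2 il)) _ lbe); last by bsupp_tac.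
have E := wder_half_space (C1M FD (hD2 ord_max)) ltac:(bsupp_tac).
have -> : \int[leb m.+1]_(x in Om) (be (hd x) *
    (F x * D2h il ord_max x + Dh il x * DF ord_max x)) =
  \int[leb m.+1]_(x in Om) (be (hd x) * (F x * D2h ord_max il x + Dh ord_max x * DF il x)) -
  \int[leb m.+1]_(x in Om) (be (hd x) * (Dh ord_max x * DF il x)) +
  \int[leb m.+1]_(x in Om) (be (hd x) * (DF ord_max x * Dh il x)).
  rewrite -IntB; [|exact: mO|lbst|lbst]; rewrite -IntD; [|exact: mO|lbst|lbst].
  by apply: eq_Rintegral => x _; rewrite sym; ring.
rewrite E.
have -> : \int[leb m.+1]_(x in Om) ((ga (hd x) * F x + be (hd x) * DF il x) * Dh ord_max x) =
  \int[leb m.+1]_(x in Om) (ga (hd x) * (F x * Dh ord_max x)) +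
  \int[leb m.+1]_(x in Om) (be (hd x) * (Dh ord_max x * DF il x)).
  rewrite -IntD; [|exact: mO|lbst|lbst].
  by apply: eq_Rintegral => x _; ring.
ring.
Qed.

(** The second derivatives of [h] are removed by approximation: both sides contain [h] only through
    its gradient against fixed integrable factors, so a gradient error [e] changes them by at most
    [e (KL + KA + KB)]. *)
Lemma wder_trace F DF h Dh : C1 F DF -> bsupp F -> C1 h Dh -> bsupp h ->
  \int[leb m]_x (be x * (F (snoc (x, 0)) * Dh il (snoc (x, 0)))) =
  - (\int[leb m.+1]_(x in Om) (be (hd x) * (DF ord_max x * Dh il x))) +
  \int[leb m.+1]_(x in Om) ((ga (hd x) * F x + be (hd x) * DF il x) * Dh ord_max x).
Proof.
move=> FD bF hD bh; have mO := @measurable_half_space R m.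
have [M HM] := C1c_mollify hD bh.
set L := LHS; set A := \int[_]_(x in _) _; set B := \int[_]_(x in _) _.
pose KL := \int[leb m]_x `|be x * F (snoc (x, 0))|.
pose KA := \int[leb m.+1]_(x in Om) `|be (hd x) * DF ord_max x|.
pose KB := \int[leb m.+1]_(x in Om) `|ga (hd x) * F x + be (hd x) * DF il x|.
have KL0 : 0 <= KL by apply: Rintegral_ge0.
have KA0 : 0 <= KA by apply: Rintegral_ge0.
have KB0 : 0 <= KB by apply: Rintegral_ge0.
suff H (e : R) : 0 < e -> `|L - (- A + B)| <= e * (KL + KA + KB).
  apply/eqP; rewrite -subr_eq0 -normr_le0; apply/ler_addgt0Pl => e e0; rewrite addr0.
  have d0 : 0 < e / (KL + KA + KB + 1) by rewrite divr_gt0// ltr_wpDl// !addr_ge0.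
  apply: le_trans (H _ d0) _.
  rewrite -mulrA ler_piMr//; first exact: ltW.
  rewrite mulrC ler_pdivrMr ?mul1r ?lerDl//; by rewrite ltr_wpDl// !addr_ge0.
move=> e0; have [h' [Dh' [D2h' [_ hD' [hD2' sym] bh' [_ He]]]]] := HM e e0.
have bsh' : bsupp h' by exact: bsuppI bh'.
have E := wder_trace_smooth FD bF hD' bsh' hD2' sym.
have bD j : bsupp (Dh j) by exact: C1_bsuppD hD bh.
have bD' j : bsupp (Dh' j) by exact: C1_bsuppD hD' bsh'.
have lD j : lbm (Dh j) by exact: C1_lbmD hD.
have lD' j : lbm (Dh' j) by exact: C1_lbmD hD'.
have est n (D : set 'rV[R]_n) (p y y' : 'rV[R]_n -> R) : measurable D ->
    lbm p -> lbm y -> lbm y' -> bsupp p -> (forall x, `|y x - y' x| <= e) ->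
    `|\int[leb n]_(x in D) (p x * y x) - \int[leb n]_(x in D) (p x * y' x)| <=
    e * \int[leb n]_(x in D) `|p x|.
  move=> mD lp ly ly' bp Hy; rewrite -IntB; [|exact: mD|lbst|lbst].
  apply: le_trans (Int_norm mD _) _; first by lbst.
  rewrite -IntZ; [|exact: mD|lbst].
  apply: (Int_le mD) => [||x _]; [lbst|lbst|].
  by rewrite -mulrBr normrM mulrC ler_wpM2r.
have E1 := est m setT (fun x => be x * F (snoc (x, 0)))
  (fun x => Dh il (snoc (x, 0))) (fun x => Dh' il (snoc (x, 0))) measurableT
  ltac:(lbm_tac) ltac:(lbm_tac) ltac:(lbm_tac) ltac:(bsupp_tac) (fun x => He il _).
have E2 := est m.+1 Om (fun x => be (hd x) * DF ord_max x)
  (Dh il) (Dh' il) mO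
  ltac:(lbm_tac) ltac:(lbm_tac) ltac:(lbm_tac) ltac:(bsupp_tac) (fun x => He il _).
have E3 := est m.+1 Om (fun x => ga (hd x) * F x + be (hd x) * DF il x)
  (Dh ord_max) (Dh' ord_max) mO
  ltac:(lbm_tac) ltac:(lbm_tac) ltac:(lbm_tac) ltac:(bsupp_tac) (fun x => He ord_max _).
have eL : L = \int[leb m]_x (be x * F (snoc (x, 0)) * Dh il (snoc (x, 0))).
  by apply: eq_Rintegral => x _; rewrite mulrA.
have eA : A = \int[leb m.+1]_(x in Om) (be (hd x) * DF ord_max x * Dh il x).
  by apply: eq_Rintegral => x _; rewrite mulrA.
have eL' : \int[leb m]_x (be x * (F (snoc (x, 0)) * Dh' il (snoc (x, 0)))) =
    \int[leb m]_x (be x * F (snoc (x, 0)) * Dh' il (snoc (x, 0))).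
  by apply: eq_Rintegral => x _; rewrite mulrA.
have eA' : \int[leb m.+1]_(x in Om) (be (hd x) * (DF ord_max x * Dh' il x)) =
    \int[leb m.+1]_(x in Om) (be (hd x) * DF ord_max x * Dh' il x).
  by apply: eq_Rintegral => x _; rewrite mulrA.
rewrite eL' eA' in E; rewrite -eL in E1; rewrite -eA in E2.
rewrite -/KL in E1; rewrite -/KA in E2; rewrite -/KB -/B in E3.
move: E1 E2 E3; rewrite !ler_norml => /andP[? ?] /andP[? ?] /andP[? ?].
by apply/andP; split; lra.
Qed.

End wder_trace.
End weak_derivative.

(** * Sharp estimate of the rotation term on the boundary *)

Lemma sum_CS (R : realFieldType) n (x y : 'I_n -> R) :
  (\sum_i x i * y i) ^+ 2 <= (\sum_i x i ^+ 2) * (\sum_i y i ^+ 2).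
Proof.
set A := \sum_i x i ^+ 2; set B := \sum_i x i * y i; set C := \sum_i y i ^+ 2.
have H s : 0 <= s ^+ 2 * A + 2 * s * B + C.
  have -> : s ^+ 2 * A + 2 * s * B + C = \sum_i (s * x i + y i) ^+ 2.
    rewrite !mulr_sumr -!big_split/=; apply: eq_bigr => i _; ring.
  by apply: sumr_ge0 => i _; exact: sqr_ge0.
have A0 : 0 <= A by apply: sumr_ge0 => i _; exact: sqr_ge0.
have [A00|An0] := eqVneq A 0.
  have [->|Bn0] := eqVneq B 0; first by rewrite A00 expr0n mul0r.
  have := H (- (C + 1) / (2 * B)); rewrite A00 mulr0 add0r.
  have -> : 2 * (- (C + 1) / (2 * B)) * B = - (C + 1) by field.
  lra.
have Ap : 0 < A by rewrite lt_def An0.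
have := H (- B / A).
have -> : (- B / A) ^+ 2 * A + 2 * (- B / A) * B + C = (A * C - B ^+ 2) / A by field.
by rewrite pmulr_lge0 ?invr_gt0// subr_ge0.
Qed.

(** Meant for [X = |x|^2], [Q = x . v] and [S = |v|^2]: the bound on [x be] and Cauchy-Schwarz give
    [|be Q| <= b |v|], and Young's inequality with weight [s] separates this from [p]. *)
Lemma young2 (R : realFieldType) (p Q S X b be s : R) :
  0 < b -> 0 < s -> be ^+ 2 * X <= b ^+ 2 -> 0 <= S -> Q ^+ 2 <= X * S ->
  2 * be * (p * Q) <= b * (p ^+ 2 / s + s * S).
Proof.
move=> b0 s0 beX S0 QS.
have H : (be * Q) ^+ 2 <= b ^+ 2 * S.
  rewrite exprMn; apply: le_trans (_ : be ^+ 2 * (X * S) <= _).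
    by rewrite ler_wpM2l// sqr_ge0.
  by rewrite mulrA ler_wpM2r.
have := sqr_ge0 (b * p - s * (be * Q)).
rewrite sqrrB (exprMn _ s).
have : s ^+ 2 * (be * Q) ^+ 2 <= s ^+ 2 * (b ^+ 2 * S) by rewrite ler_wpM2l// sqr_ge0.
move=> h1 h2.
have : 2 * be * (p * Q) * (b * s) <= b * (p ^+ 2 / s + s * S) * (b * s).
  have -> : b * (p ^+ 2 / s + s * S) * (b * s) = (b * p) ^+ 2 + s ^+ 2 * (b ^+ 2 * S).
    by field; rewrite gt_eqF.
  rewrite mulr2n in h2; lra.
by rewrite ler_pM2r// mulr_gt0.
Qed.

Lemma young (R : realFieldType) (p q c : R) : 0 < c -> 2 * (p * q) <= p ^+ 2 / c + c * q ^+ 2.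
Proof.
move=> c0; have := @young2 _ p q (q ^+ 2) 1 1 1 c ltr01 c0.
by rewrite !mulr1 !mul1r expr1n => -> //; exact: sqr_ge0.
Qed.

Section rotation.
Variables (R : realType) (m : nat).
Local Notation leb := (lebesgue_rV R).
Local Notation Om := (half_space R m).
Local Notation il i := (lift ord_max i).
Local Notation hd x := (unsnoc x).1.
Variables (be : 'rV[R]_m -> R) (ga : 'I_m -> 'rV[R]_m -> R) (b1 b2 q : R).
Hypotheses (lbe : lbm be) (lga : forall i, lbm (ga i)).
Hypothesis w : forall i, wder i be (ga i).
Hypotheses (b10 : 0 < b1) (b20 : 0 < b2) (q0 : 0 < q).
Hypothesis hb1 : forall x, be x ^+ 2 * sqn x <= b1 ^+ 2.
Let dv (x : 'rV[R]_m) := \sum_i (x ord0 i * ga i x) + m%:R * be x.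
Hypothesis hb2 : forall p1 Dp1 p2 Dp2,
  C1 p1 Dp1 -> bsupp p1 -> C1 p2 Dp2 -> bsupp p2 ->
  \int[leb m]_x (dv x ^+ 2 * (p1 x ^+ 2 + p2 x ^+ 2)) <=
  b2 ^+ 2 * \int[leb m]_x (\sum_i (Dp1 i x ^+ 2 + Dp2 i x ^+ 2)).

Lemma lbm_dv : lbm dv.
Proof. by rewrite /dv; lbm_tac. Qed.

(** The boundary inequality holds on every slice at a fixed height, and is integrated over the
    height. Working in the extended reals, only measurability of the slice integrals is required. *)
Lemma hb2_half_space p1 Dp1 p2 Dp2 :
  C1 p1 Dp1 -> bsupp p1 -> C1 p2 Dp2 -> bsupp p2 ->
  \int[leb m.+1]_(x in Om) (dv (hd x) ^+ 2 * (p1 x ^+ 2 + p2 x ^+ 2)) <=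
  b2 ^+ 2 * \int[leb m.+1]_(x in Om) (\sum_i (Dp1 (il i) x ^+ 2 + Dp2 (il i) x ^+ 2)).
Proof.
move=> D1 B1 D2 B2; have mO := @measurable_half_space R m; have ldv := lbm_dv.
have B1D i : bsupp (Dp1 (il i)) by exact: C1_bsuppD D1 B1.
have B2D i : bsupp (Dp2 (il i)) by exact: C1_bsuppD D2 B2.
have l1D i : lbm (Dp1 (il i)) by exact: C1_lbmD D1.
have l2D i : lbm (Dp2 (il i)) by exact: C1_lbmD D2.
have l1 : lbm (fun x => dv (hd x) ^+ 2 * (p1 x ^+ 2 + p2 x ^+ 2)) by lbm_tac.
have s1 : bsupp (fun x => dv (hd x) ^+ 2 * (p1 x ^+ 2 + p2 x ^+ 2)) by bsupp_tac.
have l2 : lbm (fun x => \sum_i (Dp1 (il i) x ^+ 2 + Dp2 (il i) x ^+ 2)) by lbm_tac.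
have s2 : bsupp (fun x => \sum_i (Dp1 (il i) x ^+ 2 + Dp2 (il i) x ^+ 2)) by bsupp_tac.
have G f : lbm f -> bsupp f -> (forall x, 0 <= f x) ->
    (\int[leb m.+1]_(x in Om) f x)%:E =
    (\int[@lebesgue_measure R]_t (\int[leb m]_x (f \_ Om) (snoc (x, t)))%:E)%E /\
    measurable_fun [set: measurableTypeR R]
      (fun t => (\int[leb m]_x (f \_ Om) (snoc (x, t)))%:E).
  move=> lf bf f0.
  have lfO := lbm_restrict mO lf; have bfO := bsupp_restrict Om bf.
  have fO0 x : (0 <= ((f \_ Om) x)%:E)%E.
    by rewrite lee_fin patchE; case: ifP.
  have E (t : measurableTypeR R) : (\int[leb m]_x (f \_ Om) (snoc (x, t)))%:E =
      (\int[leb m]_x ((f \_ Om) (snoc (x, t)))%:E)%E.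
    rewrite ge0_RintegralE//.
    by apply: lbs_integrable => //; [exact: lbm_slice|exact: bsupp_slice].
  have mfO : measurable_fun setT (EFin \o (f \_ Om)).
    by apply: measurableT_comp => //; exact: lbm_measurable.
  split.
    rewrite Rintegral_mkcond ge0_RintegralE//; last exact: lbs_integrable.
    rewrite ge0_integral_snoc2//.
    by apply: eq_integral => t _; rewrite E.
  rewrite (_ : (fun t : measurableTypeR R => _) = fubini_G (leb m) ((EFin \o (f \_ Om)) \o @snoc R m)).
    apply: measurable_fun_fubini_tonelli_G => //.
      by apply: measurableT_comp => //; exact: measurable_snoc.
    by move=> p; exact: fO0.
  by apply/funext => t; rewrite E.
have P1 x : 0 <= dv (hd x) ^+ 2 * (p1 x ^+ 2 + p2 x ^+ 2).
  by rewrite mulr_ge0 ?addr_ge0 ?sqr_ge0.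
have P2 (x : 'rV[R]_m.+1) : 0 <= \sum_i (Dp1 (il i) x ^+ 2 + Dp2 (il i) x ^+ 2).
  by apply: sumr_ge0 => i _; rewrite addr_ge0// sqr_ge0.
have [E1 M1] := G _ l1 s1 P1; have [E2 M2] := G _ l2 s2 P2.
rewrite -lee_fin EFinM E1 E2 -ge0_integralZl_EFin; last 4 first.
- exact: measurableT.
- by move=> t _; rewrite lee_fin; apply: Rintegral_ge0 => x _; rewrite patchE; case: ifP.
- exact: M2.
- exact: sqr_ge0.
apply: ge0_le_integral.
- exact: measurableT.
- by move=> t _; rewrite lee_fin; apply: Rintegral_ge0 => x _; rewrite patchE; case: ifP.
- exact: M1.
- exact: measurable_funeM.
move=> t _; rewrite -EFinM lee_fin.
have sl (f : 'rV[R]_m.+1 -> R) : 0 < t -> \int[leb m]_x (f \_ Om) (snoc (x, t)) =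
    \int[leb m]_x f (snoc (x, t)).
  move=> t0; apply: eq_Rintegral => x _; rewrite patchE.
  by rewrite mem_set// /half_space/= snoc_last.
have sl0 (f : 'rV[R]_m.+1 -> R) : t <= 0 -> \int[leb m]_x (f \_ Om) (snoc (x, t)) = 0.
  move=> t0; transitivity (\int[leb m]_x (0 : R)).
    apply: eq_Rintegral => x _; rewrite patchE.
    by rewrite memNset// /half_space/= snoc_last; apply/negP; rewrite -leNgt.
  by rewrite /Rintegral integral0.
have [t0|t0] := lerP t 0; first by rewrite !sl0// mulr0.
rewrite !sl//.
have := hb2 (C1_slice t D1) (bsupp_slice t B1) (C1_slice t D2) (bsupp_slice t B2).
apply: le_trans; rewrite le_eqVlt; apply/orP; left; apply/eqP.
by apply: eq_Rintegral => x _; rewrite snocK.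
Qed.

(* Pairing each component with the vertically rescaled other one, which has the same
   boundary values, introduces the free parameter [q]. *)
Lemma rotation_bound w1 Dw1 w2 Dw2 :
  C1 w1 Dw1 -> bsupp w1 -> C1 w2 Dw2 -> bsupp w2 ->
  \int[leb m]_x (2 * be x * \sum_i (x ord0 i *
    (w1 (snoc (x, 0)) * Dw2 (il i) (snoc (x, 0)) -
     w2 (snoc (x, 0)) * Dw1 (il i) (snoc (x, 0))))) <=
  (b1 / q + (b1 + b2) * q) *
    \int[leb m.+1]_(x in Om) (\sum_i (Dw1 i x ^+ 2 + Dw2 i x ^+ 2)).
Proof.
move=> D1 B1 D2 B2; have mO := @measurable_half_space R m; have ldv := lbm_dv.
(* Vertical scaling by [k] multiplies the normal energy by [k] and the tangential one by [1 / k];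
   the square is what balances the Young weights [q] and [1 / q] below. *)
pose k := q ^+ 2; have k0 : 0 < k by rewrite exprn_gt0.
pose W1 x := w1 (vert k x); pose W2 x := w2 (vert k x).
pose DW1 i x := (if i == ord_max then k else 1) * Dw1 i (vert k x).
pose DW2 i x := (if i == ord_max then k else 1) * Dw2 i (vert k x).
have DD1 : C1 W1 DW1 by exact: C1_vertscale.
have DD2 : C1 W2 DW2 by exact: C1_vertscale.
have BW1 : bsupp W1 by exact: bsupp_vert.
have BW2 : bsupp W2 by exact: bsupp_vert.
have v0 (x : 'rV[R]_m) : vert k (snoc (x, 0)) = snoc (x, 0) by rewrite vert_snoc mulr0.
have DWt1 i x : DW1 (il i) x = Dw1 (il i) (vert k x).
  by rewrite /DW1 [_ == _](negbTE _) ?mul1r// eq_sym neq_lift.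
have DWt2 i x : DW2 (il i) x = Dw2 (il i) (vert k x).
  by rewrite /DW2 [_ == _](negbTE _) ?mul1r// eq_sym neq_lift.
have bd1 i : bsupp (Dw1 i) by exact: C1_bsuppD D1 B1.
have bd2 i : bsupp (Dw2 i) by exact: C1_bsuppD D2 B2.
have ld1 i : lbm (Dw1 i) by exact: C1_lbmD D1.
have ld2 i : lbm (Dw2 i) by exact: C1_lbmD D2.
have bD1 i : bsupp (DW1 i) by exact: C1_bsuppD DD1 BW1.
have bD2 i : bsupp (DW2 i) by exact: C1_bsuppD DD2 BW2.
have lD1 i : lbm (DW1 i) by exact: C1_lbmD DD1.
have lD2 i : lbm (DW2 i) by exact: C1_lbmD DD2.
have lw1 := C1_lbm D1. have lw2 := C1_lbm D2.
pose X (x : 'rV[R]_m.+1) i := (hd x) ord0 i.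
have lX i : lbm (fun x => X x i) by apply: (@lbm_hd _ _ (fun y => y ord0 i)); exact: lbm_coord.
(* Interior density of the boundary integral of [be u (x . grad V)]. It is [wder_trace] with
   [F = x_i u], summed over [i]; the derivative of the factors [x_i] supplies the summand [m be] of
   [dv], the divergence of [x be]. *)
pose In u Du DV x := - (be (hd x) * (Du ord_max x * \sum_i X x i * DV (il i) x)) +
  (dv (hd x) * u x + be (hd x) * \sum_i X x i * Du (il i) x) * DV ord_max x.
have key u Du v V DV : C1 u Du -> bsupp u -> C1 V DV -> bsupp V ->
    (forall i x, DV (il i) (snoc (x, 0)) = v i (snoc (x, 0))) ->
    \int[leb m]_x (be x * \sum_i (x ord0 i * (u (snoc (x, 0)) * v i (snoc (x, 0))))) =
    \int[leb m.+1]_(x in Om) In u Du DV x.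
  move=> uD bu VD bV Hv.
  have ldu i : lbm (Du i) by exact: C1_lbmD uD.
  have bdu i : bsupp (Du i) by exact: C1_bsuppD uD bu.
  have ldv' i : lbm (DV i) by exact: C1_lbmD VD.
  have bdv i : bsupp (DV i) by exact: C1_bsuppD VD bV.
  have lu := C1_lbm uD.
  transitivity (\sum_i \int[leb m]_x (be x * ((snoc (x, 0) : 'rV[R]_m.+1) ord0 (il i) * u (snoc (x, 0)) * DV (il i) (snoc (x, 0))))).
    rewrite -Int_sum; [|exact: measurableT|].
      apply: eq_Rintegral => x _; rewrite mulr_sumr; apply: eq_bigr => i _.
      by rewrite snoc_lift Hv; ring.
    move=> i; split.
      apply: lbmM => //; apply: lbmM; last by lbm_tac.
      apply: lbmM; last by lbm_tac.
      by apply: (@lbm_slice _ _ (fun y => y ord0 (il i))); exact: lbm_coord.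
    apply: bsuppMr; apply: bsuppMr; exact: bsupp_slice.
  have E i : \int[leb m]_x (be x * ((snoc (x, 0) : 'rV[R]_m.+1) ord0 (il i) * u (snoc (x, 0)) * DV (il i) (snoc (x, 0)))) =
    \int[leb m.+1]_(x in Om) (- (be (hd x) * (X x i * Du ord_max x * DV (il i) x)) +
      (ga i (hd x) * (X x i * u x) + be (hd x) * (X x i * Du (il i) x + u x)) * DV ord_max x).
    have := wder_trace lbe (lga i) (w i) (C1M (C1_coord R (il i)) uD) _ VD bV.
    move=> ->; last by bsupp_tac.
    rewrite -IntN; [|exact: mO|lbst]; rewrite -IntD; [|exact: mO|lbst|lbst].
    apply: eq_Rintegral => x _.
    rewrite eqxx (negbTE (neq_lift _ _)) /X mxE /=; ring.
  under eq_bigr => i _ do rewrite E.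
  rewrite -Int_sum; [|exact: mO|by move=> i; lbst].
  apply: eq_Rintegral => x _; rewrite /In /dv.
  rewrite big_split/= sumrN -!mulr_sumr.
  congr (_ + _).
    congr (- (_ * _)); rewrite mulr_sumr; apply: eq_bigr => i _; ring.
  rewrite -mulr_suml; congr (_ * _).
  rewrite big_split/= -mulr_sumr big_split/= sumr_const card_ord.
  rewrite mulrDl mulr_suml -mulr_natl.
  rewrite (_ : \sum_i ga i (hd x) * (X x i * u x) = \sum_(i < m) (hd x) ord0 i * ga i (hd x) * u x).
    ring.
  by apply: eq_bigr => i _; rewrite /X; ring.
have lI1 : lbs (In w1 Dw1 DW2) by rewrite /In; lbst.
have lI2 : lbs (In w2 Dw2 DW1) by rewrite /In; lbst.
pose S := fun x => \sum_i (Dw1 (il i) x ^+ 2 + Dw2 (il i) x ^+ 2).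
pose Nn := fun x => Dw1 ord_max x ^+ 2 + Dw2 ord_max x ^+ 2.
have lS : lbs S by rewrite /S; lbst.
have lN : lbs Nn by rewrite /Nn; lbst.
have [[lS1 lS2] [lN1 lN2]] := (lS, lN).
have S0 x : 0 <= S x by apply: sumr_ge0 => i _; rewrite addr_ge0 ?sqr_ge0.
have N0 x : 0 <= Nn x by rewrite addr_ge0 ?sqr_ge0.
have lSv : lbs (fun x => S (vert k x)) by split; [exact: lbm_vert|exact: bsupp_vert].
have lNv : lbs (fun x => Nn (vert k x)) by split; [exact: lbm_vert|exact: bsupp_vert].
have [[lSv1 lSv2] [lNv1 lNv2]] := (lSv, lNv).
have -> : \int[leb m]_x (2 * be x * \sum_i (x ord0 i *
    (w1 (snoc (x, 0)) * Dw2 (il i) (snoc (x, 0)) -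
     w2 (snoc (x, 0)) * Dw1 (il i) (snoc (x, 0))))) =
  2 * (\int[leb m.+1]_(x in Om) In w1 Dw1 DW2 x - \int[leb m.+1]_(x in Om) In w2 Dw2 DW1 x).
  have H2 i x : DW2 (il i) (snoc (x, 0)) = Dw2 (il i) (snoc (x, 0)) by rewrite DWt2 v0.
  have H1 i x : DW1 (il i) (snoc (x, 0)) = Dw1 (il i) (snoc (x, 0)) by rewrite DWt1 v0.
  rewrite -(key _ _ (fun i => Dw2 (il i)) _ _ D1 B1 DD2 BW2 H2) -(key _ _ (fun i => Dw1 (il i)) _ _ D2 B2 DD1 BW1 H1).
  have bs i : bsupp (fun x => w1 (snoc (x, 0)) * Dw2 (il i) (snoc (x, 0))) by bsupp_tac.
  have bs' i : bsupp (fun x => w2 (snoc (x, 0)) * Dw1 (il i) (snoc (x, 0))) by bsupp_tac.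
  rewrite -IntB; [|exact: measurableT|lbst|lbst].
  rewrite -IntZ; [|exact: measurableT|lbst].
  apply: eq_Rintegral => x _; rewrite -mulrBr mulrA -sumrB; congr (_ * _).
  by apply: eq_bigr => i _; ring.
rewrite -IntB; [|exact: mO|exact: lI1|exact: lI2].
have [[lI11 lI12] [lI21 lI22]] := (lI1, lI2).
rewrite -[leLHS]IntZ; [|exact: mO|lbst].
(* Majorant from Young's inequality: weight [q] for the four products containing [be] times a radial
   derivative, weight [b2 / q] for the two products containing [dv]. *)
pose U x := (b1 * (Nn x / q) + b1 * (q * S (vert k x))) +
  ((dv (hd x) ^+ 2 * (w1 x ^+ 2 + w2 x ^+ 2)) / (b2 / q) + (b2 / q) * (k ^+ 2 * Nn (vert k x))) +
  (b1 * (q * S x) + b1 * (k ^+ 2 * Nn (vert k x) / q)).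
have lU : lbs U by rewrite /U; lbst.
apply: (@le_trans _ _ (\int[leb m.+1]_(x in Om) U x)).
  apply: (Int_le mO) => [||x _]; [lbst|exact: lU|].
  have X2 : \sum_i X x i ^+ 2 = sqn (hd x) by [].
  pose P1 := \sum_i X x i * Dw1 (il i) x. pose P2 := \sum_i X x i * Dw2 (il i) x.
  pose Q1 := \sum_i X x i * DW1 (il i) x. pose Q2 := \sum_i X x i * DW2 (il i) x.
  pose s1 := \sum_i Dw1 (il i) x ^+ 2. pose s2 := \sum_i Dw2 (il i) x ^+ 2.
  pose t1 := \sum_i DW1 (il i) x ^+ 2. pose t2 := \sum_i DW2 (il i) x ^+ 2.
  have HP1 : P1 ^+ 2 <= sqn (hd x) * s1 by exact: sum_CS.
  have HP2 : P2 ^+ 2 <= sqn (hd x) * s2 by exact: sum_CS.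
  have HQ1 : Q1 ^+ 2 <= sqn (hd x) * t1 by exact: sum_CS.
  have HQ2 : Q2 ^+ 2 <= sqn (hd x) * t2 by exact: sum_CS.
  have s10 : 0 <= s1 by apply: sumr_ge0 => i _; exact: sqr_ge0.
  have s20 : 0 <= s2 by apply: sumr_ge0 => i _; exact: sqr_ge0.
  have t10 : 0 <= t1 by apply: sumr_ge0 => i _; exact: sqr_ge0.
  have t20 : 0 <= t2 by apply: sumr_ge0 => i _; exact: sqr_ge0.
  have ES : S x = s1 + s2 by rewrite /S big_split.
  have ESv : S (vert k x) = t1 + t2.
    rewrite /S big_split/=; congr (_ + _); apply: eq_bigr => i _.
      by rewrite DWt1.
    by rewrite DWt2.
  have EDN1 : DW1 ord_max x = k * Dw1 ord_max (vert k x) by rewrite /DW1 eqxx.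
  have EDN2 : DW2 ord_max x = k * Dw2 ord_max (vert k x) by rewrite /DW2 eqxx.
  have ENv : k ^+ 2 * Nn (vert k x) = DW1 ord_max x ^+ 2 + DW2 ord_max x ^+ 2.
    by rewrite EDN1 EDN2 /Nn; ring.
  rewrite /U /In -/P1 -/P2 -/Q1 -/Q2 ENv ES ESv /Nn.
  move: (hb1 (hd x)); set B := be (hd x); set d := dv (hd x) => hB.
  move: (Dw1 ord_max x) (Dw2 ord_max x) (DW1 ord_max x) (DW2 ord_max x) (w1 x) (w2 x) => p1 p2 v1 v2 u1 u2.
  have hNB : (- B) ^+ 2 * sqn (hd x) <= b1 ^+ 2 by rewrite sqrrN.
  have A1 := young2 p1 b10 q0 hNB t20 HQ2.
  have A2 := young2 p2 b10 q0 hB t10 HQ1.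
  have A3 := young2 v2 b10 q0 hB s10 HP1.
  have A4 := young2 v1 b10 q0 hNB s20 HP2.
  have c0 : 0 < b2 / q by rewrite divr_gt0.
  have A5 := young (d * u1) v2 c0.
  have A6 := young (- (d * u2)) v1 c0.
  rewrite sqrrN !exprMn in A5 A6.
  have -> : b1 * ((p1 ^+ 2 + p2 ^+ 2) / q) + b1 * (q * (t1 + t2)) +
    (d ^+ 2 * (u1 ^+ 2 + u2 ^+ 2) / (b2 / q) + b2 / q * (v1 ^+ 2 + v2 ^+ 2)) +
    (b1 * (q * (s1 + s2)) + b1 * ((v1 ^+ 2 + v2 ^+ 2) / q)) =
    b1 * (p1 ^+ 2 / q + q * t2) + b1 * (p2 ^+ 2 / q + q * t1) +
    b1 * (v2 ^+ 2 / q + q * s1) + b1 * (v1 ^+ 2 / q + q * s2) +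
    (d ^+ 2 * u1 ^+ 2 / (b2 / q) + b2 / q * v2 ^+ 2) +
    (d ^+ 2 * u2 ^+ 2 / (b2 / q) + b2 / q * v1 ^+ 2) by ring.
  move: A1 A2 A3 A4 A5 A6; lra.
have lw : lbs (fun x => dv (hd x) ^+ 2 * (w1 x ^+ 2 + w2 x ^+ 2)) by lbst.
have [lwa lwb] := lw.
have tot : \int[leb m.+1]_(x in Om) (\sum_i (Dw1 i x ^+ 2 + Dw2 i x ^+ 2)) =
    \int[leb m.+1]_(x in Om) S x + \int[leb m.+1]_(x in Om) Nn x.
  rewrite -IntD; [|exact: mO|exact: lS|exact: lN].
  apply: eq_Rintegral => x _; rewrite (bigD1_ord ord_max)//= addrC.
  by congr (_ + _).
have dvb := hb2_half_space D1 B1 D2 B2.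
have Sv := IntO_vert k0 lS1 lS2 S0.
have Nv := IntO_vert k0 lN1 lN2 N0.
(* [IntO_vert] undoes the scaling at the cost of [1 / k]. Tangential and normal energy then come
   with the same coefficient [b1 / q + (b1 + b2) q]. *)
rewrite tot; set IS := \int[leb m.+1]_(x in Om) S x; set IN := \int[leb m.+1]_(x in Om) Nn x.
have -> : \int[leb m.+1]_(x in Om) U x =
   b1 / q * IN + b1 * q * (k^-1 * IS) +
   ((b2 / q)^-1 * \int[leb m.+1]_(x in Om) (dv (hd x) ^+ 2 * (w1 x ^+ 2 + w2 x ^+ 2)) +
    b2 / q * k ^+ 2 * (k^-1 * IN)) + (b1 * q * IS + b1 * k ^+ 2 / q * (k^-1 * IN)).
  rewrite -Sv -Nv -!(IntZ mO); [|assumption ..].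
  rewrite -!(IntD mO); [|lbst ..].
  by apply: eq_Rintegral => x _; rewrite /U; ring.
have {}dvb : \int[leb m.+1]_(x in Om) (dv (hd x) ^+ 2 * (w1 x ^+ 2 + w2 x ^+ 2)) <= b2 ^+ 2 * IS.
  exact: dvb.
have : (b2 / q)^-1 * \int[leb m.+1]_(x in Om) (dv (hd x) ^+ 2 * (w1 x ^+ 2 + w2 x ^+ 2)) <=
   b2 * q * IS.
  have -> : b2 * q * IS = (b2 / q)^-1 * (b2 ^+ 2 * IS) by field; rewrite !gt_eqF.
  by rewrite ler_wpM2l// invr_ge0 ltW// divr_gt0.
set Z := _^-1 * \int[_]_(_ in _) _ => hZ.
have -> : (b1 / q + (b1 + b2) * q) * (IS + IN) =
  b1 / q * IN + b1 * q * (k^-1 * IS) + (b2 * q * IS + b2 / q * k ^+ 2 * (k^-1 * IN)) +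
  (b1 * q * IS + b1 * k ^+ 2 / q * (k^-1 * IN)).
  by rewrite /k; field; rewrite gt_eqF.
lra.
Qed.

End rotation.

Section C1_more.
Variables (R : realType) (n : nat).

Lemma contV (T : topologicalType) (f : T -> R) :
  continuous f -> (forall x, f x != 0) -> continuous (fun x => (f x)^-1).
Proof. by move=> cf f0 x; apply: cvgV; [exact: f0|exact: cf]. Qed.

Lemma C1_inv (f : 'rV[R]_n -> R) Df : C1 f Df -> (forall x, f x != 0) ->
  C1 (fun x => (f x)^-1) (fun i x => - (f x) ^- 2 * Df i x).
Proof.
move=> fD f0; have cf := C1_cont fD.
have := @C1_comp R n (fun y => y^-1) (fun y => - y ^- 2) f Df fD; apply.
  move=> x; have := @is_deriveV R idfun (f x) 1 1 (f0 x) (is_derive_id _ _).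
  by rewrite /= /GRing.scale/= mulr1.
apply: contN; apply: contV; first by move=> x; exact: (continuous_comp (cf x) (@exprn_continuous _ 2 _)).
by move=> x; rewrite expf_neq0.
Qed.

Lemma C1_sqrt (f : 'rV[R]_n -> R) Df : C1 f Df -> (forall x, 0 < f x) ->
  C1 (fun x => Num.sqrt (f x)) (fun i x => (2 * Num.sqrt (f x))^-1 * Df i x).
Proof.
move=> fD f0; have cf := C1_cont fD.
have := @C1_comp R n Num.sqrt (fun y => (2 * Num.sqrt y)^-1) f Df fD; apply.
  by move=> x; exact: is_derive1_sqrt.
apply: contV; last by move=> x; rewrite mulf_neq0// gt_eqF// sqrtr_gt0.
apply: contM; first by exact: cst_continuous.
by move=> x; apply: continuous_comp; [exact: cf|exact: sqrt_continuous].
Qed.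

Lemma C1_cos (f : 'rV[R]_n -> R) Df : C1 f Df ->
  C1 (fun x => cos (f x)) (fun i x => - sin (f x) * Df i x).
Proof.
move=> fD; have cf := C1_cont fD.
have := @C1_comp R n cos (fun y => - sin y) f Df fD; apply.
by apply: contN => x; apply: continuous_comp; [exact: cf|exact: continuous_sin].
Qed.

Lemma C1_sin (f : 'rV[R]_n -> R) Df : C1 f Df ->
  C1 (fun x => sin (f x)) (fun i x => cos (f x) * Df i x).
Proof.
move=> fD; have cf := C1_cont fD.
have := @C1_comp R n sin cos f Df fD; apply.
by move=> x; apply: continuous_comp; [exact: cf|exact: continuous_cos].
Qed.

Definition srad (d : R) (x : 'rV[R]_n) := Num.sqrt (sqn x + d ^+ 2).

Lemma rad_gt0 (d : R) x : 0 < d -> 0 < srad d x.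
Proof. by move=> d0; rewrite sqrtr_gt0 ltr_wpDl ?sqn_ge0// exprn_gt0. Qed.

Lemma rad_sqr (d : R) x : srad d x ^+ 2 = sqn x + d ^+ 2.
Proof. by rewrite sqr_sqrtr// addr_ge0 ?sqn_ge0 ?sqr_ge0. Qed.

Lemma C1_rad (d : R) : 0 < d -> C1 (srad d) (fun i x => x ord0 i / srad d x).
Proof.
move=> d0; have H (x : 'rV[R]_n) : 0 < sqn x + d ^+ 2 by rewrite ltr_wpDl ?sqn_ge0// exprn_gt0.
have := C1_sqrt (C1D (C1_sqn R n) (C1_cst n (d ^+ 2))) H.
apply: C1_ext => // i x; rewrite addr0 -/(srad d x) invfM mulrACA mulVf// mul1r mulrC.
done.
Qed.

End C1_more.

(** * Hardy and virial inequalities *)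

Section hardy.
Variables (R : realType) (m : nat).
Local Notation leb := (lebesgue_rV R).
Local Notation Om := (half_space R m).
Local Notation il i := (lift ord_max i).

Definition xdot n (Df : 'I_n -> 'rV[R]_n -> R) (x : 'rV[R]_n) : R := \sum_i x ord0 i * Df i x.

Lemma lbm_xdot n f (Df : 'I_n -> 'rV[R]_n -> R) : C1 f Df -> lbm (xdot Df).
Proof. by move=> fD; rewrite /xdot; lbm_tac. Qed.

Lemma bsupp_xdot n f (Df : 'I_n -> 'rV[R]_n -> R) : C1 f Df -> bsupp f -> bsupp (xdot Df).
Proof. by move=> fD bf; rewrite /xdot; bsupp_tac. Qed.

Lemma xdot_bd (Df : 'I_m.+1 -> 'rV[R]_m.+1 -> R) (x : 'rV[R]_m) :
  xdot Df (snoc (x, 0)) = \sum_i x ord0 i * Df (il i) (snoc (x, 0)).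
Proof.
rewrite /xdot (bigD1_ord ord_max)//= snoc_last mul0r add0r.
by apply: eq_bigr => i _; rewrite snoc_lift.
Qed.

(** The divergence theorem for the field [x g]: its normal component has the factor [x_n], which
    vanishes on the boundary. *)
Lemma IntO_xdiv g Dg : C1 g Dg -> bsupp g ->
  \int[leb m.+1]_(x in Om) (m.+1%:R * g x + xdot Dg x) = 0.
Proof.
move=> gD bg; have mO := @measurable_half_space R m.
have lg := C1_lbm gD.
have lDg i : lbm (Dg i) by exact: C1_lbmD gD.
have bDg i : bsupp (Dg i) by exact: C1_bsuppD gD bg.
have cD i := C1M (C1_coord R i) gD.
have cb i : bsupp (fun x => x ord0 i * g x) by bsupp_tac.
have E i : \int[leb m.+1]_(x in Om) (x ord0 i * Dg i x + g x * (i == i)%:R) = 0.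
  have [j ->|->] := unliftP ord_max i; first exact: IntO_tan (cD _) (cb _).
  have := IntO_nor (cD ord_max) (cb ord_max) (@lbm_cst R m 1).
  rewrite (_ : (fun x : 'rV[R]_m => _) = fun=> 0); last first.
    by apply/funext => x; rewrite snoc_last mul0r mulr0.
  rewrite /Rintegral integral0 /= => /eqP; rewrite -/(Rintegral _ _ _) eq_sym oppr_eq0 => /eqP H.
  by rewrite -[RHS]H; apply: eq_Rintegral => x _; rewrite mul1r.
transitivity (\sum_i \int[leb m.+1]_(x in Om) (x ord0 i * Dg i x + g x * (i == i)%:R)).
  rewrite -Int_sum; [|exact: mO|by move=> i; lbst].
  apply: eq_Rintegral => x _; rewrite big_split/= addrC; congr (_ + _).
  under eq_bigr do rewrite eqxx mulr1.
  by rewrite sumr_const card_ord mulr_natl.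
by rewrite big1.
Qed.

(** Adding a multiple of a divergence changes the integrand but not the integral, so a pointwise
    inequality is enough. Both Hardy inequalities are obtained in this way. *)
Lemma xdiv_ge0 L g Dg (c : R) : lbm L -> bsupp L -> C1 g Dg -> bsupp g ->
  (forall x, 0 <= L x + c * (m.+1%:R * g x + xdot Dg x)) ->
  0 <= \int[leb m.+1]_(x in Om) L x.
Proof.
move=> lL bL gD bg H; have mO := @measurable_half_space R m.
have lg := C1_lbm gD; have lx := lbm_xdot gD; have bx := bsupp_xdot gD bg.
have : 0 <= \int[leb m.+1]_(x in Om) (L x + c * (m.+1%:R * g x + xdot Dg x)).
  by apply: Rintegral_ge0 => x _; exact: H.
rewrite IntD; [|exact: mO|lbst|lbst].
rewrite IntZ; [|exact: mO|lbst].
by rewrite IntO_xdiv// mulr0 addr0.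
Qed.

(** Expansion of [|D + c w x|^2 >= 0]. *)
Lemma sqn_complete (x y : 'rV[R]_m.+1) (D : 'I_m.+1 -> 'rV[R]_m.+1 -> R) (c w : R) :
  0 <= \sum_i D i y ^+ 2 + 2 * c * w * (\sum_i x ord0 i * D i y) + c ^+ 2 * sqn x * w ^+ 2.
Proof.
rewrite (_ : _ + _ = \sum_i (D i y + c * w * x ord0 i) ^+ 2).
  by apply: sumr_ge0 => i _; exact: sqr_ge0.
rewrite /sqn !mulr_sumr mulr_suml -!big_split/=.
by apply: eq_bigr => i _; ring.
Qed.

Lemma xdot_rho w1 Dw1 w2 Dw2 t Dt (x : 'rV[R]_m.+1) :
  xdot (fun i x => (w1 x ^+ 2 + w2 x ^+ 2) * Dt i x +
     t x * (2 * w1 x * Dw1 i x + 2 * w2 x * Dw2 i x)) x =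
  (w1 x ^+ 2 + w2 x ^+ 2) * xdot Dt x +
  2 * t x * (w1 x * xdot Dw1 x + w2 x * xdot Dw2 x).
Proof.
rewrite /xdot mulrDr !mulr_sumr -!big_split/=; apply: eq_bigr => i _; ring.
Qed.

Lemma C1_rho n w1 (Dw1 : 'I_n -> 'rV[R]_n -> R) w2 Dw2 : C1 w1 Dw1 -> C1 w2 Dw2 ->
  C1 (fun x => w1 x ^+ 2 + w2 x ^+ 2) (fun i x => 2 * w1 x * Dw1 i x + 2 * w2 x * Dw2 i x).
Proof.
move=> D1 D2; have := C1D (C1M D1 D1) (C1M D2 D2).
by apply: C1_ext => [x|i x]; ring.
Qed.

Hypothesis m3 : (3 <= m)%N.

(** With [u = (1 + |x|^2)^-1], the divergence of [x u |w|^2] is added and the square of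
    [grad w + u w x] completed. What remains is [(N - 1 - 3 u |x|^2) u |w|^2], nonnegative because
    [u |x|^2 <= 1] and [N >= 4]. *)
Lemma hardy w1 Dw1 w2 Dw2 : C1 w1 Dw1 -> bsupp w1 -> C1 w2 Dw2 -> bsupp w2 ->
  \int[leb m.+1]_(x in Om) ((w1 x ^+ 2 + w2 x ^+ 2) * (1 + sqn x)^-1) <=
  \int[leb m.+1]_(x in Om) (\sum_i (Dw1 i x ^+ 2 + Dw2 i x ^+ 2)).
Proof.
move=> D1 B1 D2 B2; have mO := @measurable_half_space R m.
have u0 (x : 'rV[R]_m.+1) : 0 < 1 + sqn x by rewrite ltr_pwDl// sqn_ge0.
have uD : C1 (fun x : 'rV[R]_m.+1 => (1 + sqn x)^-1)
   (fun i x => - (1 + sqn x) ^- 2 * (2 * x ord0 i)).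
  have := C1_inv (C1D (C1_cst m.+1 1) (C1_sqn R m.+1)) (fun x => lt0r_neq0 (u0 x)).
  by apply: C1_ext => // i x; rewrite add0r.
have gD := C1M (C1_rho D1 D2) uD.
have lu := C1_lbm uD.
have bd1 i : bsupp (Dw1 i) by exact: C1_bsuppD D1 B1.
have bd2 i : bsupp (Dw2 i) by exact: C1_bsuppD D2 B2.
rewrite -subr_ge0 -IntB; [|exact: mO|lbst|lbst].
apply: (xdiv_ge0 (c := 1) _ _ gD) => [|||x]; [lbm_tac|bsupp_tac|bsupp_tac|].
rewrite xdot_rho.
have -> : xdot (fun i (x : 'rV[R]_m.+1) => - (1 + sqn x) ^- 2 * (2 * x ord0 i)) x =
   - (2 * (1 + sqn x) ^- 2 * sqn x).
  by rewrite /xdot /sqn mulr_sumr -sumrN; apply: eq_bigr => i _; ring.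
set u := (1 + sqn x)^-1; rewrite (_ : (1 + sqn x) ^- 2 = u ^+ 2); last by rewrite exprVn.
have H1 := sqn_complete x x Dw1 u (w1 x); have H2 := sqn_complete x x Dw2 u (w2 x).
rewrite -!/(xdot _ x) in H1 H2.
rewrite big_split/=.
have us : u * sqn x <= 1.
  by rewrite /u mulrC ler_pdivrMr// mul1r lerDr.
have ug : 0 <= u * (w1 x ^+ 2 + w2 x ^+ 2).
  by apply: mulr_ge0; [rewrite /u invr_ge0 ltW|rewrite addr_ge0 ?sqr_ge0].
have N4 : (4 : R) <= m.+1%:R by rewrite ler_nat.
have H3 : u * (w1 x ^+ 2 + w2 x ^+ 2) * (u * sqn x) <= u * (w1 x ^+ 2 + w2 x ^+ 2) * 1.
  by rewrite ler_wpM2l.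
have H4 : 4 * (u * (w1 x ^+ 2 + w2 x ^+ 2)) <= m.+1%:R * (u * (w1 x ^+ 2 + w2 x ^+ 2)).
  by rewrite ler_wpM2r.
move: H1 H2 H3 H4; set s1 := \sum_i _; set s2 := \sum_i _ ; lra.
Qed.

(** Half of the divergence of [x |w|^2 / r] is added and the square of [grad w + w x / r^2]
    completed; the remainder is [(N - 3 |x|^2 / r^2) |w|^2 / (2 r)]. This integral is the part of
    the virial identity proportional to [mu]. *)
Lemma hardy_rad (d : R) w1 Dw1 w2 Dw2 : 0 < d ->
  C1 w1 Dw1 -> bsupp w1 -> C1 w2 Dw2 -> bsupp w2 ->
  0 <= \int[leb m.+1]_(x in Om) (srad d x * (\sum_i (Dw1 i x ^+ 2 + Dw2 i x ^+ 2)) +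
      (srad d x)^-1 * (w1 x * xdot Dw1 x + w2 x * xdot Dw2 x)).
Proof.
move=> d0 D1 B1 D2 B2; have mO := @measurable_half_space R m.
have r0 (x : 'rV[R]_m.+1) : 0 < srad d x by exact: rad_gt0.
have tD : C1 (fun x : 'rV[R]_m.+1 => (srad d x)^-1)
   (fun i x => - (srad d x) ^- 2 * (x ord0 i / srad d x)).
  exact: (C1_inv (C1_rad _ d0) (fun x => lt0r_neq0 (r0 x))).
have gD := C1M (C1_rho D1 D2) tD.
have lt := C1_lbm tD; have lr := C1_lbm (C1_rad m.+1 d0).
have bd1 i : bsupp (Dw1 i) by exact: C1_bsuppD D1 B1.
have bd2 i : bsupp (Dw2 i) by exact: C1_bsuppD D2 B2.
have lx1 := lbm_xdot D1; have lx2 := lbm_xdot D2.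
apply: (xdiv_ge0 (c := 2^-1) _ _ gD) => [|||x]; [lbm_tac|bsupp_tac|bsupp_tac|].
rewrite xdot_rho.
set t := (srad d x)^-1; set r := srad d x.
have -> : xdot (fun i (x : 'rV[R]_m.+1) => - (srad d x) ^- 2 * (x ord0 i / srad d x)) x =
   - (t ^+ 3 * sqn x).
  rewrite /xdot /sqn mulr_sumr -sumrN; apply: eq_bigr => i _.
  by rewrite -exprVn -/t; ring.
have H1 := sqn_complete x x Dw1 (t ^+ 2) (w1 x); have H2 := sqn_complete x x Dw2 (t ^+ 2) (w2 x).
rewrite -!/(xdot _ x) in H1 H2.
rewrite big_split/=.
have rt : r * t = 1 by rewrite /r /t mulfV// gt_eqF.
have t0 : 0 < t by rewrite invr_gt0.
have us : t ^+ 2 * sqn x <= 1.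
  rewrite exprVn mulrC ler_pdivrMr ?exprn_gt0// mul1r rad_sqr lerDl sqr_ge0 //.
have ug : 0 <= t * (w1 x ^+ 2 + w2 x ^+ 2).
  by apply: mulr_ge0; [rewrite ltW|rewrite addr_ge0 ?sqr_ge0].
have N4 : (3 : R) <= m.+1%:R by rewrite ler_nat (leq_trans m3).
have H3 : t * (w1 x ^+ 2 + w2 x ^+ 2) * (t ^+ 2 * sqn x) <= t * (w1 x ^+ 2 + w2 x ^+ 2) * 1.
  by rewrite ler_wpM2l.
have H4 : 3 * (t * (w1 x ^+ 2 + w2 x ^+ 2)) <= m.+1%:R * (t * (w1 x ^+ 2 + w2 x ^+ 2)).
  by rewrite ler_wpM2r.
have H5 := mulr_ge0 (ltW (r0 x)) (addr_ge0 H1 H2).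
move: H5; rewrite -/r; set s1 := \sum_i _; set s2 := \sum_i _.
have -> : r * (s1 + 2 * t ^+ 2 * w1 x * xdot Dw1 x + (t ^+ 2) ^+ 2 * sqn x * w1 x ^+ 2 +
   (s2 + 2 * t ^+ 2 * w2 x * xdot Dw2 x + (t ^+ 2) ^+ 2 * sqn x * w2 x ^+ 2)) =
  r * (s1 + s2) + 2 * (r * t) * t * (w1 x * xdot Dw1 x + w2 x * xdot Dw2 x) +
  (r * t) * (t * (w1 x ^+ 2 + w2 x ^+ 2) * (t ^+ 2 * sqn x)) by ring.
rewrite rt; move: H3 H4; lra.
Qed.

End hardy.

(** * The virial inequality *)

Section key.
Variables (R : realType) (m : nat).
Local Notation leb := (lebesgue_rV R).
Local Notation Om := (half_space R m).
Local Notation il i := (lift ord_max i).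
Local Notation N := (m.+1%:R).
Variables be1 be2 : 'rV[R]_m -> R.
Hypotheses (lbe1 : lbm be1) (lbe2 : lbm be2).

(** Real part of the weak eigenvalue equation for [f + i g] against a real [v], where [be1 + i be2]
    is the Robin coefficient and [l1 + i l2] the eigenvalue. The imaginary part is the same
    expression at [(g, - f)]. *)
Definition rform (l1 l2 : R) (f : 'rV[R]_m.+1 -> R) (Df : 'I_m.+1 -> 'rV[R]_m.+1 -> R)
    (g v : 'rV[R]_m.+1 -> R) (Dv : 'I_m.+1 -> 'rV[R]_m.+1 -> R) : R :=
  \int[leb m.+1]_(x in Om) (\sum_i Df i x * Dv i x) +
  \int[leb m]_x ((be1 x * f (snoc (x, 0)) - be2 x * g (snoc (x, 0))) * v (snoc (x, 0))) -
  \int[leb m.+1]_(x in Om) ((l1 * f x - l2 * g x) * v x).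

(** What [rform] becomes for the test function [2 x . grad a + N a]: formally [int grad a . grad (2
    x . grad a + N a) = 2 int |grad a|^2], which leaves no second derivative. *)
Definition virial (l1 l2 : R) (a : 'rV[R]_m.+1 -> R) Da (b : 'rV[R]_m.+1 -> R) : R :=
  \int[leb m.+1]_(x in Om) (2 * (\sum_i Da i x ^+ 2) -
    (l1 * a x - l2 * b x) * (2 * xdot Da x + N * a x)) +
  \int[leb m]_x ((be1 x * a (snoc (x, 0)) - be2 x * b (snoc (x, 0))) *
       (2 * xdot Da (snoc (x, 0)) + N * a (snoc (x, 0)))).

Variables (k mu d : R).
Hypotheses (mu0 : 0 <= mu) (d0 : 0 < d).

(** Real part of [- u + mu r u - 2 i k r u] for [u = a + i b]; the imaginary part is the same
    formula at [(b, - a)]. *)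
Definition etaf (a b : 'rV[R]_m.+1 -> R) (x : 'rV[R]_m.+1) : R :=
  - a x + mu * (srad d x * a x) + 2 * k * (srad d x * b x).
Definition Deta (a b : 'rV[R]_m.+1 -> R) (Da Db : 'I_m.+1 -> 'rV[R]_m.+1 -> R) i
    (x : 'rV[R]_m.+1) : R :=
  - Da i x + mu * (x ord0 i / srad d x * a x + srad d x * Da i x) +
  2 * k * (x ord0 i / srad d x * b x + srad d x * Db i x).

Lemma C1_eta a Da b Db : C1 a Da -> C1 b Db -> C1 (etaf a b) (Deta a b Da Db).
Proof.
move=> aD bD; have rD := C1_rad m.+1 d0.
have := C1D (C1D (C1N aD) (C1Z mu (C1M rD aD))) (C1Z (2 * k) (C1M rD bD)).
by apply: C1_ext => // i x; rewrite /Deta; ring.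
Qed.

Lemma bsupp_eta a b : bsupp a -> bsupp b -> bsupp (etaf a b).
Proof. by move=> ba bb; rewrite /etaf; bsupp_tac. Qed.

Variables (ga1 : 'I_m -> 'rV[R]_m -> R) (c0 K : R).
Hypothesis lga1 : forall i, lbm (ga1 i).
Hypothesis w1 : forall i, wder i be1 (ga1 i).
Hypothesis be1_ge0 : forall x, 0 <= be1 x.
Hypothesis ga1_le0 : forall x, xdot ga1 x <= 0.
Hypothesis be2K : forall x, `|be2 x| <= K.
Hypothesis m3 : (3 <= m)%N.
Hypothesis c01 : 0 <= c0 <= 1.
Hypothesis rot : forall w1 Dw1 w2 Dw2,
  C1 w1 Dw1 -> bsupp w1 -> C1 w2 Dw2 -> bsupp w2 ->
  \int[leb m]_x (2 * be2 x * \sum_i (x ord0 i *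
    (w1 (snoc (x, 0)) * Dw2 (il i) (snoc (x, 0)) -
     w2 (snoc (x, 0)) * Dw1 (il i) (snoc (x, 0))))) <=
  c0 * \int[leb m.+1]_(x in Om) (\sum_i (Dw1 i x ^+ 2 + Dw2 i x ^+ 2)).
Let l1 := k ^+ 2.
Let l2 := mu * k.

(** The bracket is the divergence of [x r]. Moved onto [be1] it leaves [- int (x . ga1) r], whose
    sign is the radial monotonicity. *)
Lemma radial_weight_ge0 r Dr : C1 r Dr -> bsupp r -> (forall x, 0 <= r x) ->
  0 <= \int[leb m]_x (be1 x * (xdot Dr x + m%:R * r x)).
Proof.
move=> rD br r0; have lr := C1_lbm rD.
have lD i : lbm (Dr i) by exact: C1_lbmD rD.
have bD i : bsupp (Dr i) by exact: C1_bsuppD rD br.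
have E i : \int[leb m]_x (be1 x * (x ord0 i * Dr i x + r x * (i == i)%:R)) =
    - \int[leb m]_x (ga1 i x * (x ord0 i * r x)).
  have br' : bsupp (fun x => x ord0 i * r x) by bsupp_tac.
  exact: (w1 i (C1M (C1_coord R i) rD) br').
have -> : \int[leb m]_x (be1 x * (xdot Dr x + m%:R * r x)) =
    \sum_i - \int[leb m]_x (ga1 i x * (x ord0 i * r x)).
  under eq_bigr => i _ do rewrite -E.
  rewrite -Int_sum; [|exact: measurableT|by move=> i; lbst].
  apply: eq_Rintegral => x _; rewrite -mulr_sumr big_split/=; congr (_ * (_ + _)).
  by under eq_bigr do rewrite eqxx mulr1; rewrite sumr_const card_ord mulr_natl.
rewrite sumrN -Int_sum; [|exact: measurableT|by move=> i; lbst].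
rewrite -IntN; [|exact: measurableT|by apply: lbs_sum => i; lbst].
apply: Rintegral_ge0 => x _.
have -> : \sum_i (ga1 i x * (x ord0 i * r x)) = xdot ga1 x * r x.
  by rewrite mulr_suml; apply: eq_bigr => i _; ring.
by rewrite -mulNr mulr_ge0// oppr_ge0.
Qed.

(** Up to a divergence the interior density is [|grad w|^2 + mu L + P], with [L] the integrand of
    [hardy_rad] and [P >= 0] the effect of [|x|^2 = r^2 - d^2]. On the boundary there remain the
    radial term [V], the nonnegative [M1], the rotation term [T], absorbed up to the factor [c0],
    and [er], which is of order [d]. [hardy] for [w] concludes, as [|w| = |u|]. *)
Lemma virial_ge a Da b Db : C1 a Da -> bsupp a -> C1 b Db -> bsupp b ->
  (1 - c0) * \int[leb m.+1]_(x in Om) ((a x ^+ 2 + b x ^+ 2) * (1 + sqn x)^-1) <=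
  virial l1 l2 a Da b + virial l1 l2 b Db (fun x => - a x) +
  (rform l1 l2 a Da b (etaf a b) (Deta a b Da Db) +
   rform l1 l2 b Db (fun x => - a x) (etaf b (fun x => - a x))
     (Deta b (fun x => - a x) Db (fun i x => - Da i x))) +
  2 * `|k| * K * d * \int[leb m]_x (a (snoc (x, 0)) ^+ 2 + b (snoc (x, 0)) ^+ 2).
Proof.
move=> aD ba bD bb; have mO := @measurable_half_space R m.
have rD := C1_rad m.+1 d0.
have r0 (x : 'rV[R]_m.+1) : 0 < srad d x by exact: rad_gt0.
have lr := C1_lbm rD.
have lt : lbm (fun x : 'rV[R]_m.+1 => (srad d x)^-1).
  exact: (C1_lbm (C1_inv rD (fun x => lt0r_neq0 (r0 x)))).
have la := C1_lbm aD; have lb := C1_lbm bD.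
have lDa i : lbm (Da i) by exact: C1_lbmD aD.
have lDb i : lbm (Db i) by exact: C1_lbmD bD.
have bDa i : bsupp (Da i) by exact: C1_bsuppD aD ba.
have bDb i : bsupp (Db i) by exact: C1_bsuppD bD bb.
have lXa := lbm_xdot aD; have lXb := lbm_xdot bD.
have bXa := bsupp_xdot aD ba; have bXb := bsupp_xdot bD bb.
pose c (x : 'rV[R]_m.+1) := cos (k * srad d x); pose s (x : 'rV[R]_m.+1) := sin (k * srad d x).
have cs x : c x ^+ 2 + s x ^+ 2 = 1 by rewrite /c /s cos2Dsin2.
have cD : C1 c (fun i x => - s x * (k * (x ord0 i / srad d x))) by exact: (C1_cos (C1Z k rD)).
have sD : C1 s (fun i x => c x * (k * (x ord0 i / srad d x))) by exact: (C1_sin (C1Z k rD)).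
(* [u1 + i u2 = exp (- i k r) (a + i b)]. *)
pose u1 x := a x * c x + b x * s x; pose u2 x := b x * c x - a x * s x.
pose Du1 i x := c x * Da i x + s x * Db i x + k * (x ord0 i / srad d x) * u2 x.
pose Du2 i x := c x * Db i x - s x * Da i x - k * (x ord0 i / srad d x) * u1 x.
have D1 : C1 u1 Du1.
  have := C1D (C1M aD cD) (C1M bD sD).
  by apply: C1_ext => // i x; rewrite /Du1 /u2; ring.
have D2 : C1 u2 Du2.
  have := C1B (C1M bD cD) (C1M aD sD).
  by apply: C1_ext => // i x; rewrite /Du2 /u1; ring.
have B1 : bsupp u1 by rewrite /u1; bsupp_tac.
have B2 : bsupp u2 by rewrite /u2; bsupp_tac.
have rho x : u1 x ^+ 2 + u2 x ^+ 2 = a x ^+ 2 + b x ^+ 2.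
  rewrite -[RHS]mul1r -{1}(cs x) /u1 /u2; ring.
pose SW x := \sum_i (Du1 i x ^+ 2 + Du2 i x ^+ 2).
pose S x := \sum_i (Da i x ^+ 2 + Db i x ^+ 2).
have bu1 i : bsupp (Du1 i) by exact: C1_bsuppD D1 B1.
have bu2 i : bsupp (Du2 i) by exact: C1_bsuppD D2 B2.
have lu1 i : lbm (Du1 i) by exact: C1_lbmD D1.
have lu2 i : lbm (Du2 i) by exact: C1_lbmD D2.
have lSW : lbm SW by rewrite /SW; lbm_tac.
have bSW : bsupp SW by rewrite /SW; bsupp_tac.
have lX1 := lbm_xdot D1; have lX2 := lbm_xdot D2.
have bX1 := bsupp_xdot D1 B1; have bX2 := bsupp_xdot D2 B2.
have lu := C1_lbm D1; have lv := C1_lbm D2.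
have SWE x : SW x = S x + k ^+ 2 * (sqn x * (srad d x)^-1 ^+ 2) * (a x ^+ 2 + b x ^+ 2) +
    2 * k * (srad d x)^-1 * (b x * xdot Da x - a x * xdot Db x).
  rewrite /SW /S /sqn /xdot mulr_suml mulr_sumr mulr_suml.
  rewrite [b x * _]mulr_sumr [a x * _]mulr_sumr -sumrB mulr_sumr -!big_split/=.
  by apply: eq_bigr => i _; rewrite -[RHS]mul1r -{1}(cs x) /Du1 /Du2 /u1 /u2; ring.
have XWE x : u1 x * xdot Du1 x + u2 x * xdot Du2 x = a x * xdot Da x + b x * xdot Db x.
  rewrite /xdot !mulr_sumr -!big_split/=.
  by apply: eq_bigr => i _; rewrite -[RHS]mul1r -{1}(cs x) /Du1 /Du2 /u1 /u2; ring.
have RWE (x : 'rV[R]_m.+1) : \sum_i (x ord0 i * (u1 x * Du2 i x - u2 x * Du1 i x)) =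
    a x * xdot Db x - b x * xdot Da x - k * (sqn x * (srad d x)^-1) * (a x ^+ 2 + b x ^+ 2).
  rewrite /xdot /sqn !mulr_sumr mulr_suml mulr_sumr mulr_suml -!sumrB.
  by apply: eq_bigr => i _; rewrite -[RHS]mul1r -{1}(cs x) /Du1 /Du2 /u1 /u2; ring.
have rho_D := C1_rho aD bD.
have brho : bsupp (fun x => a x ^+ 2 + b x ^+ 2) by bsupp_tac.
have lrho := C1_lbm rho_D.
have lXr := lbm_xdot rho_D; have bXr := bsupp_xdot rho_D brho.
have XrE x : xdot (fun i x => 2 * a x * Da i x + 2 * b x * Db i x) x =
    2 * (a x * xdot Da x + b x * xdot Db x).
  by rewrite /xdot !mulr_sumr -big_split mulr_sumr/=; apply: eq_bigr => i _; ring.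
have H1 := hardy m3 D1 B1 D2 B2.
have H2 := hardy_rad m3 d0 D1 B1 D2 B2.
have H3 := IntO_xdiv rho_D brho.
(* The components are exchanged: [T] enters the identity with a minus sign, so an upper bound for
   the reversed rotation is wanted. *)
have rotA := rot D2 B2 D1 B1.
have radb : 0 <= \int[leb m]_x (be1 x * (2 * (a (snoc (x, 0)) * xdot Da (snoc (x, 0)) +
    b (snoc (x, 0)) * xdot Db (snoc (x, 0))) +
    m%:R * (a (snoc (x, 0)) ^+ 2 + b (snoc (x, 0)) ^+ 2))).
  have := radial_weight_ge0 (C1_slice 0 rho_D) (bsupp_slice 0 brho).
  have P0 x : 0 <= a (snoc (x, 0)) ^+ 2 + b (snoc (x, 0)) ^+ 2 by rewrite addr_ge0 ?sqr_ge0.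
  move=> /(_ P0); congr (0 <= _); apply: eq_Rintegral => x _.
  congr (_ * (_ + _)); rewrite -XrE xdot_bd.
  by [].
have rn0 (x : 'rV[R]_m.+1) : srad d x != 0 by rewrite gt_eqF.
have sqE (x : 'rV[R]_m.+1) : sqn x = srad d x ^+ 2 - d ^+ 2 by rewrite rad_sqr addrK.
pose L x := srad d x * SW x + (srad d x)^-1 * (u1 x * xdot Du1 x + u2 x * xdot Du2 x).
have lL : lbm L by rewrite /L; lbm_tac.
have bL : bsupp L by rewrite /L; bsupp_tac.
pose P x := (1 + mu * srad d x) * (k ^+ 2 * d ^+ 2 * (srad d x)^-1 ^+ 2) * (a x ^+ 2 + b x ^+ 2).
have lP : lbm P by rewrite /P; lbm_tac.
have bP : bsupp P by rewrite /P; bsupp_tac.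
pose rh (x : 'rV[R]_m) := a (snoc (x, 0)) ^+ 2 + b (snoc (x, 0)) ^+ 2.
pose rr (x : 'rV[R]_m) := srad d (snoc (x, 0) : 'rV[R]_m.+1).
have rr0 x : 0 < rr x by exact: r0.
have lrr : lbm rr by rewrite /rr; lbm_tac.
have lti : lbm (fun x => (rr x)^-1) by exact: (lbm_slice 0 lt).
have lrh : lbm rh by rewrite /rh; lbm_tac.
have brh : bsupp rh by rewrite /rh; bsupp_tac.
pose V (x : 'rV[R]_m) := be1 x * (2 * (a (snoc (x, 0)) * xdot Da (snoc (x, 0)) +
    b (snoc (x, 0)) * xdot Db (snoc (x, 0))) + m%:R * rh x).
have lV : lbm V by rewrite /V; lbm_tac.
have bV : bsupp V by rewrite /V; bsupp_tac.
pose T (x : 'rV[R]_m) := 2 * be2 x * \sum_i (x ord0 i *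
    (u2 (snoc (x, 0)) * Du1 (il i) (snoc (x, 0)) -
     u1 (snoc (x, 0)) * Du2 (il i) (snoc (x, 0)))).
have lT : lbm T by rewrite /T; lbm_tac.
have bT : bsupp T.
  rewrite /T; apply: bsuppMr; apply: bsupp_sum => i; apply: bsuppMr; apply: bsuppB; bsupp_tac.
pose er (x : 'rV[R]_m) := 2 * k * (be2 x * (d ^+ 2 * (rr x)^-1 * rh x)).
have ler' : lbm er by rewrite /er; lbm_tac.
have ber : bsupp er by rewrite /er; bsupp_tac.
pose M1 (x : 'rV[R]_m) := mu * (rr x * (be1 x * rh x)).
have lM1 : lbm M1 by rewrite /M1; lbm_tac.
have bM1 : bsupp M1 by rewrite /M1; bsupp_tac.
have e1D := C1_eta aD bD; have e2D := C1_eta bD (C1N aD).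
have le1 := C1_lbm e1D; have le2 := C1_lbm e2D.
have lde1 i : lbm (Deta a b Da Db i) by exact: C1_lbmD e1D.
have lde2 i : lbm (Deta b (fun x => - a x) Db (fun i x => - Da i x) i) by exact: C1_lbmD e2D.
have ZE : virial l1 l2 a Da b + virial l1 l2 b Db (fun x => - a x) +
  (rform l1 l2 a Da b (etaf a b) (Deta a b Da Db) +
   rform l1 l2 b Db (fun x => - a x) (etaf b (fun x => - a x))
     (Deta b (fun x => - a x) Db (fun i x => - Da i x))) =
  \int[leb m.+1]_(x in Om) (SW x + mu * L x + P x -
     l1 * (N * (a x ^+ 2 + b x ^+ 2) + xdot (fun i x => 2 * a x * Da i x + 2 * b x * Db i x) x)) +
  \int[leb m]_x (V x + M1 x - T x - er x).
  have reord (x1 y1 x2 y2 g1 t1 z1 g2 t2 z2 : R) : (x1 + y1) + (x2 + y2) + ((g1 + t1 - z1) + (g2 + t2 - z2)) =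
    (x1 + x2 + g1 - z1 + g2 - z2) + (y1 + y2 + t1 + t2) by ring.
  rewrite /virial /rform reord; congr (_ + _).
    rewrite -(IntD mO); [|lbst|lbst]; rewrite -(IntD mO); [|lbst|lbst].
    rewrite -(IntB mO); [|lbst|lbst]; rewrite -(IntD mO); [|lbst|lbst].
    rewrite -(IntB mO); [|lbst|lbst].
    apply: eq_Rintegral => x _.
    (* The terms [2 k r grad a . grad b] of the two forms cancel; only the gradient of [r] couples
       [a] and [b]. *)
    have GE : \sum_i Da i x * Deta a b Da Db i x +
       \sum_i Db i x * Deta b (fun x => - a x) Db (fun i x => - Da i x) i x =
       - S x + mu * ((srad d x)^-1 * (a x * xdot Da x + b x * xdot Db x) + srad d x * S x) +
       2 * k * (srad d x)^-1 * (b x * xdot Da x - a x * xdot Db x).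
      rewrite /S /xdot !mulr_sumr -!big_split/= -!sumrB -!sumrN !mulr_sumr -!big_split/= mulr_sumr -!big_split/=.
      by apply: eq_bigr => i _; rewrite /Deta; ring.
    have SE : \sum_i Da i x ^+ 2 = S x - \sum_i Db i x ^+ 2 by rewrite /S big_split/= addrK.
    have -> : \sum_i Da i x * Deta a b Da Db i x = - S x + mu * ((srad d x)^-1 * (a x * xdot Da x + b x * xdot Db x) + srad d x * S x) +
       2 * k * (srad d x)^-1 * (b x * xdot Da x - a x * xdot Db x) -
       \sum_i Db i x * Deta b (fun x => - a x) Db (fun i x => - Da i x) i x by rewrite -GE addrK.
    rewrite SE /L /P XWE XrE SWE sqE /etaf /l1 /l2; field; exact: rn0.
  rewrite -!(IntD measurableT); [|lbst ..].
  apply: eq_Rintegral => x _.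
  have TE : T x = - (2 * be2 x * (a (snoc (x, 0)) * xdot Db (snoc (x, 0)) -
       b (snoc (x, 0)) * xdot Da (snoc (x, 0)) -
       k * (sqn (snoc (x, 0) : 'rV[R]_m.+1) * (rr x)^-1) * rh x)).
    rewrite /T -mulrN -RWE; congr (_ * _).
    rewrite (bigD1_ord ord_max)//= snoc_last mul0r add0r -sumrN.
    by apply: eq_bigr => i _; rewrite snoc_lift; ring.
  rewrite TE sqE /V /M1 /er /rr /rh /etaf -natr1; field; exact: rn0.
rewrite ZE.
have lbD : \int[leb m.+1]_(x in Om) SW x <=
  \int[leb m.+1]_(x in Om) (SW x + mu * L x + P x -
     l1 * (N * (a x ^+ 2 + b x ^+ 2) + xdot (fun i x => 2 * a x * Da i x + 2 * b x * Db i x) x)).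
  rewrite (IntB mO); [|lbst|lbst]. rewrite (@IntZ _ _ _ mO l1); [|lbst].
  rewrite H3 mulr0 subr0.
  rewrite (IntD mO); [|lbst|lbst]. rewrite (IntD mO); [|lbst|lbst].
  rewrite -addrA lerDl (@IntZ _ _ _ mO mu); [|lbst].
  rewrite addr_ge0 ?mulr_ge0//.
  apply: Rintegral_ge0 => x _; rewrite /P; apply: mulr_ge0.
    apply: mulr_ge0; first by rewrite addr_ge0// mulr_ge0// ltW.
    by rewrite -!exprMn sqr_ge0.
  by rewrite addr_ge0 ?sqr_ge0.
have bdD : \int[leb m]_x (V x + M1 x - T x - er x) =
    \int[leb m]_x V x + \int[leb m]_x M1 x - \int[leb m]_x T x - \int[leb m]_x er x.
  rewrite (IntB measurableT); [|lbst|lbst]; rewrite (IntB measurableT); [|lbst|lbst].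
  by rewrite (IntD measurableT); [|lbst|lbst].
rewrite bdD.
have M1ge : 0 <= \int[leb m]_x M1 x.
  apply: Rintegral_ge0 => x _; rewrite /M1 mulr_ge0//.
  apply: mulr_ge0; first exact: (ltW (rr0 _)).
  by apply: mulr_ge0; [exact: be1_ge0|rewrite addr_ge0 ?sqr_ge0].
have erle : \int[leb m]_x er x <= 2 * `|k| * K * d * \int[leb m]_x rh x.
  rewrite -[leRHS](IntZ measurableT); [|lbst].
  apply: (Int_le measurableT) => [||x _]; [lbst|lbst|].
  have rh0 : 0 <= rh x by rewrite addr_ge0 ?sqr_ge0.
  have dt : d ^+ 2 * (rr x)^-1 <= d.
    rewrite ler_pdivrMr; last exact: rr0.
    rewrite expr2 ler_pM2l// -(@ler_pXn2r _ 2) ?nnegrE ?(ltW (rr0 _)) ?(ltW d0)//.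
    by rewrite /rr rad_sqr lerDr sqn_ge0.
  rewrite /er; apply: le_trans (ler_norm _) _.
  have D0 : 0 <= d ^+ 2 / rr x by rewrite mulr_ge0 ?sqr_ge0// invr_ge0 (ltW (rr0 _)).
  move: (d ^+ 2 / rr x) dt D0 => D dt D0.
  rewrite !normrM (ger0_norm rh0) (ger0_norm D0) (ger0_norm (ler0n R 2)).
  rewrite -!mulrA; apply: ler_wpM2l => //; apply: ler_wpM2l => //.
  by apply: ler_pM => //; [rewrite mulr_ge0|rewrite ler_wpM2r].
have SWs : \int[leb m.+1]_(x in Om) (\sum_i (Du2 i x ^+ 2 + Du1 i x ^+ 2)) =
    \int[leb m.+1]_(x in Om) SW x.
  by apply: eq_Rintegral => x _; apply: eq_bigr => i _; rewrite addrC.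
rewrite SWs in rotA.
have {}rotA : \int[leb m]_x T x <= c0 * \int[leb m.+1]_(x in Om) SW x by exact: rotA.
have {}radb : 0 <= \int[leb m]_x V x by exact: radb.
have rhoE : \int[leb m.+1]_(x in Om) ((u1 x ^+ 2 + u2 x ^+ 2) * (1 + sqn x)^-1) =
   \int[leb m.+1]_(x in Om) ((a x ^+ 2 + b x ^+ 2) * (1 + sqn x)^-1).
  by apply: eq_Rintegral => x _; rewrite rho.
rewrite rhoE in H1.
have {}H1 : (1 - c0) * \int[leb m.+1]_(x in Om) ((a x ^+ 2 + b x ^+ 2) * (1 + sqn x)^-1) <=
   (1 - c0) * \int[leb m.+1]_(x in Om) SW x.
  by rewrite ler_wpM2l// subr_ge0; case/andP: c01.
have {}erle : \int[leb m]_x er x <= 2 * `|k| * K * d *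
  \int[leb m]_x (a (snoc (x, 0)) ^+ 2 + b (snoc (x, 0)) ^+ 2) by exact: erle.
apply: (le_trans H1); rewrite -subr_ge0.
rewrite -subr_ge0 in lbD; rewrite -subr_ge0 in erle; rewrite -subr_ge0 in rotA.
have := addr_ge0 (addr_ge0 lbD erle) (addr_ge0 rotA (addr_ge0 M1ge radb)).
congr (0 <= _); ring.
Qed.

End key.

(** * Cut-offs and dilations *)

Section cfun.
Variables (R : realType) (m : nat).
Local Notation leb := (lebesgue_rV R).
Local Notation Om := (half_space R m).
Local Notation il i := (lift ord_max i).
Local Notation hd x := (unsnoc x).1.

Record cfun := CFun {
  cf :> 'rV[R]_m.+1 -> R;
  cd : 'I_m.+1 -> 'rV[R]_m.+1 -> R;
  cfD : C1 cf cd;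
  cfb : bsupp cf }.
Implicit Types f g h : cfun.

Lemma lcf f : lbm f. Proof. exact: C1_lbm (cfD f). Qed.

Lemma lcd f i : lbm (cd f i). Proof. exact: C1_lbmD (cfD f). Qed.

Lemma bcd f i : bsupp (cd f i). Proof. exact: C1_bsuppD (cfD f) (cfb f). Qed.

Definition cfunB f g := CFun (C1B (cfD f) (cfD g)) (bsuppB (cfb f) (cfb g)).
Definition cfunN f := CFun (C1N (cfD f)) (bsuppN (cfb f)).
Definition cfunZ (c : R) f := CFun (C1Z c (cfD f)) (bsuppMr (fun=> c) (cfb f)).

Definition en f x := f x ^+ 2 + \sum_i cd f i x ^+ 2.
Definition N2 f := \int[leb m.+1]_(x in Om) en f x.
Definition nn f := Num.sqrt (N2 f).

Lemma en_ge0 f x : 0 <= en f x.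
Proof. by rewrite addr_ge0 ?sqr_ge0//; apply: sumr_ge0 => i _; exact: sqr_ge0. Qed.

Lemma lbm_en f : lbm (en f).
Proof.
have lf := lcf f; have lD := lcd f; rewrite /en; lbm_tac.
Qed.

Lemma bsupp_en f : bsupp (en f).
Proof.
have lf := cfb f; have lD := bcd f; rewrite /en; bsupp_tac.
Qed.

Lemma N2_ge0 f : 0 <= N2 f.
Proof. by apply: Rintegral_ge0 => x _; exact: en_ge0. Qed.

Lemma nn_ge0 f : 0 <= nn f. Proof. exact: sqrtr_ge0. Qed.

Lemma nn_sqr f : nn f ^+ 2 = N2 f. Proof. by rewrite sqr_sqrtr// N2_ge0. Qed.

Lemma sqr_le_en f x : f x ^+ 2 <= en f x.
Proof. by rewrite lerDl; apply: sumr_ge0 => i _; exact: sqr_ge0. Qed.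

Lemma sqrD_le_en f i x : cd f i x ^+ 2 <= en f x.
Proof.
rewrite /en (bigD1 i)//= addrCA lerDl addr_ge0 ?sqr_ge0//.
by apply: sumr_ge0 => j _; exact: sqr_ge0.
Qed.

Lemma Int_CS_sqrt D (u v : 'rV[R]_m.+1 -> R) : measurable D -> lbs u -> lbs v ->
  `|\int[leb m.+1]_(x in D) (u x * v x)| <=
  Num.sqrt (\int[leb m.+1]_(x in D) (u x ^+ 2)) *
  Num.sqrt (\int[leb m.+1]_(x in D) (v x ^+ 2)).
Proof.
move=> mD [lu bu] [lv bv].
have P0 (w : 'rV[R]_m.+1 -> R) : 0 <= \int[leb m.+1]_(x in D) (w x ^+ 2).
  by apply: Rintegral_ge0 => x _; exact: sqr_ge0.
rewrite -(@ler_pXn2r _ 2) ?nnegrE ?mulr_ge0 ?sqrtr_ge0//.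
by rewrite exprMn !sqr_sqrtr// real_normK ?num_real//; exact: Int_CS.
Qed.

Lemma sqrt_Int_le (u : 'rV[R]_m.+1 -> R) f A : 0 <= A -> lbs u ->
  (forall x, u x ^+ 2 <= A ^+ 2 * en f x) ->
  Num.sqrt (\int[leb m.+1]_(x in Om) (u x ^+ 2)) <= A * nn f.
Proof.
move=> A0 [lu bu] H; have mO := @measurable_half_space R m.
rewrite -[leRHS]ger0_norm ?mulr_ge0 ?nn_ge0// -sqrtr_sqr ler_wsqrtr//.
rewrite exprMn nn_sqr -(IntZ mO); last by split; [exact: lbm_en|exact: bsupp_en].
have le := lbm_en f; have be := bsupp_en f.
by apply: (Int_le mO) => [||x _]; [lbst|lbst|exact: H].
Qed.

(** Cauchy-Schwarz; dilation by [s >= 1/2] multiplies the squared L^2 norm by at most [2^N]. The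
    constant is crude, but it does not depend on [s]. *)
Lemma bil_bd (u w : 'rV[R]_m.+1 -> R) f g (A B s : R) : 0 <= A -> 0 <= B -> 2^-1 <= s ->
  lbs u -> lbs w -> (forall x, u x ^+ 2 <= A ^+ 2 * en f x) ->
  (forall x, w x ^+ 2 <= B ^+ 2 * en g x) ->
  `|\int[leb m.+1]_(x in Om) (u x * w (s *: x))| <= A * B * 2 ^+ m.+1 * (nn f * nn g).
Proof.
move=> A0 B0 s2 lu lw Hu Hw; have mO := @measurable_half_space R m.
have s0 : 0 < s by apply: lt_le_trans s2; rewrite invr_gt0.
have [lw1 lw2] := lw.
have lws : lbs (fun x => w (s *: x)).
  split; last exact: bsupp_scale.
  rewrite (_ : (fun x => _) = fun x => w (s *: x + 0)); first exact: lbm_affine.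
  by apply/funext => x; rewrite addr0.
apply: (le_trans (Int_CS_sqrt mO lu lws)).
have -> : A * B * 2 ^+ m.+1 * (nn f * nn g) = (A * nn f) * (2 ^+ m.+1 * (B * nn g)) by ring.
apply: ler_pM; rewrite ?sqrtr_ge0//; first exact: sqrt_Int_le.
rewrite (@IntO_scale _ _ s (fun x => w x ^+ 2))//; last first.
  by apply: lbm_measurable; exact: lbmX.
rewrite sqrtrM; last by rewrite exprn_ge0// invr_ge0 ltW.
apply: ler_pM; rewrite ?sqrtr_ge0//; last exact: sqrt_Int_le.
have i2 : s^-1 <= 2 by rewrite invf_ple// posrE.
apply: (@le_trans _ _ (Num.sqrt (2 ^+ m.+1))).
  by rewrite ler_wsqrtr// lerXn2r// nnegrE// invr_ge0 ltW.
have h1 : 1 <= (2 : R) ^+ m.+1 by rewrite exprn_ege1// ler1n.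
rewrite -{2}(@sqr_sqrtr _ (2 ^+ m.+1)) ?exprn_ge0// expr2 ler_peMr ?sqrtr_ge0//.
by rewrite -[leLHS]sqrtr1 ler_wsqrtr.
Qed.

(** Bounded bilinear forms, with additivity stated for differences because [ubil_diff] is what turns
    the bound [C] into a modulus of continuity along Cauchy sequences. *)
Definition ubil (C : R) (T : cfun -> cfun -> R) :=
  [/\ forall f g, `|T f g| <= C * (nn f * nn g),
      forall f h g, T (cfunB f h) g = T f g - T h g &
      forall f g h, T f (cfunB g h) = T f g - T f h].

Lemma ubil_diff C T f f' g g' : 0 <= C -> ubil C T ->
  `|T f g - T f' g'| <= C * (nn (cfunB f f') * nn g + nn f' * nn (cfunB g g')).
Proof.
move=> C0 [b l r]; have -> : T f g - T f' g' = T (cfunB f f') g + T f' (cfunB g g').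
  by rewrite l r; ring.
by rewrite (le_trans (ler_normD _ _))// mulrDr lerD.
Qed.

(** If [P t] is a form evaluated at a test function dilated by [t], this is the form at the dilation
    quotient. Its limit at [s = 1] is [2 P' 1 + N P 1], matching the multiplier [2 x . grad + N]. *)
Definition dq (P : R -> R) (s : R) := (P s - s^-1 ^+ m.+1 * P s^-1) / (s - 1).

Lemma bernoulli (t : R) n : 0 <= t <= 1 -> 1 - t ^+ n <= n%:R * (1 - t).
Proof.
move=> /andP[t0 t1]; elim: n => [|n IH]; first by rewrite expr0 subrr mul0r.
rewrite exprS -natr1 mulrDl mul1r.
have : t * (1 - t ^+ n) <= 1 * (n%:R * (1 - t)).
  apply: ler_pM => //; rewrite subr_ge0; exact: exprn_ile1.
lra.
Qed.

(** The difference [P s - P s^-1] is treated by the mean value theorem and [s - 1/s <= 2 (s - 1)];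
    the rest, [(1 - s^-N) P s^-1], by Bernoulli's inequality, which gives [1 - s^-N <= N (s - 1)].
    Hence a bound uniform in [s]. *)
Lemma dq_bound (P P' : R -> R) (C s : R) : 1 < s <= 2 ->
  (forall t : R, 0 < t -> is_derive t 1 P (P' t)) ->
  (forall t : R, 2^-1 <= t <= 2 -> `|P t| <= C) ->
  (forall t : R, 2^-1 <= t <= 2 -> `|P' t| <= C) ->
  `|dq P s| <= (2 + m.+1%:R) * C.
Proof.
move=> /andP[s1 s2] HD H0 H1.
have s0 : 0 < s by apply: lt_trans s1.
have is1 : s^-1 < 1 by rewrite invf_lt1.
have is2 : 2^-1 <= s^-1 by rewrite lef_pV2// posrE.
have iss : s^-1 < s by apply: lt_trans s1.
have is0 : 0 < s^-1 by rewrite invr_gt0.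
have [] := @MVT _ P P' s^-1 s iss.
- move=> x; rewrite in_itv/= => /andP[x1 _]; apply: HD; exact: lt_trans x1.
- apply: derivable_within_continuous => x; rewrite in_itv/= => /andP[x1 _].
  by have [] := HD x (lt_le_trans is0 x1).
move=> c; rewrite in_itv/= => /andP[c1 c2] E.
have sm : 0 < s - 1 by rewrite subr_gt0.
rewrite /dq normrM normfV (gtr0_norm sm) ler_pdivrMr//.
have -> : P s - s^-1 ^+ m.+1 * P s^-1 = (P s - P s^-1) + (1 - s^-1 ^+ m.+1) * P s^-1 by ring.
apply: (le_trans (ler_normD _ _)).
have -> : (2 + m.+1%:R) * C * (s - 1) = C * (2 * (s - 1)) + (m.+1%:R * (s - 1)) * C by ring.
have ssE : s - s^-1 <= 2 * (s - 1).
  have : (s - 1) * s^-1 * (s - 1) >= 0 by rewrite mulr_ge0 ?mulr_ge0 ?ltW.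
  have -> : (s - 1) * s^-1 * (s - 1) = s - 2 + s^-1 by field; rewrite gt_eqF.
  lra.
apply: lerD.
  rewrite E normrM (gtr0_norm (_ : 0 < s - s^-1)) ?subr_gt0//.
  apply: ler_pM => //; first by rewrite subr_ge0 ltW.
  by apply: H1; rewrite (le_trans is2 (ltW c1)) (le_trans (ltW c2)).
have t01 : 0 <= s^-1 <= 1 by rewrite !ltW.
rewrite normrM ger0_norm; last by rewrite subr_ge0 exprn_ile1 ?ltW.
apply: ler_pM; rewrite ?subr_ge0 ?exprn_ile1 ?(ltW is0) ?(ltW is1)//; last first.
  by apply: H0; rewrite is2 (le_trans (ltW is1))// ler1n.
apply: le_trans (bernoulli m.+1 t01) _; rewrite ler_wpM2l//.
have : 0 <= (s - 1) * (1 - s^-1) by rewrite mulr_ge0 ?subr_ge0 ?ltW.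
have -> : (s - 1) * (1 - s^-1) = (s - 1) - (1 - s^-1) by field; rewrite gt_eqF.
by rewrite subr_ge0.
Qed.

Lemma dq_ubil (P P' : cfun -> cfun -> R -> R) (C s : R) : 1 < s <= 2 ->
  (forall f g (t : R), 0 < t -> is_derive t 1 (P f g) (P' f g t)) ->
  (forall f g (t : R), 2^-1 <= t <= 2 -> `|P f g t| <= C * (nn f * nn g)) ->
  (forall f g (t : R), 2^-1 <= t <= 2 -> `|P' f g t| <= C * (nn f * nn g)) ->
  (forall f h g (t : R), 0 < t -> P (cfunB f h) g t = P f g t - P h g t) ->
  (forall f g h (t : R), 0 < t -> P f (cfunB g h) t = P f g t - P f h t) ->
  ubil ((2 + m.+1%:R) * C) (fun f g => dq (P f g) s).
Proof.
move=> s12 HD H0 H1 Hl Hr; have s0 : 0 < s by case/andP: s12 => /(lt_trans ltr01).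
have is0 : 0 < s^-1 by rewrite invr_gt0.
split => [f g|f h g|f g h].
- rewrite -mulrA; apply: (dq_bound s12 (HD f g)) => t ht; [exact: H0|exact: H1].
- by rewrite /dq !Hl//; ring.
- by rewrite /dq !Hr//; ring.
Qed.

End cfun.

Ltac lbm_tac ::= first
 [ assumption
 | exact: lcf | exact: lcd
 | lazymatch goal with
   | |- lbm (fun x => _ + _) => apply: lbmD
   | |- lbm (fun x => _ * _) => apply: lbmM
   | |- lbm (fun x => - _) => apply: lbmN
   | |- lbm (fun x => _ ^+ _) => apply: lbmX
   | |- lbm (fun x => `|_|) => apply: lbm_norm
   | |- lbm (fun x => \sum_(_ <- _ | _) _) => apply: lbm_sum => ?
   | |- lbm (fun x => fun_of_matrix x _ _) => exact: lbm_coord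
   end; lbm_tac
 | exact: lbm_cst
 | lazymatch goal with |- lbm ?f =>
     lazymatch f with
     | context [snoc] => solve [apply: lbm_slice; lbm_tac]
     | context [unsnoc] => solve [apply: lbm_hd; lbm_tac]
     end
   end
 | eapply C1_lbm; eassumption
 | eapply C1_lbmD; eassumption
 | solve [eauto] ].

Ltac bsupp_tac ::= first
 [ assumption
 | exact: cfb | exact: bcd
 | lazymatch goal with
   | |- bsupp (fun _ => ?c) => fail 1
   | |- bsupp (fun x => _ + _) => apply: bsuppD; bsupp_tac
   | |- bsupp (fun x => _ * _) =>
       first [solve [apply: bsuppMl; bsupp_tac] | solve [apply: bsuppMr; bsupp_tac]]
   | |- bsupp (fun x => - _) => apply: bsuppN; bsupp_tac
   | |- bsupp (fun x => _ ^+ _) => apply: bsuppX => //; bsupp_tac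
   | |- bsupp (fun x => `|_|) => apply: bsupp_norm; bsupp_tac
   | |- bsupp (fun x => \sum_(_ <- _ | _) _) => apply: bsupp_sum => ?; bsupp_tac
   end
 | lazymatch goal with |- bsupp ?f =>
     lazymatch f with
     | context [snoc] => solve [apply: bsupp_slice; bsupp_tac]
     end
   end
 | eapply C1_bsuppD; [eassumption | assumption]
 | solve [eauto] ].

Section cutoff.
Variables (R : realType) (m : nat).
Local Notation leb := (lebesgue_rV R).
Local Notation Om := (half_space R m).
Local Notation il i := (lift ord_max i).
Local Notation hd x := (unsnoc x).1.
Local Notation N := (m.+1%:R).
Local Notation cfun := (cfun R m).
Variable e : R.
Hypothesis e0 : 0 < e.
Implicit Types f g h V : cfun.

(** Decay like [|x|^-2] is enough: [(1 + |x|^2) chi] is bounded by [1 / e]. The gradient is a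
    multiple of [x], which keeps the commutator radial. *)
Definition chi (x : 'rV[R]_m.+1) := (1 + e * sqn x)^-1.
Definition Dchi (i : 'I_m.+1) (x : 'rV[R]_m.+1) := - (2 * e * chi x ^+ 2 * x ord0 i).

Lemma chi_den_gt0 (x : 'rV[R]_m.+1) : 0 < 1 + e * sqn x.
Proof. by rewrite ltr_pwDl// mulr_ge0 ?sqn_ge0// ltW. Qed.

Lemma chi_gt0 x : 0 < chi x.
Proof. by rewrite invr_gt0 chi_den_gt0. Qed.

Lemma chi_le1 x : chi x <= 1.
Proof.
by rewrite invf_le1 ?chi_den_gt0// lerDl mulr_ge0 ?sqn_ge0// ltW.
Qed.

Lemma chi_sqn x : e * sqn x * chi x <= 1.
Proof. by rewrite ler_pdivrMr ?chi_den_gt0// mul1r lerDr. Qed.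

Lemma C1_chi : C1 chi Dchi.
Proof.
have := C1_inv (C1D (C1_cst m.+1 1) (C1Z e (C1_sqn R m.+1))) (fun x => lt0r_neq0 (chi_den_gt0 x)).
by apply: C1_ext => // i x; rewrite add0r /Dchi /chi exprVn; ring.
Qed.

Definition cutf f := CFun (C1M C1_chi (cfD f)) (bsuppMr chi (cfb f)).

(* [2 grad chi . grad f + f Laplacian chi]; the normal derivative of [chi] vanishes on the
   boundary, so cutting off creates no boundary term. *)
Definition hcut f x :=
  - (2 * e * chi x ^+ 2 * (2 * xdot (cd f) x + (N - 4 * e * sqn x * chi x) * f x)).

Lemma lbm_hcut f : lbm (hcut f).
Proof.
have lx := lbm_xdot (cfD f); have lc := C1_lbm C1_chi; have ls := C1_lbm (C1_sqn R m.+1).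
by rewrite /hcut; lbm_tac.
Qed.

Lemma bsupp_hcut f : bsupp (hcut f).
Proof.
have bx := bsupp_xdot (cfD f) (cfb f).
by rewrite /hcut; bsupp_tac.
Qed.

Lemma cd_cut f i x : cd (cutf f) i x = chi x * cd f i x - 2 * e * chi x ^+ 2 * x ord0 i * f x.
Proof. by rewrite /= /Dchi; ring. Qed.

Lemma xdot_cut f x : xdot (cd (cutf f)) x = chi x * xdot (cd f) x - 2 * e * sqn x * chi x ^+ 2 * f x.
Proof.
have -> : 2 * e * sqn x * chi x ^+ 2 * f x = \sum_i 2 * e * x ord0 i ^+ 2 * chi x ^+ 2 * f x.
  by rewrite /sqn mulr_sumr !mulr_suml.
rewrite /xdot mulr_sumr -sumrB.
by apply: eq_bigr => i _; rewrite cd_cut; ring.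
Qed.

(** The cut-off moves from the test function to the solution. The two gradient integrals differ by
    the commutator and by the divergence of [f V grad chi]; this field is [x G], so [IntO_xdiv]
    removes it. *)
Lemma rform_cut be1 be2 (l1 l2 : R) f (g : cfun) V :
  rform be1 be2 l1 l2 f (cd f) g (cutf V) (cd (cutf V)) =
  rform be1 be2 l1 l2 (cutf f) (cd (cutf f)) (cutf g) V (cd V) +
  \int[leb m.+1]_(x in Om) (hcut f x * V x).
Proof.
have mO := @measurable_half_space R m.
have lc := C1_lbm C1_chi; have lh := lbm_hcut f.
pose G : cfun := CFun (C1Z (- 2 * e) (C1M (C1M C1_chi C1_chi) (C1M (cfD f) (cfD V))))
  (bsuppMr (fun=> - 2 * e) (bsuppMr (fun x => chi x * chi x) (bsuppMl V (cfb f)))).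
have H := IntO_xdiv (cfD G) (cfb G).
have lx := lbm_xdot (cfD G); have bx := bsupp_xdot (cfD G) (cfb G).
rewrite /rform.
have -> : \int[leb m]_x ((be1 x * f (snoc (x, 0)) - be2 x * g (snoc (x, 0))) * cutf V (snoc (x, 0))) =
  \int[leb m]_x ((be1 x * cutf f (snoc (x, 0)) - be2 x * cutf g (snoc (x, 0))) * V (snoc (x, 0))).
  by apply: eq_Rintegral => x _ /=; ring.
have -> : \int[leb m.+1]_(x in Om) ((l1 * f x - l2 * g x) * cutf V x) =
  \int[leb m.+1]_(x in Om) ((l1 * cutf f x - l2 * cutf g x) * V x).
  by apply: eq_Rintegral => x _ /=; ring.
suff -> : \int[leb m.+1]_(x in Om) (\sum_i cd f i x * cd (cutf V) i x) =
  \int[leb m.+1]_(x in Om) (\sum_i cd (cutf f) i x * cd V i x) +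
  \int[leb m.+1]_(x in Om) (hcut f x * V x) by ring.
rewrite -[LHS]addr0 -[X in _ + X]H -(IntD mO); [|lbst|lbst].
rewrite -(IntD mO); [|lbst|lbst].
apply: eq_Rintegral => x _.
have -> : xdot (cd G) x = - 2 * e * (chi x ^+ 2 * (f x * xdot (cd V) x + V x * xdot (cd f) x) -
    4 * e * sqn x * chi x ^+ 3 * (f x * V x)).
  rewrite /xdot /sqn !mulr_sumr !mulr_suml -!big_split/= mulr_sumr -sumrB mulr_sumr.
  by apply: eq_bigr => i _; rewrite /= /Dchi; ring.
have -> : \sum_i cd f i x * cd (cutf V) i x =
   chi x * (\sum_i cd f i x * cd V i x) - 2 * e * chi x ^+ 2 * V x * xdot (cd f) x.
  rewrite /xdot !mulr_sumr -sumrB; apply: eq_bigr => i _; rewrite cd_cut; ring.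
have -> : \sum_i cd (cutf f) i x * cd V i x =
   chi x * (\sum_i cd f i x * cd V i x) - 2 * e * chi x ^+ 2 * f x * xdot (cd V) x.
  rewrite /xdot !mulr_sumr -sumrB; apply: eq_bigr => i _; rewrite cd_cut; ring.
have -> : G x = - 2 * e * (chi x * chi x * (f x * V x)) by [].
rewrite /hcut; ring.
Qed.

Hypothesis e1 : e <= 1.

(** A common constant, not a sharp one: its square [16 / e^2] dominates the [2 / e^2 + 8] that
    arises in [cd_cut_le]. *)
Definition Acut := 4 / e.

Lemma Acut_ge4 : 4 <= Acut. Proof. by rewrite ler_pdivlMr// ler_piMr. Qed.

Lemma wchi x : (1 + sqn x) * chi x <= e^-1.
Proof.
rewrite ler_pdivrMr ?chi_den_gt0// mulrDr mulr1 mulKf ?gt_eqF// lerD//.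
by rewrite invf_ge1.
Qed.

(** The weight is reserved for the factor [x] that differentiating a dilation brings down. *)
Lemma cut_le f x : (1 + sqn x) * cutf f x ^+ 2 <= Acut ^+ 2 * en f x.
Proof.
rewrite /= exprMn mulrA; apply: ler_pM; rewrite ?sqr_ge0 ?sqr_le_en//.
  by rewrite mulr_ge0 ?sqr_ge0// addr_ge0 ?sqn_ge0.
apply: (@le_trans _ _ e^-1).
  rewrite expr2 mulrA; apply: le_trans (wchi x).
  by rewrite ler_piMr ?chi_le1// mulr_ge0 ?addr_ge0 ?sqn_ge0 ?ltW ?chi_gt0.
have := Acut_ge4; rewrite /Acut => h4.
have e1' : 1 <= e^-1 by rewrite invf_ge1.
have : e^-1 * 1 <= e^-1 * e^-1 by rewrite ler_wpM2l// invr_ge0 ltW.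
nra.
Qed.

Lemma coord_sqn n (x : 'rV[R]_n) i : x ord0 i ^+ 2 <= sqn x.
Proof.
by rewrite /sqn (bigD1 i)//= lerDl; apply: sumr_ge0 => j _; exact: sqr_ge0.
Qed.

Lemma cd_cut_le f i x : (1 + sqn x) * cd (cutf f) i x ^+ 2 <= Acut ^+ 2 * en f x.
Proof.
have w1 : 1 <= 1 + sqn x by rewrite lerDl sqn_ge0.
have c0 := chi_gt0 x; have c1 := chi_le1 x; have cw := wchi x; have cx := coord_sqn x i.
have E0 := en_ge0 f x.
have e1' : 1 <= e^-1 by rewrite invf_ge1.
have p1 : (1 + sqn x) * (chi x * cd f i x) ^+ 2 <= e^-1 ^+ 2 * en f x.
  rewrite exprMn mulrA; apply: ler_pM; rewrite ?sqr_ge0 ?sqrD_le_en//.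
    by rewrite mulr_ge0 ?sqr_ge0// addr_ge0 ?sqn_ge0.
  apply: (@le_trans _ _ e^-1).
    rewrite expr2 mulrA; apply: le_trans (wchi x).
    by rewrite ler_piMr// mulr_ge0 ?(ltW c0)// (le_trans _ w1).
  by rewrite expr2 ler_peMl// invr_ge0 ltW.
have p2 : (1 + sqn x) * (2 * e * chi x ^+ 2 * x ord0 i * f x) ^+ 2 <= 4 * en f x.
  have -> : (1 + sqn x) * (2 * e * chi x ^+ 2 * x ord0 i * f x) ^+ 2 =
    4 * (((1 + sqn x) * chi x * e) * (x ord0 i ^+ 2 * chi x * e) * (chi x ^+ 2 * f x ^+ 2)) by ring.
  have q1 : (1 + sqn x) * chi x * e <= 1 by rewrite -ler_pdivlMr// mul1r.
  have q2 : x ord0 i ^+ 2 * chi x * e <= 1.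
    apply: le_trans q1; rewrite ler_pM2r// ler_pM2r//.
    by apply: le_trans cx _; rewrite lerDr.
  have q3 : chi x ^+ 2 * f x ^+ 2 <= 1 * en f x.
    by apply: ler_pM; rewrite ?sqr_ge0 ?sqr_le_en// exprn_ile1// ltW.
  have z1 : 0 <= (1 + sqn x) * chi x * e by rewrite !mulr_ge0 ?(ltW c0) ?(ltW e0)// (le_trans _ w1).
  have z2 : 0 <= x ord0 i ^+ 2 * chi x * e by rewrite mulr_ge0 ?(ltW e0)// mulr_ge0 ?sqr_ge0 ?(ltW c0).
  have q4 : ((1 + sqn x) * chi x * e) * (x ord0 i ^+ 2 * chi x * e) * (chi x ^+ 2 * f x ^+ 2) <=
      1 * 1 * (1 * en f x).
    apply: ler_pM => //; [exact: mulr_ge0| |exact: ler_pM].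
    by rewrite mulr_ge0 ?sqr_ge0.
  by rewrite ler_pM2l//; move: q4; rewrite !mul1r.
rewrite cd_cut.
have : (1 + sqn x) * (chi x * cd f i x - 2 * e * chi x ^+ 2 * x ord0 i * f x) ^+ 2 <=
   2 * ((1 + sqn x) * (chi x * cd f i x) ^+ 2) + 2 * ((1 + sqn x) * (2 * e * chi x ^+ 2 * x ord0 i * f x) ^+ 2).
  set u := chi x * _; set v := _ * f x.
  have uv : (u - v) ^+ 2 <= 2 * u ^+ 2 + 2 * v ^+ 2.
    by rewrite -subr_ge0 (_ : _ - _ = (u + v) ^+ 2) ?sqr_ge0//; ring.
  apply: le_trans (_ : (1 + sqn x) * (2 * u ^+ 2 + 2 * v ^+ 2) <= _); last by lra.
  by rewrite ler_wpM2l// (le_trans _ w1).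
move=> h; apply: (le_trans h).
apply: (@le_trans _ _ (2 * (e^-1 ^+ 2 * en f x) + 2 * (4 * en f x))); first by lra.
have -> : Acut ^+ 2 * en f x = 16 * (e^-1 ^+ 2 * en f x) by rewrite /Acut; ring.
have : 1 * en f x <= e^-1 ^+ 2 * en f x by rewrite ler_wpM2r// exprn_ege1.
lra.
Qed.

Lemma xdot_sqr_le f x : xdot (cd f) x ^+ 2 <= sqn x * en f x.
Proof.
apply: le_trans (sum_CS _ _) _; rewrite ler_wpM2l ?sqn_ge0//.
by rewrite /en lerDr sqr_ge0.
Qed.

Lemma hcut_bracket f x :
  (2 * xdot (cd f) x + (N - 4 * e * sqn x * chi x) * f x) ^+ 2 <=
  2 * (N + 4) ^+ 2 * ((1 + sqn x) * en f x).
Proof.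
have h1 := xdot_sqr_le f x; have h2 := sqr_le_en f x.
have h3 := chi_sqn x; have c0 := chi_gt0 x; have s0 := sqn_ge0 x.
have N0 : 1 <= (N : R) by rewrite ler1n.
set t := e * sqn x * chi x in h3.
have t0 : 0 <= t by rewrite !mulr_ge0// ltW.
have -> : 4 * e * sqn x * chi x = 4 * t by rewrite /t; ring.
have h4 : (N - 4 * t) ^+ 2 <= (N + 4) ^+ 2.
  rewrite -ler_sqrt ?sqr_ge0// !sqrtr_sqr (ger0_norm (_ : 0 <= N + 4)); last by lra.
  by rewrite ler_norml; apply/andP; split; lra.
have h5 : ((N - 4 * t) * f x) ^+ 2 <= (N + 4) ^+ 2 * en f x.
  by rewrite exprMn; apply: ler_pM; rewrite ?sqr_ge0.
have h6 : 4 <= ((N : R) + 4) ^+ 2 by nra.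
have h7 : 4 * (sqn x * en f x) <= (N + 4) ^+ 2 * (sqn x * en f x).
  by rewrite ler_wpM2r// mulr_ge0// en_ge0.
have := sqr_ge0 (2 * xdot (cd f) x - (N - 4 * t) * f x).
rewrite !sqrrD sqrrN !exprMn; move: h5; rewrite exprMn; lra.
Qed.

(** The prefactor [e chi^2] compensates both the weight and the growth of the bracket, since
    [e (1 + |x|^2) chi <= 1]. Therefore the constant is independent of [e]. *)
Lemma hcut_le f x : (1 + sqn x) * hcut f x ^+ 2 <= (3 * (N + 4)) ^+ 2 * en f x.
Proof.
have h := hcut_bracket f x.
have w1 : 1 <= 1 + sqn x by rewrite lerDl sqn_ge0.
have c0 := chi_gt0 x; have cw := wchi x; have E0 := en_ge0 f x.
have q1 : (1 + sqn x) * chi x * e <= 1 by rewrite -ler_pdivlMr// mul1r.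
have z1 : 0 <= (1 + sqn x) * chi x * e by rewrite !mulr_ge0 ?(ltW c0) ?(ltW e0)// (le_trans _ w1).
rewrite /hcut sqrrN exprMn mulrA.
have -> : (1 + sqn x) * (2 * e * chi x ^+ 2) ^+ 2 = 4 * (e * e * chi x ^+ 4 * (1 + sqn x)) by ring.
apply: (@le_trans _ _ (4 * (e * e * chi x ^+ 4 * (1 + sqn x)) * (2 * (N + 4) ^+ 2 * ((1 + sqn x) * en f x)))).
  rewrite ler_wpM2l// mulr_ge0//.
  apply: mulr_ge0; last by rewrite (le_trans _ w1).
  by apply: mulr_ge0; [rewrite -expr2 sqr_ge0|rewrite exprn_ge0 ?(ltW c0)].
have -> : 4 * (e * e * chi x ^+ 4 * (1 + sqn x)) * (2 * (N + 4) ^+ 2 * ((1 + sqn x) * en f x)) =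
  (8 * (N + 4) ^+ 2 * en f x) * (((1 + sqn x) * chi x * e) ^+ 2 * chi x ^+ 2) by ring.
have E8 : 0 <= 8 * (N + 4) ^+ 2 * en f x by rewrite mulr_ge0// mulr_ge0// sqr_ge0.
apply: (@le_trans _ _ (8 * (N + 4) ^+ 2 * en f x)).
  rewrite ler_piMr// mulr_ile1 ?exprn_ile1 ?exprn_ge0 ?(ltW c0) ?chi_le1//.
rewrite exprMn !ler_wpM2r ?sqr_ge0//; lra.
Qed.

Lemma cutB f g x : cutf (cfunB f g) x = cutf f x - cutf g x.
Proof. by rewrite /= mulrBr. Qed.

Lemma cd_cutB f g i x : cd (cutf (cfunB f g)) i x = cd (cutf f) i x - cd (cutf g) i x.
Proof. by rewrite !cd_cut /=; ring. Qed.

Lemma hcutB f g x : hcut (cfunB f g) x = hcut f x - hcut g x.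
Proof.
rewrite /hcut (_ : xdot (cd (cfunB f g)) x = xdot (cd f) x - xdot (cd g) x) /=; first by ring.
by rewrite /xdot -sumrB; apply: eq_bigr => i _ /=; ring.
Qed.

End cutoff.

(** * Bounds for dilation quotients, uniform in the dilation parameter *)

Section dilation.
Variables (R : realType) (m : nat).
Local Notation leb := (lebesgue_rV R).
Local Notation Om := (half_space R m).
Local Notation il i := (lift ord_max i).
Local Notation hd x := (unsnoc x).1.
Local Notation N := (m.+1%:R).
Local Notation cfun := (cfun R m).
Variable e : R.
Hypotheses (e0 : 0 < e) (e1 : e <= 1).
Implicit Types f g h V : cfun.
Local Notation cutf := (cutf e0).
Local Notation Ac := (Acut e).

Lemma C1_dil (s : R) f : C1 (fun x => f (s *: x)) (fun i x => s * cd f i (s *: x)).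
Proof.
have := C1_affine s 0 (cfD f).
by apply: C1_ext => [x|i x]; rewrite addr0.
Qed.

Lemma bsupp_dil (s : R) f : 0 < s -> bsupp (fun x => f (s *: x)).
Proof. by move=> s0; apply: bsupp_scale => //; exact: cfb. Qed.

Definition dil (s : R) (s0 : 0 < s) f := CFun (C1_dil s f) (bsupp_dil f s0).

Lemma lbm_dil (s : R) (w : 'rV[R]_m.+1 -> R) : lbm w -> lbm (fun x => w (s *: x)).
Proof.
move=> lw; rewrite (_ : (fun x => _) = fun x => w (s *: x + 0)); first exact: lbm_affine.
by apply/funext => x; rewrite addr0.
Qed.

Lemma snocZ0 (t : R) (x : 'rV[R]_m) : snoc (t *: x, 0) = t *: snoc (x, 0).
Proof.
apply/rowP => i; have [j ->|->] := unliftP ord_max i.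
  by rewrite snoc_lift !mxE liftK.
by rewrite snoc_last mxE snoc_last mulr0.
Qed.

Lemma Ac0 : 0 <= Ac. Proof. by apply: le_trans (Acut_ge4 e0 e1). Qed.

Lemma wt_ge1 n (x : 'rV[R]_n) (a b : R) : 0 <= a -> (1 + sqn x) * a <= b -> a <= b.
Proof.
by move=> a0; apply: le_trans; rewrite mulrDl mul1r lerDl mulr_ge0// sqn_ge0.
Qed.

Lemma wt_gex n (x : 'rV[R]_n) i (a b : R) : 0 <= a -> (1 + sqn x) * a <= b ->
  x ord0 i ^+ 2 * a <= b.
Proof.
move=> a0; apply: le_trans; rewrite ler_wpM2r//.
by apply: le_trans (coord_sqn x i) _; rewrite lerDr.
Qed.

Lemma sum_le_card n (F : 'I_n -> R) (c : R) : (forall i, F i <= c) -> \sum_i F i <= n%:R * c.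
Proof.
move=> H; apply: (@le_trans _ _ (\sum_(i < n) c)); first by apply: ler_sum => i _.
by rewrite sumr_const card_ord mulr_natl.
Qed.

(** For [z] either the commutator or the cut function itself. The [t]-derivative of [cutf g (t x)]
    produces a factor [x], which is charged to the weighted bound on [z f]; what is left of [g] is a
    first derivative. *)
Lemma inner_ubil (z : cfun -> 'rV[R]_m.+1 -> R) (A : R) : 0 <= A ->
  (forall f, lbs (z f)) ->
  (forall f x, (1 + sqn x) * z f x ^+ 2 <= A ^+ 2 * en f x) ->
  (forall f g x, z (cfunB f g) x = z f x - z g x) ->
  exists2 C, 0 <= C & forall s : R, 1 < s <= 2 ->
    ubil C (fun f g => dq m (fun t => \int[leb m.+1]_(x in Om) (z f x * cutf g (t *: x))) s).
Proof.
move=> A0 lz zA zB; have mO := @measurable_half_space R m.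
have N1 : 1 <= (N : R) by rewrite ler1n.
have C0 : 0 <= A * Ac * 2 ^+ m.+1 := mulr_ge0 (mulr_ge0 A0 Ac0) (exprn_ge0 m.+1 (ler0n R 2)).
have ld f (t : R) : 0 < t -> lbs (fun x => cutf f (t *: x)).
  by move=> t0; split; [apply: lbm_dil; exact: lcf|exact: bsupp_dil].
exists ((2 + N) * (N * (A * Ac * 2 ^+ m.+1))).
  by apply: mulr_ge0; [rewrite addr_ge0|rewrite mulr_ge0].
move=> s s12; apply: (@dq_ubil _ _ _ (fun f g t => \int[leb m.+1]_(x in Om) (z f x * xdot (fun i x => cd (cutf g) i (t *: x)) x))) => //.
- move=> f g t t0; have [lzf bzf] := lz f.
  exact: (Int_scale_derive mO lzf bzf (cfD (cutf g)) (cfb (cutf g)) t0).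
- move=> f g t /andP[t1 t2].
  apply: (@le_trans _ _ (A * Ac * 2 ^+ m.+1 * (nn f * nn g))).
    apply: bil_bd => [|||||x|x]; [exact: A0|exact: Ac0|exact: t1|exact: lz|by split; [exact: lcf|exact: cfb]| |].
      by apply: wt_ge1 (zA f x); exact: sqr_ge0.
    by apply: wt_ge1 (cut_le e0 e1 g x); exact: sqr_ge0.
  by rewrite ler_wpM2r ?mulr_ge0 ?nn_ge0// ler_peMl.
- move=> f g t /andP[t1 t2]; have [lzf bzf] := lz f.
  have t0 : 0 < t by apply: lt_le_trans t1; rewrite invr_gt0.
  have ldd i : lbm (fun x => cd (cutf g) i (t *: x)) by apply: lbm_dil; exact: lcd.
  have -> : \int[leb m.+1]_(x in Om) (z f x * xdot (fun i x => cd (cutf g) i (t *: x)) x) =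
      \sum_i \int[leb m.+1]_(x in Om) ((x ord0 i * z f x) * cd (cutf g) i (t *: x)).
    rewrite -(Int_sum mO); last by move=> i; lbst.
    apply: eq_Rintegral => x _; rewrite /xdot mulr_sumr; apply: eq_bigr => i _; ring.
  apply: (le_trans (ler_norm_sum _ _ _)).
  rewrite -mulrA; apply: sum_le_card => i.
  apply: bil_bd => [|||||x|x]; [exact: A0|exact: Ac0|exact: t1|lbst|by split; [exact: lcd|exact: bcd]| |].
    by rewrite exprMn; apply: wt_gex (zA f x); exact: sqr_ge0.
  by apply: wt_ge1 (cd_cut_le e0 e1 g i x); exact: sqr_ge0.
- move=> f h g t t0; have [lc bc] := ld g t t0; have [l1 b1] := lz f; have [l2 b2] := lz h.
  rewrite -(IntB mO); [|lbst|lbst].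
  by apply: eq_Rintegral => x _; rewrite zB mulrBl.
- move=> f g h t t0; have [lc bc] := ld g t t0; have [lc' bc'] := ld h t t0.
  have [l1 b1] := lz f.
  rewrite -(IntB mO); [|lbst|lbst].
  by apply: eq_Rintegral => x _; rewrite cutB mulrBr.
Qed.

(** For the gradient term the quotient has already been summed to the factor [(s + 1) / s <= 2], see
    [Gr_dtest]; a genuine difference quotient here would require second derivatives. *)
Lemma grad_ubil : exists2 C, 0 <= C & forall s : R, 1 < s <= 2 ->
  ubil C (fun f g => (s + 1) / s * \int[leb m.+1]_(x in Om)
    (\sum_i cd (cutf f) i x * cd (cutf g) i (s *: x))).
Proof.
have mO := @measurable_half_space R m.
have C0 : 0 <= Ac * Ac * 2 ^+ m.+1 := mulr_ge0 (mulr_ge0 Ac0 Ac0) (exprn_ge0 m.+1 (ler0n R 2)).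
exists (2 * (N * (Ac * Ac * 2 ^+ m.+1))).
  by apply: mulr_ge0 => //; rewrite mulr_ge0.
move=> s /andP[s1 s2]; have s0 : 0 < s by apply: lt_trans s1.
have is1 : s^-1 <= 1 by rewrite invf_le1// ltW.
have ss : 0 <= (s + 1) / s <= 2.
  by rewrite divr_ge0 ?addr_ge0 ?(ltW s0)//= ler_pdivrMr//; lra.
have [ss0 ss2] := andP ss.
have ld g i : lbm (fun x => cd (cutf g) i (s *: x)) by apply: lbm_dil; exact: lcd.
split => [f g|f h g|f g h].
- have -> : 2 * (N * (Ac * Ac * 2 ^+ m.+1)) * (nn f * nn g) = 2 * (N * (Ac * Ac * 2 ^+ m.+1) * (nn f * nn g)) by ring.
  rewrite normrM (ger0_norm ss0); apply: ler_pM => //.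
  rewrite (Int_sum mO); last by move=> i; lbst.
  apply: (le_trans (ler_norm_sum _ _ _)).
  rewrite -mulrA; apply: sum_le_card => i.
  apply: bil_bd => [|||||x|x]; [exact: Ac0|exact: Ac0| |by split; [exact: lcd|exact: bcd]|by split; [exact: lcd|exact: bcd]| |].
  + by apply: le_trans (ltW s1); rewrite invf_le1 ?ltr0n// ler1n.
  + by apply: wt_ge1 (cd_cut_le e0 e1 f i x); exact: sqr_ge0.
  + by apply: wt_ge1 (cd_cut_le e0 e1 g i x); exact: sqr_ge0.
- rewrite -mulrBr -(IntB mO); [|lbst|lbst].
  congr (_ * _); apply: eq_Rintegral => x _; rewrite -sumrB.
  by apply: eq_bigr => i _; rewrite cd_cutB mulrBl.
- rewrite -mulrBr -(IntB mO); [|lbst|lbst].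
  congr (_ * _); apply: eq_Rintegral => x _; rewrite -sumrB.
  by apply: eq_bigr => i _; rewrite cd_cutB mulrBr.
Qed.

Section boundary.
Variables (be : 'rV[R]_m -> R) (ga : 'I_m -> 'rV[R]_m -> R) (K : R).
Hypotheses (lbe : lbm be) (lga : forall i, lbm (ga i)).
Hypothesis w : forall i, wder i be (ga i).
Hypotheses (K0 : 0 <= K) (beK : forall x, `|be x| <= K) (gaK : forall i x, `|ga i x| <= K).

Lemma bdK_sqr (b x : R) : `|b| <= K -> (b * x) ^+ 2 <= K ^+ 2 * x ^+ 2.
Proof.
move=> bK; rewrite exprMn ler_wpM2r ?sqr_ge0//.
by rewrite -(real_normK (num_real b)) lerXn2r ?nnegrE.
Qed.

Lemma bdK_en (b x y : R) : `|b| <= K -> x ^+ 2 <= Ac ^+ 2 * y ->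
  (b * x) ^+ 2 <= (K * Ac) ^+ 2 * y.
Proof.
move=> bK xy; apply: (le_trans (bdK_sqr _ bK)).
by apply: le_trans (ler_wpM2l (sqr_ge0 K) xy) _; rewrite [(K * Ac) ^+ 2]exprMn mulrA.
Qed.

(** The H^1 norm does not control a tangential derivative on the boundary. [IntO_nor] for the values
    and [wder_trace] for their [t]-derivative turn both into interior integrals with first
    derivatives only; the regularity of the coefficient pays for this. *)
Lemma boundary_ubil :
  exists2 C, 0 <= C & forall s : R, 1 < s <= 2 ->
    ubil C (fun f g => dq m (fun t => \int[leb m]_x
      (be x * cutf f (snoc (x, 0)) * cutf g (t *: snoc (x, 0)))) s).
Proof.
have mO := @measurable_half_space R m.
have N1 : 1 <= (N : R) by rewrite ler1n.
have KA0 : 0 <= K * Ac by rewrite mulr_ge0 ?Ac0.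
have C0 : 0 <= (K * Ac) * Ac * 2 ^+ m.+1 := mulr_ge0 (mulr_ge0 KA0 Ac0) (exprn_ge0 m.+1 (ler0n R 2)).
have ld f (t : R) : 0 < t -> lbs (fun x => cutf f (t *: x)).
  by move=> t0; split; [apply: lbm_dil; exact: lcf|exact: bsupp_dil].
have lb f (t : R) : 0 < t -> lbs (fun x => cutf f (t *: snoc (x, 0))).
  move=> t0; have [l b] := ld f t t0; split; [exact: (lbm_slice 0 l)|exact: (bsupp_slice 0 b)].
pose P' f g t := \int[leb m]_x (be x * cutf f (snoc (x, 0)) *
   \sum_(i < m) x ord0 i * cd (cutf g) (il i) (t *: snoc (x, 0))).
(* [2 + N] comes from [dq_bound]. In each of the [m] tangential directions the transfer yields one
   simple product and one with three summands, hence the 4. *)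
exists ((2 + N) * (N * 4 * ((K * Ac) * Ac * 2 ^+ m.+1))).
  by apply: mulr_ge0; [rewrite addr_ge0|apply: mulr_ge0 => //; rewrite mulr_ge0].
move=> s s12; apply: (@dq_ubil _ _ _ P') => //.
- move=> f g t t0; rewrite /P'.
  have lz : lbm (fun x => be x * cutf f (snoc (x, 0))) by lbm_tac.
  have bz : bsupp (fun x => be x * cutf f (snoc (x, 0))) by bsupp_tac.
  have := Int_scale_derive measurableT lz bz (C1_slice 0 (cfD (cutf g))) (bsupp_slice 0 (cfb (cutf g))) t0.
  rewrite (_ : (fun t => _) = (fun t => \int[leb m]_x (be x * cutf f (snoc (x, 0)) * cutf g (t *: snoc (x, 0))))); last first.
    by apply/funext => t'; apply: eq_Rintegral => x _; rewrite snocZ0.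
  congr (is_derive _ _ _ _); apply: eq_Rintegral => x _; congr (_ * _).
  by apply: eq_bigr => i _; rewrite snocZ0.
- move=> f g t /andP[t1 t2]; have t0 : 0 < t by apply: lt_le_trans t1; rewrite invr_gt0.
  have [lc bc] := ld g t t0.
  have ldd : lbm (fun x => cd (cutf g) ord_max (t *: x)) by apply: lbm_dil; exact: lcd.
  pose G := C1M (cfD (cutf f)) (C1_dil t (cutf g)).
  have bG : bsupp (fun x => cutf f x * cutf g (t *: x)) by bsupp_tac.
  have := IntO_nor G bG lbe.
  rewrite (_ : \int[leb m]_x _ = \int[leb m]_x (be x * cutf f (snoc (x, 0)) * cutf g (t *: snoc (x, 0)))); last first.
    by apply: eq_Rintegral => x _; rewrite mulrA.
  move=> ->; rewrite normrN.
  have -> : \int[leb m.+1]_(x in Om) (be (hd x) * (cutf f x * (t * cd (cutf g) ord_max (t *: x)) +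
      cutf g (t *: x) * cd (cutf f) ord_max x)) =
    t * \int[leb m.+1]_(x in Om) ((be (hd x) * cutf f x) * cd (cutf g) ord_max (t *: x)) +
    \int[leb m.+1]_(x in Om) ((be (hd x) * cd (cutf f) ord_max x) * cutf g (t *: x)).
    rewrite -(IntZ mO); [|lbst]; rewrite -(IntD mO); [|lbst|lbst].
    by apply: eq_Rintegral => x _; ring.
  apply: (le_trans (ler_normD _ _)).
  have b1 : `|\int[leb m.+1]_(x in Om) ((be (hd x) * cutf f x) * cd (cutf g) ord_max (t *: x))| <=
     (K * Ac) * Ac * 2 ^+ m.+1 * (nn f * nn g).
    apply: bil_bd => [|||||x|x]; [exact: KA0|exact: Ac0|exact: t1|lbst|by split; [exact: lcd|exact: bcd]| |].
      apply: (bdK_en (beK _)).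
      by apply: wt_ge1 (cut_le e0 e1 f x); exact: sqr_ge0.
    by apply: wt_ge1 (cd_cut_le e0 e1 g _ x); exact: sqr_ge0.
  have b2 : `|\int[leb m.+1]_(x in Om) ((be (hd x) * cd (cutf f) ord_max x) * cutf g (t *: x))| <=
     (K * Ac) * Ac * 2 ^+ m.+1 * (nn f * nn g).
    apply: bil_bd => [|||||x|x]; [exact: KA0|exact: Ac0|exact: t1|lbst|by split; [exact: lcf|exact: cfb]| |].
      apply: (bdK_en (beK _)).
      by apply: wt_ge1 (cd_cut_le e0 e1 f _ x); exact: sqr_ge0.
    by apply: wt_ge1 (cut_le e0 e1 g x); exact: sqr_ge0.
  rewrite normrM (gtr0_norm t0).
  set Z := _ * 2 ^+ m.+1 * (nn f * nn g) in b1 b2 *.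
  have Z0 : 0 <= Z by apply: le_trans b1.
  have -> : N * 4 * (K * Ac * Ac * 2 ^+ m.+1) * (nn f * nn g) = N * 4 * Z by rewrite /Z !mulrA.
  have h1 : t * `|\int[leb m.+1]_(x in Om) ((be (hd x) * cutf f x) * cd (cutf g) ord_max (t *: x))| <= 2 * Z.
    by apply: ler_pM => //; exact: ltW.
  have h2 : 1 * (4 * Z) <= N * (4 * Z).
    exact: (ler_wpM2r (mulr_ge0 (ler0n R 4) Z0) N1).
  lra.
- move=> f g t /andP[t1 t2]; have t0 : 0 < t by apply: lt_le_trans t1; rewrite invr_gt0.
  have ldd i : lbm (fun x => cd (cutf g) i (t *: x)) by apply: lbm_dil; exact: lcd.
  have -> : P' f g t = \sum_(i < m) \int[leb m]_x (be x * ((snoc (x, 0) : 'rV[R]_m.+1) ord0 (il i) * cutf f (snoc (x, 0)) *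
      cd (cutf g) (il i) (t *: snoc (x, 0)))).
    rewrite /P' -(Int_sum measurableT); last first.
      move=> i; split.
        apply: lbmM => //; apply: lbmM; last by exact: (lbm_slice 0 (ldd _)).
        apply: lbmM; last by lbm_tac.
        by apply: (@lbm_slice _ _ (fun y => y ord0 (il i))); exact: lbm_coord.
      by apply: bsuppMr; apply: bsuppMl; apply: bsuppMr; bsupp_tac.
    apply: eq_Rintegral => x _; rewrite mulr_sumr; apply: eq_bigr => i _.
    by rewrite snoc_lift; ring.
  apply: (le_trans (ler_norm_sum _ _ _)).
  set Z := K * Ac * Ac * 2 ^+ m.+1 in C0 *.
  have Z0 : 0 <= Z * (nn f * nn g) by apply: mulr_ge0 => //; rewrite mulr_ge0 ?nn_ge0.
  apply: (@le_trans _ _ (m%:R * (4 * Z * (nn f * nn g)))); last first.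
    have -> : N * 4 * Z * (nn f * nn g) = N * (4 * Z * (nn f * nn g)) by ring.
    have Z4 : 0 <= 4 * Z * (nn f * nn g) by rewrite -mulrA; exact: mulr_ge0.
    by apply: (ler_wpM2r Z4); rewrite ler_nat.
  apply: sum_le_card => i; rewrite {}/Z in C0 Z0 *.
  have bF : bsupp (fun x : 'rV[R]_m.+1 => x ord0 (il i) * cutf f x) by bsupp_tac.
  have := wder_trace lbe (lga i) (w i) (C1M (C1_coord R (il i)) (cfD (cutf f))) bF (C1_dil t (cutf g)) (bsupp_dil _ t0).
  set I0 := (X in _ = X -> _) => HW.
  (* [C1_dil] gives the gradient of the dilated function with a factor [t], which [t^-1] removes. *)
  have {HW} -> : \int[leb m]_x (be x * ((snoc (x, 0) : 'rV[R]_m.+1) ord0 (il i) * cutf f (snoc (x, 0)) *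
      cd (cutf g) (il i) (t *: snoc (x, 0)))) = t^-1 * I0.
    rewrite -HW -(IntZ measurableT).
      by apply: eq_Rintegral => x _; field; rewrite gt_eqF.
    split.
      apply: lbmM => //; apply: lbmM; last by apply: lbmM; [exact: lbm_cst|exact: (lbm_slice 0 (ldd _))].
      apply: lbmM; last by lbm_tac.
      by apply: (@lbm_slice _ _ (fun y => y ord0 (il i))); exact: lbm_coord.
    by apply: bsuppMr; apply: bsuppMl; apply: bsuppMr; bsupp_tac.
  have -> : t^-1 * I0 =
    - (\int[leb m.+1]_(x in Om) ((be (hd x) * (x ord0 (il i) * cd (cutf f) ord_max x)) * cd (cutf g) (il i) (t *: x))) +
    \int[leb m.+1]_(x in Om) ((ga i (hd x) * (x ord0 (il i) * cutf f x) +
       be (hd x) * (x ord0 (il i) * cd (cutf f) (il i) x + cutf f x)) * cd (cutf g) ord_max (t *: x)).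
    rewrite /I0 mulrDr mulrN; congr (- _ + _).
      rewrite -(IntZ mO); last first.
        split; first by lbm_tac.
        by apply: bsuppMr; apply: bsuppMl; apply: bsuppD; bsupp_tac.
      apply: eq_Rintegral => x _; rewrite (negbTE (neq_lift _ _)) mulr0n.
      by field; rewrite gt_eqF.
    rewrite -(IntZ mO); last first.
      split; first by lbm_tac.
      by apply: bsuppMl; apply: bsuppD; apply: bsuppMr; [|apply: bsuppD]; bsupp_tac.
    apply: eq_Rintegral => x _; rewrite eqxx mulr1n.
    by field; rewrite gt_eqF.
  apply: (le_trans (ler_normD _ _)); rewrite normrN.
  have -> : 4 * (K * Ac * Ac * 2 ^+ m.+1) * (nn f * nn g) =
    (K * Ac) * Ac * 2 ^+ m.+1 * (nn f * nn g) + (3 * (K * Ac)) * Ac * 2 ^+ m.+1 * (nn f * nn g) by ring.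
  have q1 (x : 'rV[R]_m.+1) : (x ord0 (il i) * cutf f x) ^+ 2 <= Ac ^+ 2 * en f x.
    by rewrite exprMn; apply: wt_gex (cut_le e0 e1 f x); exact: sqr_ge0.
  have q2 j (x : 'rV[R]_m.+1) : (x ord0 (il i) * cd (cutf f) j x) ^+ 2 <= Ac ^+ 2 * en f x.
    by rewrite exprMn; apply: wt_gex (cd_cut_le e0 e1 f j x); exact: sqr_ge0.
  have q3 (x : 'rV[R]_m.+1) : cutf f x ^+ 2 <= Ac ^+ 2 * en f x.
    by apply: wt_ge1 (cut_le e0 e1 f x); exact: sqr_ge0.
  apply: lerD.
    apply: bil_bd => [|||||x|x]; [exact: KA0|exact: Ac0|exact: t1|lbst|by split; [exact: lcd|exact: bcd]| |].
      exact: (bdK_en (beK _)).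
    by apply: wt_ge1 (cd_cut_le e0 e1 g _ x); exact: sqr_ge0.
  apply: bil_bd => [|||||x|x]; [exact: (mulr_ge0 (ler0n R 3) KA0)|exact: Ac0|exact: t1|lbst|by split; [exact: lcd|exact: bcd]| |].
    have r1 := bdK_sqr (x ord0 (il i) * cutf f x) (gaK i (hd x)).
    have r2 := bdK_sqr (x ord0 (il i) * cd (cutf f) (il i) x) (beK (hd x)).
    have r3 := bdK_sqr (cutf f x) (beK (hd x)).
    have K2 : 0 <= K ^+ 2 by exact: sqr_ge0.
    have {r1} := le_trans r1 (ler_wpM2l K2 (q1 x)).
    have {r2} := le_trans r2 (ler_wpM2l K2 (q2 _ x)).
    have {r3} := le_trans r3 (ler_wpM2l K2 (q3 x)).
    move: (en f x) => E; rewrite [be (hd x) * (_ + _)]mulrDr.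
    move: (ga i (hd x) * _) (be (hd x) * (x ord0 (il i) * _)) (be (hd x) * _) => p q r hr hq hp.
    have := sqr_ge0 (p - q); have := sqr_ge0 (p - r); have := sqr_ge0 (q - r).
    set Z := _ * (_ * E) in hp hq hr.
    have -> : (3 * (K * Ac)) ^+ 2 * E = 9 * Z by rewrite /Z; ring.
    nra.
  by apply: wt_ge1 (cd_cut_le e0 e1 g _ x); exact: sqr_ge0.
- move=> f h g t t0; have [lc bc] := lb g t t0.
  rewrite -(IntB measurableT); [|lbst|lbst].
  by apply: eq_Rintegral => x _; rewrite cutB; ring.
- move=> f g h t t0; have [lc bc] := lb g t t0; have [lc' bc'] := lb h t t0.
  rewrite -(IntB measurableT); [|lbst|lbst].
  by apply: eq_Rintegral => x _; rewrite cutB; ring.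
Qed.

End boundary.

End dilation.

(** * The limit of the dilation test functions *)

Section limit.
Variables (R : realType) (m : nat).
Local Notation leb := (lebesgue_rV R).
Local Notation Om := (half_space R m).
Local Notation il i := (lift ord_max i).
Local Notation hd x := (unsnoc x).1.
Local Notation N := (m.+1%:R).
Local Notation cfun := (cfun R m).
Implicit Types f g h V : cfun.

(** A triangle inequality with constant 2, from [(p + q)^2 <= 2 p^2 + 2 q^2]; it suffices for Cauchy
    sequences. *)
Lemma nn_le3 f g h : (forall x, f x = g x + h x) ->
  (forall i x, cd f i x = cd g i x + cd h i x) -> nn f <= 2 * (nn g + nn h).
Proof.
move=> H0 H1; have mO := @measurable_half_space R m.
have lg := lbm_en g; have lh := lbm_en h; have lf := lbm_en f.
have bg := bsupp_en g; have bh := bsupp_en h; have bf := bsupp_en f.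
have P x : en f x <= 2 * en g x + 2 * en h x.
  have Q (p q : R) : (p + q) ^+ 2 <= 2 * p ^+ 2 + 2 * q ^+ 2.
    by rewrite -subr_ge0 (_ : _ - _ = (p - q) ^+ 2) ?sqr_ge0//; ring.
  rewrite /en !mulrDr !mulr_sumr addrACA -big_split/= H0 lerD//.
  by apply: ler_sum => i _; rewrite H1.
have E : N2 f <= 2 * N2 g + 2 * N2 h.
  rewrite /N2 -(IntZ mO); [|lbst]; rewrite -(IntZ mO); [|lbst]; rewrite -(IntD mO); [|lbst|lbst].
  by apply: (Int_le mO) => [||x _]; [lbst|lbst|exact: P].
rewrite -(@ler_pXn2r _ 2) ?nnegrE ?mulr_ge0 ?addr_ge0 ?nn_ge0//.
rewrite nn_sqr; apply: le_trans E _; rewrite -!nn_sqr.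
have := mulr_ge0 (nn_ge0 g) (nn_ge0 h); have := sqr_ge0 (nn g); have := sqr_ge0 (nn h).
nra.
Qed.

Lemma nnB f g : nn (cfunB f g) <= 2 * (nn f + nn g).
Proof.
have -> : nn g = nn (cfunN g).
  rewrite /nn /N2; congr Num.sqrt; apply: eq_Rintegral => x _.
  by rewrite /en /= sqrrN; congr (_ + _); apply: eq_bigr => i _; rewrite sqrrN.
exact: nn_le3.
Qed.

Lemma nn_tri f g : nn f <= 2 * (nn (cfunB f g) + nn g).
Proof. by apply: nn_le3 => [x|i x]; rewrite /= subrK. Qed.

Lemma nnZ (c : R) f : nn (cfunZ c f) = `|c| * nn f.
Proof.
have mO := @measurable_half_space R m.
rewrite -sqrtr_sqr -sqrtrM ?sqr_ge0//; congr Num.sqrt.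
rewrite /N2 -(IntZ mO); last by split; [exact: lbm_en|exact: bsupp_en].
apply: eq_Rintegral => x _; rewrite /en mulrDr mulr_sumr /= exprMn; congr (_ + _).
by apply: eq_bigr => i _; rewrite exprMn.
Qed.

Lemma nn_bound f g (C : R) : 0 <= C -> N2 f <= C ^+ 2 * N2 g -> nn f <= C * nn g.
Proof.
move=> C0 H; rewrite -(@ler_pXn2r _ 2) ?nnegrE ?mulr_ge0 ?nn_ge0//.
by rewrite exprMn !nn_sqr.
Qed.

Lemma nn_dil (s : R) (s0 : 0 < s) f :
  nn (dil s0 f) <= Num.sqrt ((1 + s ^+ 2) * s^-1 ^+ m.+1) * nn f.
Proof.
have mO := @measurable_half_space R m.
have C0 : 0 <= (1 + s ^+ 2) * s^-1 ^+ m.+1.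
  by rewrite mulr_ge0 ?addr_ge0 ?sqr_ge0// exprn_ge0// invr_ge0 ltW.
apply: nn_bound; first exact: sqrtr_ge0.
rewrite sqr_sqrtr// -mulrA -IntO_scale//; last exact: (lbm_measurable (lbm_en f)).
have lf := lbm_dil s (lbm_en f); have bf := bsupp_scale s0 (bsupp_en f).
rewrite -(IntZ mO); last by [].
apply: (Int_le mO) => [||x _].
- by split; [exact: lbm_en|exact: bsupp_en].
- by lbst.
have E0 := en_ge0 f (s *: x); have S0 := sqr_ge0 s.
rewrite /en /= mulrDl mul1r.
rewrite (eq_bigr (fun i => s ^+ 2 * cd f i (s *: x) ^+ 2)) => [|i _]; last by rewrite exprMn.
rewrite -mulr_sumr mulrDr.
have := mulr_ge0 S0 (sqr_ge0 (f (s *: x))).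
have : 0 <= \sum_i cd f i (s *: x) ^+ 2 by apply: sumr_ge0 => i _; exact: sqr_ge0.
lra.
Qed.

(** The Cauchy property in the index, uniform in [s]: this is what permits exchanging the limit in
    the index with [s] tending to 1. *)
Definition equi (X : nat -> R -> R) := forall eta : R, 0 < eta -> exists J, forall j l s,
  (J <= j)%N -> (J <= l)%N -> 1 < s <= 2 -> `|X j s - X l s| <= eta.

Lemma equiD X Y : equi X -> equi Y -> equi (fun j s => X j s + Y j s).
Proof.
move=> hX hY eta eta0; have e2 : 0 < eta / 2 by rewrite divr_gt0.
have [J1 H1] := hX _ e2; have [J2 H2] := hY _ e2.
exists (maxn J1 J2) => j l s; rewrite !geq_max => /andP[j1 j2] /andP[l1 l2] s12.
rewrite opprD addrACA (le_trans (ler_normD _ _))// (splitr eta) lerD//; [exact: H1|exact: H2].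
Qed.

Lemma equiZ (c : R) X : equi X -> equi (fun j s => c * X j s).
Proof.
move=> hX eta eta0.
have c1 : 0 < `|c| + 1 by rewrite ltr_wpDl.
have e2 : 0 < eta / (`|c| + 1) by rewrite divr_gt0.
have [J1 H1] := hX _ e2; exists J1 => j l s h1 h2 h3.
rewrite -mulrBr normrM; apply: (@le_trans _ _ ((`|c| + 1) * (eta / (`|c| + 1)))).
  by apply: ler_pM => //; [rewrite lerDl|exact: H1].
by rewrite mulrC divfK// gt_eqF.
Qed.

Definition cauchy_nn (F : nat -> cfun) := forall eta : R, 0 < eta -> exists J, forall j l,
  (J <= j)%N -> (J <= l)%N -> nn (cfunB (F j) (F l)) <= eta.

Lemma cauchy_bounded F : cauchy_nn F -> exists2 B, 0 < B & exists J, forall j, (J <= j)%N -> nn (F j) <= B.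
Proof.
move=> /(_ _ ltr01)[J HJ]; exists (2 * (1 + nn (F J))).
  by rewrite mulr_gt0// ltr_pwDl// nn_ge0.
exists J => j Jj; apply: le_trans (nn_tri (F j) (F J)) _.
by rewrite ler_wpM2l// lerD2r HJ.
Qed.

Lemma equi_ubil F G (T : R -> cfun -> cfun -> R) (C : R) : 0 <= C ->
  cauchy_nn F -> cauchy_nn G -> (forall s, 1 < s <= 2 -> ubil C (T s)) ->
  equi (fun j s => T s (F j) (G j)).
Proof.
move=> C0 cF cG hT eta eta0.
have [B1 B10 [J1 H1]] := cauchy_bounded cF; have [B2 B20 [J2 H2]] := cauchy_bounded cG.
have D0 : 0 < (C + 1) * (B1 + B2) by apply: mulr_gt0; [exact: ltr_wpDl|exact: addr_gt0].
have e2 : 0 < eta / ((C + 1) * (B1 + B2)) by rewrite divr_gt0.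
have [J3 H3] := cF _ e2; have [J4 H4] := cG _ e2.
exists (maxn (maxn J1 J2) (maxn J3 J4)) => j l s.
rewrite !geq_max => /andP[/andP[j1 j2] /andP[j3 j4]] /andP[/andP[l1 l2] /andP[l3 l4]] s12.
apply: (le_trans (ubil_diff _ _ _ _ C0 (hT s s12))).
have := H3 j l j3 l3; have := H4 j l j4 l4; move: (H1 l l1) (H2 j j2).
set e' := eta / _ => h1 h2 h4 h3.
apply: (@le_trans _ _ ((C + 1) * (e' * B2 + B1 * e'))).
  apply: ler_pM => //; [|by rewrite lerDl|].
    by rewrite addr_ge0// mulr_ge0 ?nn_ge0.
  by apply: lerD; apply: ler_pM; rewrite ?nn_ge0.
have -> : (C + 1) * (e' * B2 + B1 * e') = e' * ((C + 1) * (B1 + B2)) by ring.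
by rewrite /e' divfK// gt_eqF.
Qed.

Variables be1 be2 : 'rV[R]_m -> R.
Variables ga1 ga2 : 'I_m -> 'rV[R]_m -> R.
Variables (K l1 l2 : R).
Hypotheses (lbe1 : lbm be1) (lbe2 : lbm be2).
Hypotheses (lga1 : forall i, lbm (ga1 i)) (lga2 : forall i, lbm (ga2 i)).
Hypothesis w1 : forall i, wder i be1 (ga1 i).
Hypothesis w2 : forall i, wder i be2 (ga2 i).
Hypotheses (K0 : 0 <= K) (be1K : forall x, `|be1 x| <= K) (be2K : forall x, `|be2 x| <= K).
Hypotheses (ga1K : forall i x, `|ga1 i x| <= K) (ga2K : forall i x, `|ga2 i x| <= K).

Definition RF f g V := rform be1 be2 l1 l2 f (cd f) g V (cd V).

Variable e : R.
Hypotheses (e0 : 0 < e) (e1 : e <= 1).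
Local Notation cutf := (cutf e0).
Local Notation Ac := (Acut e).
Local Notation hcut := (hcut e).

Lemma nn_cut f : nn (cutf f) <= Num.sqrt (m.+2%:R * Ac ^+ 2) * nn f.
Proof.
have mO := @measurable_half_space R m.
have C0 : 0 <= m.+2%:R * Ac ^+ 2 by rewrite mulr_ge0 ?sqr_ge0.
apply: nn_bound; first exact: sqrtr_ge0.
rewrite sqr_sqrtr// -(IntZ mO); last by split; [exact: lbm_en|exact: bsupp_en].
have lf := lbm_en f; have bf := bsupp_en f.
apply: (Int_le mO) => [||x _].
- by split; [exact: lbm_en|exact: bsupp_en].
- by lbst.
rewrite -(natr1 m.+1) addrC mulrDl mulrDl mul1r [in leLHS]/en; apply: lerD.
  by apply: wt_ge1 (cut_le e0 e1 f x); exact: sqr_ge0.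
rewrite -mulrA; apply: sum_le_card => i.
by apply: wt_ge1 (cd_cut_le e0 e1 f i x); exact: sqr_ge0.
Qed.

Lemma inv_gt0 (s : R) : 0 < s -> 0 < s^-1. Proof. by rewrite invr_gt0. Qed.

(* Tends to [2 x . grad a + N a] as [s] tends to 1, where [a = cutf f], but is again an
   admissible test function when [f] only converges in H^1. *)
Definition dtest (s : R) (s0 : 0 < s) f : cfun :=
  cfunZ (s - 1)^-1 (cfunB (dil s0 (cutf f)) (cfunZ (s^-1 ^+ m.+1) (dil (inv_gt0 s0) (cutf f)))).

(** The constant may blow up as [s] tends to 1; the bound is used at a frozen [s] only. *)
Lemma nn_dtest (s : R) (s0 : 0 < s) : exists2 C, 0 <= C & forall f, nn (cutf (dtest s0 f)) <= C * nn f.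
Proof.
set c1 := Num.sqrt (m.+2%:R * Ac ^+ 2).
set c2 := Num.sqrt ((1 + s ^+ 2) * s^-1 ^+ m.+1).
set c3 := Num.sqrt ((1 + s^-1 ^+ 2) * s^-1^-1 ^+ m.+1).
have [c10 c20 c30] : [/\ 0 <= c1, 0 <= c2 & 0 <= c3] by split; exact: sqrtr_ge0.
set q := `|s^-1 ^+ m.+1|; have q0 : 0 <= q by exact: normr_ge0.
exists (c1 * (`|(s - 1)^-1| * (2 * (c2 * c1 + q * (c3 * c1))))).
  by rewrite mulr_ge0// mulr_ge0// mulr_ge0// addr_ge0 ?mulr_ge0.
move=> f; apply: (le_trans (nn_cut _)); rewrite -/c1 -mulrA ler_wpM2l//.
rewrite /dtest nnZ -mulrA ler_wpM2l//; apply: (le_trans (nnB _ _)).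
rewrite -mulrA ler_wpM2l// mulrDl; apply: lerD.
  by apply: (le_trans (nn_dil _ _)); rewrite -/c2 -mulrA ler_wpM2l// nn_cut.
rewrite nnZ -/q -mulrA ler_wpM2l//.
by apply: (le_trans (nn_dil _ _)); rewrite -/c3 -mulrA ler_wpM2l// nn_cut.
Qed.

Definition Pint (u : 'rV[R]_m.+1 -> R) f (t : R) := \int[leb m.+1]_(x in Om) (u x * cutf f (t *: x)).
Definition Pbd (u : 'rV[R]_m -> R) f (t : R) := \int[leb m]_x (u x * cutf f (t *: snoc (x, 0))).
Definition Gr f (t : R) := \int[leb m.+1]_(x in Om) (\sum_i cd (cutf f) i x * cd (cutf f) i (t *: x)).

Lemma dtestE (s : R) (s0 : 0 < s) f x :
  dtest s0 f x = (s - 1)^-1 * (cutf f (s *: x) - s^-1 ^+ m.+1 * cutf f (s^-1 *: x)).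
Proof. by []. Qed.

Lemma Pint_dtest u (s : R) (s0 : 0 < s) f : lbm u ->
  \int[leb m.+1]_(x in Om) (u x * dtest s0 f x) = dq m (Pint u f) s.
Proof.
move=> lu; have mO := @measurable_half_space R m.
have ls (t : R) : lbm (fun x => cutf f (t *: x)) by apply: lbm_dil; exact: lcf.
have bs (t : R) : 0 < t -> bsupp (fun x => cutf f (t *: x)) by move=> t0; exact: bsupp_dil.
have b1 := bs s s0; have b2 := bs _ (inv_gt0 s0).
rewrite /dq /Pint [RHS]mulrC -(IntZ mO); [|lbst].
rewrite -(IntB mO); [|lbst|lbst]; rewrite -(IntZ mO); [|lbst].
by apply: eq_Rintegral => x _; rewrite dtestE; ring.
Qed.

Lemma Pbd_dtest u (s : R) (s0 : 0 < s) f : lbm u ->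
  \int[leb m]_x (u x * dtest s0 f (snoc (x, 0))) = dq m (Pbd u f) s.
Proof.
move=> lu; have mO := @measurableT _ 'rV[R]_m.
have ls (t : R) : lbm (fun x => cutf f (t *: snoc (x, 0))).
  by apply: (@lbm_slice _ _ (fun x => cutf f (t *: x))); apply: lbm_dil; exact: lcf.
have bs (t : R) : 0 < t -> bsupp (fun x => cutf f (t *: snoc (x, 0))).
  by move=> t0; apply: (@bsupp_slice _ _ (fun x => cutf f (t *: x))); exact: bsupp_dil.
have b1 := bs s s0; have b2 := bs _ (inv_gt0 s0).
rewrite /dq /Pbd [RHS]mulrC -(IntZ mO); [|lbst].
rewrite -(IntB mO); [|lbst|lbst]; rewrite -(IntZ mO); [|lbst].
by apply: eq_Rintegral => x _; rewrite dtestE; ring.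
Qed.

(** The substitution [x |-> x / s] gives [Gr f s = s^-N Gr f s^-1]. The two halves of the quotient
    thus combine into [(s - 1/s) / (s - 1) = (s + 1) / s] times [Gr f s]. *)
Lemma Gr_dtest (s : R) (s0 : 0 < s) f : s != 1 ->
  \int[leb m.+1]_(x in Om) (\sum_i cd (cutf f) i x * cd (dtest s0 f) i x) = (s + 1) / s * Gr f s.
Proof.
move=> s1; have mO := @measurable_half_space R m.
have ls i (t : R) : lbm (fun x => cd (cutf f) i (t *: x)) by apply: lbm_dil; exact: lcd.
have bs i (t : R) : 0 < t -> bsupp (fun x => cd (cutf f) i (t *: x)).
  by move=> t0; apply: bsupp_scale => //; exact: bcd.
have E : Gr f s = s^-1 ^+ m.+1 * Gr f s^-1.
  rewrite /Gr -IntO_scale//; last first.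
    by apply: lbm_measurable; lbm_tac.
  apply: eq_Rintegral => x _; apply: eq_bigr => i _.
  by rewrite scalerA mulVf ?gt_eqF// scale1r mulrC.
have -> : \int[leb m.+1]_(x in Om) (\sum_i cd (cutf f) i x * cd (dtest s0 f) i x) =
   (s - 1)^-1 * (s * Gr f s - s^-1 * (s^-1 ^+ m.+1 * Gr f s^-1)).
  rewrite /Gr -!(IntZ mO); [|lbst ..]; rewrite -(IntB mO); [|lbst|lbst].
  rewrite -(IntZ mO); [|lbst].
  apply: eq_Rintegral => x _; rewrite !mulr_sumr -sumrB mulr_sumr.
  by apply: eq_bigr => i _ /=; ring.
by rewrite -E; field; rewrite subr_eq0 s1 gt_eqF.
Qed.

(** All terms of the form in which the test function appears undifferentiated. *)
Definition Pall f g (t : R) :=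
  Pint (fun x => hcut f x - (l1 * cutf f x - l2 * cutf g x)) f t +
  Pbd (fun x => be1 x * cutf f (snoc (x, 0)) - be2 x * cutf g (snoc (x, 0))) f t.

Lemma RF_dtest (s : R) (s0 : 0 < s) f g : s != 1 ->
  RF f g (cutf (dtest s0 f)) = (s + 1) / s * Gr f s + dq m (Pall f g) s.
Proof.
move=> s1; have mO := @measurable_half_space R m.
have lh := lbm_hcut e0 f.
rewrite /RF rform_cut /rform Gr_dtest//.
have dqD P Q : dq m (fun t => P t + Q t) s = dq m P s + dq m Q s by rewrite /dq; ring.
rewrite /Pall dqD -!(Pbd_dtest s0) -?(Pint_dtest s0); [|lbm_tac|lbm_tac].
have -> : \int[leb m.+1]_(x in Om) ((hcut f x - (l1 * cutf f x - l2 * cutf g x)) * dtest s0 f x) =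
  \int[leb m.+1]_(x in Om) (hcut f x * dtest s0 f x) -
  \int[leb m.+1]_(x in Om) ((l1 * cutf f x - l2 * cutf g x) * dtest s0 f x).
  by rewrite -(IntB mO); [|lbst|lbst]; apply: eq_Rintegral => x _; ring.
ring.
Qed.

Lemma RF_equi (F G : nat -> cfun) : cauchy_nn F -> cauchy_nn G ->
  equi (fun j s => (s + 1) / s * Gr (F j) s + dq m (Pall (F j) (G j)) s).
Proof.
move=> cF cG; have mO := @measurable_half_space R m.
have [C1 C10 U1] := grad_ubil m e0 e1.
have hcA f x : (1 + sqn x) * hcut f x ^+ 2 <= (3 * (N + 4)) ^+ 2 * en f x by exact: hcut_le.
have A30 : 0 <= 3 * (N + 4) :> R by [].
have lh f : lbs (hcut f) by split; [exact: lbm_hcut|exact: bsupp_hcut].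
have [C2 C20 U2] := inner_ubil e0 e1 A30 lh hcA (hcutB e).
have lc f : lbs (cutf f) by split; [exact: lcf|exact: cfb].
have [C3 C30 U3] := inner_ubil e0 e1 (Ac0 e0 e1) lc (cut_le e0 e1) (cutB e0).
have [C4 C40 U4] := boundary_ubil e0 e1 lbe1 lga1 w1 K0 be1K ga1K.
have [C5 C50 U5] := boundary_ubil e0 e1 lbe2 lga2 w2 K0 be2K ga2K.
have H1 := equi_ubil C10 cF cF U1.
have H2 := equi_ubil C20 cF cF U2.
have H3 := equiZ (- l1) (equi_ubil C30 cF cF U3).
have H4 := equiZ l2 (equi_ubil C30 cG cF U3).
have H5 := equi_ubil C40 cF cF U4.
have H6 := equiZ (- 1) (equi_ubil C50 cG cF U5).
have := equiD (equiD (equiD H1 H2) (equiD H3 H4)) (equiD H5 H6).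
move=> H eta eta0; have [J HJ] := H eta eta0; exists J => j l s Jj Jl s12.
have s0 : 0 < s by case/andP: s12 => /(lt_trans ltr01).
suff E f g : (s + 1) / s * Gr f s + dq m (Pall f g) s =
   (s + 1) / s * (\int[leb m.+1]_(x in Om) \sum_i cd (cutf f) i x * cd (cutf f) i (s *: x)) +
   dq m (fun t => \int[leb m.+1]_(x in Om) (hcut f x * cutf f (t *: x))) s +
   (- l1 * dq m (fun t => \int[leb m.+1]_(x in Om) (cutf f x * cutf f (t *: x))) s +
    l2 * dq m (fun t => \int[leb m.+1]_(x in Om) (cutf g x * cutf f (t *: x))) s) +
   (dq m (fun t => \int[leb m]_x (be1 x * cutf f (snoc (x, 0)) * cutf f (t *: snoc (x, 0)))) s +
    -1 * dq m (fun t => \int[leb m]_x (be2 x * cutf g (snoc (x, 0)) * cutf f (t *: snoc (x, 0)))) s).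
  by rewrite !E; exact: HJ.
have EP (t : R) : 0 < t -> Pall f g t =
  \int[leb m.+1]_(x in Om) (hcut f x * cutf f (t *: x)) +
  (- l1 * \int[leb m.+1]_(x in Om) (cutf f x * cutf f (t *: x)) +
   l2 * \int[leb m.+1]_(x in Om) (cutf g x * cutf f (t *: x))) +
  (\int[leb m]_x (be1 x * cutf f (snoc (x, 0)) * cutf f (t *: snoc (x, 0))) +
   -1 * \int[leb m]_x (be2 x * cutf g (snoc (x, 0)) * cutf f (t *: snoc (x, 0)))).
  move=> t0; have [lhf bhf] := lh f.
  have ls : lbm (fun x => cutf f (t *: x)) by apply: lbm_dil; exact: lcf.
  have lsb : lbm (fun x => cutf f (t *: snoc (x, 0))).
    exact: (@lbm_slice _ _ (fun x => cutf f (t *: x)) 0 ls).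
  rewrite /Pall /Pint /Pbd; congr (_ + _).
    rewrite -!(IntZ mO); [|lbst ..]; rewrite -(IntD mO); [|lbst|lbst].
    rewrite -(IntD mO); [|lbst|lbst].
    by apply: eq_Rintegral => x _; ring.
  rewrite -(IntZ measurableT); [|lbst]; rewrite -(IntD measurableT); [|lbst|lbst].
  by apply: eq_Rintegral => x _; ring.
rewrite /Gr {1}/dq !EP ?invr_gt0// /dq; ring.
Qed.

Definition L f g :=
  virial be1 be2 l1 l2 (cutf f) (cd (cutf f)) (cutf g) +
  \int[leb m.+1]_(x in Om) (hcut f x * (2 * xdot (cd (cutf f)) x + N * cutf f x)).

Lemma is_derive1_cont (P : R -> R) (x l : R) : is_derive x 1 P l -> {for x, continuous P}.
Proof.
by move=> [Pd _]; apply: differentiable_continuous; exact/derivable1_diffP.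
Qed.

Lemma dq_lim (P : R -> R) (p : R) : is_derive (1 : R) 1 P p ->
  forall eta : R, 0 < eta -> exists2 d : R, 0 < d & forall s : R, 1 < s < 1 + d ->
  `|2 * p + N * P 1 - dq m P s| <= eta.
Proof.
move=> Pp eta eta0.
have Hi : is_derive (1 : R) 1 (fun s : R => s^-1) (- 1).
  have := @is_deriveV R idfun 1 1 1 (oner_neq0 R) (is_derive_id _ _).
  by rewrite /= /GRing.scale/= mulr1 expr1n invr1.
have HP : is_derive (1 : R) 1 (fun s : R => P s^-1) (p * - 1).
  by apply: (@is_derive1_comp _ P (fun s : R => s^-1)) => //; rewrite invr1.
have Hn n : is_derive (1 : R) 1 (fun s : R => s^-1 ^+ n) (- n%:R).
  elim: n => [|n IH].
    rewrite (_ : (fun s : R => _) = cst 1); first by rewrite oppr0; exact: is_derive_cst.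
    by apply/funext => s; rewrite expr0.
  rewrite (_ : (fun s : R => _) = (fun s : R => s^-1) * (fun s : R => s^-1 ^+ n)).
    have := is_deriveM Hi IH; congr is_derive.
    by rewrite /GRing.scale/= invr1 expr1n -natr1; ring.
  by apply/funext => s; rewrite exprS.
pose F (s : R) := P s - s^-1 ^+ m.+1 * P s^-1.
have HF : is_derive (1 : R) 1 F (2 * p + N * P 1).
  have := is_deriveB Pp (is_deriveM (Hn m.+1) HP).
  congr (is_derive _ _ _ _); rewrite /GRing.scale/= invr1 expr1n; ring.
have [d d0 Hd] := (is_derive_epsP _ _ _ _).1 HF _ eta0.
exists d => // s /andP[s1 sd].
have h0 : s - 1 != 0 by rewrite gt_eqF// subr_gt0.
have hd : `|s - 1| < d by rewrite gtr0_norm ?subr_gt0// ltrBlDl.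
have := Hd _ h0 hd; rewrite /F /GRing.scale/= mulr1 subrK invr1 expr1n mul1r subrr subr0.
by rewrite /dq [(s - 1)^-1 * _]mulrC.
Qed.

Definition smooth2 f := exists D2 : 'I_m.+1 -> 'I_m.+1 -> 'rV[R]_m.+1 -> R, forall i, C1 (cd f i) (D2 i).

Lemma C1_Dchi i : exists D, C1 (Dchi e i : 'rV[R]_m.+1 -> R) D.
Proof.
have H := C1N (C1M (C1Z (2 * e) (C1M (C1_chi m e0) (C1_chi m e0))) (C1_coord R i)).
by eexists; apply: C1_ext H => // x; rewrite /Dchi expr2.
Qed.

Lemma smooth2_cut f i : smooth2 f -> exists D, C1 (cd (cutf f) i) D.
Proof.
move=> [D2 H2]; have [D HD] := C1_Dchi i.
by eexists; exact: (C1D (C1M (C1_chi m e0) (H2 i)) (C1M (cfD f) HD)).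
Qed.

(** For a function with continuous second derivatives, [Gr] is continuous at 1 and [Pall] is
    differentiable there. The radius [d] depends on [f], so this alone says nothing uniform along
    the approximants. *)
Lemma RF_lim f g : smooth2 f -> forall eta : R, 0 < eta ->
  exists2 d : R, 0 < d & forall s : R, 1 < s < 1 + d ->
  `|L f g - ((s + 1) / s * Gr f s + dq m (Pall f g) s)| <= eta.
Proof.
move=> f2 eta eta0; have mO := @measurable_half_space R m.
have eh : 0 < eta / 2 by rewrite divr_gt0.
have lh := lbm_hcut e0 f; have bh := bsupp_hcut e f.
pose u x := hcut f x - (l1 * cutf f x - l2 * cutf g x).
have lu : lbm u by rewrite /u; lbm_tac.
have bu : bsupp u by rewrite /u; bsupp_tac.
pose z (x : 'rV[R]_m) := be1 x * cutf f (snoc (x, 0)) - be2 x * cutf g (snoc (x, 0)).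
have lz : lbm z by rewrite /z; lbm_tac.
have bz : bsupp z by rewrite /z; bsupp_tac.
have lx := lbm_xdot (cfD (cutf f)); have bx := bsupp_xdot (cfD (cutf f)) (cfb (cutf f)).
have H1 := Int_scale_derive mO lu bu (cfD (cutf f)) (cfb (cutf f)) ltr01.
have H2 := Int_scale_derive measurableT lz bz (C1_slice 0 (cfD (cutf f))) (bsupp_slice 0 (cfb (cutf f))) ltr01.
have HP := is_deriveD H1 H2.
have PE : Pall f g = (fun s => \int[leb m.+1]_(x in Om) (u x * cutf f (s *: x))) +
   (fun s => \int[leb m]_x (z x * cutf f (snoc (s *: x, 0)))).
  apply/funext => t; rewrite /Pall /Pint /Pbd; congr (_ + _).
  by apply: eq_Rintegral => x _; rewrite snocZ0.
rewrite -PE in HP.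
have [d1 d10 Hd1] := dq_lim HP eh.
have GD i : exists l, is_derive (1 : R) 1 (fun s : R => \int[leb m.+1]_(x in Om) (cd (cutf f) i x * cd (cutf f) i (s *: x))) l.
  have [D HD] := smooth2_cut i f2.
  by eexists; exact: (Int_scale_derive mO (lcd _ _) (bcd _ _) HD (bcd _ _) ltr01).
have GC : {for 1, continuous (Gr f)}.
  have [l Hl] := choice GD.
  have GS : Gr f = \sum_i fun s =>  \int[leb m.+1]_(x in Om) (cd (cutf f) i x * cd (cutf f) i (s *: x)).
    apply/funext => t; rewrite /Gr fct_sumE (Int_sum mO)// => i.
    split; first by apply: lbmM; [exact: lcd|apply: lbm_dil; exact: lcd].
    by apply: bsuppMl; exact: bcd.
  by rewrite GS; apply: is_derive1_cont (is_derive_sum Hl).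
have GC2 : {for 1, continuous (fun s : R => (s + 1) / s * Gr f s)}.
  apply: cvgM => //; apply: cvgM.
    by apply: cvgD; [exact: cvg_id|exact: cvg_cst].
  by apply: cvgV.
have [d2 d20 Hd2] := cont_eps GC2 eh.
exists (Num.min d1 d2); first by rewrite lt_min d10.
move=> s /andP[s1 sd].
have sd1 : 1 < s < 1 + d1 by rewrite s1 (lt_le_trans sd)// lerD2l ge_min lexx.
have sd2 : `|1 - s| < d2.
  rewrite distrC gtr0_norm ?subr_gt0// ltrBlDl (lt_le_trans sd)// lerD2l ge_min lexx orbT//.
have h1 := Hd1 _ sd1; have h2 := ltW (Hd2 _ sd2).
have LE : L f g = (1 + 1) / 1 * Gr f 1 + (2 * (\int[leb m.+1]_(x in Om) (u x * \sum_i x ord0 i * cd (cutf f) i (1 *: x)) +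
  \int[leb m]_x (z x * \sum_i x ord0 i * cd (cutf f) (il i) (snoc (1 *: x, 0)))) +
   N * Pall f g 1).
  have -> : \int[leb m.+1]_(x in Om) (u x * \sum_i x ord0 i * cd (cutf f) i (1 *: x)) =
     \int[leb m.+1]_(x in Om) (u x * xdot (cd (cutf f)) x).
    apply: eq_Rintegral => x _; congr (_ * _); apply: eq_bigr => i _; by rewrite scale1r.
  have -> : \int[leb m]_x (z x * \sum_i x ord0 i * cd (cutf f) (il i) (snoc (1 *: x, 0))) =
     \int[leb m]_x (z x * xdot (cd (cutf f)) (snoc (x, 0))).
    apply: eq_Rintegral => x _; rewrite xdot_bd; congr (_ * _); apply: eq_bigr => i _; by rewrite scale1r.
  have -> : Pall f g 1 = \int[leb m.+1]_(x in Om) (u x * cutf f x) + \int[leb m]_x (z x * cutf f (snoc (x, 0))).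
    rewrite PE /=; congr (_ + _); apply: eq_Rintegral => x _; by rewrite scale1r.
  have -> : Gr f 1 = \int[leb m.+1]_(x in Om) (\sum_i cd (cutf f) i x ^+ 2).
    by apply: eq_Rintegral => x _; apply: eq_bigr => i _; rewrite scale1r expr2.
  rewrite /L /virial divr1.
  have reord (p q r : R) : p + q + r = (p + r) + q by ring.
  have reord2 (g0 p q r t : R) : (1 + 1) * g0 + (2 * (p + q) + N * (r + t)) =
    (2 * g0 + 2 * p + N * r) + (2 * q + N * t) by ring.
  rewrite reord reord2; congr (_ + _).
    rewrite -!(IntZ mO); [|lbst ..]; rewrite -!(IntD mO); [|lbst ..].
    by apply: eq_Rintegral => x _; rewrite /u; ring.
  rewrite -!(IntZ measurableT); [|lbst ..]; rewrite -!(IntD measurableT); [|lbst ..].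
  by apply: eq_Rintegral => x _; rewrite /z; ring.
rewrite LE opprD addrACA (le_trans (ler_normD _ _))// (splitr eta) lerD//.
Qed.

Definition RF_small (F G : nat -> cfun) := forall eta : R, 0 < eta -> exists J, forall j V,
  (J <= j)%N -> `|RF (F j) (G j) V| <= eta * nn V.

(** Two limits are exchanged. For fixed [j], taking [s] near 1 brings the form at [dtest] close to
    [L]; at this [s], [RF_equi] replaces [j] by any later index [l], and for large [l] the form is
    small because the limit solves the equation. The threshold for [j] comes from [RF_equi] alone,
    so it does not depend on [s]. *)
Lemma L_small (F G : nat -> cfun) : cauchy_nn F -> cauchy_nn G -> (forall j, smooth2 (F j)) ->
  RF_small F G -> forall eta : R, 0 < eta -> exists J, forall j, (J <= j)%N -> `|L (F j) (G j)| <= eta.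
Proof.
move=> cF cG F2 sm eta eta0; have e3 : 0 < eta / 3 by rewrite divr_gt0.
have [J HJ] := RF_equi cF cG e3; exists J => j Jj.
have [d d0 Hd] := RF_lim (G j) (F2 j) e3.
(* The minimum keeps [s] both in the range where [RF_equi] is uniform and within [d] of 1. *)
pose s := 1 + Num.min (d / 2) 1.
have m0 : 0 < Num.min (d / 2) 1 by rewrite lt_min ltr01 divr_gt0.
have s1 : 1 < s by rewrite /s ltrDl.
have s2 : s <= 2 by rewrite /s (_ : 2 = 1 + 1)// lerD2l ge_min lexx orbT.
have sd : s < 1 + d.
  by rewrite /s ltrD2l (le_lt_trans (_ : _ <= d / 2)) ?ge_min ?lexx// ltr_pdivrMr// ltr_pMr// ltr1n.
have s12 : 1 < s <= 2 by rewrite s1.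
have s0 : 0 < s by apply: lt_trans s1.
have sn1 : s != 1 by rewrite gt_eqF.
have [C C0 HC] := nn_dtest s0.
have [B B0 [J1 HB]] := cauchy_bounded cF.
have CB : 0 < C * B + 1 by rewrite ltr_wpDl// mulr_ge0// ltW.
have eCB : 0 < eta / 3 / (C * B + 1) by rewrite divr_gt0.
have [J2 HJ2] := sm _ eCB.
pose l := maxn J (maxn J1 J2).
have [Jl J1l J2l] : [/\ (J <= l)%N, (J1 <= l)%N & (J2 <= l)%N].
  by rewrite /l !leq_max !leqnn !orbT.
have hl : `|(s + 1) / s * Gr (F l) s + dq m (Pall (F l) (G l)) s| <= eta / 3.
  rewrite -(RF_dtest s0)//; apply: (le_trans (HJ2 _ _ J2l)).
  apply: (@le_trans _ _ (eta / 3 / (C * B + 1) * (C * B + 1))); last first.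
    by rewrite divfK// gt_eqF.
  rewrite ler_wpM2l ?(ltW eCB)//.
  apply: (le_trans (HC _)); apply: (@le_trans _ _ (C * B)); last by rewrite lerDl.
  by rewrite ler_wpM2l// HB.
have hj := HJ j l s Jj Jl s12.
have sd' : 1 < s < 1 + d by rewrite s1.
have hL := Hd s sd'.
move: hl hj hL; move: (_ + dq _ _ _) (_ + dq _ _ _) => Yl Yj hl hj hL.
have -> : L (F j) (G j) = (L (F j) (G j) - Yj) + ((Yj - Yl) + Yl) by ring.
apply: (le_trans (ler_normD _ _)).
have := ler_normD (Yj - Yl) Yl; lra.
Qed.

End limit.

(** * Multiplier and commutator under the cut-off *)

Section core.
Variables (R : realType) (m : nat).
Local Notation leb := (lebesgue_rV R).
Local Notation Om := (half_space R m).
Local Notation il i := (lift ord_max i).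
Local Notation hd x := (unsnoc x).1.
Local Notation N := (m.+1%:R).
Local Notation cfun := (cfun R m).
Implicit Types f g h V a b : cfun.

Lemma en_le3 f g h x : f x = g x + h x -> (forall i, cd f i x = cd g i x + cd h i x) ->
  en f x <= 2 * en g x + 2 * en h x.
Proof.
move=> H0 H1; have Q (p q : R) : (p + q) ^+ 2 <= 2 * p ^+ 2 + 2 * q ^+ 2.
  by rewrite -subr_ge0 (_ : _ - _ = (p - q) ^+ 2) ?sqr_ge0//; ring.
rewrite /en !mulrDr !mulr_sumr addrACA -big_split/= H0 lerD//.
by apply: ler_sum => i _; rewrite H1.
Qed.

Lemma nn_trace f : \int[leb m]_x (f (snoc (x, 0)) ^+ 2) <= N2 f.
Proof.
have mO := @measurable_half_space R m.
apply: (le_trans (trace_sq_le (cfD f) (cfb f))).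
apply: (Int_le mO) => [||x _]; [lbst|by split; [exact: lbm_en|exact: bsupp_en]|].
rewrite /en lerD2l (bigD1 ord_max)//= lerDl.
by apply: sumr_ge0 => i _; exact: sqr_ge0.
Qed.

Section cutoff_scale.
Variables (k mu d e : R).
Hypotheses (d0 : 0 < d) (d1 : d <= 1) (e0 : 0 < e) (e1 : e <= 1).
Local Notation cutf := (cutf e0).
Local Notation hcut := (hcut e).

Definition radc a : cfun := CFun (C1M (C1_rad m.+1 d0) (cfD a)) (bsuppMr (srad d) (cfb a)).

Definition etac a b : cfun :=
  CFun (C1_eta k mu d0 (cfD a) (cfD b)) (bsupp_eta k mu d (cfb a) (cfb b)).

Lemma rad_le (x : 'rV[R]_m.+1) : srad d x ^+ 2 <= 1 + sqn x.
Proof. by rewrite rad_sqr addrC lerD2r exprn_ile1// ltW. Qed.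

Lemma en_radc a x (E : R) : (1 + sqn x) * a x ^+ 2 <= E ->
  (forall i, (1 + sqn x) * cd a i x ^+ 2 <= E) -> en (radc a) x <= (1 + N * 4) * E.
Proof.
move=> H1 H2; have rx := rad_le x.
rewrite mulrDl mul1r [in leLHS]/en; apply: lerD.
  rewrite [radc _ _]/= exprMn; apply: le_trans H1.
  by rewrite ler_wpM2r// sqr_ge0.
rewrite -!mulrA; apply: sum_le_card => i.
rewrite [cd _ _ _]/=; have {}H2 := H2 i.
move: H1 H2; set p := a x; move: (cd a i x) => q H1 H2.
have xr : (x ord0 i / srad d x) ^+ 2 <= 1.
  rewrite exprMn exprVn ler_pdivrMr ?exprn_gt0 ?rad_gt0// mul1r rad_sqr.
  by apply: (le_trans (coord_sqn x i)); rewrite lerDl sqr_ge0.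
have P1 : p ^+ 2 <= E by apply: wt_ge1 H1; exact: sqr_ge0.
have P2 : (srad d x * q) ^+ 2 <= E.
  by rewrite exprMn; apply: le_trans H2; rewrite ler_wpM2r// sqr_ge0.
have P3 : (p * (x ord0 i / srad d x)) ^+ 2 <= E.
  by rewrite exprMn; apply: le_trans P1; rewrite ler_piMr// sqr_ge0.
move: P2 P3; move: (srad d x * q) (p * _) => u v P2 P3.
have := sqr_ge0 (u - v); rewrite sqrrB sqrrD.
have -> : u * v *+ 2 = 2 * (u * v) by rewrite mulr_natl.
lra.
Qed.

Lemma nn_radc : exists2 C, 0 <= C & forall f, nn (radc (cutf f)) <= C * nn f.
Proof.
have mO := @measurable_half_space R m.
pose A := (1 + N * 4) * (Acut e) ^+ 2.
have A0 : 0 <= A by apply: mulr_ge0; [rewrite addr_ge0// mulr_ge0|exact: sqr_ge0].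
exists (Num.sqrt A); first exact: sqrtr_ge0.
move=> f; apply: nn_bound; first exact: sqrtr_ge0.
have lf := lbm_en f; have bf := bsupp_en f.
rewrite sqr_sqrtr// -(IntZ mO); last by lbst.
apply: (Int_le mO) => [||x _]; [by split; [exact: lbm_en|exact: bsupp_en]|lbst|].
rewrite /A -mulrA; apply: en_radc => [|i]; first exact: cut_le.
exact: cd_cut_le.
Qed.

(** Multiplication by [r] is bounded from cut functions into H^1, since [r^2 <= 1 + |x|^2] for
    [d <= 1] and the cut-off provides this weight. *)
Lemma nn_etac : exists2 C, 0 <= C & forall f g, nn (cutf (etac (cutf f) (cutf g))) <= C * (nn f + nn g).
Proof.
have [C C0 HC] := nn_radc.
set c1 := Num.sqrt (m.+2%:R * (Acut e) ^+ 2).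
have c10 : 0 <= c1 by exact: sqrtr_ge0.
pose D := 2 * (2 * (c1 + `|mu| * C) + `|2 * k| * C).
have D0 : 0 <= D by rewrite mulr_ge0// addr_ge0// mulr_ge0// addr_ge0// mulr_ge0.
exists (c1 * D); first by rewrite mulr_ge0.
move=> f g; apply: (le_trans (nn_cut e0 e1 _)); rewrite -/c1 -mulrA ler_wpM2l//.
apply: (@le_trans _ _ (2 * (nn (cfunB (cfunZ mu (radc (cutf f))) (cutf f)) + nn (cfunZ (2 * k) (radc (cutf g)))))).
  move: (cutf f) (cutf g) => a b; apply: nn_le3 => [x|i x].
    change (etaf k mu d a b x = mu * (srad d x * a x) - a x + 2 * k * (srad d x * b x)).
    by rewrite /etaf; ring.
  change (Deta k mu d a b (cd a) (cd b) i x =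
    mu * (srad d x * cd a i x + a x * (x ord0 i / srad d x)) - cd a i x +
    2 * k * (srad d x * cd b i x + b x * (x ord0 i / srad d x))).
  by rewrite /Deta; ring.
rewrite /D -mulrA ler_wpM2l//.
have f0 := nn_ge0 f; have g0 := nn_ge0 g.
apply: (@le_trans _ _ ((2 * (c1 + `|mu| * C)) * nn f + `|2 * k| * C * nn g)).
  apply: lerD; last by rewrite nnZ -mulrA ler_wpM2l.
  apply: (le_trans (nnB _ _)); rewrite -mulrA ler_wpM2l// mulrDl addrC lerD//.
    by apply: nn_cut.
  by rewrite nnZ -mulrA ler_wpM2l.
rewrite mulrDl !mulrDr.
have h1 : 0 <= 2 * (c1 + `|mu| * C) * nn g by rewrite !mulr_ge0// addr_ge0// mulr_ge0.
have h2 : 0 <= `|2 * k| * C * nn f by rewrite !mulr_ge0.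
move: h1 h2; rewrite !mulrDr !mulrDl; lra.
Qed.

(** The size of the commutator: at most 1 everywhere, but at most [e (1 + |x|^2)] as well, hence
    small on a fixed compactly supported function when [e] is small. *)
Definition theta (x : 'rV[R]_m.+1) := (1 + sqn x) * chi e x * e.

Lemma theta_le1 x : theta x <= 1.
Proof. by rewrite -ler_pdivlMr// mul1r wchi. Qed.

Lemma theta_ge0 x : 0 <= theta x.
Proof. by rewrite mulr_ge0 ?(ltW e0)// mulr_ge0 ?addr_ge0 ?sqn_ge0// ltW ?chi_gt0. Qed.

Lemma theta_le x : theta x <= e * (1 + sqn x).
Proof.
by rewrite /theta mulrC ler_wpM2l ?(ltW e0)// ler_piMr ?addr_ge0 ?sqn_ge0 ?chi_le1.
Qed.

(** [2 (N + 4)^2] is the constant of [hcut_bracket]; the second summand is five times the sum of the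
    bounds [4], [16], [N^2], [mu^2], [(2 k)^2] on the five squared terms of the multiplier. *)
Definition Ctail := 2 * (N + 4) ^+ 2 + 5 * (20 + N ^+ 2 + mu ^+ 2 + 4 * k ^+ 2).

(** After factoring, the expression is [e chi^3] times [2 B W], with [B] the bracket of [hcut] and
    [W] the multiplier. Both squares are of order [(1 + |x|^2)] times the energy density, and
    [e chi (1 + |x|^2)] is [theta]. *)
Lemma tail_bound f g x :
  - (hcut f x * (2 * xdot (cd (cutf f)) x + N * cutf f x + etaf k mu d (cutf f) (cutf g) x)) <=
  Ctail * (theta x * (en f x + en g x)).
Proof.
have h1 := hcut_bracket e0 f x; have h2 := xdot_sqr_le f x.
have h3 := sqr_le_en f x; have h4 := sqr_le_en g x.
have E1 := en_ge0 f x; have E2 := en_ge0 g x.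
have c0 := chi_gt0 e0 x; have c1 := chi_le1 e0 x; have t1 := chi_sqn e0 x.
have rx := rad_le x; have s0 := sqn_ge0 x.
move: (en f x) (en g x) h1 h2 h3 h4 E1 E2 => F G h1 h2 h3 h4 E1 E2.
have -> : 2 * xdot (cd (cutf f)) x + N * cutf f x + etaf k mu d (cutf f) (cutf g) x =
   chi e x * (2 * xdot (cd f) x + (- (4 * (e * sqn x * chi e x)) * f x + (N - 1) * f x +
     (mu * (srad d x * f x) + 2 * k * (srad d x * g x)))).
  by rewrite xdot_cut /etaf /=; ring.
rewrite /hcut; move: h1; set B := 2 * xdot _ _ + _ * f x => h1.
set t := e * sqn x * chi e x in t1 *.
have t0 : 0 <= t by rewrite mulr_ge0 ?(ltW c0)// mulr_ge0 ?(ltW e0).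
set W := 2 * xdot _ _ + _.
set E := F + G.
have E0 : 0 <= E by rewrite addr_ge0.
have HW : W ^+ 2 <= 5 * (20 + N ^+ 2 + mu ^+ 2 + 4 * k ^+ 2) * ((1 + sqn x) * E).
  have sE : 0 <= sqn x * E by rewrite mulr_ge0.
  have q1 : (2 * xdot (cd f) x) ^+ 2 <= 4 * ((1 + sqn x) * E).
    have -> : (2 * xdot (cd f) x) ^+ 2 = 4 * xdot (cd f) x ^+ 2 by ring.
    apply: (@le_trans _ _ (4 * (sqn x * F))); first by rewrite ler_pM2l.
    rewrite ler_pM2l// /E !mulrDl !mul1r mulrDr.
    have := mulr_ge0 s0 E2; lra.
  have fE : f x ^+ 2 <= (1 + sqn x) * E by rewrite mulrDl mul1r /E; rewrite /E in sE; lra.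
  have gE : g x ^+ 2 <= (1 + sqn x) * E by rewrite mulrDl mul1r /E; rewrite /E in sE; lra.
  have q2 : (- (4 * t) * f x) ^+ 2 <= 16 * ((1 + sqn x) * E).
    have -> : (- (4 * t) * f x) ^+ 2 = 16 * (t ^+ 2 * f x ^+ 2) by ring.
    rewrite ler_pM2l//; apply: le_trans fE; rewrite ler_piMl ?sqr_ge0//.
    by rewrite exprn_ile1.
  have N1 : 1 <= (N : R) by rewrite ler1n.
  have q3 : ((N - 1) * f x) ^+ 2 <= N ^+ 2 * ((1 + sqn x) * E).
    rewrite exprMn; apply: ler_pM; rewrite ?sqr_ge0//.
    by rewrite lerXn2r ?nnegrE ?subr_ge0//; lra.
  have rE (p : R) en0 : 0 <= en0 -> p ^+ 2 <= en0 -> en0 <= E -> (srad d x * p) ^+ 2 <= (1 + sqn x) * E.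
    move=> en00 pe eE; rewrite exprMn; apply: ler_pM; rewrite ?sqr_ge0//.
    exact: le_trans eE.
  have q4 : (mu * (srad d x * f x)) ^+ 2 <= mu ^+ 2 * ((1 + sqn x) * E).
    by rewrite exprMn ler_wpM2l ?sqr_ge0//; apply: (rE _ (F)) => //; rewrite lerDl.
  have q5 : (2 * k * (srad d x * g x)) ^+ 2 <= (2 * k) ^+ 2 * ((1 + sqn x) * E).
    by rewrite exprMn ler_wpM2l ?sqr_ge0//; apply: (rE _ (G)) => //; rewrite lerDr.
  rewrite /W; move: q1 q2 q3 q4 q5.
  move: (2 * xdot _ _) (- (4 * t) * _) ((N - 1) * _) (mu * (_ * _)) (2 * k * (_ * _)) => z1 z2 z3 z4 z5 q1 q2 q3 q4 q5.
  (* Cauchy-Schwarz against [(1, 1, 1, 1, 1)] bounds the square of the five-term sum. *)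
  have := sum_CS (fun _ : 'I_5 => 1) (fun i : 'I_5 => nth 0 [:: z1; z2; z3; z4; z5] i).
  rewrite !big_ord_recl !big_ord0 /=.
  set Q := (1 + sqn x) * E in q1 q2 q3 q4 q5 *.
  have -> : 5 * (20 + N ^+ 2 + mu ^+ 2 + 4 * k ^+ 2) * Q =
    5 * (4 * Q + 16 * Q + N ^+ 2 * Q + mu ^+ 2 * Q + (2 * k) ^+ 2 * Q) by ring.
  lra.
have HB : B ^+ 2 <= 2 * (N + 4) ^+ 2 * ((1 + sqn x) * E).
  apply: (le_trans h1); rewrite ler_wpM2l ?mulr_ge0 ?sqr_ge0//.
  by rewrite ler_wpM2l ?addr_ge0// /E lerDl.
have -> : - (- (2 * e * chi e x ^+ 2 * B) * (chi e x * W)) = (e * chi e x) * (chi e x ^+ 2 * (2 * (B * W))) by ring.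
have BW : 2 * (B * W) <= Ctail * ((1 + sqn x) * E).
  rewrite /Ctail mulrDl; have := sqr_ge0 (B - W); nra.
have CE0 : 0 <= Ctail * ((1 + sqn x) * E).
  apply: mulr_ge0; last by rewrite mulr_ge0// addr_ge0.
  rewrite /Ctail; have := sqr_ge0 (N + 4 : R); have := sqr_ge0 (N : R); have := sqr_ge0 mu.
  have := sqr_ge0 k; lra.
have -> : Ctail * (theta x * E) = (e * chi e x) * (Ctail * ((1 + sqn x) * E)) by rewrite /theta; ring.
rewrite ler_pM2l ?mulr_gt0//.
apply: (@le_trans _ _ (chi e x ^+ 2 * (Ctail * ((1 + sqn x) * E)))).
  by rewrite ler_wpM2l ?sqr_ge0.
by rewrite ler_piMl// exprn_ile1// ltW.
Qed.

Lemma cutfN f : cf (cutf (cfunN f)) = fun x => - cutf f x.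
Proof. by apply/funext => x /=; rewrite mulrN. Qed.

Lemma cd_cutfN f : cd (cutf (cfunN f)) = fun i x => - cd (cutf f) i x.
Proof. by apply/funext => i; apply/funext => x /=; ring. Qed.

End cutoff_scale.

End core.

(** * Vanishing of the approximants *)

Section core_theorem.
Variables (R : realType) (m : nat).
Local Notation leb := (lebesgue_rV R).
Local Notation Om := (half_space R m).
Local Notation il i := (lift ord_max i).
Local Notation hd x := (unsnoc x).1.
Local Notation N := (m.+1%:R).
Local Notation cfun := (cfun R m).
Implicit Types f g h V a b : cfun.
Variables be1 be2 : 'rV[R]_m -> R.
Variables ga1 ga2 : 'I_m -> 'rV[R]_m -> R.
Variables (K l1 l2 c0 : R).
Hypotheses (lbe1 : lbm be1) (lbe2 : lbm be2).
Hypotheses (lga1 : forall i, lbm (ga1 i)) (lga2 : forall i, lbm (ga2 i)).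
Hypothesis w1 : forall i, wder i be1 (ga1 i).
Hypothesis w2 : forall i, wder i be2 (ga2 i).
Hypotheses (K0 : 0 <= K) (be1K : forall x, `|be1 x| <= K) (be2K : forall x, `|be2 x| <= K).
Hypotheses (ga1K : forall i x, `|ga1 i x| <= K) (ga2K : forall i x, `|ga2 i x| <= K).
Hypothesis be1_ge0 : forall x, 0 <= be1 x.
Hypothesis ga1_le0 : forall x, xdot ga1 x <= 0.
Hypothesis m3 : (3 <= m)%N.
Hypothesis c01 : 0 <= c0 < 1.
Hypothesis rot : forall w1 Dw1 w2 Dw2,
  C1 w1 Dw1 -> bsupp w1 -> C1 w2 Dw2 -> bsupp w2 ->
  \int[leb m]_x (2 * be2 x * \sum_i (x ord0 i *
    (w1 (snoc (x, 0)) * Dw2 (il i) (snoc (x, 0)) -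
     w2 (snoc (x, 0)) * Dw1 (il i) (snoc (x, 0))))) <=
  c0 * \int[leb m.+1]_(x in Om) (\sum_i (Dw1 i x ^+ 2 + Dw2 i x ^+ 2)).
Variables F G : nat -> cfun.
Hypotheses (cF : cauchy_nn F) (cG : cauchy_nn G).
Hypotheses (F2 : forall j, smooth2 (F j)) (G2 : forall j, smooth2 (G j)).
Hypothesis small1 : RF_small be1 be2 l1 l2 F G.
Hypothesis small2 : RF_small be1 be2 l1 l2 G (fun j => cfunN (F j)).

(** One power of the weight comes from Hardy's inequality and two from [chi^2 >= (1 + |x|^2)^-2],
    valid for [e <= 1]. The quantity is therefore free of [e] and [d]. *)
Definition mass f g := \int[leb m.+1]_(x in Om) ((f x ^+ 2 + g x ^+ 2) * (1 + sqn x)^-1 ^+ 3).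

Let wt0 (x : 'rV[R]_m.+1) : 0 < 1 + sqn x. Proof. by rewrite ltr_pwDl// sqn_ge0. Qed.

Lemma lbm_wt : lbm (fun x : 'rV[R]_m.+1 => (1 + sqn x)^-1).
Proof.
exact: (C1_lbm (C1_inv (C1D (C1_cst m.+1 1) (C1_sqn R m.+1)) (fun x => lt0r_neq0 (wt0 x)))).
Qed.

(** The equation is tested with the approximants themselves. In the sum of the two real forms the
    [be2] and [l2] terms cancel and the others are nonnegative, so the gradient energy is at most
    [eps]; Hardy's inequality concludes. *)
Lemma mass_small_nonpos : l1 <= 0 -> forall eps : R, 0 < eps -> exists J, forall j, (J <= j)%N ->
  mass (F j) (G j) <= eps.
Proof.
move=> l10 eps eps0; have mO := @measurable_half_space R m.
have [B1 B10 [J1 H1]] := cauchy_bounded cF; have [B2 B20 [J2 H2]] := cauchy_bounded cG.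
have B0 : 0 < B1 + B2 by rewrite addr_gt0.
have e0 : 0 < eps / (B1 + B2) by rewrite divr_gt0.
have [J3 H3] := small1 e0; have [J4 H4] := small2 e0.
exists (maxn (maxn J1 J2) (maxn J3 J4)) => j; rewrite !geq_max => /andP[/andP[j1 j2] /andP[j3 j4]].
have := H3 j (F j) j3; have := H4 j (G j) j4; move: (H1 j j1) (H2 j j2).
move: (F j) (G j) => f g fB gB h4 h3.
have lw := lbm_wt.
have hardyfg := hardy m3 (cfD f) (cfb f) (cfD g) (cfb g).
have massle : mass f g <= \int[leb m.+1]_(x in Om) ((f x ^+ 2 + g x ^+ 2) * (1 + sqn x)^-1).
  apply: (Int_le mO) => [||x _]; [lbst|lbst|].
  rewrite ler_wpM2l ?addr_ge0 ?sqr_ge0// exprS ler_piMr ?invr_ge0 ?(ltW (wt0 x))//.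
  by rewrite exprn_ile1 ?invr_ge0 ?(ltW (wt0 x))// invf_le1// lerDl sqn_ge0.
have sumE : RF be1 be2 l1 l2 f g f + RF be1 be2 l1 l2 g (cfunN f) g =
  \int[leb m.+1]_(x in Om) (\sum_i (cd f i x ^+ 2 + cd g i x ^+ 2)) +
  \int[leb m]_x (be1 x * (f (snoc (x, 0)) ^+ 2 + g (snoc (x, 0)) ^+ 2)) +
  - l1 * \int[leb m.+1]_(x in Om) (f x ^+ 2 + g x ^+ 2).
  have reord (a1 b1 c1 a2 b2 c2 : R) : (a1 + b1 - c1) + (a2 + b2 - c2) = (a1 + a2) + (b1 + b2) + (- c1 - c2) by ring.
  rewrite /RF /rform reord; congr (_ + _ + _).
  - rewrite -(IntD mO); [|lbst|lbst]; apply: eq_Rintegral => x _.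
    by rewrite -big_split/=; apply: eq_bigr => i _; rewrite !expr2.
  - rewrite -(IntD measurableT); [|lbst|lbst]; apply: eq_Rintegral => x _ /=; ring.
  - rewrite -(IntZ mO); [|lbst]; rewrite -(IntN mO); [|lbst]; rewrite -(IntB mO); [|lbst|lbst].
    by apply: eq_Rintegral => x _ /=; ring.
have p1 : 0 <= \int[leb m]_x (be1 x * (f (snoc (x, 0)) ^+ 2 + g (snoc (x, 0)) ^+ 2)).
  by apply: Rintegral_ge0 => x _; rewrite mulr_ge0// addr_ge0 ?sqr_ge0.
have p2 : 0 <= - l1 * \int[leb m.+1]_(x in Om) (f x ^+ 2 + g x ^+ 2).
  rewrite mulr_ge0 ?oppr_ge0//.
  by apply: Rintegral_ge0 => x _; rewrite addr_ge0 ?sqr_ge0.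
have h34 : RF be1 be2 l1 l2 f g f + RF be1 be2 l1 l2 g (cfunN f) g <= eps.
  have -> : eps = eps / (B1 + B2) * (B1 + B2) by rewrite divfK// gt_eqF.
  rewrite mulrDr; apply: lerD.
    by apply: (le_trans (ler_norm _)); apply: (le_trans h3); rewrite ler_wpM2l// ltW.
  by apply: (le_trans (ler_norm _)); apply: (le_trans h4); rewrite ler_wpM2l// ltW.
rewrite sumE in h34; apply: (le_trans massle); apply: (le_trans hardyfg); lra.
Qed.

Lemma mass_cutf (e : R) (e0 : 0 < e) (e1 : e <= 1) f g :
  mass f g <= \int[leb m.+1]_(x in Om) ((cutf e0 f x ^+ 2 + cutf e0 g x ^+ 2) * (1 + sqn x)^-1).
Proof.
have mO := @measurable_half_space R m; have lw := lbm_wt.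
apply: (Int_le mO) => [||x _]; [lbst|lbst|].
have chi1 : (1 + sqn x)^-1 <= chi e x.
  by rewrite lef_pV2 ?posrE ?wt0 ?chi_den_gt0// lerD2l ler_piMl ?sqn_ge0.
rewrite [_^-1 ^+ 3]exprSr mulrA ler_wpM2r ?invr_ge0 ?(ltW (wt0 x))//.
have -> : cutf e0 f x ^+ 2 + cutf e0 g x ^+ 2 = (f x ^+ 2 + g x ^+ 2) * chi e x ^+ 2 by rewrite /=; ring.
rewrite ler_wpM2l ?addr_ge0 ?sqr_ge0//.
have a0 : 0 <= (1 + sqn x)^-1 by rewrite invr_ge0 (ltW (wt0 x)).
by rewrite lerXn2r// nnegrE// (ltW (chi_gt0 e0 x)).
Qed.

(** The choices are made in the order [eta], [J0], [e], [d], [j]. The cut-off [e] has to make the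
    commutator small at index [J0], to which all later approximants are H^1-close; [d] follows [e]
    because the bound [Bt] on the boundary masses depends on [e]; [j] is last because the thresholds
    of [L_small] and [RF_small] are needed for these [e] and [d]. *)
Lemma mass_small_pos : 0 < l1 -> forall eps : R, 0 < eps -> exists J, forall j, (J <= j)%N ->
  mass (F j) (G j) <= eps.
Proof.
move=> l10 eps eps0; have mO := @measurable_half_space R m.
have [c0_ge0 c0_lt1] := andP c01; have c01' : 0 <= c0 <= 1 by rewrite c0_ge0 ltW.
have lw := lbm_wt.
have lw' : lbm (fun x : 'rV[R]_m.+1 => 1 + sqn x).
  exact: (C1_lbm (C1D (C1_cst m.+1 1) (C1_sqn R m.+1))).
have [k [mu [mu0 kE muE]]] : exists k mu : R, [/\ 0 <= mu, k ^+ 2 = l1 & mu * k = l2].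
  have s0 : 0 < Num.sqrt l1 by rewrite sqrtr_gt0.
  have [l20|l20] := lerP 0 l2.
    exists (Num.sqrt l1), (l2 / Num.sqrt l1); rewrite divr_ge0 ?(ltW s0)//.
    by rewrite sqr_sqrtr ?(ltW l10)// divfK// gt_eqF.
  exists (- Num.sqrt l1), (- l2 / Num.sqrt l1); rewrite divr_ge0 ?oppr_ge0 ?(ltW s0) ?(ltW l20)//.
  rewrite sqrrN sqr_sqrtr ?(ltW l10)//; split=> //.
  by field; rewrite gt_eqF.
pose C := Ctail m k mu.
have C0 : 0 <= C.
  rewrite /C /Ctail; have := sqr_ge0 (N + 4 : R); have := sqr_ge0 (N : R); have := sqr_ge0 mu.
  have := sqr_ge0 k; lra.
(* Eight portions: two for [L], two for the forms tested with [etac], three for the commutator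
   tails, one for the boundary error proportional to [d]. *)
pose eta := eps * (1 - c0) / 8.
have eta0 : 0 < eta by rewrite /eta divr_gt0// mulr_gt0// subr_gt0.
have C1' : 0 < C + 1 by rewrite ltr_wpDl.
(* Chosen so that the total tail [Th <= 6 et1] satisfies [2 C Th <= 3 eta]. *)
pose et1 := eta / (C + 1) / 4.
have et10 : 0 < et1 by apply: divr_gt0 => //; apply: divr_gt0.
pose set1 := Num.sqrt et1; have set10 : 0 < set1 by rewrite sqrtr_gt0.
have [J1 HJ1] := cF set10; have [J2 HJ2] := cG set10.
pose J0 := maxn J1 J2.
(* Finite because the functions at the fixed index [J0] have bounded support; this is why [e] is
   chosen for [J0] and not for the varying [j]. *)
pose W := \int[leb m.+1]_(x in Om) ((1 + sqn x) * en (F J0) x) +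
          \int[leb m.+1]_(x in Om) ((1 + sqn x) * en (G J0) x).
have W0 : 0 <= W.
  by apply: addr_ge0; apply: Rintegral_ge0 => x _; rewrite mulr_ge0 ?en_ge0 ?(ltW (wt0 x)).
have W1 : 0 < W + 1 by rewrite ltr_wpDl.
pose e := Num.min 1 (et1 / (W + 1)).
have e0 : 0 < e by rewrite lt_min ltr01 divr_gt0.
have e1 : e <= 1 by rewrite ge_min lexx.
have eW : e * W <= et1.
  apply: (@le_trans _ _ (et1 / (W + 1) * (W + 1))); last by rewrite divfK// gt_eqF.
  by apply: ler_pM; rewrite ?(ltW e0)// ?lerDl// ge_min lexx orbT.
have [B1 B10 [J3 H3]] := cauchy_bounded cF; have [B2 B20 [J4 H4]] := cauchy_bounded cG.
pose c := Num.sqrt (m.+2%:R * (Acut e) ^+ 2).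
have cc0 : 0 <= c by exact: sqrtr_ge0.
pose Bt := (c * B1) ^+ 2 + (c * B2) ^+ 2.
have Bt0 : 0 <= Bt by rewrite addr_ge0 ?sqr_ge0.
pose D := 2 * `|k| * K * Bt; have D0 : 0 <= D by rewrite !mulr_ge0.
have D1 : 0 < D + 1 by rewrite ltr_wpDl.
pose d := Num.min 1 (eta / (D + 1)).
have d0 : 0 < d by rewrite lt_min ltr01 divr_gt0.
have d1 : d <= 1 by rewrite ge_min lexx.
have dD : d * D <= eta.
  apply: (@le_trans _ _ (eta / (D + 1) * (D + 1))); last by rewrite divfK// gt_eqF.
  by apply: ler_pM; rewrite ?(ltW d0)// ?lerDl// ge_min lexx orbT.
have [Ce Ce0 HCe] := @nn_etac R m k mu d e d0 d1 e0 e1.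
pose CB := Ce * (B1 + B2) + 1.
have CB0 : 0 < CB by rewrite ltr_wpDl// mulr_ge0// addr_ge0// ltW.
have eCB : 0 < eta / CB by rewrite divr_gt0.
have [J5 H5] := small1 eCB; have [J6 H6] := small2 eCB.
have cNF : cauchy_nn (fun j => cfunN (F j)).
  move=> x x0; have [J HJ] := cF x0; exists J => j l h1 h2.
  apply: le_trans (HJ j l h1 h2); rewrite le_eqVlt; apply/orP; left; apply/eqP.
  rewrite /nn /N2; congr Num.sqrt; apply: eq_Rintegral => y _; rewrite /en /=.
  by rewrite -opprD sqrrN; congr (_ + _); apply: eq_bigr => i _; rewrite -opprD sqrrN.
have [J7 H7] := L_small lbe1 lbe2 lga1 lga2 w1 w2 K0 be1K be2K ga1K ga2K e0 e1 cF cG F2 small1 eta0.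
have [J8 H8] := L_small lbe1 lbe2 lga1 lga2 w1 w2 K0 be1K be2K ga1K ga2K e0 e1 cG cNF G2 small2 eta0.
exists (maxn (maxn J0 (maxn J3 J4)) (maxn (maxn J5 J6) (maxn J7 J8))) => j.
rewrite !geq_max => /andP[/andP[/andP[j1 j2] /andP[j3 j4]] /andP[/andP[j5 j6] /andP[j7 j8]]].
have L1 := H7 j j7; have L2 := H8 j j8.
have nF := H3 j j3; have nG := H4 j j4.
(* The energy at [j] is split into twice that at [J0] plus twice that of the difference:
   [theta <= e (1 + |x|^2)] serves the first part and [theta <= 1] the second. *)
have enb (Q : nat -> cfun) J : (forall i l, (J <= i)%N -> (J <= l)%N -> nn (cfunB (Q i) (Q l)) <= set1) ->
    (J <= j)%N -> (J <= J0)%N ->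
    \int[leb m.+1]_(x in Om) (theta e x * en (Q j) x) <=
    2 * (e * \int[leb m.+1]_(x in Om) ((1 + sqn x) * en (Q J0) x)) + 2 * et1.
  move=> HQ Jj JJ0.
  have l1' := lbm_en (Q j); have b1' := bsupp_en (Q j).
  have l2' := lbm_en (Q J0); have b2' := bsupp_en (Q J0).
  have l3' := lbm_en (cfunB (Q j) (Q J0)); have b3' := bsupp_en (cfunB (Q j) (Q J0)).
  have lth : lbm (theta e : 'rV[R]_m.+1 -> R).
    by rewrite /theta; have lc := C1_lbm (C1_chi m e0); lbm_tac.
  have N2e : N2 (cfunB (Q j) (Q J0)) <= et1.
    rewrite -nn_sqr -[leRHS](sqr_sqrtr (ltW et10)) lerXn2r ?nnegrE ?nn_ge0 ?sqrtr_ge0//.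
    exact: HQ.
  apply: le_trans (lerD (lexx _) (_ : 2 * N2 (cfunB (Q j) (Q J0)) <= _)); last by rewrite ler_pM2l.
  rewrite -(IntZ mO); [|lbst]; rewrite -[X in _ <= X + _](IntZ mO); [|lbst].
  rewrite -[X in _ <= _ + X](IntZ mO); [|lbst]; rewrite -(IntD mO); [|lbst|lbst].
  apply: (Int_le mO) => [||x _]; [lbst|lbst|].
  have h : en (Q j) x <= 2 * en (Q J0) x + 2 * en (cfunB (Q j) (Q J0)) x.
    by rewrite addrC; apply: en_le3 => [|i] /=; rewrite subrK.
  apply: (le_trans (ler_wpM2l (theta_ge0 e0 x) h)); rewrite mulrDr; apply: lerD.
    rewrite mulrCA ler_pM2l// mulrA ler_wpM2r ?en_ge0// theta_le//.
  by rewrite mulrCA ler_pM2l// ler_piMl ?en_ge0// theta_le1.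
have J1J0 : (J1 <= J0)%N by rewrite /J0 leq_maxl.
have J2J0 : (J2 <= J0)%N by rewrite /J0 leq_maxr.
have enF := enb F J1 HJ1 j1 J1J0; have enG := enb G J2 HJ2 j2 J2J0.
have rfF := H5 j (cutf e0 (etac k mu d0 (cutf e0 (F j)) (cutf e0 (G j)))) j5.
have rfG := H6 j (cutf e0 (etac k mu d0 (cutf e0 (G j)) (cutf e0 (cfunN (F j))))) j6.
have HCF := HCe (F j) (G j); have HCG := HCe (G j) (cfunN (F j)).
have nNF : nn (cfunN (F j)) = nn (F j).
  rewrite /nn /N2; congr Num.sqrt; apply: eq_Rintegral => y _; rewrite /en /=.
  by rewrite sqrrN; congr (_ + _); apply: eq_bigr => i _; rewrite sqrrN.
rewrite nNF in HCG.
move: L1 L2 nF nG enF enG rfF rfG HCF HCG nNF.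
move: (F j) (G j) => f g L1 L2 nF nG enF enG rfF rfG HCF HCG nNF.
have {}rfF : `|RF be1 be2 l1 l2 f g (cutf e0 (etac k mu d0 (cutf e0 f) (cutf e0 g)))| <= eta.
  apply: (le_trans rfF); apply: (@le_trans _ _ (eta / CB * CB)); last by rewrite divfK// gt_eqF.
  rewrite ler_wpM2l ?(ltW eCB)//; apply: (le_trans HCF); rewrite /CB.
  apply: (@le_trans _ _ (Ce * (B1 + B2))); last by rewrite lerDl.
  by rewrite ler_wpM2l// lerD.
have {}rfG : `|RF be1 be2 l1 l2 g (cfunN f) (cutf e0 (etac k mu d0 (cutf e0 g) (cutf e0 (cfunN f))))| <= eta.
  apply: (le_trans rfG); apply: (@le_trans _ _ (eta / CB * CB)); last by rewrite divfK// gt_eqF.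
  rewrite ler_wpM2l ?(ltW eCB)//; apply: (le_trans HCG); rewrite /CB.
  apply: (@le_trans _ _ (Ce * (B1 + B2))); last by rewrite lerDl.
  by rewrite ler_wpM2l// addrC lerD.
have Vg := virial_ge lbe1 lbe2 k mu0 d0 lga1 w1 be1_ge0 ga1_le0 be2K m3 c01' rot
  (cfD (cutf e0 f)) (cfb (cutf e0 f)) (cfD (cutf e0 g)) (cfb (cutf e0 g)).
rewrite kE muE -!(cutfN e0) -!(cd_cutfN e0) in Vg.
have rc1 := rform_cut e0 be1 be2 l1 l2 f g (etac k mu d0 (cutf e0 f) (cutf e0 g)).
have rc2 := rform_cut e0 be1 be2 l1 l2 g (cfunN f) (etac k mu d0 (cutf e0 g) (cutf e0 (cfunN f))).
have lc := C1_lbm (C1_chi m e0).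
have lth : lbm (theta e : 'rV[R]_m.+1 -> R) by rewrite /theta; lbm_tac.
have lhf := lbm_hcut e0 f; have bhf := bsupp_hcut e f.
have lhg := lbm_hcut e0 g; have bhg := bsupp_hcut e g.
have lef := lbm_en f; have bef := bsupp_en f; have leg := lbm_en g; have beg := bsupp_en g.
have lxf := lbm_xdot (cfD (cutf e0 f)); have bxf := bsupp_xdot (cfD (cutf e0 f)) (cfb (cutf e0 f)).
have lxg := lbm_xdot (cfD (cutf e0 g)); have bxg := bsupp_xdot (cfD (cutf e0 g)) (cfb (cutf e0 g)).
have enN : en (cfunN f) = en f.
  by apply/funext => y; rewrite /en /= sqrrN; congr (_ + _); apply: eq_bigr => i _; rewrite sqrrN.
pose Th := \int[leb m.+1]_(x in Om) (theta e x * (en f x + en g x)).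
have tail (p q : cfun) : (forall x, en p x + en q x = en f x + en g x) ->
   - (\int[leb m.+1]_(x in Om) (hcut e p x * (2 * xdot (cd (cutf e0 p)) x + N * cutf e0 p x))) -
   \int[leb m.+1]_(x in Om) (hcut e p x * etac k mu d0 (cutf e0 p) (cutf e0 q) x) <= C * Th.
  move=> pq; have lhp := lbm_hcut e0 p; have bhp := bsupp_hcut e p.
  have lxp := lbm_xdot (cfD (cutf e0 p)); have bxp := bsupp_xdot (cfD (cutf e0 p)) (cfb (cutf e0 p)).
  rewrite /Th -opprD -(IntD mO); [|lbst|lbst]; rewrite -(IntN mO); [|lbst].
  rewrite -(IntZ mO); [|lbst].
  apply: (Int_le mO) => [||x _]; [lbst|lbst|].
  rewrite -pq -mulrDr; exact: tail_bound.
have tF := tail f g (fun x => erefl).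
have tG : - (\int[leb m.+1]_(x in Om) (hcut e g x * (2 * xdot (cd (cutf e0 g)) x + N * cutf e0 g x))) -
   \int[leb m.+1]_(x in Om) (hcut e g x * etac k mu d0 (cutf e0 g) (cutf e0 (cfunN f)) x) <= C * Th.
  by apply: tail => x; rewrite enN addrC.
have ThE : Th <= 6 * et1.
  rewrite /Th; have -> : \int[leb m.+1]_(x in Om) (theta e x * (en f x + en g x)) =
    \int[leb m.+1]_(x in Om) (theta e x * en f x) + \int[leb m.+1]_(x in Om) (theta e x * en g x).
    by rewrite -(IntD mO); [|lbst|lbst]; apply: eq_Rintegral => x _; rewrite mulrDr.
  apply: (le_trans (lerD enF enG)); rewrite (_ : 6 * et1 = 2 * et1 + 4 * et1); last by ring.
  rewrite [leLHS](_ : _ = 2 * (e * W) + 4 * et1); last by rewrite /W; ring.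
  by rewrite lerD2r ler_pM2l.
have CTh : 2 * (C * Th) <= 3 * eta.
  apply: (@le_trans _ _ (2 * (C * (6 * et1)))); first by rewrite ler_pM2l// ler_wpM2l.
  have h : et1 * 4 * (C + 1) = eta by rewrite /et1; field; rewrite gt_eqF.
  rewrite -h -subr_ge0 (_ : _ - _ = 12 * et1); last by ring.
  by rewrite mulr_ge0// ltW.
have bdE : 2 * `|k| * K * d * \int[leb m]_x (cutf e0 f (snoc (x, 0)) ^+ 2 + cutf e0 g (snoc (x, 0)) ^+ 2) <= eta.
  apply: le_trans dD; rewrite /D (_ : d * (2 * `|k| * K * Bt) = 2 * `|k| * K * d * Bt); last by ring.
  apply: ler_wpM2l; first by rewrite !mulr_ge0// ltW.
  rewrite (IntD measurableT); [|lbst|lbst].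
  have bb (p : cfun) (B : R) : nn p <= B ->
     \int[leb m]_x (cutf e0 p (snoc (x, 0)) ^+ 2) <= (c * B) ^+ 2.
    move=> pB; apply: (le_trans (nn_trace _)); rewrite -nn_sqr lerXn2r ?nnegrE ?nn_ge0//.
      by rewrite mulr_ge0// (le_trans (nn_ge0 p)).
    by apply: (le_trans (nn_cut e0 e1 p)); rewrite ler_wpM2l.
  by rewrite /Bt lerD// bb.
have massle := mass_cutf e0 e1 f g.
have c0p : 0 < 1 - c0 by rewrite subr_gt0.
rewrite -(ler_pM2l c0p); apply: (le_trans (ler_wpM2l (ltW c0p) massle)).
apply: (le_trans Vg).
have epsE : (1 - c0) * eps = 8 * eta by rewrite /eta; field.
rewrite epsE.
rewrite /L in L1 L2; rewrite /RF rc1 in rfF; rewrite /RF rc2 in rfG.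
move: L1 L2 rfF rfG tF tG CTh bdE; rewrite !ler_norml.
set V1 := virial _ _ _ _ _ _ _; set V2 := virial _ _ _ _ _ _ _.
set I1 := \int[_]_(_ in _) _; set I2 := \int[_]_(_ in _) _.
set X1 := rform _ _ _ _ _ _ _ _ _; set X2 := rform _ _ _ _ _ _ _ _ _.
set T1 := \int[_]_(_ in _) _; set T2 := \int[_]_(_ in _) _.
move=> /andP[_ L1] /andP[_ L2] /andP[_ rfF] /andP[_ rfG] tF tG CTh.
set Bd := _ * \int[_]_(_ in _) _ => bdE.
have := lerD (lerD (lerD L1 L2) (lerD rfF rfG)) (lerD (lerD tF tG) (lerD CTh bdE)).
rewrite -subr_ge0 -[X in _ -> is_true X]subr_ge0; congr (0 <= _); ring.
Qed.

Lemma mass_small (eps : R) : 0 < eps -> exists J, forall j, (J <= j)%N ->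
  mass (F j) (G j) <= eps.
Proof.
have [l10|l10] := lerP l1 0; first exact: mass_small_nonpos.
exact: mass_small_pos.
Qed.

End core_theorem.

(** * Density of smooth functions *)

Section l1l2.
Context d (T : measurableType d) (R : realType) (mu : {measure set T -> \bar R}).
Implicit Types (b f g h : T -> R).

Definition L1fun f := mu.-integrable setT (EFin \o f).
Local Notation I f := (\int[mu]_x (f x)).

Lemma l1_meas f : L1fun f -> measurable_fun setT f.
Proof. by move=> /integrableP[/measurable_EFinP]. Qed.

Lemma l1D f g : L1fun f -> L1fun g -> L1fun (fun x => f x + g x).
Proof. by move=> hf hg; have := integrableD measurableT hf hg. Qed.

Lemma l1Z (c : R) f : L1fun f -> L1fun (fun x => c * f x).
Proof. by move=> hf; have := integrableZl measurableT c hf. Qed.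

Lemma l1N f : L1fun f -> L1fun (fun x => - f x).
Proof. by move=> hf; have := integrableN hf. Qed.

Lemma l1B f g : L1fun f -> L1fun g -> L1fun (fun x => f x - g x).
Proof. by move=> hf hg; apply: l1D hf (l1N hg). Qed.

Lemma l1_norm f : L1fun f -> L1fun (fun x => `|f x|).
Proof. by move=> hf; have := integrable_abse hf. Qed.

Lemma l1_le f g : measurable_fun setT f -> L1fun g -> (forall x, `|f x| <= g x) -> L1fun f.
Proof.
move=> mf lg fg; apply: (@le_integrable _ _ _ mu _ measurableT _ (EFin \o g)) => //.
  exact/measurable_EFinP.
by move=> x _ /=; rewrite lee_fin (le_trans (fg x))// ler_norm.
Qed.

Lemma Idct (f_ : nat -> T -> R) f g : (forall k, measurable_fun setT (f_ k)) ->
  (forall x, f_ ^~ x @ \oo --> f x) -> L1fun g -> (forall k x, `|f_ k x| <= g x) ->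
  L1fun f /\ forall e : R, 0 < e -> exists K, forall k, (K <= k)%N -> `|I (f_ k) - I f| <= e.
Proof.
move=> mf_ cvg lg fg.
have mf : measurable_fun setT f.
  by apply: (@measurable_fun_cvg _ _ _ setT f_) => // x _; exact: cvg.
have lf_ k : L1fun (f_ k) by exact: l1_le (mf_ k) lg _.
have [|||||h1 h2 h3] := @dominated_convergence _ _ _ mu setT measurableT
  (fun k => EFin \o f_ k) (EFin \o f) (EFin \o g).
- by move=> k; exact/measurable_EFinP.
- exact/measurable_EFinP.
- by apply: aeW => x _; apply: cvg_EFin (cvg x); exact: nearW.
- exact: lg.
- by apply: aeW => x k _ /=; rewrite lee_fin.
split=> // e e0.
have h4 : I (f_ k) @[k --> \oo] --> I f.
  by apply: fine_cvg; rewrite fineK; [exact: h3|exact: integrable_fin_num].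
have /cvgrPdist_le/(_ e e0)[K _ HK] := h4.
by exists K => k Kk; rewrite distrC; exact: HK.
Qed.

Definition L2fun f := measurable_fun setT f /\ L1fun (fun x => f x ^+ 2).
Definition n2 f := I (fun x => f x ^+ 2).

Lemma n2_ge0 f : 0 <= n2 f.
Proof. by apply: Rintegral_ge0 => x _; exact: sqr_ge0. Qed.

Lemma l2_le f g : measurable_fun setT f -> L2fun g -> (forall x, f x ^+ 2 <= g x ^+ 2) -> L2fun f.
Proof.
move=> mf [_ lg] fg; split=> //; apply: l1_le lg _; first exact: measurable_funX.
by move=> x; rewrite ger0_norm ?sqr_ge0.
Qed.

Lemma sqrD_le (a b : R) : (a + b) ^+ 2 <= 2 * a ^+ 2 + 2 * b ^+ 2.
Proof. by have := sqr_ge0 (a - b); rewrite sqrrB sqrrD => h; lra. Qed.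

Lemma l2D f g : L2fun f -> L2fun g -> L2fun (fun x => f x + g x).
Proof.
move=> [mf lf] [mg lg]; split; first exact: measurable_funD.
apply: (@l1_le _ (fun x => 2 * f x ^+ 2 + 2 * g x ^+ 2)).
- by apply: measurable_funX; exact: measurable_funD.
- by apply: l1D; exact: l1Z.
- by move=> x; rewrite ger0_norm ?sqr_ge0// sqrD_le.
Qed.

Lemma l2Z (c : R) f : L2fun f -> L2fun (fun x => c * f x).
Proof.
move=> [mf lf]; split; first exact: measurable_funM.
have -> : (fun x => (c * f x) ^+ 2) = fun x => c ^+ 2 * f x ^+ 2.
  by apply/funext => x; rewrite exprMn.
exact: l1Z.
Qed.

Lemma l2N f : L2fun f -> L2fun (fun x => - f x).
Proof.
move=> /(l2Z (-1)); rewrite (_ : (fun x => -1 * f x) = fun x => - f x)//.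
by apply/funext => x; rewrite mulN1r.
Qed.

Lemma l2B f g : L2fun f -> L2fun g -> L2fun (fun x => f x - g x).
Proof. by move=> hf hg; apply: l2D hf (l2N hg). Qed.

Lemma l2M f g : L2fun f -> L2fun g -> L1fun (fun x => f x * g x).
Proof.
move=> [mf lf] [mg lg]; apply: (@l1_le _ (fun x => f x ^+ 2 + g x ^+ 2)).
- exact: measurable_funM.
- exact: l1D.
- move=> x; rewrite normrM -(real_normK (num_real (f x))) -(real_normK (num_real (g x))).
  have := sqr_ge0 (`|f x| - `|g x|); rewrite sqrrB.
  have := mulr_ge0 (normr_ge0 (f x)) (normr_ge0 (g x)).
  by move=> h1 h2; lra.
Qed.

Lemma l2_bdM (c : R) b f : measurable_fun setT b -> (forall x, `|b x| <= c) -> L2fun f ->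
  L2fun (fun x => b x * f x).
Proof.
move=> mb bc lf; apply: (@l2_le _ (fun x => c * f x)); first exact: measurable_funM lf.1.
  exact: l2Z.
move=> x; rewrite !exprMn ler_wpM2r ?sqr_ge0// -(real_normK (num_real (b x))).
by rewrite ler_sqr ?nnegrE// (le_trans _ (bc x)).
Qed.

Lemma n2_le f g : L2fun f -> L2fun g -> (forall x, f x ^+ 2 <= g x ^+ 2) -> n2 f <= n2 g.
Proof. by move=> [_ lf] [_ lg] fg; apply: le_Rintegral. Qed.

Lemma n2Z (c : R) f : L2fun f -> n2 (fun x => c * f x) = c ^+ 2 * n2 f.
Proof.
move=> [_ lf]; rewrite /n2 -RintegralZl//.
by apply: eq_Rintegral => x _; rewrite exprMn.
Qed.

Lemma n2D f g : L2fun f -> L2fun g -> n2 (fun x => f x + g x) <= 2 * n2 f + 2 * n2 g.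
Proof.
move=> hf hg; have [_ lf] := hf; have [_ lg] := hg; have [_ lfg] := l2D hf hg.
rewrite /n2 -!RintegralZl// -RintegralD//; [|exact: l1Z|exact: l1Z].
apply: le_Rintegral => //; first by apply: l1D; exact: l1Z.
by move=> x _; exact: sqrD_le.
Qed.

Lemma n2_bdM (c : R) b f : measurable_fun setT b -> (forall x, `|b x| <= c) -> L2fun f ->
  n2 (fun x => b x * f x) <= c ^+ 2 * n2 f.
Proof.
move=> mb bc lf; rewrite -n2Z//; apply: n2_le; [exact: l2_bdM bc lf|exact: l2Z|].
move=> x; rewrite !exprMn ler_wpM2r ?sqr_ge0// -(real_normK (num_real (b x))).
by rewrite ler_sqr ?nnegrE// (le_trans _ (bc x)).
Qed.

Lemma n2_CS f g : L2fun f -> L2fun g -> I (fun x => f x * g x) ^+ 2 <= n2 f * n2 g.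
Proof. by move=> hf hg; apply: Rint_CS hf.2 hg.2 (l2M hf hg). Qed.

Lemma n2_dct (f_ : nat -> T -> R) g : (forall k, measurable_fun setT (f_ k)) ->
  (forall x, f_ ^~ x @ \oo --> 0) -> L2fun g -> (forall k x, `|f_ k x| <= `|g x|) ->
  forall e : R, 0 < e -> exists K, forall k, (K <= k)%N -> n2 (f_ k) <= e.
Proof.
move=> mf cf lg fg e e0.
have [||||_ /(_ e e0)[K HK]] := @Idct (fun k x => f_ k x ^+ 2) (fun=> 0) (fun x => g x ^+ 2).
- by move=> k; exact: measurable_funX.
- by move=> x; have := cvgM (cf x) (cf x); rewrite mulr0 => h; exact: h.
- exact: lg.2.
- move=> k x; rewrite ger0_norm ?sqr_ge0//.
  by rewrite -(real_normK (num_real (f_ k x))) -(real_normK (num_real (g x))) ler_sqr ?nnegrE.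
exists K => k /HK; rewrite (_ : I (fun=> 0) = 0); last by rewrite /Rintegral integral0.
by rewrite subr0; exact: le_trans (ler_norm _).
Qed.

End l1l2.

Section smooth_approx.
Variables (R : realType) (n : nat).
Local Notation leb := (lebesgue_rV R n).
Implicit Types (f g phi psi : 'rV[R]_n -> R).

Definition sm01 phi := (forall k : nat, isCk k phi) /\ forall x : 'rV[R]_n, 0 <= phi x <= 1.

Lemma isCk_measurable phi : isCk 0 phi -> measurable_fun setT phi.
Proof. by move=> /isCk_lbm/lbm_measurable. Qed.

Lemma sm01N phi : sm01 phi -> sm01 (fun x => 1 - phi x).
Proof.
move=> [pC p01]; split=> [k|x].
  have -> : (fun x => 1 - phi x) = fun x => 1 + (-1) * phi x.
    by apply/funext => x; rewrite mulN1r.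
  by apply: isCkD; [exact: isCk_cst|apply: isCkM; [exact: isCk_cst|exact: pC]].
by have /andP[h1 h2] := p01 x; apply/andP; split; lra.
Qed.

Lemma sm01M phi psi : sm01 phi -> sm01 psi -> sm01 (fun x => phi x * psi x).
Proof.
move=> [pC p01] [qC q01]; split=> [k|x]; first exact: isCkM.
have /andP[h1 h2] := p01 x; have /andP[h3 h4] := q01 x.
by rewrite mulr_ge0//= mulr_ile1.
Qed.

Section weight.
Variables (w : 'rV[R]_n -> R).
Hypotheses (w0 : forall x, 0 <= w x) (lw : L1fun leb w).

(** The class for a monotone class argument. The weight [w] plays the role of a finite measure, and
    values confined to [[0, 1]] give both domination by [w] and stability under products. *)
Definition sm_approx f := [/\ measurable_fun setT f, forall x : 'rV[R]_n, 0 <= f x <= 1 &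
  forall e : R, 0 < e -> exists2 phi, sm01 phi & \int[leb]_x (`|f x - phi x| * w x) <= e].

Lemma dist01 (a b : R) : 0 <= a <= 1 -> 0 <= b <= 1 -> `|a - b| <= 1.
Proof. by move=> /andP[? ?] /andP[? ?]; rewrite ler_norml; apply/andP; split; lra. Qed.

Lemma dist_l1 f g : measurable_fun setT f -> measurable_fun setT g ->
  (forall x : 'rV[R]_n, 0 <= f x <= 1) -> (forall x : 'rV[R]_n, 0 <= g x <= 1) ->
  L1fun leb (fun x => `|f x - g x| * w x).
Proof.
move=> mf mg f01 g01; apply: l1_le lw _.
  apply: measurable_funM (l1_meas lw); apply: measurableT_comp => //.
  exact: measurable_funB.
move=> x; rewrite normrM normr_id (ger0_norm (w0 x)) -[leRHS]mul1r ler_wpM2r//.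
exact: dist01.
Qed.

Lemma sm_approx_sm phi : sm01 phi -> sm_approx phi.
Proof.
move=> p; split=> [|x|e e0]; [exact: isCk_measurable (p.1 0%N)|exact: p.2|exists phi => //].
rewrite (_ : (fun x => _) = fun=> 0); first by rewrite /Rintegral integral0 ltW.
by apply/funext => x; rewrite subrr normr0 mul0r.
Qed.

Lemma sm_approx_lim (f_ : nat -> 'rV[R]_n -> R) f : (forall k, sm_approx (f_ k)) ->
  (forall x, f_ ^~ x @ \oo --> f x) -> sm_approx f.
Proof.
move=> clf cf.
have mf : measurable_fun setT f.
  by apply: (@measurable_fun_cvg _ _ _ setT f_) => [k|x _]; [case: (clf k)|exact: cf].
have f01 x : 0 <= f x <= 1.
  have icf : cvg (f_ k x @[k --> \oo]) by apply/cvg_ex; exists (f x); exact: cf.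
  have <- := cvg_lim (@Rhausdorff R) (cf x).
  apply/andP; split; [apply: limr_ge icf _|apply: limr_le icf _];
    by apply: nearW => k; have [_ /(_ x)/andP[]] := clf k.
split=> // e e0.
have e2 : 0 < e / 2 by rewrite divr_gt0.
have [||||_ /(_ _ e2)[K /(_ K (leqnn _)) HK]] :=
    @Idct _ _ _ leb (fun k x => `|f_ k x - f x| * w x) (fun=> 0) w.
- move=> k; apply: measurable_funM (l1_meas lw); apply: measurableT_comp => //.
  by apply: measurable_funB => //; case: (clf k).
- move=> x; rewrite -[X in _ --> X](mul0r (w x)); apply: cvgM; last exact: cvg_cst.
  rewrite -(normr0 R); apply: cvg_norm; rewrite -(subrr (f x)).
  by apply: cvgB; [exact: cf|exact: cvg_cst].
- exact: lw.
- move=> k x; rewrite normrM normr_id (ger0_norm (w0 x)) -[leRHS]mul1r ler_wpM2r//.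
  by apply: dist01 => //; case: (clf k).
have [mK K01 /(_ _ e2)[phi p hp]] := clf K.
exists phi => //.
have mp := isCk_measurable (p.1 0%N).
have l1a := dist_l1 mK mf K01 f01; have l1b := dist_l1 mK mp K01 p.2.
apply: (@le_trans _ _ (\int[leb]_x (`|f_ K x - f x| * w x) + \int[leb]_x (`|f_ K x - phi x| * w x))).
  rewrite -RintegralD//; apply: le_Rintegral => //.
  - exact: dist_l1 mf mp f01 p.2.
  - exact: l1D l1a l1b.
  - move=> x _; rewrite -mulrDl ler_wpM2r// (distrC (f_ K x)); exact: ler_distD.
rewrite (_ : (\int[leb]_x 0) = 0) ?subr0 in HK; last by rewrite /Rintegral integral0.
by have := le_trans (ler_norm _) HK => h; lra.
Qed.

Lemma sm_approxN f : sm_approx f -> sm_approx (fun x => 1 - f x).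
Proof.
move=> [mf f01 H]; split=> [|x|e /H[phi p hp]]; first exact: measurable_funB.
  by have /andP[h1 h2] := f01 x; apply/andP; split; lra.
exists (fun x => 1 - phi x); first exact: sm01N.
apply: le_trans hp; rewrite le_eqVlt; apply/orP; left; apply/eqP.
by apply: eq_Rintegral => x _; rewrite opprD addrACA subrr add0r -opprD normrN.
Qed.

Lemma sm_approxM f g : sm_approx f -> sm_approx g -> sm_approx (fun x => f x * g x).
Proof.
move=> [mf f01 Hf] [mg g01 Hg]; split=> [|x|e e0]; first exact: measurable_funM.
  have /andP[h1 h2] := f01 x; have /andP[h3 h4] := g01 x.
  by rewrite mulr_ge0//= mulr_ile1.
have e2 : 0 < e / 2 by rewrite divr_gt0.
have [phi p hp] := Hf _ e2; have [psi q hq] := Hg _ e2.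
exists (fun x => phi x * psi x); first exact: sm01M.
have mp := isCk_measurable (p.1 0%N); have mq := isCk_measurable (q.1 0%N).
have pq := sm01M p q.
have l1a := dist_l1 mf mp f01 p.2; have l1b := dist_l1 mg mq g01 q.2.
apply: (@le_trans _ _ (\int[leb]_x (`|f x - phi x| * w x) + \int[leb]_x (`|g x - psi x| * w x))).
  rewrite -RintegralD//; apply: le_Rintegral => //.
  - apply: dist_l1 pq.2; [exact: measurable_funM|exact: measurable_funM|].
    move=> x; have /andP[h1 h2] := f01 x; have /andP[h3 h4] := g01 x.
    by rewrite mulr_ge0//= mulr_ile1.
  - exact: l1D l1a l1b.
  - move=> x _; rewrite -mulrDl ler_wpM2r//.
    have -> : f x * g x - phi x * psi x = (f x - phi x) * g x + phi x * (g x - psi x) by ring.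
    have /andP[h1 h2] := p.2 x; have /andP[h3 h4] := g01 x.
    apply: (le_trans (ler_normD _ _)); rewrite !normrM (ger0_norm h1) (ger0_norm h3).
    by apply: lerD; [rewrite ler_piMr|rewrite ler_piMl].
by lra.
Qed.

Lemma sm_approx_avg f g : sm_approx f -> sm_approx g -> forall c : R, 0 <= c <= 1 ->
  sm_approx (fun x => c * f x + (1 - c) * g x).
Proof.
move=> [mf f01 Hf] [mg g01 Hg] c /andP[c0 c1].
have c1' : 0 <= 1 - c by rewrite subr_ge0.
have H01 a b : 0 <= a <= 1 -> 0 <= b <= 1 -> 0 <= c * a + (1 - c) * b <= 1.
  move=> /andP[? ?] /andP[? ?]; rewrite addr_ge0 ?mulr_ge0//=.
  by rewrite (@le_trans _ _ (c * 1 + (1 - c) * 1))//; [apply: lerD; rewrite ler_wpM2l|rewrite !mulr1; lra].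
split=> [|x|e e0]; first by apply: measurable_funD; exact: measurable_funM.
  exact: H01.
have e2 : 0 < e / 2 by rewrite divr_gt0.
have [phi p hp] := Hf _ e2; have [psi q hq] := Hg _ e2.
have s01 : sm01 (fun x => c * phi x + (1 - c) * psi x).
  split=> [k|x]; last exact: H01 (p.2 x) (q.2 x).
  by apply: isCkD; (apply: isCkM; [exact: isCk_cst|]); [exact: p.1|exact: q.1].
exists (fun x => c * phi x + (1 - c) * psi x) => //.
have mp := isCk_measurable (p.1 0%N); have mq := isCk_measurable (q.1 0%N).
have l1a := dist_l1 mf mp f01 p.2; have l1b := dist_l1 mg mq g01 q.2.
apply: (@le_trans _ _ (\int[leb]_x (`|f x - phi x| * w x) + \int[leb]_x (`|g x - psi x| * w x))).
  rewrite -RintegralD//; apply: le_Rintegral => //.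
  - apply: dist_l1 s01.2 => [||x]; last exact: H01.
    + by apply: measurable_funD; exact: measurable_funM.
    + exact: isCk_measurable (s01.1 0%N).
  - exact: l1D l1a l1b.
  - move=> x _; rewrite -mulrDl ler_wpM2r//.
    have -> : c * f x + (1 - c) * g x - (c * phi x + (1 - c) * psi x) =
      c * (f x - phi x) + (1 - c) * (g x - psi x) by ring.
    apply: (le_trans (ler_normD _ _)); rewrite !normrM (ger0_norm c0) (ger0_norm c1').
    by apply: lerD; rewrite ler_piMl//; lra.
by lra.
Qed.

End weight.
End smooth_approx.

Section smooth_approx2.
Variables (R : realType) (n : nat).
Local Notation leb := (lebesgue_rV R n).
Implicit Types (f g phi psi : 'rV[R]_n -> R).
Variables (w : 'rV[R]_n -> R).
Hypotheses (w0 : forall x, 0 <= w x) (lw : L1fun leb w).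
Local Notation sma := (sm_approx w).

Lemma sma_cst (c : R) : 0 <= c <= 1 -> sma (fun=> c).
Proof. by move=> c01; apply: sm_approx_sm => //; split=> // k; exact: isCk_cst. Qed.

Lemma sma_setC A : sma \1_A -> sma \1_(~` A).
Proof.
move=> /sm_approxN; rewrite (_ : (fun x => 1 - \1_A x) = \1_(~` A))//.
by apply/funext => x; rewrite !indicE in_setC; case: (x \in A); rewrite ?subrr ?subr0.
Qed.

(** The complement of the union is the limit of the finite products of the indicators of the
    complements. *)
Lemma sma_bigcup (F : nat -> set 'rV[R]_n) : (forall k, sma \1_(F k)) -> sma \1_(\bigcup_k F k).
Proof.
move=> H; pose p K (x : 'rV[R]_n) : R := \prod_(k < K) (1 - \1_(F k) x).
have pS K : p K.+1 = fun x => p K x * (1 - \1_(F K) x).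
  by apply/funext => x; rewrite /p big_ord_recr.
have Hp K : sma (p K).
  elim: K => [|K IH].
    have -> : p 0%N = fun=> 1 by apply/funext => x; rewrite /p big_ord0.
    by apply: sma_cst; rewrite ler01 lexx.
  by rewrite pS; apply: sm_approxM => //; exact: sm_approxN.
apply: (@sm_approx_lim _ _ _ w0 lw (fun K x => 1 - p K x)) => [K|x]; first exact: sm_approxN.
rewrite indicE; have [|Fx] := boolP (x \in _).
  rewrite inE => -[k _ Fk]; apply: cvg_near_cst; exists k.+1 => // K /= kK.
  rewrite /p (bigD1 (Ordinal kK))//= indicE (mem_set Fk) subrr mul0r subr0//.
rewrite (_ : (fun K => _) = fun=> 0); first exact: cvg_cst.
apply/funext => K; rewrite /p big1 ?subrr// => k _; rewrite indicE memNset ?subr0//.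
by move=> Fk; move/negP: Fx; apply; rewrite inE; exists k.
Qed.

(** The smooth functions [exp (- k fexp 0 (x_i - t))] equal 1 where [x_i <= t] and decrease to 0
    elsewhere. *)
Lemma sma_ray i (t : R) : sma \1_[set x : 'rV[R]_n | t < x ord0 i].
Proof.
rewrite (_ : [set x | _] = ~` [set x : 'rV[R]_n | x ord0 i <= t]); last first.
  by apply/seteqP; split=> x /=; rewrite ltNge => /negP.
apply: sma_setC.
apply: (@sm_approx_lim _ _ _ w0 lw (fun k x => expR (- (k%:R * fexp 0 (x ord0 i - t))))) => [k|x].
  apply: sm_approx_sm => //; split=> [j|x].
    pose h (s : R) := expR (-1 * (k%:R * fexp 0 s)).
    have -> : (fun x : 'rV[R]_n => expR (- (k%:R * fexp 0 (x ord0 i - t)))) =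
        fun x => h (x ord0 i - t) by apply/funext => x; rewrite /h mulN1r.
    apply: isCk_comp => [|j'].
      by apply: smX; apply: smM; [exact: smC|apply: smM; [exact: smC|exact: smE]].
    by apply: isCkD; [exact: isCk_coord|exact: isCk_cst].
  by rewrite expR_ge0/= -expR0 ler_expR oppr_le0 mulr_ge0// fexp_ge0.
rewrite indicE; have [h|h] := ltP t (x ord0 i).
  rewrite memNset /=; last by apply/negP; rewrite -ltNge.
  rewrite (_ : (fun k : nat => _) = GRing.exp (expR (- fexp 0 (x ord0 i - t)))).
    apply: cvg_expr; rewrite ger0_norm ?expR_ge0// -expR0 ltr_expR oppr_lt0.
    by rewrite fexp_gt0// subr_gt0.
  by apply/funext => k; rewrite -mulrN expRM_natl.
rewrite mem_set//= fexp_eq0 ?subr_le0// (_ : (fun k : nat => _) = fun=> 1); first exact: cvg_cst.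
by apply/funext => k; rewrite mulr0 oppr0 expR0.
Qed.

Lemma sma_indic A : measurable A -> sma \1_A.
Proof.
apply: (@smallest_sub _ _ _ [set A | sma \1_A]).
  split=> /=.
  - by rewrite indic0; apply: sma_cst; rewrite lexx ler01.
  - by move=> B mB; rewrite setTD; exact: sma_setC.
  - by move=> F mF; exact: sma_bigcup.
rewrite -bigcup_seq/= => B [i _ [C mC <-]] /=; rewrite setTI.
have {}mC : (@RGenOInfty.G R).-sigma.-measurable C by rewrite -RGenOInfty.measurableE.
move: C mC.
apply: (@smallest_sub _ _ _ [set C | sma \1_(@rV_coord R n i @^-1` C)]).
  split=> /=.
  - by rewrite preimage_set0 indic0; apply: sma_cst; rewrite lexx ler01.
  - by move=> D mD; rewrite setTD preimage_setC; exact: sma_setC.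
  - by move=> F mF; rewrite preimage_bigcup; exact: sma_bigcup.
move=> _ [t ->] /=; rewrite (_ : _ @^-1` _ = [set x : 'rV[R]_n | t < x ord0 i]); first exact: sma_ray.
by apply/seteqP; split=> x /=; rewrite in_itv/= andbT.
Qed.

Lemma sum_step (K : nat) (y : R) : 0 <= y ->
  (K%:R <= y -> \sum_(j < K) (j.+1%:R <= y)%R%:R = K%:R :> R) /\
  (y <= K%:R -> y - 1 <= \sum_(j < K) (j.+1%:R <= y)%R%:R <= y).
Proof.
move=> y0; elim: K => [|K [IH1 IH2]]; first by rewrite big_ord0; split=> // h; apply/andP; split; lra.
rewrite big_ord_recr/=; have [h|h] := lerP K.+1%:R y.
  have hK : K%:R <= y by apply: le_trans h; rewrite ler_nat.
  rewrite IH1//= natr1; split=> // h'; apply/andP; split; last by [].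
  by lra.
rewrite addr0; split=> [//|_].
have [hK|hK] := lerP K%:R y; last by apply: IH2; exact: ltW.
by rewrite IH1//; apply/andP; split=> //; move: h; rewrite -natr1 => h; lra.
Qed.

(* By averaging indicators of superlevel sets (layer cake). *)
Lemma sma_bounded f : measurable_fun setT f -> (forall x, 0 <= f x <= 1) -> sma f.
Proof.
move=> mf f01.
pose S (K : nat) k (x : 'rV[R]_n) : R := \sum_(j < k) \1_[set x | j.+1%:R <= K%:R * f x] x.
have mA (K j : nat) : measurable [set x | j.+1%:R <= K%:R * f x].
  rewrite -[X in measurable X]setTI; apply: measurable_fun_le => //.
  exact: measurable_funM.
have HS K k : sma (fun x => k.+1%:R^-1 * S K k.+1 x).
  elim: k => [|k IH].
    rewrite (_ : (fun x => _) = \1_[set x | 1%:R <= K%:R * f x]); first exact: sma_indic.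
    by apply/funext => x; rewrite /S big_ord1 invr1 mul1r.
  have k0 : (k.+1%:R + 1 : R) != 0 by rewrite natr1 pnatr_eq0.
  have k1 : (k.+1%:R : R) != 0 by rewrite pnatr_eq0.
  (* [sm_approx_avg] mixes two functions only, so the mean of the indicators is updated one at a
     time, with weights [(k + 1) / (k + 2)] and [1 / (k + 2)]. *)
  rewrite (_ : (fun x => _) = fun x => (k.+1%:R / k.+2%:R) * (k.+1%:R^-1 * S K k.+1 x) +
     (1 - (k.+1%:R / k.+2%:R)) * \1_[set x | k.+2%:R <= K%:R * f x] x).
    apply: sm_approx_avg => //; first exact: sma_indic.
    by rewrite divr_ge0//= ler_pdivrMr// mul1r ler_nat.
  apply/funext => x; rewrite /S big_ord_recr /= -[in LHS]natr1 -[k.+2%:R in RHS]natr1.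
  by move: (\sum_(_ < _) _) => s; move: (\1_ _ _) => v; move: (k.+1%:R : R) k0 k1 => c k0 k1; field; rewrite k0 k1.
apply: (@sm_approx_lim _ _ _ w0 lw (fun k x => k.+1%:R^-1 * S k.+1 k.+1 x)) => [k|x]; first exact: HS.
apply/cvgrPdist_le => e e0; near=> k.
have kp : 0 < k.+1%:R :> R by [].
have /andP[f0 f1] := f01 x.
have -> : S k.+1 k.+1 x = \sum_(j < k.+1) (j.+1%:R <= k.+1%:R * f x)%R%:R.
  by apply: eq_bigr => j _; rewrite indicE; congr (nat_of_bool _)%:R; apply/idP/idP; rewrite inE.
have [_ /(_ _)/andP[|h1 h2]] := @sum_step k.+1 (k.+1%:R * f x) (mulr_ge0 (ltW kp) f0).
  by rewrite ler_piMr.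
move: (\sum_(j < k.+1) _) h1 h2 => s h1 h2.
have -> : f x - k.+1%:R^-1 * s = k.+1%:R^-1 * (k.+1%:R * f x - s).
  by rewrite mulrBr mulKf// gt_eqF.
rewrite normrM ger0_norm ?invr_ge0// ger0_norm ?subr_ge0//.
apply: (@le_trans _ _ (k.+1%:R^-1 * 1)); first by rewrite ler_wpM2l ?invr_ge0//; lra.
rewrite mulr1; near: k; have /cvgrPdist_le/(_ e e0) := @cvg_harmonic R.
by apply: filterS => k; rewrite sub0r normrN ger0_norm// invr_ge0.
Unshelve. all: by end_near. Qed.

End smooth_approx2.

(** * Test functions and the fundamental lemma of the calculus of variations *)

Section test_functions.
Variables (R : realType) (n : nat).
Local Notation leb := (lebesgue_rV R n).
Implicit Types (D K : set 'rV[R]_n) (f g phi psi : 'rV[R]_n -> R).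

Lemma closed_ball_norm (M : R) : closed [set x : 'rV[R]_n | `|x| <= M].
Proof.
apply: (@closed_comp _ _ (fun x : 'rV[R]_n => `|x|) [set t : R | t <= M]); last exact: closed_le.
by move=> x _; exact: norm_continuous.
Qed.

Lemma closed_bounded_compact K (M : R) : closed K -> (forall x, K x -> `|x| <= M) -> compact K.
Proof.
move=> cK bK; apply: bounded_closed_compact => //.
by exists M; split; [exact: num_real|move=> N MN x /bK h; exact: le_trans (ltW MN)].
Qed.

Lemma compact_normP K : compact K -> exists M : R, forall x, K x -> `|x| <= M.
Proof.
move=> /compact_bounded[M [_ HM]]; exists (M + 1) => x Kx.
by apply: HM => //; rewrite ltrDl.
Qed.

Lemma test_functionI D K phi : (forall k : nat, isCk k phi) -> compact K -> K `<=` D ->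
  (forall x, ~ K x -> phi x = 0) -> test_function D phi.
Proof.
move=> pC cK KD pK.
have sub : closure [set x | phi x != 0] `<=` K.
  rewrite [X in _ `<=` X](closure_id _).1; last exact: compact_closed.
  by apply: closure_subset => x /= /eqP px; apply: contrapT => /pK.
split=> //; last exact: subset_trans sub KD.
by apply: subclosed_compact cK sub; exact: closed_closure.
Qed.

Lemma test_functionM D phi (th : 'rV[R]_n -> R) : (forall k : nat, isCk k phi) -> test_function D th ->
  test_function D (fun x => th x * phi x).
Proof.
move=> pC [tC cK KD]; apply: test_functionI cK KD _ => [k|x]; first exact: isCkM.
by move=> h; have [->|tx] := eqVneq (th x) 0; rewrite ?mul0r//; exfalso; apply/h/(@subset_closure _ [set x | th x != 0]).
Qed.

Lemma test_bsupp D phi : test_function D phi -> bsupp phi.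
Proof.
move=> [_ /compact_normP[M HM] _]; apply: (bsuppI (M := M)) => x Mx.
have [//|px] := eqVneq (phi x) 0.
have h := HM x (@subset_closure _ [set x | phi x != 0] x px).
by move: (lt_le_trans Mx h); rewrite ltxx.
Qed.

Lemma test_out D phi x : test_function D phi -> ~ D x -> phi x = 0.
Proof.
move=> [_ _ KD] Dx; have [//|px] := eqVneq (phi x) 0.
by exfalso; apply/Dx/KD/(@subset_closure _ [set x | phi x != 0]).
Qed.

Lemma test_C1 D phi : test_function D phi -> C1 phi (fun i => partial i phi).
Proof. by move=> [/(_ 1%N)/isCk_C1]. Qed.

Lemma test_lbs D phi : test_function D phi -> lbs phi.
Proof. by move=> tp; split; [exact: C1_lbm (test_C1 tp)|exact: test_bsupp tp]. Qed.

(** A substitute for a partition of unity: these test functions see every point of [D], which is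
    enough to localise almost everywhere statements. *)
Definition exhausting D (th : nat -> 'rV[R]_n -> R) :=
  [/\ forall k, test_function D (th k), forall k x, 0 <= th k x &
      forall x, D x -> exists k, 0 < th k x].

Lemma compact_measurable_rV K : compact K -> measurable K.
Proof.
move=> /(compact_closed (@norm_hausdorff R _)) cK; rewrite -(setCK K).
by apply: measurableC; apply: open_measurable_rV; exact: closed_openC.
Qed.

Lemma loc_test_l1 D g (th : 'rV[R]_n -> R) : locally_integrable_rV D g -> test_function D th ->
  L1fun leb (fun x => (g \_ D) x * th x).
Proof.
move=> lg tt; have [tC cK KD] := tt; set K := closure _ in cK KD.
have mK := compact_measurable_rV cK.
have [lt bt] := test_lbs tt; have [C C0 HC] := lbm_bounded lt bt.
have gK : L1fun leb (g \_ K).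
  by rewrite /L1fun -restrict_EFin; apply/(integrable_mkcond _ mK).1; exact: lg.
have -> : (fun x => (g \_ D) x * th x) = fun x => (g \_ K) x * th x.
  apply/funext => x; rewrite !patchE; have [->|tx] := eqVneq (th x) 0; first by rewrite !mulr0.
  have Kx : K x by exact: (@subset_closure _ [set x | th x != 0]).
  by rewrite !mem_set//; exact: KD.
apply: (@l1_le _ _ _ leb _ (fun x => C * `|(g \_ K) x|)).
- by apply: measurable_funM (l1_meas gK) _; exact: lbm_measurable.
- by apply: l1Z; exact: l1_norm.
- by move=> x; rewrite normrM mulrC ler_wpM2r.
Qed.

(** [phi] approximates the indicator of [f > 0] in L^1 with weight [|f|]; hence the integral of the
    positive part is within [e] of [int f phi = 0]. *)
Lemma I_pos_part f : L1fun leb f -> (forall phi, (forall k : nat, isCk k phi) ->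
    (forall x, 0 <= phi x <= 1) -> \int[leb]_x (f x * phi x) = 0) ->
  \int[leb]_x (Num.max (f x) 0) <= 0.
Proof.
move=> lf H; apply/ler_addgt0Pl => e e0; rewrite addr0.
have mA : measurable [set x | 0 < f x].
  rewrite (_ : [set x | _] = f @^-1` `]0, +oo[%classic); last first.
    by apply/seteqP; split=> x /=; rewrite in_itv/= andbT.
  by rewrite -[X in measurable X]setTI; exact: (l1_meas lf).
have [mi i01 /(_ e e0)[phi [pC p01] hp]] :=
  sma_indic (fun x => normr_ge0 (f x)) (l1_norm lf) mA.
have lfM g : measurable_fun setT g -> (forall x, `|g x| <= 1) -> L1fun leb (fun x => f x * g x).
  move=> mg g1; apply: l1_le (l1_norm lf) _; first exact: measurable_funM (l1_meas lf) mg.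
  by move=> x; rewrite normrM ler_piMr.
have mp := isCk_measurable (pC 0%N).
have n01 g : (forall x : 'rV[R]_n, 0 <= g x <= 1) -> forall x, `|g x| <= 1.
  by move=> h x; have /andP[? ?] := h x; rewrite ger0_norm.
apply: le_trans hp.
have -> : \int[leb]_x (Num.max (f x) 0) =
    \int[leb]_x (f x * \1_[set x | 0 < f x] x) - \int[leb]_x (f x * phi x).
  rewrite (H _ pC p01) subr0; apply: eq_Rintegral => x _; rewrite indicE.
  have [h|h] := ltP 0 (f x); first by rewrite mem_set// mulr1.
  by rewrite memNset ?mulr0//=; apply/negP; rewrite -leNgt.
rewrite -RintegralB//; [|exact: lfM mi (n01 _ i01)|exact: lfM mp (n01 _ p01)].
apply: le_Rintegral => //.
- by apply: l1B; [exact: lfM mi (n01 _ i01)|exact: lfM mp (n01 _ p01)].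
- exact: (dist_l1 (fun x => normr_ge0 (f x)) (l1_norm lf)) mi mp i01 p01.
- by move=> x _; rewrite -mulrBr (le_trans (ler_norm _))// normrM mulrC.
Qed.

(** Multiplied by [th k], the function becomes globally integrable, and [I_pos_part] applies to it
    and to its opposite. *)
Lemma fundamental D g (th : nat -> 'rV[R]_n -> R) : exhausting D th -> locally_integrable_rV D g ->
  (forall phi, test_function D phi -> \int[leb]_(x in D) (g x * phi x) = 0) ->
  {ae leb, forall x, D x -> g x = 0}.
Proof.
move=> [tt th0 thp] lg H.
suff A k : {ae leb, forall x, (g \_ D) x * th k x = 0}.
  have := (@ae_foralln _ _ _ leb (fun k x => (g \_ D) x * th k x = 0)) A.
  apply: filterS => x Hx Dx; have [k tk] := thp x Dx.
  have := Hx k; rewrite patchE mem_set// => /eqP; rewrite mulf_eq0 (gt_eqF tk) orbF.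
  by move/eqP.
have lf := loc_test_l1 lg (tt k); set f := fun x => _ in lf.
have Hf phi : (forall k : nat, isCk k phi) -> \int[leb]_x (f x * phi x) = 0.
  move=> pC; rewrite -(H _ (test_functionM pC (tt k))) [RHS]Rintegral_mkcond.
  by apply: eq_Rintegral => x _; rewrite /f !patchE; case: ifPn => _; rewrite ?mul0r// mulrA.
have h1 := I_pos_part lf (fun phi pC _ => Hf phi pC).
have h2 : \int[leb]_x (Num.max (- f x) 0) <= 0.
  apply: I_pos_part; first exact: l1N.
  move=> phi pC _; rewrite -[RHS]oppr0 -(Hf _ pC) -[RHS]mulN1r -RintegralZl//.
    by apply: eq_Rintegral => x _; rewrite mulNr mulN1r.
  have [l' p'] : L1fun leb (fun x => (g \_ D) x * (th k x * phi x)) /\ true.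
    by split=> //; exact: loc_test_l1 lg (test_functionM pC (tt k)).
  by rewrite (_ : (EFin \o _) = EFin \o (fun x => (g \_ D) x * (th k x * phi x)))//;
    apply/funext => x; rewrite /= /f mulrA.
have h3 : \int[leb]_x `|f x| = 0.
  apply/eqP; rewrite eq_le Rintegral_ge0 ?andbT//.
  apply: (@le_trans _ _ (\int[leb]_x (Num.max (f x) 0) + \int[leb]_x (Num.max (- f x) 0))); last first.
    by rewrite -[leRHS]addr0; exact: lerD.
  have lm h : L1fun leb h -> L1fun leb (fun x => Num.max (h x) 0).
    move=> lh; apply: l1_le (l1_norm lh) _; first by apply: measurable_maxr (l1_meas lh) _; exact: measurable_cst.
    by move=> x; rewrite ger0_norm ?le_max ?lexx ?orbT// ge_max ler_norm/= normr_ge0.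
  rewrite -RintegralD//; [|exact: lm|by apply: lm; exact: l1N].
  apply: le_Rintegral => //; first exact: l1_norm.
    by apply: l1D; apply: lm => //; exact: l1N.
  move=> x _; rewrite ler_norml; apply/andP; split; last by rewrite -[leLHS]addr0 lerD// le_max lexx ?orbT.
  by rewrite lerNl -[leLHS]add0r lerD// le_max lexx ?orbT.
have h4 : (\int[leb]_x `|(EFin \o f) x| = 0)%E.
  by have := ge0_RintegralE measurableT (l1_norm lf); rewrite h3 => <-.
have mf : measurable_fun setT (EFin \o f) by apply/measurable_EFinP; exact: l1_meas lf.
have := (ae_eq_integral_abs _ measurableT mf).1 h4.
by apply: filterS => x /(_ I) [].
Qed.

End test_functions.

Lemma partial_near0 (R : realType) n (phi : 'rV[R]_n -> R) i (x : 'rV[R]_n) :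
  (\forall y \near x, phi y = 0) -> partial i phi x = 0.
Proof.
move=> h; by rewrite /partial (near_eq_derive _ (g := fun=> 0)) ?derive_cst.
Qed.

Lemma test_partial (R : realType) n (D : set 'rV[R]_n) i phi : test_function D phi -> test_function D (partial i phi).
Proof.
move=> [pC cK KD]; apply: test_functionI cK KD _ => [k|x hx]; first exact: isCk_partial (pC k.+1).
apply: partial_near0; have : nbhs x (~` closure [set x | phi x != 0]).
  by apply: open_nbhs_nbhs; split=> //; apply: closed_openC; exact: closed_closure.
by apply: filterS => y hy; apply: contrapT => /eqP py; apply/hy/(@subset_closure _ [set x | phi x != 0]).
Qed.

Section exhaustion.
Variable R : realType.

Lemma rbump_far n (k : nat) (x : 'rV[R]_n) : ~ `|x| <= k.+1%:R -> rbump 0 k.+1%:R x = 0.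
Proof.
move=> h; apply: contrapT => /eqP p; apply: h.
by have := bump_supp (ltr0Sn _ _) p; rewrite subr0.
Qed.

Lemma rbump_near n (k : nat) (x : 'rV[R]_n) : sqn x < k.+1%:R -> 0 < rbump 0 k.+1%:R x.
Proof.
move=> h; apply: bump_gt0 => //; rewrite subr0 (lt_le_trans h)// expr2 -[leLHS]mul1r.
by rewrite ler_wpM2r// ler1n.
Qed.

Lemma exhausting_setT n : exhausting setT (fun k => @rbump R n 0 k.+1%:R).
Proof.
split=> [k|k x|x _]; last by exists (Num.truncn (sqn x)); apply: rbump_near; exact: truncnS_gt.
  apply: (@test_functionI _ _ _ [set x | `|x| <= k.+1%:R]) => // [j||x].
  - exact: isCk_bump.
  - apply: closed_bounded_compact; first exact: closed_ball_norm.
    by move=> x; exact.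
  - exact: rbump_far.
exact: bump_ge0.
Qed.

Lemma closed_coord_ge n (i : 'I_n) (t : R) : closed [set x : 'rV[R]_n | t <= x ord0 i].
Proof.
apply: (@closed_comp _ _ (fun x : 'rV[R]_n => x ord0 i) [set s : R | t <= s]); last exact: closed_ge.
by move=> x _; exact: coord_continuous.
Qed.

Lemma exhausting_half_space m :
  exhausting (half_space R m) (fun k x => rbump 0 k.+1%:R x * fexp 0 (x ord0 ord_max - k.+1%:R^-1)).
Proof.
split=> [k|k x|x]; last first.
- rewrite /half_space/= => x0; exists (Num.truncn (sqn x + (x ord0 ord_max)^-1)).
  set k := Num.truncn _; have : sqn x + (x ord0 ord_max)^-1 < k.+1%:R by exact: truncnS_gt.
  have i0 : 0 < (x ord0 ord_max)^-1 by rewrite invr_gt0.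
  move=> h; rewrite mulr_gt0//.
    by apply: rbump_near; apply: le_lt_trans h; rewrite lerDl ltW.
  apply: fexp_gt0; rewrite subr_gt0 invf_plt ?posrE//.
  by apply: le_lt_trans h; rewrite lerDr sqn_ge0.
- by rewrite mulr_ge0//; [exact: bump_ge0|exact: fexp_ge0].
- pose K : set 'rV[R]_m.+1 := [set x | `|x| <= k.+1%:R] `&` [set x : 'rV[R]_m.+1 | k.+1%:R^-1 <= x ord0 ord_max].
  have := @test_functionI _ _ (half_space R m) K (fun x : 'rV[R]_m.+1 => rbump 0 k.+1%:R x * fexp 0 (x ord0 ord_max - k.+1%:R^-1)).
  apply => [j||x|x /=].
  + apply: isCkM; first exact: isCk_bump.
    apply: isCk_comp => [|j']; first exact: smE.
    by apply: isCkD; [exact: isCk_coord|exact: isCk_cst].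
  + apply: (@closed_bounded_compact _ _ K k.+1%:R); last by move=> x [].
    by apply: closedI; [exact: closed_ball_norm|exact: closed_coord_ge].
  + by move=> [_ h]; rewrite /half_space/=; apply: lt_le_trans h; rewrite invr_gt0.
  + move=> /not_andP[/rbump_far ->|/= h]; first by rewrite mul0r.
    by rewrite [fexp _ _]fexp_eq0 ?mulr0// subr_le0 leNgt; apply/negP => /ltW.
Qed.

End exhaustion.

(** * Weak derivatives and Sobolev functions *)

Section weak_partials.
Variables (R : realType) (n : nat) (D : set 'rV[R]_n) (th : nat -> 'rV[R]_n -> R).
Hypotheses (Dth : exhausting D th) (mD : measurable D).
Local Notation leb := (lebesgue_rV R n).
Implicit Types (u v g h : 'rV[R]_n -> R).

(** Local integrability gives measurability on compact sets only; [D] is the countable union of the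
    supports of the [th k]. *)
Lemma loc_measurable g : locally_integrable_rV D g -> measurable_fun setT (g \_ D).
Proof.
move=> lg; have [tt _ thp] := Dth; pose K k := closure [set x | th k x != 0].
have DK : D = \bigcup_k K k.
  apply/seteqP; split=> [x /thp[k kx]|x [k _]]; last by have [_ _] := tt k; apply.
  by exists k => //; apply: (@subset_closure _ [set x | th k x != 0]) => /=; rewrite gt_eqF.
have : measurable_fun D g; last by move/(measurable_restrictT _ mD).1.
rewrite DK.
apply/measurable_fun_bigcup => k; first by apply: compact_measurable_rV; have [] := tt k.
have [_ cK KD] := tt k.
by have /integrableP[/measurable_EFinP] := lg _ cK KD.
Qed.

Lemma loc_testI g phi : locally_integrable_rV D g -> test_function D phi ->
  leb.-integrable D (EFin \o (fun x => g x * phi x)).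
Proof.
move=> lg tp; apply/(integrable_mkcond _ mD).2; rewrite restrict_EFin.
rewrite (_ : _ \_ D = fun x => (g \_ D) x * phi x); first exact: loc_test_l1.
by apply/funext => x; rewrite !patchE; case: ifPn; rewrite ?mul0r.
Qed.

Lemma locB u v : locally_integrable_rV D u -> locally_integrable_rV D v ->
  locally_integrable_rV D (fun x => u x - v x).
Proof.
move=> lu lv K cK KD; have mK := compact_measurable_rV cK.
by have := integrableB mK (lu K cK KD) (lv K cK KD).
Qed.

Lemma cont_loc u : continuous u -> locally_integrable_rV D u.
Proof.
move=> cu K cK KD; have mK := compact_measurable_rV cK; have [M HM] := compact_normP cK.
apply: (@eq_integrable _ _ _ leb _ mK (EFin \o (u \_ K))) => [x xK|].
  by rewrite /= patchE xK.
apply: lbs_integrable => //; first by apply: lbm_restrict => //; exact: lbm_cont.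
apply: (@bsuppI _ _ _ M) => x Mx; rewrite patchE memNset// => /HM h.
by move: (lt_le_trans Mx h); rewrite ltxx.
Qed.

Lemma is_weak_partialB i u v g h : is_weak_partial D i u g -> is_weak_partial D i v h ->
  is_weak_partial D i (fun x => u x - v x) (fun x => g x - h x).
Proof.
move=> [lu lg Hu] [lv lh Hv]; split; [exact: locB|exact: locB|move=> phi tp].
have tdp := test_partial i tp.
transitivity (\int[leb]_(x in D) (u x * partial i phi x) - \int[leb]_(x in D) (v x * partial i phi x)).
  rewrite -RintegralB//; [|exact: loc_testI|exact: loc_testI].
  by apply: eq_Rintegral => x _; rewrite mulrBl.
rewrite Hu// Hv// -opprB; congr (- _); rewrite opprK addrC -RintegralB//; [|exact: loc_testI|exact: loc_testI].
by apply: eq_Rintegral => x _; rewrite mulrBl.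
Qed.

Lemma is_weak_partial_unique i u g h : is_weak_partial D i u g -> is_weak_partial D i u h ->
  {ae leb, forall x, D x -> g x = h x}.
Proof.
move=> Hg Hh; have [_ lg _] := is_weak_partialB Hg Hh.
have : {ae leb, forall x, D x -> g x - h x = 0}.
  apply: (fundamental Dth lg) => phi tp; have [_ _ /(_ phi tp) e] := is_weak_partialB Hg Hh.
  apply: oppr_inj; rewrite oppr0 -e; rewrite (_ : (fun x => _) = fun=> 0).
    by rewrite /Rintegral integral0.
  by apply/funext => x; rewrite subrr mul0r.
by apply: filterS => x H /H/eqP; rewrite subr_eq0 => /eqP.
Qed.

Lemma weak_partialP i u g : is_weak_partial D i u g -> is_weak_partial D i u (weak_partial D i u).
Proof. by move=> H; rewrite /weak_partial; case: xgetP => [//|/(_ g)]. Qed.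

Lemma weak_partialE i u g : is_weak_partial D i u g ->
  {ae leb, forall x, D x -> weak_partial D i u x = g x}.
Proof. by move=> H; exact: is_weak_partial_unique (weak_partialP H) H. Qed.

Lemma is_weak_partial_C1 i u Du : C1 u Du -> is_weak_partial D i u (Du i).
Proof.
move=> uD; split; [exact: cont_loc (C1_cont uD)|exact: cont_loc (C1_contD (i := i) uD)|move=> phi tp].
have pD := test_C1 tp; have bp := test_bsupp tp.
have supD (f : 'rV[R]_n -> R) : \int[leb]_(x in D) (f x * phi x) = \int[leb]_x (f x * phi x).
  rewrite Rintegral_mkcond; apply: eq_Rintegral => x _; rewrite patchE; case: ifPn => // /negP xD.
  by rewrite (test_out tp) ?mulr0// => Dx; apply: xD; rewrite inE.
have supD' : \int[leb]_(x in D) (u x * partial i phi x) = \int[leb]_x (u x * partial i phi x).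
  rewrite Rintegral_mkcond; apply: eq_Rintegral => x _; rewrite patchE; case: ifPn => // /negP xD.
  by rewrite (test_out (test_partial i tp)) ?mulr0// => Dx; apply: xD; rewrite inE.
have bdp : bsupp (partial i phi) by exact: C1_bsuppD pD bp.
rewrite supD supD'; have [lu lDu lp ldp] : [/\ lbm u, lbm (Du i), lbm phi & lbm (partial i phi)].
  by split; [exact: C1_lbm uD|exact: C1_lbmD uD|exact: C1_lbm pD|exact: C1_lbmD pD].
have := Int_translation measurableT (i := i) (C1M uD pD) (bsuppMr u bp) (fun _ _ => conj id id).
rewrite (IntD measurableT); [|lbst|lbst] => /eqP; rewrite addr_eq0 => /eqP ->; congr (- _).
by apply: eq_Rintegral => x _; rewrite mulrC.
Qed.

End weak_partials.

Section cutoff_sequence.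
Variables (R : realType) (n : nat).
Implicit Types (k : nat) (x : 'rV[R]_n).

(** The divisor is the value of the bump at its centre, so that the cut-offs tend to 1
    everywhere. *)
Definition zcut k x : R := rbump 0 k.+1%:R x / fexp 0 1.

Lemma fexp01 : 0 < fexp 0 (1 : R).
Proof. exact: fexp_gt0. Qed.

Lemma zcut_test k : test_function setT (zcut k).
Proof.
have -> : zcut k = fun x => rbump 0 k.+1%:R x * (fexp 0 1)^-1 by [].
apply: test_functionM; first by move=> j; exact: isCk_cst.
by have [] := @exhausting_setT R n.
Qed.

Lemma zcut01 k x : 0 <= zcut k x <= 1.
Proof.
rewrite divr_ge0 ?bump_ge0 ?(ltW fexp01)//= ler_pdivrMr ?fexp01// mul1r.
apply: fexp0_le; rewrite gerBl divr_ge0 ?sqr_ge0//; exact: sqn_ge0.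
Qed.

Lemma zcut_cvg x : zcut k x @[k --> \oo] --> (1 : R).
Proof.
have c1 : {for (1 : R), continuous (@fexp R 0)}.
  by apply: differentiable_continuous; apply/derivable1_diffP; have [] := is_derive_fexp 0 (1 : R).
have f1 : fexp 0 (1 : R) != 0 by rewrite gt_eqF// fexp01.
rewrite -(divff f1); apply: cvgM; last exact: cvg_cst.
apply: (cvg_comp (fun k => 1 - sqn (x - 0) / k.+1%:R ^+ 2) (fexp 0)); last exact: c1.
suff : (1 - sqn (x - 0) / k.+1%:R ^+ 2) @[k --> \oo] --> (1 : R) by exact.
rewrite -[X in _ --> X]subr0; apply: cvgB; first exact: cvg_cst.
rewrite -(mulr0 (sqn (x - 0))); apply: cvgM; first exact: cvg_cst.
rewrite (_ : (fun k => _) = fun k : nat => (k.+1%:R^-1 : R) * k.+1%:R^-1); last first.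
  by apply/funext => k; rewrite expr2 invfM.
by rewrite -(mulr0 (0 : R)); apply: cvgM; exact: cvg_harmonic.
Qed.

(** [12 = 6 * 2]: [fexp_le] gives [|fexp 2| <= 3!] on [[0, 1]], and the gradient of [|x|^2 / r^2] is
    at most [2 / r] where the bump is nonzero. *)
Lemma partial_zcut k i x : `|partial i (zcut k) x| <= 12 / fexp 0 1 / k.+1%:R.
Proof.
set r : R := k.+1%:R; have r0 : 0 < r by [].
pose s (x : 'rV[R]_n) : R := 1 - sqn (x - 0) / r ^+ 2.
have sE : s = fun x => 1 - r ^- 2 * sqn x by apply/funext => y; rewrite /s subr0 mulrC.
have sD : C1 s (fun i x => 0 - r ^- 2 * (2 * x ord0 i)).
  by rewrite sE; apply: C1B; [exact: C1_cst|apply: C1Z; exact: C1_sqn].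
have pE : partial i (zcut k) = fun x => (fexp 0 1)^-1 * ((fexp 2 (s x) - 0%:R * fexp 1 (s x)) * (0 - r ^- 2 * (2 * x ord0 i))).
  apply: partial_E => y; have [_ _ /(_ i y) h] := sD.
  have h1 := is_derive_comp1 h (is_derive_fexp 0 (s y)).
  have -> : zcut k = fun x => (fexp 0 1)^-1 * (fexp 0 \o s) x.
    by apply/funext => z; rewrite /zcut mulrC.
  exact: is_deriveZ.
rewrite pE mul0r subr0 sub0r; have [s0|s0] := lerP (s x) 0.
  by rewrite [fexp 2 _]fexp_eq0// mul0r mulr0 normr0 !divr_ge0// ltW// fexp01.
have xi : `|x ord0 i| <= r.
  rewrite -(@ler_pXn2r _ 2) ?nnegrE ?(ltW r0)// real_normK ?num_real//.
  move: s0; rewrite sE subr_gt0 mulrC ltr_pdivrMr ?exprn_gt0// mul1r => /ltW; apply: le_trans.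
  rewrite /sqn (bigD1 i)//= lerDl; by apply: sumr_ge0 => j _; exact: sqr_ge0.
have f6 : `|fexp 2 (s x)| <= 6.
  rewrite ger0_norm ?fexp_ge0//; apply: (le_trans (fexp_le 2 _)).
  rewrite -[leRHS]mulr1; apply: ler_pM => //.
  by rewrite gtr0_norm// /s gerBl divr_ge0 ?sqr_ge0//; exact: sqn_ge0.
rewrite normrM ger0_norm ?invr_ge0 ?(ltW fexp01)//.
rewrite mulrAC [leRHS]mulrC ler_wpM2l ?invr_ge0 ?(ltW fexp01)//.
rewrite normrM normrN !normrM (ger0_norm (_ : 0 <= r ^- 2)) ?invr_ge0 ?exprn_ge0 ?(ltW r0)//.
apply: (@le_trans _ _ (6 * (r ^- 2 * (2 * r)))).
  apply: ler_pM => //; first by rewrite mulr_ge0// ?mulr_ge0// invr_ge0 exprn_ge0 ?ltW.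
  rewrite ler_wpM2l ?invr_ge0 ?exprn_ge0 ?(ltW r0)// (ger0_norm (ler0n R 2)) ler_wpM2l//.
by rewrite le_eqVlt; apply/orP; left; apply/eqP; field; rewrite gt_eqF.
Qed.

End cutoff_sequence.

(** * Density and mollification in L^2 *)

Section L2_density.
Variables (R : realType) (n : nat).
Local Notation leb := (lebesgue_rV R n).
Local Notation L2fun := (L2fun leb).
Local Notation n2 := (n2 leb).
Implicit Types (f g : 'rV[R]_n -> R).

Lemma lbs_l2 f : lbs f -> L2fun f.
Proof.
move=> [lf bf]; split; first exact: lbm_measurable.
by apply: (lbs_int measurableT (f := fun x => f x ^+ 2)); lbst.
Qed.

Lemma zcut_measurable k : measurable_fun setT (@zcut R n k).
Proof. by have [/lbm_measurable] := test_lbs (zcut_test R n k). Qed.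

Lemma l2_zcut f e : L2fun f -> 0 < e -> exists K, forall k, (K <= k)%N ->
  n2 (fun x => (1 - zcut k x) * f x) <= e.
Proof.
move=> lf; apply: (@n2_dct _ _ _ leb (fun k x => (1 - zcut k x) * f x) f) => // [k|x|k x].
- by apply: measurable_funM lf.1; apply: measurable_funB => //; exact: zcut_measurable.
- rewrite -[X in _ --> X](mul0r (f x)); apply: cvgM; last exact: cvg_cst.
  by rewrite -[X in _ --> X](subrr (1 : R)); apply: cvgB; [exact: cvg_cst|exact: zcut_cvg].
- rewrite normrM ler_piMl//; have /andP[? ?] := zcut01 k x.
  by rewrite ger0_norm; lra.
Qed.

Lemma l2_clamp f e : L2fun f -> 0 < e -> exists K, forall k, (K <= k)%N ->
  n2 (fun x => f x - Num.max (- k%:R) (Num.min k%:R (f x))) <= e.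
Proof.
move=> lf; apply: (@n2_dct _ _ _ leb (fun k x => f x - Num.max (- k%:R) (Num.min k%:R (f x))) f) => // [k|x|k x].
- by apply: measurable_funB lf.1 _; apply: measurable_maxr => //; apply: measurable_minr => //; exact: lf.1.
- apply: cvg_near_cst; exists (Num.truncn `|f x|).+1 => // k /= hk.
  have : `|f x| < k%:R by apply: (lt_le_trans (truncnS_gt _)); rewrite ler_nat.
  rewrite ltr_norml => /andP[h1 h2].
  by rewrite (min_idPr (ltW h2)) (max_idPr (ltW h1)) subrr.
- have k0 : 0 <= k%:R :> R by [].
  case: (ltrP (f x) k%:R) => h; last first.
    rewrite max_r; last lra.
    rewrite !ger0_norm; lra.
  case: (ltrP (- k%:R) (f x)) => h'; first by rewrite subrr normr0.
  rewrite !ler0_norm; lra.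
Qed.

(** Values are truncated to [[- k, k]], cut off by [z] and mapped affinely into [[0, 1]], where
    [sma_bounded] applies with weight [z]. The L^1 error controls the L^2 error because the
    difference is at most 1. *)
Lemma l2_dense f e : L2fun f -> 0 < e ->
  exists2 phi, test_function setT phi & n2 (fun x => f x - phi x) <= e.
Proof.
move=> lf e0; have e8 : 0 < e / 16 by rewrite divr_gt0.
have [K /(_ K.+1 (leqnSn K))] := l2_clamp lf e8.
(* The successor makes [k] positive, as needed for the division in [V]. *)
set k : R := K.+1%:R; have k0 : 0 < k by [].
set t := fun x => Num.max (- k) (Num.min k (f x)) => h1.
have tk x : - k <= t x <= k by rewrite /t ge_max le_max lexx/= ge_min lexx/= andbT; lra.
have mt : measurable_fun setT t.
  by apply: measurable_maxr => //; apply: measurable_minr => //; exact: lf.1.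
have lt : L2fun t.
  apply: l2_le mt lf _ => x; rewrite /t -(real_normK (num_real (f x))).
  rewrite -[leLHS](real_normK (num_real _)) ler_sqr ?nnegrE//.
  case: (ltrP (f x) k) => h; last first.
    rewrite max_r; last lra.
    rewrite !ger0_norm; lra.
  by case: (ltrP (- k) (f x)) => h' //; rewrite !ler0_norm; lra.
have [Z /(_ Z (leqnn Z)) h2] := l2_zcut lt e8.
have tz := zcut_test R n Z; have [lz bz] := test_lbs tz.
set z := zcut Z in tz lz bz h2.
have z01 x : 0 <= z x <= 1 by exact: zcut01.
have z0 x : 0 <= z x by have /andP[] := z01 x.
have lwz : L1fun leb z by apply: (lbs_int measurableT); split.
pose V x := (t x / k + 1) / 2.
have V01 x : 0 <= V x <= 1.
  have /andP[t1 t2] := tk x.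
  have : -1 <= t x / k <= 1 by rewrite ler_pdivlMr// ler_pdivrMr// mulN1r mul1r t1.
  by rewrite /V; move: (t x / k) => v /andP[? ?]; apply/andP; split; lra.
have mV : measurable_fun setT V.
  by apply: measurable_funM => //; apply: measurable_funD => //; exact: measurable_funM.
have d0 : 0 < e / (32 * k ^+ 2) by rewrite divr_gt0// mulr_gt0// exprn_gt0.
have [_ _ /(_ _ d0)[phi [pC p01] hp]] := sma_bounded z0 lwz mV V01.
have pC' j : isCk j (fun x => k * (2 * phi x + -1)).
  apply: isCkM; first exact: isCk_cst.
  by apply: isCkD; [apply: isCkM; [exact: isCk_cst|exact: pC]|exact: isCk_cst].
have tp := test_functionM pC' tz.
exists (fun x => z x * (k * (2 * phi x + -1))) => //.
have lp := lbs_l2 (test_lbs tp).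
have mz : measurable_fun setT z by exact: lbm_measurable.
have lzt : L2fun (fun x => z x * t x).
  apply: (l2_bdM (c := 1)) lt => // x; have /andP[? ?] := z01 x.
  by rewrite ger0_norm.
have l1zt : L2fun (fun x => (1 - z x) * t x).
  apply: (l2_bdM (c := 1)) lt => [|x]; first exact: measurable_funB.
  by have /andP[? ?] := z01 x; rewrite ger0_norm; lra.
have ld : L1fun leb (fun x => `|V x - phi x| * z x).
  exact: (dist_l1 z0 lwz mV (isCk_measurable (pC 0%N)) V01 p01).
have h3 : n2 (fun x => z x * t x - z x * (k * (2 * phi x + -1))) <= e / 8.
  apply: (@le_trans _ _ (\int[leb]_x (4 * k ^+ 2 * (`|V x - phi x| * z x)))).
    apply: le_Rintegral => //; first exact: (l2B lzt lp).2.
      exact: l1Z ld.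
    move=> x _; have -> : z x * t x - z x * (k * (2 * phi x + -1)) = 2 * k * ((V x - phi x) * z x).
      by rewrite /V; field; rewrite gt_eqF.
    rewrite exprMn (_ : (2 * k) ^+ 2 = 4 * k ^+ 2); last by ring.
    rewrite ler_wpM2l ?mulr_ge0 ?sqr_ge0//.
    have := z0 x; move=> zx; rewrite -{2}(ger0_norm zx) -normrM -(real_normK (num_real _)).
    rewrite expr2 ler_piMl// normrM mulr_ile1//; first exact: dist01.
    by have /andP[? ?] := z01 x; rewrite ger0_norm.
  rewrite RintegralZl//.
  apply: (@le_trans _ _ (4 * k ^+ 2 * (e / (32 * k ^+ 2)))).
    by rewrite ler_wpM2l ?mulr_ge0 ?sqr_ge0.
  by rewrite le_eqVlt; apply/orP; left; apply/eqP; field; rewrite gt_eqF.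
have -> : (fun x => f x - z x * (k * (2 * phi x + -1))) = fun x => (f x - t x) +
    ((1 - z x) * t x + (z x * t x - z x * (k * (2 * phi x + -1)))).
  by apply/funext => x; ring.
have lft := l2B lf lt; have lr := l2B lzt lp.
have := n2D lft (l2D l1zt lr); have := n2D l1zt lr => h4 h5.
apply: (le_trans h5); lra.
Qed.

End L2_density.

Section young_mconv.
Variables (R : realType) (n : nat).
Local Notation leb := (lebesgue_rV R n).
Local Notation L2fun := (L2fun leb).
Local Notation n2 := (n2 leb).
Implicit Types (f g k : 'rV[R]_n -> R).

Lemma l2_loc1 f : L2fun f -> loc1 f.
Proof.
move=> [mf lf]; split=> // M; have mB := @measurable_ball_rV R n M.
apply: (@le_integrable _ _ _ leb _ mB _ (EFin \o (fun x => 1 + f x ^+ 2))).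
- by apply/measurable_EFinP; exact: measurable_funTS.
- move=> x _ /=; rewrite lee_fin -(real_normK (num_real (f x))) [leRHS]ger0_norm ?addr_ge0 ?sqr_ge0//.
  by have := sqr_ge0 (`|f x| - 1); rewrite sqrrB => h; have := normr_ge0 (f x); lra.
- apply: (@integrableD _ _ _ leb _ mB (cst 1%E) (fun x => (f x ^+ 2)%:E)).
    apply/integrableP; split; first exact: measurable_cst.
    under eq_integral do rewrite /= normr1.
    by rewrite integral_cst// mul1e; exact: lebesgue_rV_ball.
  by apply: integrableS lf.
Qed.

Lemma l1_loc1 f : L1fun leb f -> loc1 f.
Proof.
move=> lf; split; first exact: l1_meas lf.
by move=> M; apply: integrableS lf => //; exact: measurable_ball_rV.
Qed.

(** Jensen's inequality for the probability density [k (. - x)], read off [int (f - C)^2 k >= 0]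
    with [C] the mean of [f]. *)
Lemma conv_sqr_le f k x (r : R) c : L2fun f -> mollifier r c k ->
  mconv f k x ^+ 2 <= mconv (fun y => f y ^+ 2) k x.
Proof.
move=> lf [kC _ k0 kr [k1 _]].
have lk := isCk_lbm (kC 0%N); have bk : bsupp k by exact: supp_ball kr.
have [l1k b1k] := lbs_shift x lk bk.
have i0 := lbs_int measurableT (conj l1k b1k).
have i1 := conv_int x (l2_loc1 lf) lk bk.
have i2 := conv_int x (l1_loc1 lf.2) lk bk.
set C := mconv f k x.
have : 0 <= \int[leb]_y ((f y ^+ 2 * k (y - x) - 2 * C * (f y * k (y - x))) + C ^+ 2 * k (y - x)).
  apply: Rintegral_ge0 => y _.
  have -> : f y ^+ 2 * k (y - x) - 2 * C * (f y * k (y - x)) + C ^+ 2 * k (y - x) =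
    (f y - C) ^+ 2 * k (y - x) by ring.
  by rewrite mulr_ge0 ?sqr_ge0.
rewrite RintegralD//; [|by apply: (l1B i2); exact: (l1Z (2 * C) i1)|exact: (l1Z (C ^+ 2) i0)].
rewrite RintegralB//; [|exact: (l1Z (2 * C) i1)].
rewrite !RintegralZl// k1 -/(mconv f k x) -/C -/(mconv (fun y => f y ^+ 2) k x).
move: (mconv (fun y => _) k x) => P; rewrite mulr1 => h.
suff e1 : P - 2 * C * C + C ^+ 2 = P - C ^+ 2 by move: h; rewrite e1 subr_ge0.
by ring.
Qed.

Lemma conv_l1_int f k (r : R) c : L1fun leb f -> (forall y, 0 <= f y) -> mollifier r c k ->
  L1fun leb (mconv f k) /\ \int[leb]_x mconv f k x = \int[leb]_y f y.
Proof.
move=> lf f0 [kC _ k0 kr [_ k1]].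
have lk := isCk_lbm (kC 0%N); have bk : bsupp k by exact: supp_ball kr.
have mk := lbm_measurable lk.
have E : (\int[leb]_x \int[leb]_y (f y * k (y - x))%:E = \int[leb]_y (f y)%:E)%E.
  have mF : measurable_fun setT (fun p : 'rV[R]_n * 'rV[R]_n => (f p.2 * k (p.2 - p.1))%:E).
    apply/measurable_EFinP; apply: measurable_funM.
      by apply: measurableT_comp (l1_meas lf) _; exact: measurable_snd.
    apply: measurableT_comp mk _; apply: measurable_fun_rV => i.
    rewrite (_ : _ \o _ = fun p : 'rV[R]_n * 'rV[R]_n => rV_coord i p.2 - rV_coord i p.1).
      by apply: measurable_funB; apply: measurableT_comp (measurable_rV_coord i) _;
        [exact: measurable_snd|exact: measurable_fst].
    by apply/funext => p; rewrite /rV_coord /= !mxE.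
  have F0 (p : 'rV[R]_n * 'rV[R]_n) : (0 <= (f p.2 * k (p.2 - p.1))%:E)%E.
    by rewrite lee_fin mulr_ge0.
  rewrite (@fubini_tonelli _ _ _ _ _ leb leb _ mF F0); apply: eq_integral => y _ /=.
  have lks : lbs (fun x : 'rV[R]_n => k (y - x)).
    split.
      have -> : (fun x : 'rV[R]_n => k (y - x)) = fun x => k (-1 *: x + y).
        by apply/funext => x; rewrite scaleN1r addrC.
      exact: lbm_affine.
    have [M HM] := bsuppE bk; apply: (bsuppI (M := M + `|y|)) => x Mx; apply: HM.
    by have := lerB_dist x y; rewrite distrC => h; lra.
  transitivity ((f y)%:E * \int[leb]_x (k (y - x))%:E)%E.
    rewrite -ge0_integralZl_EFin//.
    - by move=> x _; rewrite lee_fin.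
    - by apply/measurable_EFinP; exact: lbm_measurable lks.1.
  by rewrite -(ge0_RintegralE measurableT (lbs_int measurableT lks)) k1 mule1.
have fin x : (\int[leb]_y (f y * k (y - x))%:E = (mconv f k x)%:E)%E.
  by rewrite (ge0_RintegralE measurableT (conv_int x (l1_loc1 lf) lk bk)).
have c0 x : 0 <= mconv f k x by apply: Rintegral_ge0 => y _; rewrite mulr_ge0.
have mc : measurable_fun setT (mconv f k).
  apply: continuous_measurable_rV.
  exact: conv_cont (l1_loc1 lf) (isCk_C1 (kC 1%N)) bk.
have E2 : (\int[leb]_x (mconv f k x)%:E = \int[leb]_y (f y)%:E)%E.
  by rewrite -E; apply: eq_integral => x _; rewrite fin.
have lc : L1fun leb (mconv f k).
  apply/integrableP; split; first exact/measurable_EFinP.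
  under eq_integral do rewrite /= ger0_norm//.
  rewrite E2; have /integrableP[_] := lf.
  by under eq_integral do rewrite /= ger0_norm//.
split=> //; apply: EFin_inj.
by rewrite (ge0_RintegralE measurableT lc) (ge0_RintegralE measurableT lf).
Qed.

Lemma young_mconv f k (r : R) c : L2fun f -> mollifier r c k -> L2fun (mconv f k) /\ n2 (mconv f k) <= n2 f.
Proof.
move=> lf Mk; have [kC _ k0 kr _] := Mk; have bk : bsupp k by exact: supp_ball kr.
have [lc cE] := conv_l1_int lf.2 (fun y => sqr_ge0 _) Mk.
have mc : measurable_fun setT (mconv f k).
  by apply: continuous_measurable_rV; exact: conv_cont (l2_loc1 lf) (isCk_C1 (kC 1%N)) bk.
have lcc : L2fun (mconv f k).
  split=> //; apply: l1_le lc _; first exact: measurable_funX.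
  by move=> x; rewrite ger0_norm ?sqr_ge0//; exact: conv_sqr_le Mk.
split=> //; rewrite /n2 -cE; apply: le_Rintegral => //; first exact: lcc.2.
by move=> x _; exact: conv_sqr_le Mk.
Qed.

(** Convolution is a contraction of L^2, so [f] may be replaced by a test function [phi]; for [phi]
    the convergence is uniform and takes place in one fixed ball of finite measure. *)
Lemma conv_l2_cvg f (e : R) : L2fun f -> 0 < e -> exists2 d : R, 0 < d &
  forall r c k, mollifier r c k -> 0 <= r -> r + `|c| < d -> n2 (fun x => mconv f k x - f x) <= e.
Proof.
move=> lf e0; have e1 : 0 < e / 16 by rewrite divr_gt0.
have [phi tp hp] := l2_dense lf e1; have [lp bp] := test_lbs tp.
have [M HM] := bsuppE bp.
pose B : set 'rV[R]_n := [set x | `|x| <= M + 1].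
have mB : measurable B by exact: measurable_ball_rV.
have lB : lbs (\1_B : 'rV[R]_n -> R).
  split.
    have -> : (\1_B : 'rV[R]_n -> R) = (fun=> 1 : R) \_ B.
      by apply/funext => x; rewrite patchE indicE; case: (x \in B).
    by apply: lbm_restrict => //; exact: lbm_cst.
  by apply: (@bsuppI _ _ _ (M + 1)) => x Mx; rewrite indicE memNset// => xB; move: Mx; rewrite ltNge xB.
pose v := \int[leb]_x (\1_B x : R).
have v0 : 0 <= v by apply: Rintegral_ge0 => x _; rewrite indicE.
have e2 : 0 < Num.sqrt (e / (16 * (v + 1))).
  by rewrite sqrtr_gt0 divr_gt0// mulr_gt0// ltr_wpDl.
set eta := Num.sqrt _ in e2.
have [d d0 Hd] := unif_cont (C1_cont (test_C1 tp)) bp e2.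
exists (Num.min 1 d); first by rewrite lt_min ltr01.
move=> r c k Mk r0; rewrite lt_min => /andP[rc1 rcd].
have [kC _ k0 kr [k1 _]] := Mk; have bk : bsupp k by exact: supp_ball kr.
have lk := isCk_lbm (kC 0%N).
have lphi := lbs_l2 (test_lbs tp).
have lfp := l2B lf lphi.
have [la ha] := young_mconv lfp Mk; have [lb _] := young_mconv lphi Mk.
have lbphi := l2B lb lphi.
have hb : n2 (fun x => mconv phi k x - phi x) <= e / 16.
  have le x : (mconv phi k x - phi x) ^+ 2 <= eta ^+ 2 * \1_B x.
    rewrite indicE; have [xB|xB] := boolP (x \in B).
      rewrite mulr1 -(real_normK (num_real _)) ler_sqr ?nnegrE ?(ltW e2)//.
      apply: (conv_near lp Mk (ltW e2)) => y hy; apply: Hd.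
      apply: le_lt_trans rcd; apply: le_trans (lerD hy (lexx _)).
      by have := ler_normD (y - x - c) c; rewrite subrK.
    have Mx : M + 1 < `|x| by move: xB; rewrite notin_setE/= ltNge => /negP.
    rewrite (HM x) ?subr0; last by rewrite (lt_trans _ Mx)// ltrDl.
    rewrite /mconv (_ : (fun y => _) = fun=> 0); first by rewrite /Rintegral integral0 expr0n mulr0.
    apply/funext => y; have [h1|h1] := ltrP M `|y|; first by rewrite HM ?mul0r.
    rewrite kr ?mulr0//.
    have t1 := ler_normD (y - x - c) c; have t2 := lerB_dist x y.
    by rewrite subrK in t1; rewrite (distrC x) in t2; lra.
  apply: (@le_trans _ _ (\int[leb]_x (eta ^+ 2 * \1_B x))).
    apply: le_Rintegral => //; first exact: lbphi.2.
    by apply: l1Z; exact: lbs_int.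
  rewrite (IntZ measurableT)// /eta sqr_sqrtr; last by rewrite divr_ge0 ?(ltW e0)// mulr_ge0// addr_ge0.
  rewrite -/v; have v1 : 0 < v + 1 by rewrite ltr_wpDl.
  have -> : e / (16 * (v + 1)) * v = e / 16 * (v / (v + 1)) by field; rewrite gt_eqF.
  by rewrite ler_piMr ?(ltW e1)// ler_pdivrMr// mul1r lerDl.
have -> : (fun x => mconv f k x - f x) = fun x => mconv (fun y => f y - phi y) k x +
    ((mconv phi k x - phi x) + (phi x - f x)).
  apply/funext => x; rewrite /mconv; have -> : \int[leb]_y ((f y - phi y) * k (y - x)) =
      \int[leb]_y (f y * k (y - x)) - \int[leb]_y (phi y * k (y - x)).
    rewrite -RintegralB//; [|exact: conv_int (l2_loc1 lf) lk bk|exact: conv_int (l2_loc1 lphi) lk bk].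
    by apply: eq_Rintegral => y _; rewrite mulrBl.
  by ring.
have lpf := l2B lphi lf.
have hpf : n2 (fun x => phi x - f x) <= e / 16.
  apply: le_trans hp; rewrite le_eqVlt; apply/orP; left; apply/eqP.
  by apply: eq_Rintegral => x _; rewrite -sqrrN opprB.
have := n2D la (l2D lbphi lpf); have := n2D lbphi lpf => h4 h5.
apply: (le_trans h5); have := le_trans ha hp; lra.
Qed.

End young_mconv.

Section Lnorm2.
Context d (T : measurableType d) (R : realType) (mu : {measure set T -> \bar R}).
Implicit Types f g : T -> R.

Lemma Lnorm2E f : L2fun mu f -> 'N[mu]_2%:E[EFin \o f]%E = (Num.sqrt (n2 mu f))%:E.
Proof.
move=> [mf lf]; rewrite unlock /Lnorm.
have -> : (\int[mu]_x `|(EFin \o f) x| `^ 2 = (n2 mu f)%:E)%E.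
  rewrite /n2 (ge0_RintegralE measurableT lf); apply: eq_integral => x _ /=.
  by rewrite powR_mulrn// real_normK// num_real.
by rewrite poweR_EFin powR12_sqrt// n2_ge0.
Qed.

Lemma Lfun2P f : f \in Lfun mu 2%:E <-> L2fun mu f.
Proof.
split=> [lf|lf].
  split; last exact: Lfun2_integrable_sqr.
  by move: lf; rewrite inE => /andP[mf _]; move: mf; rewrite inE.
rewrite inE; apply/andP; split; rewrite inE/=; first exact: lf.1.
by rewrite /finite_norm Lnorm2E// ltry.
Qed.

Lemma l2_ae f g : L2fun mu f -> measurable_fun setT g -> {ae mu, forall x, f x = g x} ->
  L2fun mu g /\ n2 mu g = n2 mu f.
Proof.
move=> [mf lf] mg fg.
have mg2 : measurable_fun setT (fun x => g x ^+ 2) by exact: measurable_funX.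
have mf2 : measurable_fun setT (fun x => f x ^+ 2) by exact: measurable_funX.
have E : (\int[mu]_x (g x ^+ 2)%:E = \int[mu]_x (f x ^+ 2)%:E)%E.
  apply: ge0_ae_eq_integral => //; [exact/measurable_EFinP|exact/measurable_EFinP| | |].
  - by move=> x _; rewrite lee_fin sqr_ge0.
  - by move=> x _; rewrite lee_fin sqr_ge0.
  - by apply: filterS fg => x -> _.
split; last by rewrite /n2 /Rintegral E.
split=> //; apply/integrableP; split; first exact/measurable_EFinP.
under eq_integral do rewrite /= ger0_norm ?sqr_ge0//.
rewrite E; have /integrableP[_] := lf.
by under eq_integral do rewrite /= ger0_norm ?sqr_ge0//.
Qed.

End Lnorm2.

(** * H^1 functions and their approximation up to the boundary *)

Section H1.
Variables (R : realType) (n : nat) (D : set 'rV[R]_n) (th : nat -> 'rV[R]_n -> R).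
Hypotheses (Dth : exhausting D th) (mD : measurable D).
Local Notation leb := (lebesgue_rV R n).
Local Notation L2fun := (L2fun leb).
Local Notation n2 := (n2 leb).
Implicit Types (u v : 'rV[R]_n -> R) (g h : 'I_n -> 'rV[R]_n -> R).

Definition H1_data u g := L2fun (u \_ D) /\ forall i, is_weak_partial D i u (g i) /\ L2fun (g i \_ D).

Lemma restrictB u v : (fun x => u x - v x) \_ D = fun x => (u \_ D) x - (v \_ D) x.
Proof. by apply/funext => x; rewrite !patchE; case: ifPn => _; rewrite ?subrr. Qed.

Lemma H1_dataB u v g h : H1_data u g -> H1_data v h ->
  H1_data (fun x => u x - v x) (fun i x => g i x - h i x).
Proof.
move=> [lu Hu] [lv Hv]; split; first by rewrite restrictB; exact: l2B.
move=> i; have [wu lg] := Hu i; have [wv lh] := Hv i.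
by split; [exact: is_weak_partialB|rewrite restrictB; exact: l2B].
Qed.

Lemma l2_restrict u : L2fun u -> L2fun (u \_ D).
Proof.
move=> lu; apply: (l2_le _ lu) => [|x].
  have := lu.1; move/(measurable_funS measurableT (@subsetT _ D)).
  by move/(measurable_restrictT _ mD).1.
by rewrite patchE; case: ifPn => // _; rewrite expr0n sqr_ge0.
Qed.

Lemma H1_data_C1 u Du : C1 u Du -> bsupp u -> H1_data u Du.
Proof.
move=> uD bu; split; first by apply: l2_restrict; apply: lbs_l2; split => //; exact: C1_lbm uD.
move=> i; split; first exact: is_weak_partial_C1.
by apply/l2_restrict/lbs_l2; split; [exact: C1_lbmD uD|exact: C1_bsuppD uD bu].
Qed.

Lemma W1p_data u : W1p D 2%:E u -> H1_data u (fun i => weak_partial D i u).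
Proof.
move=> [/Lfun2P lu Hu]; split=> // i; have [g wg /Lfun2P lg] := Hu i.
have wp := weak_partialP wg; split=> //; have [_ lwp _] := wp.
apply: (l2_ae lg (loc_measurable Dth mD lwp) _).1.
apply: filterS (weak_partialE Dth mD wg) => x Hx; rewrite !patchE.
by case: ifPn => // /set_mem Dx; rewrite Hx.
Qed.

Lemma H1_data_W1p u g : H1_data u g -> W1p D 2%:E u.
Proof.
by move=> [lu Hu]; split=> [|i]; [exact/Lfun2P|have [? ?] := Hu i; exists (g i); last exact/Lfun2P].
Qed.

Lemma H1_normE u g : H1_data u g ->
  H1_norm D u = (Num.sqrt (n2 (u \_ D)) + \sum_(i < n) Num.sqrt (n2 (g i \_ D)))%:E.
Proof.
move=> Hu; have [lu Hg] := Hu; have [_ Hw] := W1p_data (H1_data_W1p Hu).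
rewrite /H1_norm Lnorm2E// [RHS]EFinD -sumEFin; congr (_ + _)%E; apply: eq_bigr => i _.
have [wg lg] := Hg i; have [ww lw] := Hw i.
rewrite Lnorm2E//; congr (Num.sqrt _)%:E.
apply: (l2_ae lg lw.1 _).2.
apply: filterS (weak_partialE Dth mD wg) => x Hx; rewrite !patchE.
by case: ifPn => // /set_mem Dx; rewrite Hx.
Qed.

Lemma H1_cvg0 (v : nat -> 'rV[R]_n -> R) (g : nat -> 'I_n -> 'rV[R]_n -> R) :
  (forall k, H1_data (v k) (g k)) ->
  (forall e : R, 0 < e -> exists K, forall k, (K <= k)%N ->
     n2 (v k \_ D) <= e /\ forall i, n2 (g k i \_ D) <= e) <->
  H1_norm D (v k) @[k --> \oo] --> 0%E.
Proof.
move=> Hv; pose s k : R := Num.sqrt (n2 (v k \_ D)) + \sum_(i < n) Num.sqrt (n2 (g k i \_ D)).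
have -> : (fun k => H1_norm D (v k)) = EFin \o s.
  by apply/funext => k; rewrite (H1_normE (Hv k)).
have s0 k : 0 <= s k by rewrite addr_ge0 ?sqrtr_ge0// sumr_ge0// => i _; exact: sqrtr_ge0.
split=> [H|/fine_cvgP[_] /cvgrPdist_le H e e0].
  apply: cvg_EFin; first exact: nearW.
  apply/cvgrPdist_le => e e0; have c0 : 0 < (e / n.+1%:R) ^+ 2 by rewrite exprn_gt0// divr_gt0.
  have [K HK] := H _ c0; exists K => // k /= /HK[h1 h2].
  have sq a : 0 <= a -> a <= (e / n.+1%:R) ^+ 2 -> Num.sqrt a <= e / n.+1%:R.
    move=> a0 h; rewrite -[leRHS]ger0_norm ?divr_ge0 ?(ltW e0)// -sqrtr_sqr.
    by rewrite ler_wsqrtr.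
  rewrite sub0r normrN /= ger0_norm//.
  apply: (@le_trans _ _ (e / n.+1%:R + \sum_(i < n) (e / n.+1%:R))).
    by apply: lerD; [|apply: ler_sum => i _]; apply: sq; rewrite ?n2_ge0.
  by rewrite sumr_const card_ord -mulrS -[leLHS]mulr_natr divfK ?pnatr_eq0.
have e1 : 0 < Num.sqrt e by rewrite sqrtr_gt0.
have [K _ HK] := H _ e1; exists K => k /HK; rewrite sub0r normrN /= ger0_norm// => h.
have sq a : 0 <= a -> Num.sqrt a <= s k -> a <= e.
  move=> a0 h1; rewrite -(sqr_sqrtr a0) -(sqr_sqrtr (ltW e0)) ler_sqr ?nnegrE ?sqrtr_ge0//.
  by apply: le_trans h1 _; exact: h.
split=> [|i]; apply: sq; rewrite ?n2_ge0//.
  by rewrite lerDl sumr_ge0// => i _; exact: sqrtr_ge0.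
rewrite /s (bigD1 i)//= addrCA lerDl addr_ge0 ?sqrtr_ge0// sumr_ge0// => j _.
Qed.

End H1.

Lemma max_index (I : finType) (P : I -> nat -> Prop) :
  (forall i, exists K, forall k, (K <= k)%N -> P i k) ->
  exists K, forall k, (K <= k)%N -> forall i, P i k.
Proof.
move=> /choice[K HK]; exists (\max_i K i) => k hk i; apply: HK.
exact: leq_trans (leq_bigmax i) hk.
Qed.

Lemma min_radius (R : realType) (I : finType) (P : I -> R -> Prop) :
  (forall i, exists2 d : R, 0 < d & forall r, 0 < r -> r < d -> P i r) ->
  exists2 d : R, 0 < d & forall r, 0 < r -> r < d -> forall i, P i r.
Proof.
move=> H; have /choice[d Hd] i : exists d : R, 0 < d /\ forall r, 0 < r -> r < d -> P i r.
  by have [d d0 Hd] := H i; exists d.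
exists (\big[Num.min/1]_i d i).
  by elim/big_ind: _ => // [x y x0 y0|i _]; [rewrite lt_min x0|case: (Hd i)].
move=> r r0 hr i; apply: (Hd i).2 => //; apply: lt_le_trans hr _; exact: bigmin_le.
Qed.

Section H1_density.
Variables (R : realType) (m : nat).
Local Notation n := m.+1.
Local Notation leb := (lebesgue_rV R n).
Local Notation Om := (half_space R m).
Local Notation L2fun := (L2fun leb).
Local Notation n2 := (n2 leb).
Local Notation en := (delta_mx ord0 ord_max : 'rV[R]_n).
Implicit Types (u k : 'rV[R]_n -> R) (g : 'I_n -> 'rV[R]_n -> R).

Lemma isCk_shift (j : nat) k (a : 'rV[R]_n) : (forall p : nat, isCk p k) ->
  isCk j (fun y => k (y - a)) /\ forall i, partial i (fun y => k (y - a)) = fun y => partial i k (y - a).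
Proof.
have D q i : (forall p : nat, isCk p q) -> forall y, is_derive y (delta_mx ord0 i) (fun y : 'rV[R]_n => q (y - a)) (partial i q (y - a)).
  move=> qC y; apply: (is_derive_lin (L := fun y : 'rV[R]_n => y - a)); last exact: isCk_derive (qC 1%N).
  by move=> h; rewrite addrA.
have C q : (forall p : nat, isCk p q) -> continuous (fun y : 'rV[R]_n => q (y - a)).
  move=> qC; have [+ _ _] := C1_affine 1 (- a) (isCk_C1 (qC 1%N)).
  by under eq_fun do rewrite scale1r.
move=> kC; split; last by move=> i; apply: partial_E; exact: D.
elim: j k kC => [|j IH] k kC; first by split=> //; exact: C.
by apply: isCkS (C _ kC) (fun i => D _ i kC) _ => i; apply: IH => p; exact: isCk_partial (kC p.+1).
Qed.

(** The support lies within [r] of [x + 2 r e_n], hence at height at least [x_n + r > 0]. *)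
Lemma mollifier_test (r : R) k x : 0 < r -> mollifier r ((2 * r) *: en) k -> Om x ->
  test_function Om (fun y => k (y - x)).
Proof.
move=> r0 [kC _ _ kr _] x0.
apply: (@test_functionI _ _ _ [set y | `|y - (x + (2 * r) *: en)| <= r]) => [j||y|y].
- by have [] := isCk_shift j x kC.
- apply: (@closed_bounded_compact _ _ _ (r + `|x + (2 * r) *: en|)) => [|y /= h].
    apply: (@closed_comp _ _ (fun y : 'rV[R]_n => `|y - (x + (2 * r) *: en)|) [set t : R | t <= r]); last exact: closed_le.
    move=> y _; apply: nonexp_cont => y1 y2; apply: (le_trans (ler_dist_dist _ _)).
    by rewrite opprB addrA subrK.
  by have := ler_normD (y - (x + (2 * r) *: en)) (x + (2 * r) *: en); rewrite subrK; lra.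
- move=> h; rewrite /half_space/=; have := coord_le_norm (y - (x + (2 * r) *: en)) ord_max.
  move=> /le_trans/(_ h); rewrite !mxE !eqxx/= mulr1 => /ler_normlP[h1 _].
  by move: x0; rewrite /half_space/= => x0; lra.
- move=> /negP; rewrite -ltNge => h; apply: kr.
  by rewrite -addrA -opprD.
Qed.

(** Extension by zero creates a jump across the boundary. A kernel centred at [2 r e_n] averages
    only over points above [x], so from inside the half-space the jump is invisible and the gradient
    of the mollified function is the mollified gradient. The cut-off [zcut] then makes the support
    compact. *)
Lemma H1_dense u g (e : R) : H1_data Om u g -> 0 < e -> exists2 phi, test_function setT phi &
  n2 ((fun x => phi x - u x) \_ Om) <= e /\ forall i, n2 ((fun x => partial i phi x - g i x) \_ Om) <= e.
Proof.
move=> [lU Hg] e0; have lG i : L2fun (g i \_ Om) by case: (Hg i).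
have wg i : is_weak_partial Om i u (g i) by case: (Hg i).
have mO := @measurable_half_space R m.
have e1 : 0 < e / 16 by rewrite divr_gt0.
have r3 (r d : R) : 0 < r -> r < d / 3 -> r + `|(2 * r) *: en| < d.
  move=> r0 h; apply: (@le_lt_trans _ _ (r + 2 * r)); last by lra.
  rewrite lerD2l; apply: norm_le_coord => [|i]; first by rewrite mulr_ge0// ltW.
  rewrite !mxE/=; case: (_ == _); rewrite ?mulr1 ?mulr0 ?normr0 ?mulr_ge0 ?(ltW r0)//.
  by rewrite ger0_norm// mulr_ge0// ltW.
pose good (f : 'rV[R]_n -> R) (r : R) := forall k, mollifier r ((2 * r) *: en) k ->
  n2 (fun x => mconv f k x - f x) <= e / 16.
have cv f : L2fun f -> exists2 d : R, 0 < d & forall r, 0 < r -> r < d -> good f r.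
  move=> lf; have [d d0 Hd] := conv_l2_cvg lf e1; exists (d / 3); first by rewrite divr_gt0.
  by move=> r r0 rd k Mk; apply: Hd Mk _ _; [exact: ltW|exact: r3].
have [d1 d10 H1] := cv _ lU; have [d2 d20 H2] := min_radius (fun i => cv _ (lG i)).
pose r := Num.min d1 d2 / 2.
have d0 : 0 < Num.min d1 d2 by rewrite lt_min d10.
have r0 : 0 < r by rewrite divr_gt0.
have rd : r < Num.min d1 d2 by rewrite ltr_pdivrMr// ltr_pMr// ltr1n.
have [k Mk] := mollifier_exists ((2 * r) *: en) r0.
have hU : n2 (fun x => mconv (u \_ Om) k x - (u \_ Om) x) <= e / 16.
  by apply: H1 Mk => //; apply: lt_le_trans rd _; rewrite ge_min lexx.
have hG i : n2 (fun x => mconv (g i \_ Om) k x - (g i \_ Om) x) <= e / 16.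
  by apply: H2 Mk => //; apply: lt_le_trans rd _; rewrite ge_min lexx orbT.
have [kC _ k0 kr _] := Mk; have bk : bsupp k by exact: supp_ball kr.
pose psi := mconv (u \_ Om) k.
have pC j : isCk j psi by exact: isCk_conv (l2_loc1 lU) kC bk.
have pD i x : Om x -> partial i psi x = mconv (g i \_ Om) k x.
  move=> Ox; have tk := mollifier_test r0 Mk Ox.
  have -> : partial i psi = fun x => - mconv (u \_ Om) (partial i k) x.
    by apply: partial_E => y; apply: conv_derive (l2_loc1 lU) (isCk_C1 (kC 1%N)) bk.
  have [_ _ /(_ _ tk)] := wg i; have [_ ->] := isCk_shift 0 x kC => h.
  rewrite /mconv; apply: oppr_inj; rewrite opprK.
  have RO (f q : 'rV[R]_n -> R) : \int[leb]_y ((f \_ Om) y * q y) = \int[leb]_(y in Om) (f y * q y).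
    rewrite [RHS]Rintegral_mkcond; apply: eq_Rintegral => y _; rewrite !patchE.
    by case: ifPn; rewrite ?mul0r.
  by rewrite !RO h.
have [lpsi _] := young_mconv lU Mk; have lpsiG i := (young_mconv (lG i) Mk).1.
have c0 : 0 < fexp 0 (1 : R) := fexp01 R.
pose C : R := 12 / fexp 0 1.
have C0 : 0 <= C by rewrite divr_ge0// ltW.
have [Z1 HZ1] := l2_zcut lU e1.
have [Z2 HZ2] := max_index (fun i => l2_zcut (lG i) e1).
(* The product rule leaves [psi] times the gradient of the cut-off, which is of order
   [1 / (j + 1)]. *)
have [Z3 HZ3] : exists K, forall j, (K <= j)%N -> (C / j.+1%:R) ^+ 2 * n2 psi <= e / 16.
  exists (Num.truncn (C ^+ 2 * n2 psi / (e / 16))) => j hj.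
  have : C ^+ 2 * n2 psi / (e / 16) <= j.+1%:R.
    by apply: le_trans (ltW (truncnS_gt _)) _; rewrite ler_nat.
  rewrite ler_pdivrMr// => h.
  have j1 : (1 : R) <= j.+1%:R by rewrite ler1n.
  have jp : 0 < j.+1%:R :> R by [].
  rewrite exprMn exprVn mulrAC ler_pdivrMr ?exprn_gt0// (le_trans h)// mulrC ler_wpM2l ?(ltW e1)//.
  by rewrite expr2 ler_peMr// ltW.
pose Z := maxn Z1 (maxn Z2 Z3).
have /HZ1 z1 : (Z1 <= Z)%N by rewrite leq_maxl.
have /HZ2 z2 : (Z2 <= Z)%N by rewrite /Z maxnCA leq_maxl.
have /HZ3 z3 : (Z3 <= Z)%N by rewrite /Z maxnA leq_maxr.
have tz := zcut_test R n Z; set z := zcut Z in tz z1 z2.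
have mz : measurable_fun setT z by exact: zcut_measurable.
have z01 x : `|z x| <= 1 by have /andP[? ?] := zcut01 Z x; rewrite ger0_norm.
have z01' x : `|1 - z x| <= 1 by have /andP[? ?] := zcut01 Z x; rewrite ger0_norm ?subr_ge0// gerBl.
have mz1 : measurable_fun setT (fun x => 1 - z x) by exact: measurable_funB.
have half w w' : L2fun w -> L2fun w' -> n2 (fun x => w x - w' x) <= e / 16 ->
    n2 (fun x => (1 - z x) * w' x) <= e / 16 ->
    L2fun (fun x => z x * (w x - w' x) - (1 - z x) * w' x) /\
    n2 (fun x => z x * (w x - w' x) - (1 - z x) * w' x) <= e / 4.
  move=> lw lw' h1 h2; have lww := l2B lw lw'.
  have la := l2_bdM mz z01 lww; have lb := l2N (l2_bdM mz1 z01' lw'); split; first exact: l2D la lb.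
  have hn : n2 (fun x => - ((1 - z x) * w' x)) = n2 (fun x => (1 - z x) * w' x).
    by apply: eq_Rintegral => x _; rewrite sqrrN.
  have := n2_bdM mz z01 lww; rewrite expr1n mul1r.
  have := n2D la lb; rewrite hn => h3 h4; apply: (le_trans h3); lra.
exists (fun x => z x * psi x); first exact: test_functionM.
have rn (v w : 'rV[R]_n -> R) : L2fun w -> (forall x, Om x -> v x = w x) -> n2 (v \_ Om) <= n2 w.
  move=> lw vw; have -> : v \_ Om = w \_ Om.
    by apply/funext => x; rewrite !patchE; case: ifPn => // /set_mem/vw.
  apply: n2_le (l2_restrict mO lw) lw _ => x.
  by rewrite patchE; case: ifPn => // _; rewrite expr0n sqr_ge0.
split=> [|i].
  have [la ha] := half _ _ lpsi lU hU z1.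
  apply: (le_trans (rn _ _ la _)); last by lra.
  by move=> x Ox; rewrite patchE mem_set// /psi; ring.
have [la ha] := half _ _ (lpsiG i) (lG i) (hG i) (z2 i).
have zi x : `|partial i z x| <= C / Z.+1%:R by exact: partial_zcut.
have mzi : measurable_fun setT (partial i z).
  by apply: isCk_measurable; have [/(_ 1%N)/(isCk_partial i)] := tz.
have lb := l2_bdM mzi zi lpsi; have hb := n2_bdM mzi zi lpsi.
have h := n2D la lb.
apply: (le_trans (rn _ _ (l2D la lb) _)); last by have := le_trans hb z3; lra.
move=> x Ox; rewrite patchE mem_set// -(pD i x Ox).
have -> : partial i (fun x => z x * psi x) = fun x => z x * partial i psi x + psi x * partial i z x.
  by apply: partial_E => y; have [_ _] := C1M (test_C1 tz) (isCk_C1 (pC 1%N)); apply.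
by rewrite -/psi; ring.
Qed.

End H1_density.

(** * Traces *)

Section slice_integral.
Variables (R : realType) (m : nat).
Local Notation leb := (lebesgue_rV R).
Local Notation mu := (@lebesgue_measure R).
Implicit Types (V W : 'rV[R]_m.+1 -> R).

Definition sint V (x : 'rV[R]_m) : R := \int[mu]_t V (snoc (x, t)).

Lemma measurable_sint V : measurable_fun setT V -> measurable_fun setT (sint V).
Proof.
move=> mV; have mVs : measurable_fun setT (fun p : 'rV[R]_m * measurableTypeR R => (V (snoc p))%:E).
  by apply/measurable_EFinP; apply: measurableT_comp mV _; exact: measurable_snoc.
have -> : sint V = fine \o (fun x => \int[mu]_t ((fun p => (V (snoc p))%:E)^\+ (x, t)) -
    \int[mu]_t ((fun p => (V (snoc p))%:E)^\- (x, t)))%E.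
  apply/funext => x; rewrite /sint /Rintegral /= integralE.
  by congr (fine (_ - _)%E); apply: eq_integral => t _; rewrite ?funeposE ?funenegE.
apply: measurableT_comp; first exact: (fine_measurable measurableT).
by apply: emeasurable_funB; apply: measurable_fun_fubini_tonelli_F => //;
  [exact: measurable_funepos|exact: measurable_funeneg].
Qed.

Lemma l2_slice V : L2fun (leb m.+1) V ->
  {ae leb m, forall x, L2fun mu (fun t : measurableTypeR R => V (snoc (x, t)))}.
Proof.
move=> [mV lV]; pose H x := (\int[mu]_t (V (snoc (x, t)) ^+ 2)%:E)%E.
have mV2 : measurable_fun setT (fun x => (V x ^+ 2)%:E).
  by apply/measurable_EFinP; exact: measurable_funX.
have H0 x : (0 <= H x)%E by apply: integral_ge0 => t _; rewrite lee_fin sqr_ge0.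
have mH : measurable_fun setT H.
  apply: (@measurable_fun_fubini_tonelli_F _ _ _ _ _ mu (fun p => (V (snoc p) ^+ 2)%:E)).
    by apply: measurableT_comp mV2 _; exact: measurable_snoc.
  by move=> p; rewrite lee_fin sqr_ge0.
have EH : (\int[leb m]_x H x = (n2 (leb m.+1) V)%:E)%E.
  rewrite /n2 (ge0_RintegralE measurableT lV) ge0_integral_snoc// => x.
  by rewrite lee_fin sqr_ge0.
have iH : (leb m).-integrable setT H.
  apply/integrableP; split=> //; under eq_integral do rewrite gee0_abs//.
  by rewrite EH ltry.
apply: filterS (integrable_ae measurableT iH) => x /(_ I) fx.
have mVx : measurable_fun setT (fun t : measurableTypeR R => V (snoc (x, t))).
  by apply: measurableT_comp mV _; exact: measurable_snocr.
split=> //; apply/integrableP; split; first by apply/measurable_EFinP; exact: measurable_funX.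
under eq_integral do rewrite /= ger0_norm ?sqr_ge0//.
by rewrite -ge0_fin_numE//; exact: H0.
Qed.

Definition in_strip V := forall x t, ~~ (0 < t <= 1) -> V (snoc (x, t)) = 0.

(** Cauchy-Schwarz on a vertical interval of length 1. *)
Lemma strip_l1 V x : in_strip V -> L2fun mu (fun t : measurableTypeR R => V (snoc (x, t))) ->
  L1fun mu (fun t : measurableTypeR R => V (snoc (x, t))) /\
  sint V x ^+ 2 <= n2 mu (fun t : measurableTypeR R => V (snoc (x, t))).
Proof.
move=> sV lV; pose o (t : measurableTypeR R) : R := \1_(`]0, 1]%classic) t.
have mI : measurable (`]0, 1]%classic : set (measurableTypeR R)) by exact: measurable_itv.
have mo : measurable_fun setT o by exact: measurable_indic.
have o2 t : o t ^+ 2 = o t by rewrite /o indicE; case: (_ \in _); rewrite ?expr1n ?expr0n.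
have io : \int[mu]_t o t = 1.
  rewrite /Rintegral integral_indic// setIT /= lebesgue_measure_itv/= lte_fin ltr01.
  by rewrite oppr0 adde0.
have lo : L2fun mu o.
  split=> //; rewrite (_ : (fun t => o t ^+ 2) = o); last by apply/funext => t; exact: o2.
  apply/integrableP; split; first exact/measurable_EFinP.
  rewrite (eq_integral (fun t => (o t)%:E)) => [|t _]; last by rewrite /= ger0_norm// /o indicE.
  by rewrite integral_indic// setIT /= lebesgue_measure_itv/= lte_fin ltr01 -EFinB ltry.
have E t : V (snoc (x, t)) = V (snoc (x, t)) * o t.
  rewrite /o indicE; have [_|h] := boolP (t \in _); first by rewrite mulr1.
  by rewrite mulr0 sV//; apply: contra h => h; rewrite inE/= in_itv.
have EE : (fun t : measurableTypeR R => V (snoc (x, t))) = fun t => V (snoc (x, t)) * o t.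
  by apply/funext => t; exact: E.
split; first by rewrite EE; exact: l2M.
have := n2_CS lV lo; rewrite /sint EE /n2.
rewrite [X in _ <= _ * X -> _](_ : _ = 1) ?mulr1 -?EE// -[RHS]io.
by apply: eq_Rintegral => t _; exact: o2.
Qed.

Lemma sint_l2 V : in_strip V -> L2fun (leb m.+1) V ->
  L2fun (leb m) (sint V) /\ n2 (leb m) (sint V) <= n2 (leb m.+1) V.
Proof.
move=> sV lV; have [mV l1V] := lV; have ms := measurable_sint mV.
have E : (\int[leb m]_x (sint V x ^+ 2)%:E <= (n2 (leb m.+1) V)%:E)%E.
  rewrite /n2 (ge0_RintegralE measurableT l1V) ge0_integral_snoc//; last first.
  - by move=> x; rewrite lee_fin sqr_ge0.
  - by apply/measurable_EFinP; exact: measurable_funX.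
  apply: ae_ge0_le_integral => //.
  - by move=> x _; rewrite lee_fin sqr_ge0.
  - by apply/measurable_EFinP; exact: measurable_funX.
  - by move=> x _; apply: integral_ge0 => t _; rewrite lee_fin sqr_ge0.
  - apply: (@measurable_fun_fubini_tonelli_F _ _ _ _ _ mu (fun p => (V (snoc p) ^+ 2)%:E)).
      by apply/measurable_EFinP; apply: measurable_funX; apply: measurableT_comp mV _; exact: measurable_snoc.
    by move=> p; rewrite lee_fin sqr_ge0.
  - apply: filterS (l2_slice lV) => x lx _; have [_ h] := strip_l1 sV lx.
    by rewrite -(ge0_RintegralE measurableT lx.2) lee_fin.
have ls : L2fun (leb m) (sint V).
  split=> //; apply/integrableP; split; first by apply/measurable_EFinP; exact: measurable_funX.
  under eq_integral do rewrite /= ger0_norm ?sqr_ge0//.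
  exact: le_lt_trans E (ltry _).
by split=> //; rewrite -lee_fin {1}/n2 (ge0_RintegralE measurableT ls.2).
Qed.

(** Only almost everywhere: on a null set of base points the slice need not be integrable, and the
    integral is then not additive. *)
Lemma sintB V W : in_strip V -> in_strip W -> L2fun (leb m.+1) V -> L2fun (leb m.+1) W ->
  {ae leb m, forall x, sint (fun y => V y - W y) x = sint V x - sint W x}.
Proof.
move=> sV sW lV lW; apply: filterS2 (l2_slice lV) (l2_slice lW) => x lx lx'.
by rewrite /sint RintegralB//; [exact: (strip_l1 sV lx).1|exact: (strip_l1 sW lx').1].
Qed.

End slice_integral.

Section trace.
Variables (R : realType) (m : nat).
Local Notation leb := (lebesgue_rV R).
Local Notation Om := (half_space R m).
Local Notation bd f := (fun x : 'rV[R]_m => f (snoc (x, 0 : R))).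
Implicit Types (u : 'rV[R]_m.+1 -> R) (g : 'I_m.+1 -> 'rV[R]_m.+1 -> R).

Let mO := @measurable_half_space R m.
Let eO := @exhausting_half_space R m.

Lemma n2_eq0 d (T : measurableType d) (mu : {measure set T -> \bar R}) (f : T -> R) :
  L2fun mu f -> n2 mu f <= 0 -> {ae mu, forall x, f x = 0}.
Proof.
move=> lf h; have nf : 'N[mu]_2%:E[EFin \o f]%E = 0%E.
  by rewrite Lnorm2E// ler0_sqrtr.
have := Lnorm_eq0_eq0 _ _ nf; case=> //; first by apply/measurable_EFinP; exact: lf.1.
move=> N [mN N0 sN]; exists N; split=> // x /= fx; apply: sN => /= h2.
by apply: fx; have [] := h2 I.
Qed.

Lemma n2_restrict d (T : measurableType d) (mu : {measure set T -> \bar R}) (D : set T) (f : T -> R) :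
  n2 mu (f \_ D) = \int[mu]_(x in D) (f x ^+ 2).
Proof.
rewrite [RHS]Rintegral_mkcond; apply: eq_Rintegral => x _; rewrite !patchE.
by case: ifPn; rewrite ?expr0n.
Qed.

(* Integrated over 0 < t <= 1 with [v] the normal derivative of [u], this is minus the
   integral of d/dt ((1 - t) u), that is, the trace of [u]. *)
Definition wstrip (u v : 'rV[R]_m.+1 -> R) (x : 'rV[R]_m.+1) : R :=
  let t := x ord0 ord_max in if 0 < t <= 1 then u x - (1 - t) * v x else 0.

Lemma wstrip_in u v : in_strip (wstrip u v).
Proof. by move=> x t h; rewrite /wstrip snoc_last (negbTE h). Qed.

Lemma wstripE u v (x : 'rV[R]_m.+1) : wstrip u v x =
  \1_[set x : 'rV[R]_m.+1 | 0 < x ord0 ord_max <= 1] x * (u \_ Om) x -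
  (\1_[set x : 'rV[R]_m.+1 | 0 < x ord0 ord_max <= 1] x * (1 - x ord0 ord_max)) * (v \_ Om) x.
Proof.
rewrite /wstrip indicE; case: ifPn => h.
  have [h1 h2] := andP h; rewrite mem_set//= !patchE mem_set ?mul1r//.
by rewrite memNset ?mul0r ?subrr//=; exact/negP.
Qed.

Lemma wstrip_l2 u v : L2fun (leb m.+1) (u \_ Om) -> L2fun (leb m.+1) (v \_ Om) ->
  L2fun (leb m.+1) (wstrip u v) /\
  n2 (leb m.+1) (wstrip u v) <= 2 * n2 (leb m.+1) (u \_ Om) + 2 * n2 (leb m.+1) (v \_ Om).
Proof.
move=> lu lv; pose S := [set x : 'rV[R]_m.+1 | 0 < x ord0 ord_max <= 1].
have mS : measurable S.
  rewrite (_ : S = @rV_coord R m.+1 ord_max @^-1` `]0, 1]%classic); last first.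
    by apply/seteqP; split=> x /=; rewrite in_itv.
  by rewrite -[X in measurable X]setTI; apply: measurable_rV_coord.
have m1 : measurable_fun setT (\1_S : 'rV[R]_m.+1 -> R) by exact: measurable_indic.
have b1 x : `|\1_S x : R| <= 1 by rewrite indicE; case: (_ \in _); rewrite ?normr1 ?normr0.
have m2 : measurable_fun setT (fun x : 'rV[R]_m.+1 => \1_S x * (1 - x ord0 ord_max)).
  by apply: measurable_funM => //; apply: measurable_funB => //; exact: measurable_rV_coord.
have b2 (x : 'rV[R]_m.+1) : `|\1_S x * (1 - x ord0 ord_max) : R| <= 1.
  rewrite indicE; have [/set_mem/andP[h1 h2]|_] := boolP (x \in S); last by rewrite mul0r normr0.
  by rewrite mul1r ger0_norm; lra.
have la := l2_bdM m1 b1 lu; have lb := l2N (l2_bdM m2 b2 lv).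
have -> : wstrip u v = fun x => \1_S x * (u \_ Om) x + - ((\1_S x * (1 - x ord0 ord_max)) * (v \_ Om) x).
  by apply/funext => x; rewrite wstripE.
split; first exact: l2D la lb.
have ha := n2_bdM m1 b1 lu; have hb := n2_bdM m2 b2 lv.
apply: (le_trans (n2D la lb)).
have -> : n2 (leb m.+1) (fun x => - (\1_S x * (1 - x ord0 ord_max) * (v \_ Om) x)) =
    n2 (leb m.+1) (fun x => \1_S x * (1 - x ord0 ord_max) * (v \_ Om) x).
  by apply: eq_Rintegral => x _; rewrite sqrrN.
by move: ha hb; rewrite expr1n !mul1r => ha hb; lra.
Qed.

Lemma sint_C1 f Df (x : 'rV[R]_m) : C1 f Df -> bsupp f ->
  sint (wstrip f (Df ord_max)) x = f (snoc (x, 0)).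
Proof.
move=> fD bf; rewrite (trace_formula x fD) /sint.
have lf := C1_lbm fD; have lDf : lbm (Df ord_max) by exact: C1_lbmD fD.
have bDf : bsupp (Df ord_max) by exact: C1_bsuppD fD bf.
rewrite -Rintegral_itv_obnd_cbnd; last first.
  have mI : measurable (`]0, 1]%classic : set (measurableTypeR R)) by exact: measurable_itv.
  have lF : lbm (fun y : 'rV[R]_m.+1 => f y - (1 - y ord0 ord_max) * Df ord_max y) by lbm_tac.
  have bF : bsupp (fun y : 'rV[R]_m.+1 => f y - (1 - y ord0 ord_max) * Df ord_max y) by bsupp_tac.
  have := slice_integrable_in x mI lF bF.
  rewrite (_ : (fun t => _) = fun t => f (snoc (x, t)) - (1 - t) * Df ord_max (snoc (x, t)))//.
  by apply/funext => t; rewrite snoc_last.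
rewrite [RHS]Rintegral_mkcond; apply: eq_Rintegral => t _.
by rewrite patchE /wstrip snoc_last mem_setE in_itv.
Qed.

Lemma wstripB u v u' v' : (fun x => wstrip u v x - wstrip u' v' x) =
  wstrip (fun x => u x - u' x) (fun x => v x - v' x).
Proof.
by apply/funext => x; rewrite /wstrip; case: ifP => _; rewrite ?subrr//; ring.
Qed.

Lemma H1_data_test u g f : H1_data Om u g -> test_function setT f ->
  H1_data Om (fun x => f x - u x) (fun i x => partial i f x - g i x).
Proof.
move=> Hu tf; have Hf := H1_data_C1 mO (test_C1 tf) (test_bsupp tf).
by have := H1_dataB mO Hf Hu.
Qed.

(** By [trace_formula], [sint (wstrip ...)] restores the boundary values of a smooth function; it is
    linear and bounded on H^1, so it also measures the distance between [f] on the boundary and the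
    candidate trace of [u]. *)
Lemma trace_approx u g f : H1_data Om u g -> test_function setT f ->
  L2fun (leb m) (fun x => f (snoc (x, 0)) - sint (wstrip u (g ord_max)) x) /\
  n2 (leb m) (fun x => f (snoc (x, 0)) - sint (wstrip u (g ord_max)) x) <=
  2 * n2 (leb m.+1) ((fun x => f x - u x) \_ Om) +
  2 * n2 (leb m.+1) ((fun x => partial ord_max f x - g ord_max x) \_ Om).
Proof.
move=> Hu tf; have fD := test_C1 tf; have bf := test_bsupp tf.
have Hf := H1_data_C1 mO fD bf.
have [lfu /(_ ord_max)[_ ldg]] := H1_dataB mO Hf Hu.
have [lf /(_ ord_max)[_ ldf]] := Hf; have [lu /(_ ord_max)[_ lg]] := Hu.
have [lw hw] := wstrip_l2 lfu ldg.
have [ls hs] := sint_l2 (@wstrip_in _ _) lw.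
have mf0 : measurable_fun setT (fun x : 'rV[R]_m => f (snoc (x, 0)) - sint (wstrip u (g ord_max)) x).
  apply: measurable_funB; last by apply: measurable_sint; exact: (wstrip_l2 lu lg).1.1.
  by apply: lbm_measurable; apply: lbm_slice; exact: C1_lbm fD.
suff H : {ae leb m, forall x, sint (wstrip (fun x => f x - u x)
    (fun x => partial ord_max f x - g ord_max x)) x = f (snoc (x, 0)) - sint (wstrip u (g ord_max)) x}.
  by have [l h] := l2_ae ls mf0 H; split; [exact: l|rewrite h; exact: le_trans hs hw].
rewrite -wstripB; apply: filterS (sintB (@wstrip_in _ _) (@wstrip_in _ _) (wstrip_l2 lf ldf).1 (wstrip_l2 lu lg).1) => x ->.
by rewrite (@sint_C1 f (fun i => partial i f)).
Qed.

Lemma n2_cvg0 d (T : measurableType d) (mu : {measure set T -> \bar R}) (f : nat -> T -> R) :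
  (forall k, L2fun mu (f k)) ->
  (forall e : R, 0 < e -> exists K, forall k, (K <= k)%N -> n2 mu (f k) <= e) <->
  ('N[mu]_2%:E[EFin \o f k] @[k --> \oo] --> 0)%E.
Proof.
move=> lf; have -> : (fun k => 'N[mu]_2%:E[EFin \o f k])%E = EFin \o (fun k => Num.sqrt (n2 mu (f k))).
  by apply/funext => k; rewrite Lnorm2E.
split=> [H|/fine_cvgP[_] /cvgrPdist_le H e e0].
  apply: cvg_EFin; first exact: nearW.
  apply/cvgrPdist_le => e e0; have [K HK] := H _ (exprn_gt0 2 e0); exists K => // k /= /HK h.
  rewrite sub0r normrN ger0_norm ?sqrtr_ge0// -[leRHS]ger0_norm ?(ltW e0)// -sqrtr_sqr.
  by rewrite ler_wsqrtr.
have e1 : 0 < Num.sqrt e by rewrite sqrtr_gt0.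
have [K _ HK] := H _ e1; exists K => k /HK; rewrite sub0r normrN /= ger0_norm ?sqrtr_ge0// => h.
rewrite -(sqr_sqrtr (n2_ge0 mu (f k))) -(sqr_sqrtr (ltW e0)) ler_sqr ?nnegrE ?sqrtr_ge0//.
Qed.

Lemma trace_exists u g : H1_data Om u g -> exists tau, is_trace u tau.
Proof.
move=> Hu; have c0 k : 0 < (k.+1%:R^-1 : R) by rewrite invr_gt0.
have /choice[phi Hphi] k : exists phi, test_function setT phi /\
    (n2 (leb m.+1) ((fun x => phi x - u x) \_ Om) <= k.+1%:R^-1 /\
     forall i, n2 (leb m.+1) ((fun x => partial i phi x - g i x) \_ Om) <= k.+1%:R^-1).
  by have [phi tp hp] := H1_dense Hu (c0 k); exists phi.
have small (e : R) : 0 < e -> exists K, forall k, (K <= k)%N -> (k.+1%:R^-1 : R) <= e.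
  move=> e0; have /cvgrPdist_le/(_ e e0)[K _ HK] := @cvg_harmonic R; exists K => k /HK.
  by rewrite sub0r normrN /= ger0_norm.
pose tau := sint (wstrip u (g ord_max)).
have tk k := trace_approx Hu (Hphi k).1.
have lt : L2fun (leb m) tau.
  have -> : tau = fun x => phi 0%N (snoc (x, 0)) - (phi 0%N (snoc (x, 0)) - tau x).
    by apply/funext => x; rewrite opprB addrC subrK.
  apply: l2B (tk 0%N).1; apply: lbs_l2; have [lp bp] := test_lbs (Hphi 0%N).1.
  by split; [exact: lbm_slice|exact: bsupp_slice].
exists tau; split; first exact: H1_data_W1p Hu.
  by apply/Lfun2P; rewrite patch_setT.
exists phi; split=> [k||]; first exact: (Hphi k).1.
  apply/(H1_cvg0 eO mO (v := fun k x => phi k x - u x) (g := fun k i x => partial i (phi k) x - g i x)) => [k|e e0].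
    exact: H1_data_test Hu (Hphi k).1.
  have [K HK] := small _ e0; exists K => k /HK h; have [_ [h1 h2]] := Hphi k.
  by split=> [|i]; [exact: le_trans h1 h|exact: le_trans (h2 i) h].
apply/(n2_cvg0 (f := fun k x => phi k (snoc (x, 0)) - tau x)) => [k|e e0]; first exact: (tk k).1.
have e4 : 0 < e / 4 by rewrite divr_gt0.
have [K HK] := small _ e4; exists K => k /HK h; have [_ [h1 /(_ ord_max) h2]] := Hphi k.
apply: (le_trans (tk k).2); have h3 := le_trans h1 h; have h4 := le_trans h2 h; lra.
Qed.

Lemma is_traceP u g tau : H1_data Om u g -> is_trace u tau -> L2fun (leb m) tau /\
  exists phi : nat -> 'rV[R]_m.+1 -> R, (forall k, test_function setT (phi k)) /\
  forall e : R, 0 < e -> exists K, forall k, (K <= k)%N ->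
   [/\ n2 (leb m.+1) ((fun x => phi k x - u x) \_ Om) <= e,
      forall i, n2 (leb m.+1) ((fun x => partial i (phi k) x - g i x) \_ Om) <= e &
      n2 (leb m) (fun x => phi k (snoc (x, 0)) - tau x) <= e].
Proof.
move=> Hu [_ /Lfun2P lt [phi [tp h1 h2]]].
have {}lt : L2fun (leb m) tau by move: lt; rewrite patch_setT.
split=> //; exists phi; split=> // e e0.
have lk k : L2fun (leb m) (fun x => phi k (snoc (x, 0)) - tau x).
  apply: l2B lt; apply: lbs_l2; have [lp bp] := test_lbs (tp k).
  by split; [exact: lbm_slice|exact: bsupp_slice].
have [K1 HK1] := (n2_cvg0 lk).2 h2 e e0.
have Hk k : H1_data Om (fun x => phi k x - u x) (fun i x => partial i (phi k) x - g i x).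
  exact: H1_data_test Hu (tp k).
have [K2 HK2] := (H1_cvg0 eO mO Hk).2 h1 e e0.
exists (maxn K1 K2) => k; rewrite geq_max => /andP[/HK1 a /HK2[b c]]; split=> //.
Qed.

(** The sequence defining the trace converges to [f] in H^1, and [trace_sq_le] applied to
    [phi K - f] transfers this to the boundary. *)
Lemma is_trace_C1 f Df tau : C1 f Df -> bsupp f -> is_trace f tau ->
  {ae leb m, forall x, tau x = f (snoc (x, 0))}.
Proof.
move=> fD bf Ht; have Hf := H1_data_C1 mO fD bf.
have [lt [phi [tp Hp]]] := is_traceP Hf Ht.
have lf0 : L2fun (leb m) (bd f).
  by apply: lbs_l2; split; [apply: lbm_slice; exact: C1_lbm fD|exact: bsupp_slice].
have ld := l2B lt lf0.
suff /(n2_eq0 ld) : n2 (leb m) (fun x => tau x - f (snoc (x, 0))) <= 0.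
  by apply: filterS => x /eqP; rewrite subr_eq0 => /eqP.
apply/ler_addgt0Pl => e e0; rewrite addr0.
have e6 : 0 < e / 6 by rewrite divr_gt0.
have [K /(_ K (leqnn _))[h1 /(_ ord_max) h2 h3]] := Hp _ e6.
have pD := test_C1 (tp K); have bp := test_bsupp (tp K).
have lp0 : L2fun (leb m) (bd (phi K)).
  by apply: lbs_l2; split; [apply: lbm_slice; exact: C1_lbm pD|exact: bsupp_slice].
have bpf : bsupp (fun x => phi K x - f x) by bsupp_tac.
have h4 : n2 (leb m) (fun x => phi K (snoc (x, 0)) - f (snoc (x, 0))) <= e / 6 + e / 6.
  have := trace_sq_le (C1B pD fD) bpf; move/le_trans; apply.
  have bdp : bsupp (fun x => partial ord_max (phi K) x - Df ord_max x).
    exact: C1_bsuppD (C1B pD fD) bpf.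
  have lpf : lbm (fun x => phi K x - f x) by exact: C1_lbm (C1B pD fD).
  have ldp : lbm (fun x => partial ord_max (phi K) x - Df ord_max x) by exact: C1_lbmD (C1B pD fD).
  rewrite (IntD mO (f := fun x => (phi K x - f x) ^+ 2)); [|lbst|lbst].
  by rewrite -!n2_restrict; exact: lerD.
have -> : (fun x => tau x - f (snoc (x, 0))) = fun x =>
    - (phi K (snoc (x, 0)) - tau x) + (phi K (snoc (x, 0)) - f (snoc (x, 0))).
  by apply/funext => x; ring.
have la := l2B lp0 lt; have lb := l2B lp0 lf0.
apply: (le_trans (n2D (l2N la) lb)).
have -> : n2 (leb m) (fun x => - (phi K (snoc (x, 0)) - tau x)) = n2 (leb m) (fun x => phi K (snoc (x, 0)) - tau x).
  by apply: eq_Rintegral => x _; rewrite sqrrN.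
move: h3 h4; lra.
Qed.

End trace.

(** * From smooth to C^1 test functions *)

Section mollifying_sequence.
Variables (R : realType) (n : nat).
Local Notation leb := (lebesgue_rV R n).
Implicit Types (h : 'rV[R]_n -> R) (D : set 'rV[R]_n).

Lemma C1c_seq h Dh : C1 h Dh -> bsupp h -> exists hk : nat -> 'rV[R]_n -> R,
  (forall k, test_function setT (hk k)) /\ exists C M : R,
  [/\ forall k x, M < `|x| -> hk k x = 0,
      (forall k x, `|hk k x| <= C) /\ (forall k i x, `|partial i (hk k) x| <= C),
      forall x, hk k x @[k --> \oo] --> h x &
      forall i x, partial i (hk k) x @[k --> \oo] --> Dh i x].
Proof.
move=> hD bh; have [M HM] := C1c_mollify hD bh.
have [M0 HM0] := bsuppE bh.
have c0 k : 0 < (k.+1%:R^-1 : R) by rewrite invr_gt0.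
have /choice[hk Hk] k : exists h' : 'rV[R]_n -> R, [/\ forall p : nat, isCk p h', forall x, M < `|x| -> h' x = 0,
    forall x, `|h x - h' x| <= k.+1%:R^-1 & forall i x, `|Dh i x - partial i h' x| <= k.+1%:R^-1].
  have [h' [Dh' [D2h' [h1 h2 _ h3 [h4 h5]]]]] := HM _ (c0 k); exists h'; split=> // i x.
  by have -> : partial i h' = Dh' i; [apply: partial_E => y; have [_ _] := h2; apply|].
have lim (f : nat -> R) (l : R) : (forall k, `|l - f k| <= k.+1%:R^-1) -> f k @[k --> \oo] --> l.
  move=> H; apply/cvgrPdist_le => e e0.
  have /cvgrPdist_le/(_ e e0)[K _ HK] := @cvg_harmonic R; exists K => // k /HK.
  by rewrite sub0r normrN /= ger0_norm// => h0; exact: le_trans (H k) h0.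
exists hk; split=> [k|].
  have [h1 h2 _ _] := Hk k.
  apply: (@test_functionI _ _ _ [set x | `|x| <= M]) => // [|x /negP].
    by apply: closed_bounded_compact (fun x => id); exact: closed_ball_norm.
  by rewrite -ltNge; exact: h2.
have [C C_ge0 HC] := lbm_bounded (C1_lbm hD) bh.
have /choice[Ci HCi] i : exists c : R, forall x, `|Dh i x| <= c.
  by have [c _ Hc] := lbm_bounded (C1_lbmD i hD) (C1_bsuppD i hD bh); exists c.
exists (Num.max C (\big[Num.max/0]_i Ci i) + 1), M; split=> [k x|||].
- by have [_ + _ _] := Hk k; apply.
- have up (a b c : R) (k : nat) : `|a| <= c -> `|a - b| <= k.+1%:R^-1 -> `|b| <= c + 1.
    move=> h1 h2; have h3 : (k.+1%:R^-1 : R) <= 1 by rewrite invf_le1// ler1n.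
    have h4 := ler_normB a (a - b); have e1 : a - (a - b) = b by ring.
    by rewrite e1 in h4; apply: (le_trans h4); exact: lerD h1 (le_trans h2 h3).
  split=> [k x|k i x]; have [_ _ h1 h2] := Hk k.
    apply: up (h1 x); rewrite le_max HC//.
  apply: up (h2 i x); rewrite le_max; apply/orP; right.
  by apply: le_trans (HCi i x) _; exact: le_bigmax.
- by move=> x; apply: lim => k; have [_ _ + _] := Hk k; apply.
- by move=> i x; apply: lim => k; have [_ _ _] := Hk k; apply.
Qed.

Lemma Int_lim D (w f : 'rV[R]_n -> R) (f_ : nat -> 'rV[R]_n -> R) (C M : R) :
  measurable D -> lbm w -> (forall k, measurable_fun setT (f_ k)) ->
  (forall k x, `|f_ k x| <= C) -> (forall k x, M < `|x| -> f_ k x = 0) ->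
  (forall x, f_ k x @[k --> \oo] --> f x) ->
  \int[leb]_(x in D) (w x * f_ k x) @[k --> \oo] --> \int[leb]_(x in D) (w x * f x).
Proof.
move=> mD lw mf fC fM cf; pose B : set 'rV[R]_n := [set x | `|x| <= M].
have mB : measurable B by exact: measurable_ball_rV.
have lB : lbs ((w \_ D) \_ B).
  split; first by apply: lbm_restrict => //; exact: lbm_restrict.
  by apply: (bsuppI (M := M)) => x Mx; rewrite patchE memNset// => xB; move: Mx; rewrite ltNge xB.
pose G x := C * `|((w \_ D) \_ B) x|.
have lG : L1fun leb G by apply: l1Z; apply: l1_norm; exact: (lbs_int measurableT).
have mwD : measurable_fun setT (w \_ D) by apply: lbm_measurable; exact: lbm_restrict.
have RD (g : 'rV[R]_n -> R) : \int[leb]_(x in D) (w x * g x) = \int[leb]_x ((w \_ D) x * g x).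
  by rewrite Rintegral_mkcond; apply: eq_Rintegral => x _; rewrite !patchE; case: ifPn; rewrite ?mul0r.
have [||||_ H] := @Idct _ _ _ leb (fun k x => (w \_ D) x * f_ k x) (fun x => (w \_ D) x * f x) G.
- by move=> k; exact: measurable_funM.
- by move=> x; apply: cvgM; [exact: cvg_cst|exact: cf].
- exact: lG.
- move=> k x; rewrite normrM mulrC /G [((w \_ D) \_ B) x]patchE.
  have [xB|xB] := boolP (x \in B); first by rewrite ler_wpM2r.
  rewrite fM ?normr0 ?mul0r ?mulr0//.
  by move: xB; rewrite notin_setE/= ltNge => /negP.
rewrite (RD f); apply/cvgrPdist_le => e e0; have [K HK] := H e e0; exists K => // k /HK.
by rewrite distrC (RD (f_ k)).
Qed.

Lemma ae_eq_Rint (f g : 'rV[R]_n -> R) : measurable_fun setT f -> measurable_fun setT g ->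
  {ae leb, forall x, f x = g x} -> \int[leb]_x f x = \int[leb]_x g x.
Proof.
move=> mf mg fg; rewrite /Rintegral; congr fine.
apply: ae_eq_integral => //; [exact/measurable_EFinP|exact/measurable_EFinP|].
by apply: filterS fg => x -> _.
Qed.

Lemma supp_test_partial (M : R) h i : (forall x, M < `|x| -> h x = 0) ->
  forall x, M < `|x| -> partial i h x = 0.
Proof.
move=> hM x Mx; apply: partial_near0; near=> y; apply: hM; near: y.
apply: (@open_nbhs_nbhs _ _ [set y : 'rV[R]_n | M < `|y|]); split=> //.
rewrite -[X in open X]setCK; apply: closed_openC.
rewrite (_ : ~` _ = [set y : 'rV[R]_n | `|y| <= M]); first exact: closed_ball_norm.
by apply/seteqP; split=> y /=; [move=> /negP; rewrite -leNgt|move=> h1; apply/negP; rewrite -leNgt].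
Unshelve. all: by end_near. Qed.

(** Dominated convergence along [C1c_seq] passes from smooth to C^1 test functions, while integrals
    do not notice the change of representatives. *)
Lemma wder_weak i (a w be ga : 'rV[R]_n -> R) : is_weak_partial setT i a w ->
  lbm be -> lbm ga -> {ae leb, forall x, a x = be x} -> {ae leb, forall x, w x = ga x} ->
  wder i be ga.
Proof.
move=> [la lw H] lbe lga abe wga h Dh hD bh.
have eT := @exhausting_setT R n.
have ma : measurable_fun setT a by have := loc_measurable eT measurableT la; rewrite patch_setT.
have mw : measurable_fun setT w by have := loc_measurable eT measurableT lw; rewrite patch_setT.
have [hk [tk [C [M [hM [hC hDC] ch chD]]]]] := C1c_seq hD bh.
have mh k : measurable_fun setT (hk k) by apply: lbm_measurable; have [] := test_lbs (tk k).
have mhD i' k : measurable_fun setT (partial i' (hk k)).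
  by apply: lbm_measurable; have [] := test_lbs (test_partial i' (tk k)).
have E k : \int[leb]_x (be x * partial i (hk k) x) = - \int[leb]_x (ga x * hk k x).
  have -> : \int[leb]_x (be x * partial i (hk k) x) = \int[leb]_x (a x * partial i (hk k) x).
    apply: ae_eq_Rint; [by apply: measurable_funM => //; exact: lbm_measurable|exact: measurable_funM|].
    by apply: filterS abe => x ->.
  have -> : \int[leb]_x (ga x * hk k x) = \int[leb]_x (w x * hk k x).
    apply: ae_eq_Rint; [by apply: measurable_funM => //; exact: lbm_measurable|exact: measurable_funM|].
    by apply: filterS wga => x ->.
  by have := H _ (tk k).
have hMD k := supp_test_partial i (hM k).
have c1 := Int_lim measurableT lbe (mhD i) (fun k x => hDC k i x) hMD (chD i).
have c2 := Int_lim measurableT lga mh hC hM ch.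
have c3 : (- \int[leb]_x (ga x * hk k x)) @[k --> \oo] --> - \int[leb]_x (ga x * h x) by exact: cvgN c2.
have cE : (fun k => \int[leb]_x (be x * partial i (hk k) x)) = fun k => - \int[leb]_x (ga x * hk k x).
  by apply/funext => k; exact: E.
by rewrite cE in c1; rewrite -(cvg_lim (@Rhausdorff R) c1) -(cvg_lim (@Rhausdorff R) c3).
Qed.

End mollifying_sequence.

(** * The Robin coefficients *)

Section divergence_bound.
Variables (R : realType) (n : nat).
Local Notation leb := (lebesgue_rV R n).
Implicit Types (a w be : 'rV[R]_n -> R).
Let eT := @exhausting_setT R n.

Lemma weak_partial_measurable i a w : is_weak_partial setT i a w ->
  measurable_fun setT a /\ measurable_fun setT w.
Proof.
move=> [la lw _]; have := loc_measurable eT measurableT la.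
by have := loc_measurable eT measurableT lw; rewrite !patch_setT.
Qed.

Lemma weak_partial_setT_ae i a w : is_weak_partial setT i a w ->
  {ae leb, forall x, weak_partial setT i a x = w x}.
Proof. by move=> H; apply: filterS (weak_partialE eT measurableT H) => x; apply. Qed.

Lemma loc_lbmM a be : locally_integrable_rV setT a -> lbm be ->
  locally_integrable_rV setT (fun x => a x * be x).
Proof.
move=> la lb K cK KT; have mK := compact_measurable_rV cK; have [M HM] := compact_normP cK.
have [C HC] := lbm_locally_bounded M lb.
have iK := la K cK KT; have /integrableP[/measurable_EFinP ma _] := iK.
apply: (@le_integrable _ _ _ leb _ mK _ (fun y => C%:E * (a y)%:E)%E).
- apply/measurable_EFinP; apply: measurable_funM => //.
  by apply: measurable_funS (lbm_measurable lb).
- move=> x Kx /=; rewrite lee_fin !normrM mulrC ler_wpM2r//.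
  by rewrite (le_trans (HC x (HM x Kx)))// ler_norm.
- exact: integrableZl.
Qed.

Lemma locD a b : locally_integrable_rV setT a -> locally_integrable_rV setT b ->
  locally_integrable_rV setT (fun x : 'rV[R]_n => a x + b x).
Proof.
move=> la lb K cK KT; have mK := compact_measurable_rV cK.
by have := integrableD mK (la K cK KT) (lb K cK KT).
Qed.

(** The product rule: the definition for [a] is applied to the test function [x_i phi]. *)
Lemma is_weak_partial_coord i a w : is_weak_partial setT i a w ->
  is_weak_partial setT i (fun x => a x * x ord0 i) (fun x => w x * x ord0 i + a x).
Proof.
move=> [la lw H]; have lc := @lbm_coord R n i.
have la' := loc_lbmM la lc; split=> [||phi tp]; [exact: la'|exact: locD (loc_lbmM lw lc) la|].
have pC j : isCk j (fun x : 'rV[R]_n => x ord0 i) by exact: isCk_coord.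
have tx := test_functionM pC tp.
have h1 := loc_testI measurableT la tp.
have h2 := loc_testI measurableT (loc_lbmM lw lc) tp.
have h3 := loc_testI measurableT la' (test_partial i tp).
have h4 := loc_testI measurableT la (test_partial i tx).
have := H _ tx.
have -> : partial i (fun x => phi x * x ord0 i) = fun x => x ord0 i * partial i phi x + phi x.
  apply: partial_E => x; have [_ _ /(_ i x)] := C1M (test_C1 tp) (C1_coord R i).
  by rewrite eqxx mulr1 addrC.
have -> : \int[leb]_x (a x * (x ord0 i * partial i phi x + phi x)) =
    \int[leb]_x (a x * x ord0 i * partial i phi x) + \int[leb]_x (a x * phi x).
  rewrite -RintegralD//; apply: eq_Rintegral => x _; ring.
have -> : \int[leb]_x (w x * (phi x * x ord0 i)) = \int[leb]_x (w x * x ord0 i * phi x).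
  by apply: eq_Rintegral => x _; ring.
have -> : \int[leb]_x ((w x * x ord0 i + a x) * phi x) =
    \int[leb]_x (w x * x ord0 i * phi x) + \int[leb]_x (a x * phi x).
  by rewrite -RintegralD//; apply: eq_Rintegral => x _; ring.
move: (\int[leb]_x (a x * x ord0 i * _)) (\int[leb]_x (a x * phi x)) => I1 I2.
by move: (\int[leb]_x _) => I3 h; lra.
Qed.

Lemma weak_div_ae a (w : 'I_n -> 'rV[R]_n -> R) : (forall i, is_weak_partial setT i a (w i)) ->
  measurable_fun setT (weak_div (fun y => a y *: y)) /\
  {ae leb, forall x, weak_div (fun y => a y *: y) x = \sum_i (x ord0 i * w i x) + n%:R * a x}.
Proof.
move=> wa; have P i : is_weak_partial setT i (fun y => (a y *: y) ord0 i) (fun x => w i x * x ord0 i + a x).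
  have := is_weak_partial_coord (wa i).
  by rewrite (_ : (fun x => a x * x ord0 i) = fun y => (a y *: y) ord0 i)//; apply/funext => y; rewrite mxE.
split.
  apply: measurable_sum => i; exact: (weak_partial_measurable (weak_partialP (P i))).2.
have : {ae leb, forall x, forall i, weak_partial setT i (fun y => (a y *: y) ord0 i) x = w i x * x ord0 i + a x}.
  by apply: filter_forall => i; exact: weak_partial_setT_ae (P i).
apply: filterS => x H; rewrite /weak_div (eq_bigr _ (fun i _ => H i)) big_split/= sumr_const card_ord.
by rewrite mulr_natl; congr (_ + _); apply: eq_bigr => i _; rewrite mulrC.
Qed.

Variables (a be : 'rV[R]_n -> R) (w ga : 'I_n -> 'rV[R]_n -> R) (b2 : R).
Hypotheses (lbe : lbm be) (lga : forall i, lbm (ga i)).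
Hypothesis wa : forall i, is_weak_partial setT i a (w i).
Hypotheses (abe : {ae leb, forall x, a x = be x}) (wga : forall i, {ae leb, forall x, w i x = ga i x}).
Hypothesis hb : forall psi : 'rV[R]_n -> R[i], cW1p setT 2%:E psi ->
     (\int[leb]_x (weak_div (fun y => a y *: y)%R x ^+ 2 * normc2 (psi x))%:E
      <= (b2 ^+ 2)%:E * \int[leb]_x (\sum_(i < n) normc2 (cweak_partial setT i psi x))%:E)%E.
Let dv (x : 'rV[R]_n) := \sum_i (x ord0 i * ga i x) + n%:R * be x.

Lemma divergence_bound_test p q : test_function setT p -> test_function setT q ->
  \int[leb]_x (dv x ^+ 2 * (p x ^+ 2 + q x ^+ 2)) <=
  b2 ^+ 2 * \int[leb]_x (\sum_i (partial i p x ^+ 2 + partial i q x ^+ 2)).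
Proof.
move=> tp tq; have pD := test_C1 tp; have qD := test_C1 tq.
have [lp bp] := test_lbs tp; have [lq bq] := test_lbs tq.
have HW f : test_function setT f -> W1p setT 2%:E f.
  move=> tf; apply: (@H1_data_W1p _ _ _ _ (fun i => partial i f)).
  exact: (H1_data_C1 measurableT (test_C1 tf) (test_bsupp tf)).
have /hb : cW1p setT 2%:E (fun x => (p x +i* q x)%C) by split; exact: HW.
have ldv : lbm dv by rewrite /dv; lbm_tac.
have lpD i : lbm (partial i p) by exact: C1_lbmD pD.
have lqD i : lbm (partial i q) by exact: C1_lbmD qD.
have bpD i : bsupp (partial i p) by exact: C1_bsuppD pD bp.
have bqD i : bsupp (partial i q) by exact: C1_bsuppD qD bq.
have lA : lbs (fun x => dv x ^+ 2 * (p x ^+ 2 + q x ^+ 2)) by lbst.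
have lB : lbs (fun x => \sum_i (partial i p x ^+ 2 + partial i q x ^+ 2)).
  by apply: lbs_sum => i; lbst.
have [mdiv aediv] := weak_div_ae wa.
have -> : (\int[leb]_x (weak_div (fun y => a y *: y)%R x ^+ 2 * normc2 (p x +i* q x)%C)%:E =
    \int[leb]_x (dv x ^+ 2 * (p x ^+ 2 + q x ^+ 2))%:E)%E.
  apply: ae_eq_integral => //.
  - apply/measurable_EFinP; apply: measurable_funM; first exact: measurable_funX.
    by apply: lbm_measurable; rewrite /normc2/=; lbm_tac.
  - by apply/measurable_EFinP; exact: lbm_measurable lA.1.
  - have : {ae leb, forall x, forall i, w i x = ga i x} by apply: filter_forall => i; exact: wga.
    apply: filterS3 aediv abe => x h1 h2 h3 _; rewrite h1 h2 /normc2/=.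
    by congr ((_ ^+ 2 * _)%:E); rewrite /dv; congr (_ + _); apply: eq_bigr => i _; rewrite h3.
have wp (f : 'rV[R]_n -> R) (i : 'I_n) : test_function setT f -> is_weak_partial setT i f (partial i f).
  by move=> tf; have := is_weak_partial_C1 setT i (test_C1 tf).
have -> : (\int[leb]_x (\sum_(i < n) normc2 (cweak_partial setT i (fun x => (p x +i* q x)%C) x))%:E =
    \int[leb]_x (\sum_i (partial i p x ^+ 2 + partial i q x ^+ 2))%:E)%E.
  have Ep : {ae leb, forall x, forall i, weak_partial setT i p x = partial i p x}.
    by apply: filter_forall => i; exact: weak_partial_setT_ae (wp p i tp).
  have Eq : {ae leb, forall x, forall i, weak_partial setT i q x = partial i q x}.
    by apply: filter_forall => i; exact: weak_partial_setT_ae (wp q i tq).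
  apply: ae_eq_integral => //.
  - apply/measurable_EFinP; apply: measurable_sum => i; rewrite /normc2/=.
    by apply: measurable_funD; apply: measurable_funX;
      [exact: (weak_partial_measurable (weak_partialP (wp _ i tp))).2|exact: (weak_partial_measurable (weak_partialP (wp _ i tq))).2].
  - by apply/measurable_EFinP; exact: lbm_measurable lB.1.
  - apply: filterS2 Ep Eq => x h1 h2 _; congr (_%:E); apply: eq_bigr => i _.
    by rewrite /normc2 /= -h1 -h2.
rewrite -(ge0_RintegralE measurableT (lbs_int measurableT lA)).
by rewrite -(ge0_RintegralE measurableT (lbs_int measurableT lB)) -EFinM lee_fin.
Qed.

Lemma divergence_bound p Dp q Dq : C1 p Dp -> bsupp p -> C1 q Dq -> bsupp q ->
  \int[leb]_x (dv x ^+ 2 * (p x ^+ 2 + q x ^+ 2)) <=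
  b2 ^+ 2 * \int[leb]_x (\sum_i (Dp i x ^+ 2 + Dq i x ^+ 2)).
Proof.
move=> pD bp qD bq.
have [hp [tp [C [M [hM [hC hDC] ch chD]]]]] := C1c_seq pD bp.
have [hq [tq [C' [M' [hM' [hC' hDC'] ch' chD']]]]] := C1c_seq qD bq.
have ldv2 : lbm (fun x => dv x ^+ 2) by rewrite /dv; lbm_tac.
have mt h : test_function setT h -> measurable_fun setT h by move=> /test_lbs[/lbm_measurable].
have sq (f : nat -> R) (l : R) : f k @[k --> \oo] --> l -> f k ^+ 2 @[k --> \oo] --> l ^+ 2.
  by move=> h; exact: (cvgM h h).
have sqb (x c : R) : `|x| <= c -> `|x ^+ 2| <= c ^+ 2.
  by move=> h; rewrite normrX lerXn2r// nnegrE//; exact: le_trans h.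
have L1 := @Int_lim _ _ setT (fun x => dv x ^+ 2) (fun x => p x ^+ 2 + q x ^+ 2)
  (fun k x => hp k x ^+ 2 + hq k x ^+ 2) (C ^+ 2 + C' ^+ 2) (Num.max M M') measurableT ldv2.
have L2 := @Int_lim _ _ setT (fun=> 1) (fun x => \sum_i (Dp i x ^+ 2 + Dq i x ^+ 2))
  (fun k x => \sum_i (partial i (hp k) x ^+ 2 + partial i (hq k) x ^+ 2))
  (\sum_(i < n) (C ^+ 2 + C' ^+ 2)) (Num.max M M') measurableT (lbm_cst n 1).
have {}L1 : \int[leb]_x (dv x ^+ 2 * (hp k x ^+ 2 + hq k x ^+ 2)) @[k --> \oo] -->
    \int[leb]_x (dv x ^+ 2 * (p x ^+ 2 + q x ^+ 2)).
  apply: L1 => [k|k x|k x|x].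
  - by apply: measurable_funD; apply: measurable_funX; exact: mt.
  - by apply: (le_trans (ler_normD _ _)); apply: lerD; exact: sqb.
  - by rewrite gt_max => /andP[h1 h2]; rewrite hM// hM'// expr0n addr0.
  - by apply: cvgD; exact: sq.
have {}L2 : \int[leb]_x (1 * \sum_i (partial i (hp k) x ^+ 2 + partial i (hq k) x ^+ 2)) @[k --> \oo] -->
    \int[leb]_x (1 * \sum_i (Dp i x ^+ 2 + Dq i x ^+ 2)).
  apply: L2 => [k|k x|k x|x].
  - by apply: measurable_sum => i; apply: measurable_funD; apply: measurable_funX; apply: mt; exact: test_partial.
  - apply: (le_trans (ler_norm_sum _ _ _)); apply: ler_sum => i _.
    by apply: (le_trans (ler_normD _ _)); apply: lerD; exact: sqb.
  - rewrite gt_max => /andP[h1 h2]; rewrite big1// => i _.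
    by rewrite (supp_test_partial i (hM k))// (supp_test_partial i (hM' k))// expr0n addr0.
  - by apply: cvg_big => [|i _]; [exact: add_continuous|apply: cvgD]; apply: sq; [exact: chD|exact: chD'].
have L3 : b2 ^+ 2 * \int[leb]_x (1 * \sum_i (partial i (hp k) x ^+ 2 + partial i (hq k) x ^+ 2)) @[k --> \oo] -->
    b2 ^+ 2 * \int[leb]_x (1 * \sum_i (Dp i x ^+ 2 + Dq i x ^+ 2)).
  exact: cvgM (cvg_cst _) L2.
have -> : \int[leb]_x (\sum_i (Dp i x ^+ 2 + Dq i x ^+ 2)) = \int[leb]_x (1 * \sum_i (Dp i x ^+ 2 + Dq i x ^+ 2)).
  by apply: eq_Rintegral => x _; rewrite mul1r.
apply: (ler_cvg_to L1 L3); apply: nearW => k; apply: (le_trans (divergence_bound_test (tp k) (tq k))).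
by rewrite le_eqVlt; apply/orP; left; apply/eqP; congr (_ * _); apply: eq_Rintegral => x _; rewrite mul1r.
Qed.

End divergence_bound.

Section coefficients.
Variables (R : realType) (n : nat).
Local Notation leb := (lebesgue_rV R n).

(** [Lnorm] at [+oo] is an essential supremum when the measure is nonzero, which the unit ball
    guarantees. *)
Lemma Linfty_le (f : 'rV[R]_n -> R) (b : R) : ('N[leb]_+oo[EFin \o f] <= b%:E)%E ->
  {ae leb, forall x, `|f x| <= b}.
Proof.
rewrite unlock /Lnorm ifT => [h|]; last first.
  apply: (lt_le_trans (@lebesgue_rV_ball_gt0 R n 1 ltr01)); apply: le_measure => //.
  - by rewrite inE; exact: measurable_ball_rV.
  - by rewrite inE.
apply: filterS (ess_sup_ge leb (abse \o (EFin \o f))) => x hx.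
by rewrite -lee_fin; exact: le_trans hx h.
Qed.

Lemma Lp_infty_bound (f : 'rV[R]_n -> R) : Lp setT +oo%E f -> measurable_fun setT f /\
  exists2 K : R, 0 <= K & {ae leb, forall x, `|f x| <= K}.
Proof.
rewrite /Lp patch_setT => lf; split.
  by move: lf; rewrite inE => /andP[mf _]; move: mf; rewrite inE.
move: lf; rewrite inE => /andP[_]; rewrite inE/= /finite_norm => h.
exists (fine 'N[leb]_+oo[EFin \o f]%E); first by apply: fine_ge0; exact: Lnorm_ge0.
by apply: Linfty_le; rewrite fineK// ge0_fin_numE// Lnorm_ge0.
Qed.

Lemma W1p_infty_bound (f : 'rV[R]_n -> R) : W1p setT +oo%E f -> measurable_fun setT f /\
  exists2 K : R, 0 <= K & {ae leb, forall x, `|f x| <= K /\ forall i, `|weak_partial setT i f x| <= K} /\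
    forall i, is_weak_partial setT i f (weak_partial setT i f).
Proof.
move=> [/Lp_infty_bound[mf [K K0 HK]] H]; split=> //.
have wp i : is_weak_partial setT i f (weak_partial setT i f).
  by have [g wg _] := H i; exact: weak_partialP wg.
have /choice[Ki HKi] i : exists c : R, {ae leb, forall x, `|weak_partial setT i f x| <= c}.
  have [g wg /Lp_infty_bound[_ [c _ Hc]]] := H i; exists c.
  by apply: filterS2 Hc (weak_partial_setT_ae wg) => x h ->.
exists (Num.max K (\big[Num.max/0]_i Ki i)); first by rewrite le_max K0.
split=> //; have H2 : {ae leb, forall x, forall i, `|weak_partial setT i f x| <= Ki i}.
  by apply: filter_forall => i; exact: HKi.
apply: filterS2 HK H2 => x h1 h2; split=> [|i]; rewrite le_max; first by rewrite h1.
by apply/orP; right; apply: le_trans (h2 i) _; exact: le_bigmax.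
Qed.

Variables (a1 a2 : 'rV[R]_n -> R) (b1 b2 : R).
Hypotheses (W1 : W1p setT +oo%E a1) (W2 : W1p setT +oo%E a2).
Hypothesis a12 : {ae leb, forall x : 'rV[R]_n, `|a2 x| <= a1 x}.
Hypothesis a1_radial : {ae leb, forall x : 'rV[R]_n, \sum_(i < n) x ord0 i * weak_partial setT i a1 x <= 0}.
Hypotheses (b1_ge0 : 0 <= b1).
Hypothesis a2_b1 : ('N[leb]_+oo[EFin \o (fun x => enorm (a2 x *: x))] <= b1%:E)%E.
Hypothesis a2_b2 : forall psi : 'rV[R]_n -> R[i], cW1p setT 2%:E psi ->
     (\int[leb]_x (weak_div (fun y => a2 y *: y)%R x ^+ 2 * normc2 (psi x))%:E
      <= (b2 ^+ 2)%:E * \int[leb]_x (\sum_(i < n) normc2 (cweak_partial setT i psi x))%:E)%E.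

(* Replacing everything by zero off a set of full measure makes the almost everywhere
   hypotheses hold everywhere. *)
Lemma robin_coefficients : exists (be1 be2 : 'rV[R]_n -> R) (ga1 ga2 : 'I_n -> 'rV[R]_n -> R) (K : R),
  [/\ [/\ lbm be1, lbm be2, forall i, lbm (ga1 i), forall i, lbm (ga2 i) & 0 <= K],
      [/\ forall x, `|be1 x| <= K, forall x, `|be2 x| <= K,
          forall i x, `|ga1 i x| <= K & forall i x, `|ga2 i x| <= K],
      [/\ forall i, wder i be1 (ga1 i), forall i, wder i be2 (ga2 i) &
          forall p Dp q Dq, C1 p Dp -> bsupp p -> C1 q Dq -> bsupp q ->
          \int[leb]_x ((\sum_i (x ord0 i * ga2 i x) + n%:R * be2 x) ^+ 2 * (p x ^+ 2 + q x ^+ 2)) <=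
          b2 ^+ 2 * \int[leb]_x (\sum_i (Dp i x ^+ 2 + Dq i x ^+ 2))],
      [/\ forall x, 0 <= be1 x, forall x, xdot ga1 x <= 0 &
          forall x, be2 x ^+ 2 * sqn x <= b1 ^+ 2] &
      {ae leb, forall x, a1 x = be1 x} /\ {ae leb, forall x, a2 x = be2 x}].
Proof.
have [m1 [K1 K1_ge0 [HK1 wp1]]] := W1p_infty_bound W1.
have [m2 [K2 K2_ge0 [HK2 wp2]]] := W1p_infty_bound W2.
set w1 := fun i => weak_partial setT i a1; set w2 := fun i => weak_partial setT i a2.
have mw1 i : measurable_fun setT (w1 i) by exact: (weak_partial_measurable (wp1 i)).2.
have mw2 i : measurable_fun setT (w2 i) by exact: (weak_partial_measurable (wp2 i)).2.
have Hb1 := Linfty_le a2_b1.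
pose K := Num.max K1 K2.
have K_ge0 : 0 <= K by rewrite le_max K1_ge0.
have K1K x : x <= K1 -> x <= K by rewrite le_max => ->.
have K2K x : x <= K2 -> x <= K by rewrite le_max => ->; rewrite orbT.
pose P (x : 'rV[R]_n) := [/\ `|a1 x| <= K1 /\ (forall i, `|w1 i x| <= K1), `|a2 x| <= K2 /\ (forall i, `|w2 i x| <= K2),
   `|a2 x| <= a1 x, xdot w1 x <= 0 & a2 x ^+ 2 * sqn x <= b1 ^+ 2].
have [N [mN N0 HN]] : {ae leb, forall x : 'rV[R]_n, P x}.
  have H2 : {ae leb, forall x : 'rV[R]_n, `|a2 x| <= a1 x /\ xdot w1 x <= 0}.
    by apply: filterS2 a12 a1_radial => x h h'.
  have H3 : {ae leb, forall x : 'rV[R]_n, (`|a1 x| <= K1 /\ (forall i, `|w1 i x| <= K1)) /\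
      (`|a2 x| <= K2 /\ (forall i, `|w2 i x| <= K2))}.
    by apply: filterS2 HK1 HK2 => x h h'.
  apply: filterS3 H3 H2 Hb1 => x [h1 h2] [h4 h5] h3.
  split=> //; move: h3 => /(le_trans (ler_norm _)); rewrite /enorm => h3.
  have -> : a2 x ^+ 2 * sqn x = \sum_(i < n) (a2 x *: x) ord0 i ^+ 2.
    by rewrite /sqn mulr_sumr; apply: eq_bigr => i _; rewrite mxE exprMn.
  have s0 : 0 <= \sum_(i < n) (a2 x *: x) ord0 i ^+ 2 by apply: sumr_ge0 => i _; exact: sqr_ge0.
  by rewrite -(sqr_sqrtr s0) ler_sqr ?nnegrE ?sqrtr_ge0.
pose E := ~` N; have mE : measurable E by exact: measurableC.
have EP x : E x -> P x by move=> Ex; apply: contrapT => h; apply: Ex; exact: HN.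
have aeE (f : 'rV[R]_n -> R) : {ae leb, forall x, f x = (f \_ E) x}.
  exists N; split=> // x /= h; apply: contrapT => Nx; apply: h.
  by rewrite patchE mem_set.
have lE (f : 'rV[R]_n -> R) : measurable_fun setT f -> (forall x, E x -> `|f x| <= K) ->
    lbm (f \_ E) /\ forall x, `|(f \_ E) x| <= K.
  move=> mf fK; have bd x : `|(f \_ E) x| <= K.
    by rewrite patchE; case: ifPn => [/set_mem/fK//|_]; rewrite normr0.
  split=> //; split; last by move=> M; exists K.
  have := mf; move/(measurable_funS measurableT (@subsetT _ E)).
  by move/(measurable_restrictT _ mE).1.
have [m1' k1] := lE a1 m1 (fun x Ex => K1K _ (let: And5 h _ _ _ _ := EP x Ex in h.1)).
have [m2' k2] := lE a2 m2 (fun x Ex => K2K _ (let: And5 _ h _ _ _ := EP x Ex in h.1)).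
have lg1 i := lE (w1 i) (mw1 i) (fun x Ex => K1K _ (let: And5 h _ _ _ _ := EP x Ex in h.2 i)).
have lg2 i := lE (w2 i) (mw2 i) (fun x Ex => K2K _ (let: And5 _ h _ _ _ := EP x Ex in h.2 i)).
exists (a1 \_ E), (a2 \_ E), (fun i => w1 i \_ E), (fun i => w2 i \_ E), K; split.
- by split=> // i; [have [] := lg1 i|have [] := lg2 i].
- by split=> // i x; [have [_] := lg1 i|have [_] := lg2 i]; apply.
- split=> [i|i|p Dp q Dq].
  + by apply: (wder_weak (wp1 i) m1' (lg1 i).1); exact: aeE.
  + by apply: (wder_weak (wp2 i) m2' (lg2 i).1); exact: aeE.
  + move=> pD bp qD bq.
    have H := @divergence_bound R n a2 (a2 \_ E) w2 (fun i => w2 i \_ E) b2 m2' (fun i => (lg2 i).1) wp2 (aeE a2) (fun i => aeE (w2 i)) a2_b2 _ _ _ _ pD bp qD bq.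
    exact: H.
- split=> x; have [Ex|Ex] := boolP (x \in E).
  + by rewrite patchE Ex; have [_ _ h _ _] := EP x (set_mem Ex); exact: le_trans h.
  + by rewrite patchE (negbTE Ex).
  + have [_ _ _ h _] := EP x (set_mem Ex); apply: le_trans h; rewrite le_eqVlt; apply/orP; left; apply/eqP.
    by apply: eq_bigr => i _; rewrite patchE Ex.
  + by rewrite /xdot big1// => i _; rewrite patchE (negbTE Ex) mulr0.
  + by rewrite patchE Ex; have [_ _ _ _] := EP x (set_mem Ex).
  + by rewrite patchE (negbTE Ex) expr0n mul0r sqr_ge0.
- by split; exact: aeE.
Qed.

End coefficients.

(** * The eigenvalue equation *)

Section l2_pairing.
Context d (T : measurableType d) (R : realType) (mu : {measure set T -> \bar R}).
Implicit Types a b : T -> R.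

Lemma n2_CS_le a b (x y : R) : L2fun mu a -> L2fun mu b -> 0 <= x -> 0 <= y ->
  n2 mu a <= x ^+ 2 -> n2 mu b <= y ^+ 2 -> `|\int[mu]_t (a t * b t)| <= x * y.
Proof.
move=> la lb x0 y0 ha hb; rewrite -ler_sqr ?nnegrE ?mulr_ge0// real_normK ?num_real//.
apply: (le_trans (n2_CS la lb)); rewrite exprMn.
by apply: ler_pM => //; exact: n2_ge0.
Qed.

Lemma pairBl a a' b : L2fun mu a -> L2fun mu a' -> L2fun mu b ->
  \int[mu]_t ((a t - a' t) * b t) = \int[mu]_t (a t * b t) - \int[mu]_t (a' t * b t).
Proof.
move=> la la' lb; rewrite -RintegralB//; [|exact: l2M|exact: l2M].
by apply: eq_Rintegral => t _; rewrite mulrBl.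
Qed.

Lemma pairBr a b b' : L2fun mu a -> L2fun mu b -> L2fun mu b' ->
  \int[mu]_t (a t * (b t - b' t)) = \int[mu]_t (a t * b t) - \int[mu]_t (a t * b' t).
Proof.
move=> la lb lb'; rewrite -RintegralB//; [|exact: l2M|exact: l2M].
by apply: eq_Rintegral => t _; rewrite mulrBr.
Qed.

End l2_pairing.

Section weak_form.
Variables (R : realType) (m : nat).
Local Notation leb := (lebesgue_rV R).
Local Notation Om := (half_space R m).
Local Notation N := (m.+1%:R).
Local Notation cfun := (cfun R m).
Local Notation bd f := (fun x : 'rV[R]_m => f (snoc (x, 0 : R))).
Variables (be1 be2 : 'rV[R]_m -> R) (K l1 l2 : R).
Hypotheses (lbe1 : lbm be1) (lbe2 : lbm be2).
Hypotheses (K0 : 0 <= K) (be1K : forall x, `|be1 x| <= K) (be2K : forall x, `|be2 x| <= K).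
Local Notation L2 := (L2fun (leb m.+1)).
Local Notation L2b := (L2fun (leb m)).
Implicit Types (P : 'I_m.+1 -> 'rV[R]_m.+1 -> R) (p q : 'rV[R]_m.+1 -> R) (s t : 'rV[R]_m -> R).
Implicit Types V f g : cfun.

Let mO := @measurable_half_space R m.

(** [rform] for L^2 data. Gradient, values and traces are independent arguments, so that one
    expression covers the eigenfunction and its approximants and is continuous in all of them. *)
Definition wform P p q s t V : R :=
  \sum_i \int[leb m.+1]_x (P i x * (cd V i \_ Om) x) +
  (\int[leb m]_x (s x * (be1 x * V (snoc (x, 0)))) - \int[leb m]_x (t x * (be2 x * V (snoc (x, 0))))) -
  (l1 * \int[leb m.+1]_x (p x * (cf V \_ Om) x) - l2 * \int[leb m.+1]_x (q x * (cf V \_ Om) x)).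

Definition wdata P p q s t := [/\ forall i, L2 (P i), L2 p, L2 q, L2b s & L2b t].

Definition wsize P p q s t (e : R) := [/\ forall i, n2 (leb m.+1) (P i) <= e, n2 (leb m.+1) p <= e,
  n2 (leb m.+1) q <= e, n2 (leb m) s <= e & n2 (leb m) t <= e].

Lemma l2_cf V : L2 (cf V \_ Om).
Proof. by apply: l2_restrict => //; apply: lbs_l2; split; [exact: lcf|exact: cfb]. Qed.

Lemma l2_cd V i : L2 (cd V i \_ Om).
Proof. by apply: l2_restrict => //; apply: lbs_l2; split; [exact: lcd|exact: bcd]. Qed.

Lemma lbs_bd V : lbs (bd V).
Proof. by split; [apply: lbm_slice; exact: lcf|apply: bsupp_slice; exact: cfb]. Qed.

Lemma l2_be (be : 'rV[R]_m -> R) V : lbm be -> L2b (fun x => be x * V (snoc (x, 0))).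
Proof. by move=> lb; have [lv bv] := lbs_bd V; apply: lbs_l2; split; [exact: lbmM|exact: bsuppMr]. Qed.

Lemma n2_cf_le V : n2 (leb m.+1) (cf V \_ Om) <= nn V ^+ 2.
Proof.
rewrite n2_restrict nn_sqr; apply: (Int_le mO) => [||x _]; last exact: sqr_le_en.
  by have := cfb V; have := lcf V => ? ?; lbst.
by split; [exact: lbm_en|exact: bsupp_en].
Qed.

Lemma n2_cd_le V i : n2 (leb m.+1) (cd V i \_ Om) <= nn V ^+ 2.
Proof.
rewrite n2_restrict nn_sqr; apply: (Int_le mO) => [||x _]; last exact: sqrD_le_en.
  by have := bcd V i; have := lcd V i => ? ?; lbst.
by split; [exact: lbm_en|exact: bsupp_en].
Qed.

Lemma n2_be_le (be : 'rV[R]_m -> R) V : lbm be -> (forall x, `|be x| <= K) ->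
  n2 (leb m) (fun x => be x * V (snoc (x, 0))) <= (K * nn V) ^+ 2.
Proof.
move=> lb bK; apply: (le_trans (n2_bdM (lbm_measurable lb) bK (lbs_l2 (lbs_bd V)))).
rewrite exprMn ler_wpM2l ?sqr_ge0// nn_sqr; exact: nn_trace.
Qed.

Lemma wform_bound P p q s t V (e : R) : wdata P p q s t -> 0 <= e -> wsize P p q s t (e ^+ 2) ->
  `|wform P p q s t V| <= (N + 2 * K + `|l1| + `|l2|) * e * nn V.
Proof.
move=> [lP lp lq ls lt] e0 [hP hp hq hs ht].
have nV := nn_ge0 V; have KV : 0 <= K * nn V by rewrite mulr_ge0.
have h1 : `|\sum_i \int[leb m.+1]_x (P i x * (cd V i \_ Om) x)| <= N * (e * nn V).
  apply: (le_trans (ler_norm_sum _ _ _)).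
  apply: (@le_trans _ _ (\sum_(i < m.+1) (e * nn V))).
    by apply: ler_sum => i _; apply: n2_CS_le (hP i) (n2_cd_le V i) => //; exact: l2_cd.
  by rewrite sumr_const card_ord mulr_natl.
have h2 := n2_CS_le ls (l2_be V lbe1) e0 KV hs (n2_be_le V lbe1 be1K).
have h3 := n2_CS_le lt (l2_be V lbe2) e0 KV ht (n2_be_le V lbe2 be2K).
have h4 := n2_CS_le lp (l2_cf V) e0 nV hp (n2_cf_le V).
have h5 := n2_CS_le lq (l2_cf V) e0 nV hq (n2_cf_le V).
rewrite /wform; apply: (le_trans (ler_normB _ _)).
apply: (le_trans (lerD (ler_normD _ _) (ler_normB _ _))).
rewrite !normrM.
have h6 := le_trans (ler_normB _ _) (lerD h2 h3).
have h7 := ler_wpM2l (normr_ge0 l1) h4; have h8 := ler_wpM2l (normr_ge0 l2) h5.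
have h9 := lerD (lerD h1 h6) (lerD h7 h8); apply: (le_trans h9).
by rewrite le_eqVlt; apply/orP; left; apply/eqP; ring.
Qed.

Lemma wformB P p q s t P' p' q' s' t' V : wdata P p q s t -> wdata P' p' q' s' t' ->
  wform (fun i x => P i x - P' i x) (fun x => p x - p' x) (fun x => q x - q' x)
    (fun x => s x - s' x) (fun x => t x - t' x) V = wform P p q s t V - wform P' p' q' s' t' V.
Proof.
move=> [lP lp lq ls lt] [lP' lp' lq' ls' lt'].
have lcf := l2_cf V; have lb1 := l2_be V lbe1; have lb2 := l2_be V lbe2.
rewrite /wform (pairBl lp lp' lcf) (pairBl lq lq' lcf) (pairBl ls ls' lb1) (pairBl lt lt' lb2).
rewrite (eq_bigr _ (fun i _ => pairBl (lP i) (lP' i) (l2_cd V i))) sumrB; ring.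
Qed.

Lemma wformBr P p q s t V W : wdata P p q s t ->
  wform P p q s t (cfunB V W) = wform P p q s t V - wform P p q s t W.
Proof.
move=> [lP lp lq ls lt].
have E i : \int[leb m.+1]_x (P i x * (cd (cfunB V W) i \_ Om) x) =
    \int[leb m.+1]_x (P i x * (cd V i \_ Om) x) - \int[leb m.+1]_x (P i x * (cd W i \_ Om) x).
  rewrite -(pairBr (lP i) (l2_cd V i) (l2_cd W i)); apply: eq_Rintegral => x _.
  by rewrite !patchE; case: ifPn => _ //=; rewrite subrr.
have Ef (f : 'rV[R]_m.+1 -> R) : L2 f -> \int[leb m.+1]_x (f x * (cf (cfunB V W) \_ Om) x) =
    \int[leb m.+1]_x (f x * (cf V \_ Om) x) - \int[leb m.+1]_x (f x * (cf W \_ Om) x).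
  move=> lf; rewrite -(pairBr lf (l2_cf V) (l2_cf W)); apply: eq_Rintegral => x _.
  by rewrite !patchE; case: ifPn => _ //=; rewrite subrr.
have Eb (be r : 'rV[R]_m -> R) : lbm be -> L2b r -> \int[leb m]_x (r x * (be x * cfunB V W (snoc (x, 0)))) =
    \int[leb m]_x (r x * (be x * V (snoc (x, 0)))) - \int[leb m]_x (r x * (be x * W (snoc (x, 0)))).
  move=> lb lr; rewrite -(pairBr lr (l2_be V lb) (l2_be W lb)).
  by apply: eq_Rintegral => x _; rewrite -mulrBr.
rewrite /wform (eq_bigr _ (fun i _ => E i)) sumrB (Ef _ lp) (Ef _ lq) (Eb _ _ lbe1 ls) (Eb _ _ lbe2 lt).
by ring.
Qed.

Lemma wdataB P p q s t P' p' q' s' t' : wdata P p q s t -> wdata P' p' q' s' t' ->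
  wdata (fun i x => P i x - P' i x) (fun x => p x - p' x) (fun x => q x - q' x)
    (fun x => s x - s' x) (fun x => t x - t' x).
Proof.
by move=> [lP lp lq ls lt] [lP' lp' lq' ls' lt']; split=> [i||||]; exact: l2B.
Qed.

Lemma wdata_cf f g : wdata (fun i => cd f i \_ Om) (cf f \_ Om) (cf g \_ Om) (bd f) (bd g).
Proof.
by split=> [i||||]; [exact: l2_cd|exact: l2_cf|exact: l2_cf|exact: lbs_l2 (lbs_bd f)|exact: lbs_l2 (lbs_bd g)].
Qed.

Lemma pair_restrict (f g : 'rV[R]_m.+1 -> R) :
  \int[leb m.+1]_x ((f \_ Om) x * (g \_ Om) x) = \int[leb m.+1]_(x in Om) (f x * g x).
Proof.
rewrite [RHS]Rintegral_mkcond; apply: eq_Rintegral => x _; rewrite !patchE.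
by case: ifPn => _; rewrite ?mul0r.
Qed.

Lemma RF_wform f g V : RF be1 be2 l1 l2 f g V =
  wform (fun i => cd f i \_ Om) (cf f \_ Om) (cf g \_ Om) (bd f) (bd g) V.
Proof.
have [lf bf] := lbs_bd f; have [lg bg] := lbs_bd g; have [lV bV] := lbs_bd V.
rewrite /RF /rform /wform; congr (_ + _ - _).
- rewrite (Int_sum mO) => [|i]; last by have ? := lcd f i; have ? := lcd V i; have ? := bcd f i; lbst.
  by apply: eq_bigr => i _; rewrite pair_restrict.
- rewrite -(IntB measurableT); [|lbst|lbst].
  by apply: eq_Rintegral => x _; ring.
- rewrite !pair_restrict -!(IntZ mO); [|lbst|lbst]; rewrite -(IntB mO); [|lbst|lbst].
  by apply: eq_Rintegral => x _; ring.
Qed.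

(** The form is bounded by the H^1 norm of [V], in which smooth functions approximate C^1 ones by
    dominated convergence. *)
Lemma wform_ext P p q s t : wdata P p q s t ->
  (forall V, (forall k : nat, isCk k V) -> wform P p q s t V = 0) ->
  forall V, wform P p q s t V = 0.
Proof.
move=> wd H V.
pose S := \sum_i n2 (leb m.+1) (P i) + n2 (leb m.+1) p + n2 (leb m.+1) q + n2 (leb m) s + n2 (leb m) t.
have sP : 0 <= \sum_i n2 (leb m.+1) (P i) by apply: sumr_ge0 => i _; exact: n2_ge0.
have [p0 q0 s0 t0] : [/\ 0 <= n2 (leb m.+1) p, 0 <= n2 (leb m.+1) q, 0 <= n2 (leb m) s & 0 <= n2 (leb m) t].
  by split; exact: n2_ge0.
have S0 : 0 <= S by rewrite /S !addr_ge0.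
have ws : wsize P p q s t (Num.sqrt S ^+ 2).
  rewrite sqr_sqrtr//; split=> [i||||]; rewrite /S; try lra.
  have : n2 (leb m.+1) (P i) <= \sum_i n2 (leb m.+1) (P i).
    by rewrite (bigD1 i)//= lerDl sumr_ge0// => j _; exact: n2_ge0.
  by lra.
set C := (N + 2 * K + `|l1| + `|l2|) * Num.sqrt S.
have C0 : 0 <= C by rewrite mulr_ge0 ?sqrtr_ge0// !addr_ge0 ?mulr_ge0.
have bound W : `|wform P p q s t W| <= C * nn W by exact: wform_bound ws.
have [hk [tk [C' [M [hM [hC hDC] ch chD]]]]] := C1c_seq (cfD V) (cfb V).
pose W k := CFun (test_C1 (tk k)) (test_bsupp (tk k)).
have WV k : `|wform P p q s t V| <= C * nn (cfunB V (W k)).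
  have := bound (cfunB V (W k)); rewrite wformBr// (H (W k)) ?subr0//.
  by have [] := tk k.
have cdE i : partial i (cf V) = cd V i by apply: partial_E => y; have [_ _] := cfD V; apply.
have cN : N2 (cfunB V (W k)) @[k --> \oo] --> (0 : R).
  have [Mv HMv] := bsuppE (cfb V).
  have [Cv Cv0 HCv] := lbm_bounded (lcf V) (cfb V).
  have /choice[Cd HCd] i : exists c : R, forall x, `|cd V i x| <= c.
    by have [c _ Hc] := lbm_bounded (lcd V i) (bcd V i); exists c.
  have sqb (x c : R) : `|x| <= c -> x ^+ 2 <= c ^+ 2.
    by move=> h; rewrite -(real_normK (num_real x)) lerXn2r// nnegrE//; exact: le_trans h.
  have := @Int_lim _ _ Om (fun=> 1) (fun=> 0) (fun k x => en (cfunB V (W k)) x)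
    ((Cv + C') ^+ 2 + \sum_i (Cd i + C') ^+ 2) (Num.max Mv M) mO (lbm_cst _ 1).
  rewrite (_ : \int[_]_(x in Om) (1 * 0) = 0); last by rewrite /Rintegral; under eq_integral do rewrite mulr0; rewrite integral0.
  rewrite (_ : (fun k => \int[_]_(x in Om) _) = fun k => N2 (cfunB V (W k))); last first.
    by apply/funext => k; apply: eq_Rintegral => x _; rewrite mul1r.
  apply=> [k|k x|k x|x].
  - by apply: lbm_measurable; exact: lbm_en.
  - rewrite ger0_norm ?en_ge0// /en /=; apply: lerD; first by apply: sqb; rewrite (le_trans (ler_normB _ _))// lerD.
    by apply: ler_sum => i _; apply: sqb; rewrite (le_trans (ler_normB _ _))// lerD.
  - rewrite gt_max => /andP[h1 h2]; rewrite /en /= HMv// hM// subrr expr0n add0r big1// => i _.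
    by rewrite (supp_test_partial i (hM k) h2) -cdE (supp_test_partial i HMv h1) subrr expr0n.
  - rewrite /en /= -[X in _ --> X](addr0 (0 : R)); apply: cvgD.
      rewrite -[X in _ --> X](mulr0 (0 : R)) -(subrr (V x)).
      by apply: cvgM; (apply: cvgB; [exact: cvg_cst|exact: ch]).
    rewrite [X in _ --> X](_ : 0 = \sum_(i < m.+1) (cd V i x - cd V i x) * (cd V i x - cd V i x)).
      apply: cvg_big => [|i _]; first exact: add_continuous.
      by apply: cvgM; (apply: cvgB; [exact: cvg_cst|exact: chD]).
    by rewrite big1// => i _; rewrite subrr mulr0.
apply/eqP; rewrite -normr_le0; apply/ler_addgt0Pl => e e0; rewrite addr0.
have C1 : 0 < C + 1 by rewrite ltr_wpDl.
have d0 : 0 < (e / (C + 1)) ^+ 2 by rewrite exprn_gt0// divr_gt0.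
move/cvgrPdist_le : cN => /(_ _ d0)[k _ /(_ k (leqnn k))].
rewrite sub0r normrN ger0_norm ?N2_ge0// -nn_sqr ler_sqr ?nnegrE ?nn_ge0 ?divr_ge0 ?(ltW e0) ?(ltW C1)// => h.
apply: (le_trans (WV k)); apply: (@le_trans _ _ ((C + 1) * (e / (C + 1)))).
  by apply: ler_pM => //; [exact: nn_ge0|rewrite lerDl].
by rewrite mulrC divfK// gt_eqF.
Qed.

End weak_form.

Lemma l1_sum d (T : measurableType d) (R : realType) (mu : {measure set T -> \bar R})
    (I : Type) (r : seq I) (f : I -> T -> R) : (forall i, L1fun mu (f i)) ->
  L1fun mu (fun x => \sum_(i <- r) f i x) /\
  \int[mu]_x (\sum_(i <- r) f i x) = \sum_(i <- r) \int[mu]_x f i x.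
Proof.
move=> lf; elim: r => [|i r [lr IH]].
  rewrite big_nil (_ : (fun x => _) = fun=> 0); last by apply/funext => x; rewrite big_nil.
  split; last by rewrite /Rintegral integral0.
  exact: integrable0.
rewrite (_ : (fun x => _) = fun x => f i x + \sum_(j <- r) f j x); last first.
  by apply/funext => x; rewrite big_cons.
by split; [exact: l1D|rewrite big_cons -IH; exact: RintegralD measurableT (lf i) lr].
Qed.

Lemma measurable_re_mul3 d (T : measurableType d) (R : realType) (a b c e g h : T -> R) :
  measurable_fun setT a -> measurable_fun setT b -> measurable_fun setT c ->
  measurable_fun setT e -> measurable_fun setT g -> measurable_fun setT h ->
  measurable_fun setT (fun x => (a x * c x - b x * e x) * g x + (a x * e x + b x * c x) * h x).
Proof.
move=> ma mb mc me mg mh; apply: measurable_funD; apply: measurable_funM => //.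
  by apply: measurable_funB; exact: measurable_funM.
by apply: measurable_funD; exact: measurable_funM.
Qed.

Section eigenfunction.
Variables (R : realType) (m : nat) (alpha : 'rV[R]_m -> R[i]) (lambda : R[i]) (u : 'rV[R]_m.+1 -> R[i]).
Local Notation leb := (lebesgue_rV R).
Local Notation Om := (half_space R m).
Local Notation cfun := (cfun R m).
Local Notation bd f := (fun x : 'rV[R]_m => f (snoc (x, 0 : R))).
Local Notation L2 := (L2fun (leb m.+1)).
Local Notation L2b := (L2fun (leb m)).
Local Notation cre := (@complex.Re R).
Local Notation cim := (@complex.Im R).
Local Notation l1 := (cre lambda).
Local Notation l2 := (cim lambda).
Local Notation p := (cre \o u).
Local Notation q := (cim \o u).
Local Notation wp f := (fun i => weak_partial Om i f).

Variables (be1 be2 : 'rV[R]_m -> R) (K : R).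
Hypotheses (lbe1 : lbm be1) (lbe2 : lbm be2) (K0 : 0 <= K).
Hypotheses (be1K : forall x, `|be1 x| <= K) (be2K : forall x, `|be2 x| <= K).
Hypotheses (ma1 : measurable_fun setT (cre \o alpha)) (ma2 : measurable_fun setT (cim \o alpha)).
Hypotheses (abe1 : {ae leb m, forall x, cre (alpha x) = be1 x}) (abe2 : {ae leb m, forall x, cim (alpha x) = be2 x}).
Hypothesis Hu : robin_laplacian alpha u (fun x => lambda * u x).

Let mO := @measurable_half_space R m.
Let eO := @exhausting_half_space R m.

Let Hp : H1_data Om p (wp p).
Proof. by have [[h _] _ _] := Hu; have := W1p_data eO mO h. Qed.

Let Hq : H1_data Om q (wp q).
Proof. by have [[_ h] _ _] := Hu; have := W1p_data eO mO h. Qed.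

Lemma traceP f g : H1_data Om f g -> is_trace f (trace f).
Proof. by move=> /trace_exists[tau Ht]; rewrite /trace; case: xgetP => [//|/(_ tau)]. Qed.

Let tp : L2b (trace p). Proof. by have [] := is_traceP Hp (traceP Hp). Qed.
Let tq : L2b (trace q). Proof. by have [] := is_traceP Hq (traceP Hq). Qed.

Definition wform1 := wform be1 be2 l1 l2 (fun i => wp p i \_ Om) (p \_ Om) (q \_ Om) (trace p) (trace q).
Definition wform2 := wform be1 be2 l1 l2 (fun i => wp q i \_ Om) (q \_ Om) (fun x => - (p \_ Om) x)
  (trace q) (fun x => - trace p x).

Lemma wdata1 : wdata (fun i => wp p i \_ Om) (p \_ Om) (q \_ Om) (trace p) (trace q).
Proof. by have [lp Hp'] := Hp; have [lq _] := Hq; split=> // i; case: (Hp' i). Qed.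

Lemma wdata2 : wdata (fun i => wp q i \_ Om) (q \_ Om) (fun x => - (p \_ Om) x) (trace q) (fun x => - trace p x).
Proof.
have [lp _] := Hp; have [lq Hq'] := Hq; split=> //; [by move=> i; case: (Hq' i)|exact: l2N|exact: l2N].
Qed.

Lemma cRe_sum (I : Type) (r : seq I) (f : I -> R[i]) : cre (\sum_(i <- r) f i) = \sum_(i <- r) cre (f i).
Proof. by apply: (big_morph cre) => // -[a b] [c d]. Qed.

Lemma cRe_mul_conj' (z : R[i]) (c d : R) : cre (z * (c -i* d)%C) = cre z * c + cim z * d.
Proof. by case: z => [a b] /=; rewrite mulrN opprK. Qed.

Lemma cRe_mul3 (z w y : R[i]) : cre (z * w * conjc y) =
  (cre z * cre w - cim z * cim w) * cre y + (cre z * cim w + cim z * cre w) * cim y.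
Proof. by case: z w y => [a b] [c d] [e f] /=; rewrite mulrN opprK. Qed.

(** Only the real part of the complex identity is used: against [v = V + i W] it is the real part of
    the equation paired with [V] plus the imaginary part paired with [W]. Setting one of them to
    zero isolates the other. *)
Lemma weak_equation (V W : cfun) : (forall k : nat, isCk k V) -> (forall k : nat, isCk k W) ->
  wform1 V + wform2 W = 0.
Proof.
move=> VC WC; have HV := H1_data_C1 mO (cfD V) (cfb V); have HW := H1_data_C1 mO (cfD W) (cfb W).
pose v x : R[i] := (V x +i* W x)%C.
have cv : cW1p Om 2%:E v by split; [exact: H1_data_W1p HV|exact: H1_data_W1p HW].
have [_ _ /(_ v cv) H] := Hu.
have {}H : \int[leb m.+1]_(x in Om) cre (\sum_(i < m.+1) cweak_partial Om i u x * conjc (cweak_partial Om i v x)) +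
    \int[leb m]_x cre (alpha x * ctrace u x * conjc (ctrace v x)) =
    \int[leb m.+1]_(x in Om) cre (lambda * u x * conjc (v x)).
  exact: (congr1 cre H).
have [lp Hp'] := Hp; have [lq Hq'] := Hq.
have lP i : L2 (wp p i \_ Om) by case: (Hp' i).
have lQ i : L2 (wp q i \_ Om) by case: (Hq' i).
have lcV := l2_cf V; have lcW := l2_cf W; have ldV := l2_cd V; have ldW := l2_cd W.
have [_ HwV] := W1p_data eO mO (H1_data_W1p HV); have [_ HwW] := W1p_data eO mO (H1_data_W1p HW).
have aeD (F : cfun) : H1_data Om F (cd F) -> {ae leb m.+1, forall x, forall i, (wp F i \_ Om) x = (cd F i \_ Om) x}.
  move=> [_ HF]; apply: filter_forall => i; apply: filterS (weak_partialE eO mO (HF i).1) => x h.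
  by rewrite !patchE; case: ifPn => // /set_mem/h.
have E1 : \int[leb m.+1]_(x in Om) cre (\sum_(i < m.+1) cweak_partial Om i u x * conjc (cweak_partial Om i v x)) =
    \sum_i \int[leb m.+1]_x ((wp p i \_ Om) x * (cd V i \_ Om) x) +
    \sum_i \int[leb m.+1]_x ((wp q i \_ Om) x * (cd W i \_ Om) x).
  have l1i i : L1fun (leb m.+1) (fun x => (wp p i \_ Om) x * (cd V i \_ Om) x + (wp q i \_ Om) x * (cd W i \_ Om) x).
    by apply: l1D; exact: l2M.
  rewrite -big_split/=.
  rewrite (eq_bigr (fun i => \int[leb m.+1]_x ((wp p i \_ Om) x * (cd V i \_ Om) x + (wp q i \_ Om) x * (cd W i \_ Om) x))); last first.
    by move=> i _; rewrite RintegralD//; exact: l2M.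
  have [ls <-] := l1_sum (index_enum 'I_m.+1) l1i.
  rewrite [LHS]Rintegral_mkcond.
  rewrite [LHS](_ : _ = \int[leb m.+1]_x (\sum_i ((wp p i \_ Om) x * (wp V i \_ Om) x + (wp q i \_ Om) x * (wp W i \_ Om) x))); last first.
    apply: eq_Rintegral => x _; rewrite patchE; case: ifPn => [/set_mem xO|xO]; last first.
      have z (f : 'rV[R]_m.+1 -> R) : (f \_ Om) x = 0.
        by rewrite patchE memNset// => Ox; move/negP: xO; apply; exact: mem_set.
      by rewrite big1// => i _; rewrite !z !mul0r addr0.
    have z (f : 'rV[R]_m.+1 -> R) : (f \_ Om) x = f x.
      by rewrite patchE mem_set.
    by rewrite cRe_sum; apply: eq_bigr => i _; rewrite cRe_mul_conj' !z.
  apply: ae_eq_Rint; last 1 first.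
  - apply: filterS2 (aeD V HV) (aeD W HW) => x h1 h2; apply: eq_bigr => i _.
    by rewrite h1 h2.
  - apply: measurable_sum => i; apply: measurable_funD.
      exact: measurable_funM (lP i).1 (HwV i).2.1.
    exact: measurable_funM (lQ i).1 (HwW i).2.1.
  - exact: l1_meas ls.
have tV := traceP HV; have tW := traceP HW.
have [ltV _] := is_traceP HV tV; have [ltW _] := is_traceP HW tW.
have E2 : \int[leb m]_x cre (alpha x * ctrace u x * conjc (ctrace v x)) =
    (\int[leb m]_x (trace p x * (be1 x * V (snoc (x, 0)))) - \int[leb m]_x (trace q x * (be2 x * V (snoc (x, 0))))) +
    (\int[leb m]_x (trace q x * (be1 x * W (snoc (x, 0)))) - \int[leb m]_x ((- trace p x) * (be2 x * W (snoc (x, 0))))).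
  have a1 := l2_be V lbe1; have a2 := l2_be V lbe2; have a3 := l2_be W lbe1; have a4 := l2_be W lbe2.
  have b1 := l2M tp a1; have b2 := l2M tq a2; have b3 := l2M tq a3; have b4 := l2M (l2N tp) a4.
  rewrite -!RintegralB// -RintegralD//; [|exact: l1B|exact: l1B].
  rewrite (_ : \int[leb m]_x cre _ = \int[leb m]_x (
    (cre (alpha x) * trace p x - cim (alpha x) * trace q x) * trace V x +
    (cre (alpha x) * trace q x + cim (alpha x) * trace p x) * trace W x)); last first.
    by apply: eq_Rintegral => x _; exact: cRe_mul3.
  apply: ae_eq_Rint.
  - exact: (measurable_re_mul3 ma1 ma2 tp.1 tq.1 ltV.1 ltW.1).
  - exact: l1_meas (l1D (l1B b1 b2) (l1B b3 b4)).
  - have c1 : {ae leb m, forall x, cre (alpha x) = be1 x /\ cim (alpha x) = be2 x} by apply: filterS2 abe1 abe2 => x.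
    apply: filterS3 c1 (is_trace_C1 (cfD V) (cfb V) tV) (is_trace_C1 (cfD W) (cfb W) tW) => x [-> ->] -> ->.
    have aux (a b c d e f : R) : (a * c - b * d) * e + (a * d + b * c) * f =
      (c * (a * e) - d * (b * e)) + (d * (a * f) - (- c) * (b * f)) by ring.
    exact: aux.
have E3 : \int[leb m.+1]_(x in Om) cre (lambda * u x * conjc (v x)) =
    (l1 * \int[leb m.+1]_x ((p \_ Om) x * (cf V \_ Om) x) - l2 * \int[leb m.+1]_x ((q \_ Om) x * (cf V \_ Om) x)) +
    (l1 * \int[leb m.+1]_x ((q \_ Om) x * (cf W \_ Om) x) - l2 * \int[leb m.+1]_x ((- (p \_ Om) x) * (cf W \_ Om) x)).
  have b1 := l2M lp lcV; have b2 := l2M lq lcV; have b3 := l2M lq lcW; have b4 := l2M (l2N lp) lcW.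
  have c1 := l1Z l1 b1; have c2 := l1Z l2 b2; have c3 := l1Z l1 b3; have c4 := l1Z l2 b4.
  rewrite -!RintegralZl// -!RintegralB// -RintegralD//; [|exact: l1B|exact: l1B].
  rewrite [LHS]Rintegral_mkcond; apply: eq_Rintegral => x _; rewrite !patchE; case: ifPn => _; last by rewrite !(mul0r, mulr0, oppr0, addr0, subrr).
  have aux (a b c d e f : R) : (a * c - b * d) * e + (a * d + b * c) * f =
    (a * (c * e) - b * (d * e)) + (a * (d * f) - b * ((- c) * f)) by ring.
  by rewrite cRe_mul3; exact: aux.
have -> : wform1 V + wform2 W =
   (\sum_i \int[leb m.+1]_x ((wp p i \_ Om) x * (cd V i \_ Om) x) +
    \sum_i \int[leb m.+1]_x ((wp q i \_ Om) x * (cd W i \_ Om) x)) +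
   ((\int[leb m]_x (trace p x * (be1 x * V (snoc (x, 0)))) - \int[leb m]_x (trace q x * (be2 x * V (snoc (x, 0))))) +
    (\int[leb m]_x (trace q x * (be1 x * W (snoc (x, 0)))) - \int[leb m]_x ((- trace p x) * (be2 x * W (snoc (x, 0)))))) -
   ((l1 * \int[leb m.+1]_x ((p \_ Om) x * (cf V \_ Om) x) - l2 * \int[leb m.+1]_x ((q \_ Om) x * (cf V \_ Om) x)) +
    (l1 * \int[leb m.+1]_x ((q \_ Om) x * (cf W \_ Om) x) - l2 * \int[leb m.+1]_x ((- (p \_ Om) x) * (cf W \_ Om) x))).
  rewrite /wform1 /wform2 /wform.
  have aux (a b c d e f : R) : a + b - c + (d + e - f) = a + d + (b + e) - (c + f) by ring.
  exact: aux.
by rewrite -E1 -E2 -E3 H subrr.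
Qed.

Lemma wform0 P a b s t : wform be1 be2 l1 l2 P a b s t (CFun (C1_cst m.+1 0) (@bsupp_cst0 R m.+1)) = 0.
Proof.
have z (d : measure_display) (T : measurableType d) (mu : {measure set T -> \bar R}) (f g : T -> R) :
    (forall x, g x = 0) -> \int[mu]_x (f x * g x) = 0.
  move=> g0; rewrite (_ : (fun x => _) = fun=> 0); first by rewrite /Rintegral integral0.
  by apply/funext => x; rewrite g0 mulr0.
have r0 x : (cf (CFun (C1_cst m.+1 0) (@bsupp_cst0 R m.+1)) \_ Om) x = 0 by rewrite patchE; case: ifP.
rewrite /wform big1 => [|i _]; last by apply: z => x; rewrite patchE; case: ifP.
by rewrite !z ?mulr0 ?subr0 ?addr0// => x; rewrite mulr0.
Qed.

Lemma wform1_eq0 V : wform1 V = 0.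
Proof.
apply: (wform_ext lbe1 lbe2 K0 be1K be2K wdata1) => {}V VC.
have := @weak_equation V (CFun (C1_cst m.+1 0) (@bsupp_cst0 R m.+1)) VC (fun k => isCk_cst _ k 0).
by rewrite /wform2 wform0 addr0.
Qed.

Lemma wform2_eq0 V : wform2 V = 0.
Proof.
apply: (wform_ext lbe1 lbe2 K0 be1K be2K wdata2) => {}V VC.
have := @weak_equation (CFun (C1_cst m.+1 0) (@bsupp_cst0 R m.+1)) V (fun k => isCk_cst _ k 0) VC.
by rewrite /wform1 wform0 add0r.
Qed.

End eigenfunction.

(** * Approximating sequences for the eigenfunction *)

Section approximants.
Variables (R : realType) (m : nat).
Local Notation leb := (lebesgue_rV R).
Local Notation Om := (half_space R m).
Local Notation N := (m.+1%:R).
Local Notation cfun := (cfun R m).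
Local Notation bd f := (fun x : 'rV[R]_m => f (snoc (x, 0 : R))).
Let mO := @measurable_half_space R m.

Lemma N2_split (f : cfun) :
  N2 f = n2 (leb m.+1) (cf f \_ Om) + \sum_i n2 (leb m.+1) (cd f i \_ Om).
Proof.
have lf := lcf f; have bf := cfb f; have ld i := lcd f i; have bdd i := bcd f i.
rewrite /N2 /en (IntD mO (f := fun x => f x ^+ 2)); [|lbst|lbst].
rewrite (Int_sum mO) => [|i]; last by lbst.
by rewrite n2_restrict; congr (_ + _); apply: eq_bigr => i _; rewrite n2_restrict.
Qed.

Lemma cauchy_approx (p : 'rV[R]_m.+1 -> R) (P : 'I_m.+1 -> 'rV[R]_m.+1 -> R) (F : nat -> cfun) :
  H1_data Om p P ->
  (forall e : R, 0 < e -> exists J, forall j, (J <= j)%N ->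
     n2 (leb m.+1) ((fun x => F j x - p x) \_ Om) <= e /\
     forall i, n2 (leb m.+1) ((fun x => cd (F j) i x - P i x) \_ Om) <= e) ->
  cauchy_nn F.
Proof.
(* The squared norm has [m.+2] parts, the function and its [m.+1] partial derivatives, each at most
   [4 e]. *)
move=> Hp H eta eta0; pose e := eta ^+ 2 / (4 * m.+2%:R).
have e0 : 0 < e by rewrite divr_gt0 ?exprn_gt0// mulr_gt0.
have [J HJ] := H _ e0; exists J => j l /HJ[a1 a2] /HJ[b1 b2].
have D (f g h : 'rV[R]_m.+1 -> R) : L2fun (leb m.+1) (f \_ Om) -> L2fun (leb m.+1) (g \_ Om) ->
    L2fun (leb m.+1) (h \_ Om) ->
    n2 (leb m.+1) ((fun x => f x - h x) \_ Om) <= e -> n2 (leb m.+1) ((fun x => g x - h x) \_ Om) <= e ->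
    n2 (leb m.+1) ((fun x => f x - g x) \_ Om) <= 4 * e.
  rewrite !restrictB => lf lg lh h1 h2.
  have -> : (fun x => (f \_ Om) x - (g \_ Om) x) = fun x => ((f \_ Om) x - (h \_ Om) x) + - ((g \_ Om) x - (h \_ Om) x).
    by apply/funext => x; ring.
  apply: (le_trans (n2D (l2B lf lh) (l2N (l2B lg lh)))).
  have -> : n2 (leb m.+1) (fun x => - ((g \_ Om) x - (h \_ Om) x)) = n2 (leb m.+1) (fun x => (g \_ Om) x - (h \_ Om) x).
    by apply: eq_Rintegral => x _; rewrite sqrrN.
  lra.
have [lp Hi] := Hp; have lP i : L2fun (leb m.+1) (P i \_ Om) by case: (Hi i).
rewrite -ler_sqr ?nnegrE ?nn_ge0 ?(ltW eta0)// nn_sqr N2_split.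
apply: (@le_trans _ _ (4 * e + \sum_(i < m.+1) (4 * e))).
  apply: lerD; first exact: (D _ _ _ (l2_cf _) (l2_cf _) lp a1 b1).
  by apply: ler_sum => i _; exact: (D _ _ _ (l2_cd _ _) (l2_cd _ _) (lP i) (a2 i) (b2 i)).
rewrite sumr_const card_ord -mulrS -[leLHS]mulr_natr /e le_eqVlt; apply/orP; left; apply/eqP.
by field; rewrite ?pnatr_eq0 ?gt_eqF//.
Qed.

Section small.
Variables (be1 be2 : 'rV[R]_m -> R) (K l1 l2 : R).
Hypotheses (lbe1 : lbm be1) (lbe2 : lbm be2).
Hypotheses (K0 : 0 <= K) (be1K : forall x, `|be1 x| <= K) (be2K : forall x, `|be2 x| <= K).

Lemma RF_small_approx P p q s t (F G : nat -> cfun) : wdata P p q s t ->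
  (forall V, wform be1 be2 l1 l2 P p q s t V = 0) ->
  (forall e : R, 0 < e -> exists J, forall j, (J <= j)%N ->
     wsize (fun i x => (cd (F j) i \_ Om) x - P i x) (fun x => (cf (F j) \_ Om) x - p x)
       (fun x => (cf (G j) \_ Om) x - q x) (fun x => F j (snoc (x, 0)) - s x)
       (fun x => G j (snoc (x, 0)) - t x) e) ->
  RF_small be1 be2 l1 l2 F G.
Proof.
move=> wd H0 H eta eta0; pose C := N + 2 * K + `|l1| + `|l2|.
have C0 : 0 < C by rewrite /C -!addrA ltr_pwDl// !addr_ge0// mulr_ge0.
have e0 : 0 < eta / C by rewrite divr_gt0.
have [J HJ] := H _ (exprn_gt0 2 e0); exists J => j V /HJ hj.
have wdj := wdata_cf (F j) (G j).
have E := wformB l1 l2 lbe1 lbe2 V wdj wd; rewrite H0 subr0 in E.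
rewrite RF_wform// -E.
apply: (le_trans (wform_bound l1 l2 lbe1 lbe2 K0 be1K be2K V (wdataB wdj wd) (ltW e0) hj)).
by rewrite -/C [C * _]mulrC divfK// gt_eqF.
Qed.

End small.

End approximants.

(** [rotation_bound] divides by [b2], and the optimal [q] degenerates with [b1]; the strict
    inequality leaves room to make both positive. *)
Lemma enlarge_bounds (R : realType) (b1 b2 : R) : 0 <= b1 -> 0 <= b2 ->
  2 * Num.sqrt (b1 * (b1 + b2)) < 1 -> exists b1' b2', [/\ 0 < b1' /\ b1 <= b1', 0 < b2' /\ b2 <= b2' &
  2 * Num.sqrt (b1' * (b1' + b2')) < 1].
Proof.
move=> b10 b20 b12.
pose P := b1 * (b1 + b2); have P0 : 0 <= P by rewrite mulr_ge0// addr_ge0.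
have P1 : P < 4^-1.
  have s0 := sqrtr_ge0 P; rewrite -(sqr_sqrtr P0).
  have h : Num.sqrt P < 2^-1 by move: b12; rewrite -/P => h; lra.
  have -> : (4^-1 : R) = 2^-1 ^+ 2 by field.
  by rewrite ltr_pXn2r// nnegrE.
(* For [d <= 1], [(b1 + d) (b1 + b2 + 2 d) = P + d (3 b1 + b2 + 2 d) <= P + d S]. *)
pose S := 3 * b1 + b2 + 2; have S0 : 0 < S by rewrite /S; lra.
pose d := Num.min 1 ((4^-1 - P) / (2 * S)).
have d0 : 0 < d by rewrite lt_min ltr01/= divr_gt0 ?mulr_gt0// subr_gt0.
have d1 : d <= 1 by rewrite ge_min lexx.
have dS : d * S <= (4^-1 - P) / 2.
  have : d <= (4^-1 - P) / (2 * S) by rewrite ge_min lexx orbT.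
  by rewrite invfM mulrA ler_pdivlMr.
exists (b1 + d), (b2 + d); split; [by split; lra|by split; lra|].
have E : (b1 + d) * (b1 + d + (b2 + d)) < 4^-1.
  have : (b1 + d) * (b1 + d + (b2 + d)) <= P + d * S.
    have -> : (b1 + d) * (b1 + d + (b2 + d)) = P + d * (3 * b1 + b2 + 2 * d) by rewrite /P; ring.
    by rewrite lerD2l ler_wpM2l ?(ltW d0)// /S; lra.
  by move=> h; lra.
have E0 : 0 <= (b1 + d) * (b1 + d + (b2 + d)) by rewrite mulr_ge0//; lra.
have s0 := sqrtr_ge0 ((b1 + d) * (b1 + d + (b2 + d))).
have : Num.sqrt ((b1 + d) * (b1 + d + (b2 + d))) < 2^-1.
  rewrite -(@ltr_pXn2r _ 2) ?nnegrE//; rewrite sqr_sqrtr//.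
  by apply: lt_le_trans E _; rewrite le_eqVlt; apply/orP; left; apply/eqP; field.
by lra.
Qed.

Section vanishing.
Variables (R : realType) (m : nat).
Local Notation leb := (lebesgue_rV R).
Local Notation Om := (half_space R m).
Local Notation cfun := (cfun R m).
Let mO := @measurable_half_space R m.
Let eO := @exhausting_half_space R m.

(** The weight [v] is positive and bounded, and [v^2] is at most the weight of [mass]. So [v F j]
    tends to 0 in L^2, while it also tends to [v p]. *)
Lemma vanish_of_mass (p : 'rV[R]_m.+1 -> R) (F G : nat -> cfun) :
  L2fun (leb m.+1) (p \_ Om) ->
  (forall e : R, 0 < e -> exists J, forall j, (J <= j)%N ->
     n2 (leb m.+1) ((fun x => F j x - p x) \_ Om) <= e) ->
  (forall e : R, 0 < e -> exists J, forall j, (J <= j)%N -> mass (F j) (G j) <= e) ->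
  {ae leb m.+1, forall x, Om x -> p x = 0}.
Proof.
move=> lp Hp Hm; pose v (x : 'rV[R]_m.+1) : R := (1 + sqn x)^-1 ^+ 2.
have d0 (x : 'rV[R]_m.+1) : 0 < 1 + sqn x by rewrite ltr_pwDl// sqn_ge0.
have i1 (x : 'rV[R]_m.+1) : 0 <= (1 + sqn x)^-1 <= 1.
  by rewrite invr_ge0 (ltW (d0 x))/= invf_le1// lerDl sqn_ge0.
have lv : lbm v by apply: lbmX; exact: lbm_wt.
have mv := lbm_measurable lv.
have v1 x : `|v x| <= 1.
  have /andP[h1 h2] := i1 x; rewrite ger0_norm ?exprn_ge0// exprn_ile1//.
have v0 x : 0 < v x by rewrite exprn_gt0// invr_gt0.
have lvp := l2_bdM mv v1 lp.
suff /(n2_eq0 lvp) : n2 (leb m.+1) (fun x => v x * (p \_ Om) x) <= 0.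
  apply: filterS => x /eqP; rewrite mulf_eq0 (gt_eqF (v0 x))/= => /eqP + Ox.
  by rewrite patchE mem_set.
apply/ler_addgt0Pl => e e0; rewrite addr0.
have e4 : 0 < e / 4 by rewrite divr_gt0.
have [J1 H1] := Hp _ e4; have [J2 H2] := Hm _ e4.
pose j := maxn J1 J2.
have h1 := H1 j (leq_maxl _ _); have h2 := H2 j (leq_maxr _ _).
have lF := l2_cf (F j).
have lvF := l2_bdM mv v1 lF; have lFp := l2B lF lp.
have lvFp := l2_bdM mv v1 lFp.
have -> : (fun x => v x * (p \_ Om) x) =
    fun x => v x * (cf (F j) \_ Om) x + - (v x * ((cf (F j) \_ Om) x - (p \_ Om) x)).
  by apply/funext => x; ring.
apply: (le_trans (n2D lvF (l2N lvFp))).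
have -> : n2 (leb m.+1) (fun x => - (v x * ((cf (F j) \_ Om) x - (p \_ Om) x))) =
    n2 (leb m.+1) (fun x => v x * ((cf (F j) \_ Om) x - (p \_ Om) x)).
  by apply: eq_Rintegral => x _; rewrite sqrrN.
have h3 := n2_bdM mv v1 lFp; rewrite expr1n mul1r in h3.
rewrite restrictB in h1.
have h4 : n2 (leb m.+1) (fun x => v x * (cf (F j) \_ Om) x) <= mass (F j) (G j).
  have -> : (fun x => v x * (cf (F j) \_ Om) x) = (fun x => v x * F j x) \_ Om.
    by apply/funext => x; rewrite !patchE; case: ifPn => // _; rewrite mulr0.
  rewrite n2_restrict /mass; have lf := lcf (F j); have bf := cfb (F j).
  have lg := lcf (G j); have bg := cfb (G j); have lw := lbm_wt R m.
  apply: (Int_le mO) => [||x _]; [lbst|lbst|].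
  have /andP[a0 a1] := i1 x; rewrite /v exprMn mulrC -exprM.
  apply: ler_pM; rewrite ?sqr_ge0 ?exprn_ge0//; first by rewrite lerDl sqr_ge0.
  by apply: ler_wiXn2l.
by have := le_trans h3 h1; have := le_trans h4 h2 => a b; lra.
Qed.

Variables (alpha : 'rV[R]_m -> R[i]) (lambda : R[i]) (u : 'rV[R]_m.+1 -> R[i]).
Local Notation l1 := (complex.Re lambda).
Local Notation l2 := (complex.Im lambda).
Local Notation p := (@complex.Re R \o u).
Local Notation q := (@complex.Im R \o u).
Local Notation wp f := (fun i => weak_partial Om i f).
Variables (be1 be2 : 'rV[R]_m -> R) (ga1 ga2 : 'I_m -> 'rV[R]_m -> R) (K b1 b2 : R).
Hypotheses (lbe1 : lbm be1) (lbe2 : lbm be2).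
Hypotheses (lga1 : forall i, lbm (ga1 i)) (lga2 : forall i, lbm (ga2 i)).
Hypothesis w1 : forall i, wder i be1 (ga1 i).
Hypothesis w2 : forall i, wder i be2 (ga2 i).
Hypotheses (K0 : 0 <= K) (be1K : forall x, `|be1 x| <= K) (be2K : forall x, `|be2 x| <= K).
Hypotheses (ga1K : forall i x, `|ga1 i x| <= K) (ga2K : forall i x, `|ga2 i x| <= K).
Hypothesis be1_ge0 : forall x, 0 <= be1 x.
Hypothesis ga1_le0 : forall x, xdot ga1 x <= 0.
Hypothesis m3 : (3 <= m)%N.
Hypotheses (b10 : 0 <= b1) (b20 : 0 <= b2) (b12 : 2 * Num.sqrt (b1 * (b1 + b2)) < 1).
Hypothesis hb1 : forall x, be2 x ^+ 2 * sqn x <= b1 ^+ 2.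
Hypothesis hb2 : forall p Dp q Dq, C1 p Dp -> bsupp p -> C1 q Dq -> bsupp q ->
  \int[leb m]_x ((\sum_i (x ord0 i * ga2 i x) + m%:R * be2 x) ^+ 2 * (p x ^+ 2 + q x ^+ 2)) <=
  b2 ^+ 2 * \int[leb m]_x (\sum_i (Dp i x ^+ 2 + Dq i x ^+ 2)).
Hypotheses (ma1 : measurable_fun setT (@complex.Re R \o alpha)) (ma2 : measurable_fun setT (@complex.Im R \o alpha)).
Hypotheses (abe1 : {ae leb m, forall x, complex.Re (alpha x) = be1 x})
  (abe2 : {ae leb m, forall x, complex.Im (alpha x) = be2 x}).
Hypothesis Hu : robin_laplacian alpha u (fun x => lambda * u x).

Lemma eigenfunction_zero : {ae leb m.+1, forall x, Om x -> u x = 0}.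
Proof.
have [b1' [b2' [[b1p b1le] [b2p b2le] b12']]] := enlarge_bounds b10 b20 b12.
have b12p : 0 < b1' * (b1' + b2') by rewrite mulr_gt0// addr_gt0.
pose s := Num.sqrt (b1' * (b1' + b2')); have sp : 0 < s by rewrite sqrtr_gt0.
have s2 : s ^+ 2 = b1' * (b1' + b2') by rewrite sqr_sqrtr// ltW.
(* This value of [q] minimises [b1' / q + (b1' + b2') q]; the minimum is [2 s], below 1 by
   hypothesis. *)
have q0 : 0 < b1' / s by rewrite divr_gt0.
have hb1' x : be2 x ^+ 2 * sqn x <= b1' ^+ 2.
  by apply: le_trans (hb1 x) _; rewrite lerXn2r// nnegrE// ltW.
have hb2' p Dp q Dq : C1 p Dp -> bsupp p -> C1 q Dq -> bsupp q ->
  \int[leb m]_x ((\sum_i (x ord0 i * ga2 i x) + m%:R * be2 x) ^+ 2 * (p x ^+ 2 + q x ^+ 2)) <=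
  b2' ^+ 2 * \int[leb m]_x (\sum_i (Dp i x ^+ 2 + Dq i x ^+ 2)).
  move=> pD bp qD bq; apply: (le_trans (hb2 pD bp qD bq)); rewrite ler_wpM2r//.
    by apply: Rintegral_ge0 => x _; apply: sumr_ge0 => i _; rewrite addr_ge0 ?sqr_ge0.
  by rewrite lerXn2r// nnegrE// ltW.
have rot := rotation_bound lbe2 lga2 w2 b1p b2p q0 hb1' hb2'.
have cE : b1' / (b1' / s) + (b1' + b2') * (b1' / s) = 2 * s.
  have -> : (b1' + b2') * (b1' / s) = s ^+ 2 / s by rewrite s2; ring.
  by field; rewrite !gt_eqF.
have c01 : 0 <= b1' / (b1' / s) + (b1' + b2') * (b1' / s) < 1.
  by rewrite cE b12' andbT mulr_ge0// ltW.
have [Hp Hq] : H1_data Om p (wp p) /\ H1_data Om q (wp q).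
  by have [[h1 h2] _ _] := Hu; have := W1p_data eO mO h1; have := W1p_data eO mO h2.
have [ltp [phi [tphi Hphi]]] := is_traceP Hp (traceP Hp).
have [ltq [psi [tpsi Hpsi]]] := is_traceP Hq (traceP Hq).
pose F k : cfun := CFun (test_C1 (tphi k)) (test_bsupp (tphi k)).
pose G k : cfun := CFun (test_C1 (tpsi k)) (test_bsupp (tpsi k)).
have wd1 := wdata1 Hu; have wd2 := wdata2 Hu.
have z1 := wform1_eq0 lbe1 lbe2 K0 be1K be2K ma1 ma2 abe1 abe2 Hu.
have z2 := wform2_eq0 lbe1 lbe2 K0 be1K be2K ma1 ma2 abe1 abe2 Hu.
have cF : cauchy_nn F.
  apply: (cauchy_approx Hp) => e e0; have [J HJ] := Hphi e e0; exists J => j /HJ[h1 h2 _].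
  by split.
have cG : cauchy_nn G.
  apply: (cauchy_approx Hq) => e e0; have [J HJ] := Hpsi e e0; exists J => j /HJ[h1 h2 _].
  by split.
have F2 j : smooth2 (F j).
  have [pC _ _] := tphi j; exists (fun i k => partial k (partial i (phi j))) => i.
  exact: isCk_C1 (isCk_partial i (pC 2%N)).
have G2 j : smooth2 (G j).
  have [pC _ _] := tpsi j; exists (fun i k => partial k (partial i (psi j))) => i.
  exact: isCk_C1 (isCk_partial i (pC 2%N)).
have small1 : RF_small be1 be2 l1 l2 F G.
  apply: (RF_small_approx lbe1 lbe2 K0 be1K be2K wd1 z1) => e e0.
  have [J1 H1] := Hphi e e0; have [J2 H2] := Hpsi e e0; exists (maxn J1 J2) => j.
  rewrite geq_max => /andP[/H1[a1 a2 a3] /H2[c1 c2 c3]].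
  split=> [i||||]; [|by move: a1; rewrite restrictB|by move: c1; rewrite restrictB|exact: a3|exact: c3].
  by have := a2 i; rewrite restrictB.
have small2 : RF_small be1 be2 l1 l2 G (fun j => cfunN (F j)).
  apply: (RF_small_approx lbe1 lbe2 K0 be1K be2K wd2 z2) => e e0.
  have [J1 H1] := Hphi e e0; have [J2 H2] := Hpsi e e0; exists (maxn J1 J2) => j.
  rewrite geq_max => /andP[/H1[a1 a2 a3] /H2[c1 c2 c3]].
  split=> [i||||]; [|by move: c1; rewrite restrictB| |exact: c3|].
  - by have := c2 i; rewrite restrictB.
  - apply: le_trans a1; rewrite restrictB le_eqVlt; apply/orP; left; apply/eqP.
    apply: eq_Rintegral => x _.
    have -> : (cf (cfunN (F j)) \_ Om) x = - (cf (F j) \_ Om) x.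
      by rewrite !patchE; case: ifPn => _ //=; rewrite oppr0.
    by rewrite -opprD sqrrN.
  - apply: le_trans a3; rewrite le_eqVlt; apply/orP; left; apply/eqP.
    by apply: eq_Rintegral => x _ /=; ring.
have ms := mass_small lbe1 lbe2 lga1 lga2 w1 w2 K0 be1K be2K ga1K ga2K be1_ge0 ga1_le0 m3 c01 rot
  cF cG F2 G2 small1 small2.
have p0 : {ae leb m.+1, forall x, Om x -> p x = 0}.
  apply: (vanish_of_mass (F := F) (G := G) Hp.1) => e e0; last exact: ms.
  by have [J HJ] := Hphi e e0; exists J => j /HJ[].
have q0' : {ae leb m.+1, forall x, Om x -> q x = 0}.
  apply: (vanish_of_mass (F := G) (G := F) Hq.1) => e e0.
    by have [J HJ] := Hpsi e e0; exists J => j /HJ[].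
  have [J HJ] := ms e e0; exists J => j /HJ; apply: le_trans.
  rewrite le_eqVlt; apply/orP; left; apply/eqP; apply: eq_Rintegral => x _.
  by rewrite addrC.
apply: filterS2 p0 q0' => x h1 h2 Ox; apply/eqP; rewrite eq_complex.
by move: (h1 Ox) (h2 Ox) => /= -> ->; rewrite !eqxx.
Qed.

End vanishing.

Local Open Scope complex_scope.

Theorem theorem1p3 (R : realType) (n : nat) (n_ge4 : (4 <= n)%N)
  (alpha : 'rV[R]_n.-1 -> R[i])
  (alphaW : cW1p setT +oo%E alpha)
  (alpha_Re_Im : {ae lebesgue_rV R n.-1,
     forall x : 'rV[R]_n.-1, `|complex.Im (alpha x)| <= complex.Re (alpha x)})
  (alpha_radial : {ae lebesgue_rV R n.-1,
     forall x : 'rV[R]_n.-1, \sum_(i < n.-1)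
       x ord0 i * weak_partial setT i (fun y => complex.Re (alpha y)) x <= 0})
  (b1 b2 : R) (b1_ge0 : 0 <= b1) (b2_ge0 : 0 <= b2)
  (b12 : 2 * Num.sqrt (b1 * (b1 + b2)) < 1)
  (alpha_b1 : ('N[lebesgue_rV R n.-1]_+oo[
     EFin \o (fun x => enorm (complex.Im (alpha x) *: x))] <= b1%:E)%E)
  (alpha_b2 : forall psi : 'rV[R]_n.-1 -> R[i], cW1p setT 2%:E psi ->
     (\int[lebesgue_rV R n.-1]_x
        (weak_div (fun y => complex.Im (alpha y) *: y)%R x ^+ 2 * normc2 (psi x))%:E
      <= (b2 ^+ 2)%:E *
         \int[lebesgue_rV R n.-1]_x
           (\sum_(i < n.-1) normc2 (cweak_partial setT i psi x))%:E)%E) :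
  point_spectrum (half_space R n.-1) (robin_laplacian alpha) = set0.
Proof.
have m3 : (3 <= n.-1)%N by rewrite -ltnS prednK//; apply: leq_trans n_ge4.
have [W1 W2] := alphaW.
have [be1 [be2 [ga1 [ga2 [K [[lbe1 lbe2 lga1 lga2 K0] [be1K be2K ga1K ga2K] [w1 w2 hb2] [be1_ge0 ga1_le0 hb1] [ab1 ab2]]]]]]] :=
  robin_coefficients W1 W2 alpha_Re_Im alpha_radial b1_ge0 alpha_b1 alpha_b2.
have [ma1 _] := W1p_infty_bound W1; have [ma2 _] := W1p_infty_bound W2.
apply/seteqP; split=> // lambda [u Hu]; apply.
exact: (eigenfunction_zero lbe1 lbe2 lga1 lga2 w1 w2 K0 be1K be2K ga1K ga2K be1_ge0 ga1_le0 m3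
  b1_ge0 b2_ge0 b12 hb1 hb2 ma1 ma2 ab1 ab2 Hu).
Qed.
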